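(* Let $\ell\in\mathbb Z_{\ge0}$ and $n\in\mathbb Z_{\ge2}$. The restricted elliptic quantum group $E_\ell(A_{n-1}^{(1)})$ defined in the context has a representation $\sigma_V$ on the $\pi$-graded vector space $V=V^{\mathrm{RSOS}}$ given by $$\sigma_V(T_b^c(u))\,e_x=\sum_y(\check R_{VV})_{bx}^{yc}(u)\,e_y,\qquad \sigma_V((T^* )_b^c(u))\,e_x=\sum_y(\check R_{V^*V})_{bx}^{yc}(u)\,e_y,$$ $$\sigma_V(\xi_2^\pm(u))=\rho_2(u)^{\pm1},\qquad \rho_2(u)=\frac{[\lambda+u][\lambda-u]}{[1+\lambda+u][1+\lambda-u]},$$ where $b,c,x,y$ run over the labels of the homogeneous basis $(e_b)_{b\in B}$ of $V$ (and $\xi^\pm_{2,f}(u)$ acts on $V_f$ by the scalar $\rho_2(u)^{\pm1}$).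
   Context: **Theta function.** $\theta(u,\tau)=-\sum_{m\in\mathbb Z}e^{i\pi(m+\frac12)^2\tau+2\pi i(m+\frac12)(u+\frac12)}$, $[u]=\theta(u/L,\tau)\big/\big(\tfrac1L\theta'(0,\tau)\big)$, $\mathrm{Im}\,\tau>0$. Here $L=\ell+n$, $\lambda=-n/2$. **Groupoid and $V$.** $\bar\varepsilon_1,\dots,\bar\varepsilon_n$ is the standard basis of $\mathbb R^n$, $\varepsilon_i=\bar\varepsilon_i-\frac1n\sum_j\bar\varepsilon_j$. $P_{++}=\{a\in\mathbb R^n:\sum_ia_i=0,\ a_i-a_j\in\mathbb Z,\ a_1>a_2>\dots>a_n,\ a_1-a_n<L\}$. $\pi$ is the groupoid with object set $P_{++}$ and exactly one arrow $(a,b-a)$ from $a$ to $b$ for all $a,b\in P_{++}$; $s,t$ are source and target, $\beta\circ\alpha$ means first $\alpha$, then $\beta$. A $\pi$-graded vector space is a family indexed by arrows; $(V\otimes W)_l=\bigoplus_{j\circ i=l}V_i\otimes W_j$; $\mathbf 1$ has $\mathbf 1_{\mathrm{id}_a}=\mathbb C$ and other components $0$; $(V^* )_i=(V_{i^{-1}})^*$. $V=V^{\mathrm{RSOS}}$ has basis $e_{(a,i)}$, $(a,i)\in B:=\{(a,i):1\le i\le n,\ a,a+\varepsilon_i\in P_{++}\}$, where $e_{(a,i)}$ has degree $|(a,i)|=(a,\varepsilon_i)$; $V^*$ has the dual basis $e^*_{(a,i)}$ of degree the inverse arrow $a+\varepsilon_i\to a$. **$R$-matrix.** $\check R_{VV}(u)(e_{(a,i)}\otimes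 e_{(a+\varepsilon_i,j)})=\sum_{k,l}W^{kl}_{ij}(u,a)\,e_{(a,k)}\otimes e_{(a+\varepsilon_k,l)}$ (sum over $k,l$ with $\varepsilon_k+\varepsilon_l=\varepsilon_i+\varepsilon_j$ and both labels in $B$), where the nonzero weights are $W_{ii}^{ii}=1$ and, for $i\ne j$, $W^{ij}_{ij}=\frac{[1][a_i-a_j-u]}{[1+u][a_i-a_j]}$, $W^{ji}_{ij}=\frac{[u]}{[1+u]}\sqrt{\frac{[a_i-a_j+1][a_i-a_j-1]}{[a_i-a_j]^2}}$. Square roots (here and below) are the nonnegative ones for $\tau\in i\mathbb R_{>0}$, continued analytically in $\tau$. **Pairings.** $G_a=\prod_{i<j}[a_i-a_j]$. For $(a,i)\in B$: $\omega(e_{(a,i)}\otimes e^*_{(a,i)})=\sqrt{G_{a+\varepsilon_i}/G_a}$, $\omega^*(e^*_{(a,i)}\otimes e_{(a,i)})=\sqrt{G_a/G_{a+\varepsilon_i}}$, all other pairings of basis vectors zero; $\sigma(1_c)=\sum_{(a,i):a+\varepsilon_i=c}\sqrt{G_a/G_c}\;e^*_{(a,i)}\otimes e_{(a,i)}$; $\sigma^*(1_a)=\sum_i\sqrt{G_{a+\varepsilon_i}/G_a}\;e_{(a,i)}\otimes e^*_{(a,i)}$. Write $\omega_{bc}=\omega(e_b\otimes e^*_c)$, $\omega^*_{bc}=\omega^*(e^*_b\otimes e_c)$, and $\sigma^{bc},\sigma^{*bc}$ for the coefficients of $e_b^*\otimes e_c$ in $\sigma$ and of $e_b\otimes e_c^*$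 in $\sigma^*$. **Rotations.** $\check R_{V^*V}(u)=(\omega^*\otimes\mathrm{id}_V\otimes\mathrm{id}_{V^*})(\mathrm{id}_{V^*}\otimes\check R_{VV}(\lambda-u)\otimes\mathrm{id}_{V^*})(\mathrm{id}_{V^*}\otimes\mathrm{id}_V\otimes\sigma^* )$, $\check R_{VV^*}(u)=(\mathrm{id}_{V^*}\otimes\mathrm{id}_V\otimes\omega)(\mathrm{id}_{V^*}\otimes\check R_{VV}(\lambda-u)\otimes\mathrm{id}_{V^*})(\sigma\otimes\mathrm{id}_V\otimes\mathrm{id}_{V^*})$, $\check R_{V^*V^*}(u)=(\mathrm{id}_{V^*}\otimes\mathrm{id}_{V^*}\otimes\omega)(\mathrm{id}_{V^*}\otimes\check R_{VV^*}(\lambda-u)\otimes\mathrm{id}_{V^*})(\sigma\otimes\mathrm{id}_{V^*}\otimes\mathrm{id}_{V^*})$. Matrix elements: $\check R_{VV}(e_b\otimes e_c)=\sum(\check R_{VV})_{bc}^{kl}e_k\otimes e_l$, $\check R_{V^*V}(e_b^*\otimes e_c)=\sum(\check R_{V^*V})_{bc}^{kl}e_k\otimes e_l^*$, $\check R_{V^*V^*}(e_b^*\otimes e_c^* )=\sum(\check R_{V^*V^*})_{bc}^{kl}e_k^*\otimes e_l^*$. **Expansions.** All matrix elements above are expanded as power series in $z=e^{2\pi iu/L}$, $w=e^{2\pi i(\tau-u/L)}$ (functions of $\tau$ alone in powers of $p=zw$). A generating series is $X(u)=\sum_{m,n\ge0}X[m,n]z^nw^m$; $X(u+c)$ means $z\mapsto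 e^{2\pi ic/L}z$, $w\mapsto e^{-2\pi ic/L}w$. Identities in $u$ are read coefficientwise in $z,w$; in identities in $u_1,u_2$ one substitutes for $(z,w)$ the pair $(z_1,z_2w)$ in functions of $u_1-u_2$, $(z_1z_2,w)$ in series in $u_1$, $(z_2,z_1w)$ in series in $u_2$, and compares coefficients in $z_1,z_2,w$. **Squares and $E_\ell(A_{n-1}^{(1)})$.** A square of $\pi$ has top $f:a\to a'$, bottom $g:b\to b'$, left $a\to b$, right $a'\to b'$ (always commutative here); $[i,j]$ denotes the square with left arrow $i$ and right arrow $j$; $\mathrm{id}^\circ_f$ has top = bottom = $f$ and identity left and right arrows; $\beta\circ\alpha$ is vertical pasting with $\alpha$ above $\beta$, defined if bottom$(\alpha)$ = top$(\beta)$. A $\pi^2$-graded unital algebra is a family $(A_\alpha)$ over squares with associative products $A_\alpha\times A_\beta\to A_{\beta\circ\alpha}$ and units $\eta_f\in A_{\mathrm{id}^\circ_f}$. $E_\ell(A_{n-1}^{(1)})$ is the $\pi^2$-graded unital algebra over $\mathbb C$ generated by the coefficients of series $T_b^c(u)$ of degree $[|b|,|c|]$, $(T^* )_b^c(u)$ of degree $[|b|^{-1},|c|^{-1}]$ ($b,c\in B$), $\xi^\pm_{2,f}(u)$ of degree $\mathrm{id}^\circ_f$ ($f$ an arrow), with relations (non-composable products omitted; imposed on each homogeneous component): - $\xi^\pm_{2,f}x=x\,\xi^\pm_{2,g}$ for $x$ of degree with top $f$, bottom $g$; $\xi^\pm_{2,f}(u)\xi^\mp_{2,f}(u)=\eta_f$;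 - $\sum_{k,l}(\check R_{VV})^{mn}_{kl}(u_1-u_2)T_i^k(u_1)T_j^l(u_2)=\sum_{k,l}T_k^m(u_2)T_l^n(u_1)(\check R_{VV})^{kl}_{ij}(u_1-u_2)$; - $\sum_{k,l}(\check R_{V^*V^*})^{mn}_{kl}(u_1-u_2)(T^* )_i^k(u_1)(T^* )_j^l(u_2)=\sum_{k,l}(T^* )_k^m(u_2)(T^* )_l^n(u_1)(\check R_{V^*V^*})^{kl}_{ij}(u_1-u_2)$; - $\sum_{k,l}(\check R_{V^*V})^{mn}_{kl}(u_1-u_2)(T^* )_i^k(u_1)T_j^l(u_2)=\sum_{k,l}T_k^m(u_2)(T^* )_l^n(u_1)(\check R_{V^*V})^{kl}_{ij}(u_1-u_2)$; - for $t|i|=t|j|$, $f:s|i|\to a$: $\sum_{k,l:\,s|k|=a}\omega_{kl}T_i^k(u+\lambda)(T^* )_j^l(u)=\omega_{ij}\xi^+_{2,f}(u)$; - for $s|i|=s|j|$, $f:t|i|\to a$: $\sum_{k,l:\,t|k|=a}\omega^*_{kl}(T^* )_i^k(u+\lambda)T_j^l(u)=\omega^*_{ij}\eta_f$; - for $s|i|=s|j|$, $f:a\to t|i|$: $\sum_{k,l:\,t|k|=a}(T^* )_k^i(u)T_l^j(u+\lambda)\sigma^{kl}=\xi^+_{2,f}(u)\sigma^{ij}$; - for $t|i|=t|j|$, $f:a\to s|i|$: $\sum_{k,l:\,s|k|=a}T_k^i(u)(T^* )_l^j(u+\lambda)\sigma^{*kl}=\eta_f\sigma^{*ij}$. **Representation.**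 A representation on a $\pi$-graded space $V$ is a family of linear maps $\rho:A_\alpha\to\mathrm{Hom}(V_g,V_f)$ ($\alpha$ with top $f$, bottom $g$) with $\rho(xy)=\rho(x)\rho(y)$ for vertically composable $x,y$ and $\rho(\eta_f)=\mathrm{id}_{V_f}$. On series it is applied coefficientwise. *)

(* Defs.v *)
From HB Require Import structures.
From mathcomp Require Import all_boot all_order all_algebra.
From mathcomp Require Import generic_quotient complex.
From mathcomp Require Import boolp classical_sets reals topology normedtype.
From mathcomp Require Import sequences derive exp trigo.

Set Implicit Arguments.
Unset Strict Implicit.
Unset Printing Implicit Defensive.

Import Order.TTheory GRing.Theory Num.Theory.
Import numFieldNormedType.Exports.

Local Open Scope ring_scope.
Local Open Scope classical_set_scope.
Local Open Scope complex_scope.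

(* R[i], packed as a numClosedFieldType so that the topology and the
   derivative of MathComp-Analysis are available on it. *)
Definition cplx (R : realType) : numClosedFieldType := R[i].

Definition cexp (R : realType) (x : cplx R) : cplx R :=
  (expR (complex.Re x))%:C *
    (cos (complex.Im x) +i* sin (complex.Im x) : cplx R).

Section Theta.
Variables (R : realType) (L : R).
Local Notation C := (cplx R).

Definition twopii : C := (2 * pi : R)%:C * 'i%C.

Definition theta_term (u tau : C) (m : int) : C :=
  let h : C := m%:~R + 2^-1 in
  cexp ((pi : R)%:C * 'i%C * h ^+ 2 * tau + twopii * h * (u + 2^-1)).

(* The sum over the integers, split as m >= 0 and m = -k-1 < 0. *)
Definition theta (u tau : C) : C :=
  - (limn (series (fun k : nat => theta_term u tau (Posz k))) +
     limn (series (fun k : nat => theta_term u tau (Negz k)))).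

(* [u] *)
Definition brac (u tau : C) : C :=
  theta (u / L%:C) tau /
    ((L%:C)^-1 * derive1 (fun v : C => theta v tau : C^o) 0).

Definition zvar (u : C) : C := cexp (twopii * (u / L%:C)).
Definition wvar (u tau : C) : C := cexp (twopii * (tau - u / L%:C)).

(* The coefficient X m n is the one of z^n w^m. *)
Definition ser := nat -> nat -> C.

Definition ser_psum (X : ser) (z w : C) (N : nat) : C :=
  \sum_(m < N) \sum_(n < N) X m n * z ^+ n * w ^+ m.

Definition ser_norm_psum (X : ser) (z w : C) (N : nat) : C :=
  \sum_(m < N) \sum_(n < N) `|X m n * z ^+ n * w ^+ m|.

(* X converges absolutely to f on a polydisc around (z, w) = (0, 0).  It is
   enough to compare them for purely imaginary tau = i t, t > 0: these points
   determine X, and the sum of X on the whole polydisc is then the analytic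
   continuation of f.  So the square roots occurring in f only have to be the
   nonnegative ones for imaginary tau, as with sqrtC below. *)
Definition is_expansion (f : C -> C -> C) (X : ser) : Prop :=
  exists2 r : C, 0 < r & forall (u : C) (t : R),
    let tau : C := t%:C * 'i%C in
    0 < t -> `|zvar u| < r -> `|wvar u tau| < r ->
    (exists M : C, forall N, ser_norm_psum X (zvar u) (wvar u tau) N <= M) /\
    ser_psum X (zvar u) (wvar u tau) @ \oo --> f u tau.

Definition expansion (f : C -> C -> C) : ser := get [set X | is_expansion f X].

End Theta.

Section Groupoid.
Variables (R : realType) (n ell : nat).

Definition Lev : R := (ell + n)%:R.

Definition eps (i : 'I_n) : 'rV[R]_n :=
  \row_j ((i == j)%:R - n%:R^-1).

Definition in_alcove (a : 'rV[R]_n) : bool :=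
  [&& \sum_i a 0 i == 0,
      [forall i, forall j, (a 0 i - a 0 j) \is a Num.int],
      [forall i : 'I_n, forall j : 'I_n, (i < j)%N ==> (a 0 j < a 0 i)] &
      [forall i : 'I_n, forall j : 'I_n,
         (val i == 0%N) && (val j == n.-1) ==> (a 0 i - a 0 j < Lev)]].

(* P_{++} *)
Record alcove := Alcove { aval :> 'rV[R]_n; alcoveP : in_alcove aval }.

HB.instance Definition _ := [isSub for aval].
HB.instance Definition _ := [Choice of alcove by <:].

Definition gaps (a : alcove) : {ffun 'I_n * 'I_n -> 'I_(ell + n).+1} :=
  [ffun ij => inord (Num.truncn (aval a 0 ij.1 - aval a 0 ij.2))].

Lemma gaps_inj : injective gaps.
Proof.
have bnd (a : alcove) (i j : 'I_n) : (i < j)%N ->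
    0 <= aval a 0 i - aval a 0 j < Lev.
  case: a => a /= /and4P[_ _ /forallP dec /forallP lev] ij.
  have le (k l : 'I_n) : (k <= l)%N -> a 0 l <= a 0 k.
    rewrite leq_eqVlt => /orP[/eqP kl|kl]; first by rewrite (val_inj kl).
    by have /forallP/(_ l)/implyP/(_ kl)/ltW := dec k.
  rewrite subr_ge0 le ?(ltnW ij)//=.
  have n0 : (0 < n)%N by case: (n) i {ij} => [[]|].
  have n1 : (n.-1 < n)%N by rewrite prednK.
  have /forallP/(_ (Ordinal n1)) := lev (Ordinal n0).
  rewrite /= !eqxx /=; apply: le_lt_trans.
  by apply: lerB; apply: le => //=; rewrite -ltnS prednK.
move=> a b ab; apply/val_inj/rowP => i.
have key (k l : 'I_n) : (k < l)%N ->
    aval a 0 k - aval a 0 l = aval b 0 k - aval b 0 l.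
  move=> kl; have /ffunP/(_ (k, l)) := ab; rewrite !ffunE /=.
  have isnat (c : alcove) :
      exists2 m, (m < (ell + n).+1)%N & aval c 0 k - aval c 0 l = m%:R :> R.
    have /andP[c0 cL] := bnd c k l kl.
    have cI : aval c 0 k - aval c 0 l \is a Num.int.
      by case: c {c0 cL} => c /= /and4P[_ /forallP/(_ k)/forallP/(_ l)].
    have /natrP[m mE] : aval c 0 k - aval c 0 l \is a Num.nat.
      by rewrite natrEint cI.
    by exists m => //; rewrite ltnS; move: cL; rewrite mE ltr_nat => /ltnW.
  have [p pL ->] := isnat a; have [q qL ->] := isnat b.
  by rewrite !Num.Theory.natrK => /(congr1 val); rewrite /= !inordK // => ->.
have keys (k l : 'I_n) :
    aval a 0 k - aval a 0 l = aval b 0 k - aval b 0 l.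
  case: (ltngtP k l) => [/key//|/key kl|/val_inj ->]; last by rewrite !subrr.
  by rewrite -opprB kl opprB.
have sum0 (c : alcove) : \sum_j aval c 0 j = 0.
  by case: c => c /= /and4P[/eqP].
have : \sum_(j < n) (aval a 0 i - aval a 0 j) =
       \sum_(j < n) (aval b 0 i - aval b 0 j) by apply: eq_bigr.
rewrite !sumrB !sum0 !subr0 !sumr_const card_ord => /eqP.
rewrite -subr_eq0 -mulrnBl mulrn_eq0 subr_eq0 => /orP[/eqP n0|/eqP //].
by have := ltn_ord i; rewrite [X in (_ < X)%N]n0.
Qed.

Definition gaps_inv (y : {ffun 'I_n * 'I_n -> 'I_(ell + n).+1}) :
    option alcove :=
  if pselect (exists a, gaps a == y) is left h then Some (xchoose h) else None.

Lemma gapsK : pcancel gaps gaps_inv.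
Proof.
move=> a; rewrite /gaps_inv; case: pselect => [h|]; last by case; exists a.
by congr Some; apply: gaps_inj; apply/eqP/(xchooseP h).
Qed.

HB.instance Definition _ := PCanIsCountable gapsK.
HB.instance Definition _ : isFinite alcove := PCanIsFinite gapsK.

(* An arrow of the groupoid is its pair (source, target). *)
Definition arrow := (alcove * alcove)%type.
HB.instance Definition _ := Finite.on arrow.
Definition inv_arrow (f : arrow) : arrow := (f.2, f.1).

(* A square is the pair (top, bottom), which determines the left and right
   arrows since there is exactly one arrow between any two objects. *)
Definition square := (arrow * arrow)%type.
HB.instance Definition _ := Finite.on square.

(* [i, j], with left arrow i and right arrow j *)
Definition sqLR (i j : arrow) : square := ((i.1, j.1), (i.2, j.2)).
Definition sqid (f : arrow) : square := (f, f).

(* B *)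
Record label := Label {
  lval : alcove * 'I_n;
  labelP : in_alcove (aval lval.1 + eps lval.2) }.

HB.instance Definition _ := [isSub for lval].
HB.instance Definition _ := [Finite of label by <:].

Definition src (b : label) : alcove := (lval b).1.
Definition tgt (b : label) : alcove := Alcove (labelP b).
Definition dir (b : label) : 'I_n := (lval b).2.
Definition deg (b : label) : arrow := (src b, tgt b).

End Groupoid.

Section Weights.
Variables (R : realType) (n ell : nat).
Local Notation C := (cplx R).
Local Notation L := (Lev R n ell).
Local Notation "[[ x ]]_ tau" := (brac L x tau) (at level 2, tau at level 2).
Local Notation label := (label R n ell).

Definition lam : C := - (n%:R / 2).

Definition Wt (k l i j : 'I_n) (u : C) (a : 'rV[R]_n) (tau : C) : C :=
  let d : C := (a 0 i - a 0 j)%:C in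
  if i == j then ((k == i) && (l == i))%:R
  else if (k == i) && (l == j) then
    [[1]]_tau * [[d - u]]_tau / ([[1 + u]]_tau * [[d]]_tau)
  else if (k == j) && (l == i) then
    [[u]]_tau / [[1 + u]]_tau *
      sqrtC ([[d + 1]]_tau * [[d - 1]]_tau / [[d]]_tau ^+ 2)
  else 0.

(* Matrix elements: the first two labels are the inputs (lower indices), the
   last two the outputs (upper indices).  In the names, v stands for V and d
   for its dual. *)
Definition Rvv (b c k l : label) (u tau : C) : C :=
  if [&& src c == tgt b, src k == src b & src l == tgt k]
  then Wt (dir k) (dir l) (dir b) (dir c) u (src b) tau else 0.

Definition Gfun (a : 'rV[R]_n) (tau : C) : C :=
  \prod_(i < n) \prod_(j < n | (i < j)%N) [[(a 0 i - a 0 j)%:C]]_tau.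

Definition up (b : label) (tau : C) : C :=
  sqrtC (Gfun (tgt b) tau / Gfun (src b) tau).
Definition down (b : label) (tau : C) : C :=
  sqrtC (Gfun (src b) tau / Gfun (tgt b) tau).

Definition omega (b c : label) (tau : C) : C :=
  if b == c then up b tau else 0.
Definition omegas (b c : label) (tau : C) : C :=
  if b == c then down b tau else 0.
Definition sigma (b c : label) (tau : C) : C :=
  if b == c then down b tau else 0.
Definition sigmas (b c : label) (tau : C) : C :=
  if b == c then up b tau else 0.

(* Matrix elements of the rotations: j and m are the labels of the two
   intermediate tensor factors contracted with the pairings.  Terms that are
   not composable in the groupoid vanish because those of Rvv do. *)
Definition Rdv (b c k l : label) (u tau : C) : C :=
  \sum_(m : label) \sum_(j : label)
    omegas b j tau * Rvv c m j k (lam - u) tau * sigmas m l tau.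

Definition Rvd (b c k l : label) (u tau : C) : C :=
  \sum_(j : label) \sum_(m : label)
    omega m c tau * Rvv j b l m (lam - u) tau * sigma k j tau.

Definition Rdd (b c k l : label) (u tau : C) : C :=
  \sum_(j : label) \sum_(m : label)
    omega m c tau * Rvd j b l m (lam - u) tau * sigma k j tau.

Definition rho2 (u tau : C) : C :=
  [[lam + u]]_tau * [[lam - u]]_tau /
    ([[1 + lam + u]]_tau * [[1 + lam - u]]_tau).

Definition Rvv_ser b c k l : ser R := expansion L (Rvv b c k l).
Definition Rdv_ser b c k l : ser R := expansion L (Rdv b c k l).
Definition Rdd_ser b c k l : ser R := expansion L (Rdd b c k l).
Definition omega_ser b c : ser R := expansion L (fun _ => omega b c).
Definition omegas_ser b c : ser R := expansion L (fun _ => omegas b c).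
Definition sigma_ser b c : ser R := expansion L (fun _ => sigma b c).
Definition sigmas_ser b c : ser R := expansion L (fun _ => sigmas b c).
Definition rho2_ser : ser R := expansion L rho2.
Definition rho2V_ser : ser R := expansion L (fun u tau => (rho2 u tau)^-1).

End Weights.

Section GradedAlgebras.
Variables (R : realType) (n ell : nat).
Local Notation C := (cplx R).
Local Notation arrow := (arrow R n ell).

(* galg f g is the component of the square with top f and bottom g. *)
Record pi2_algebra := Pi2Algebra {
  galg :> arrow -> arrow -> lmodType C;
  gmul : forall f g h, galg f g -> galg g h -> galg f h;
  gone : forall f, galg f f;
  gmulA : forall f g h k (x : galg f g) (y : galg g h) (z : galg h k),
    gmul x (gmul y z) = gmul (gmul x y) z;
  gmul1l : forall f g (x : galg f g), gmul (gone f) x = x;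
  gmul1r : forall f g (x : galg f g), gmul x (gone g) = x;
  gmulDl : forall f g h (x y : galg f g) (z : galg g h),
    gmul (x + y) z = gmul x z + gmul y z;
  gmulDr : forall f g h (x : galg f g) (y z : galg g h),
    gmul x (y + z) = gmul x y + gmul x z;
  gmulZl : forall f g h (c : C) (x : galg f g) (y : galg g h),
    gmul (c *: x) y = c *: gmul x y;
  gmulZr : forall f g h (c : C) (x : galg f g) (y : galg g h),
    gmul x (c *: y) = c *: gmul x y }.

Record is_representation (A : pi2_algebra) (V : arrow -> lmodType C)
    (rho : forall f g, A f g -> {linear V g -> V f}) : Prop :=
  IsRepresentation {
    rep_linear : forall f g (c : C) (x y : A f g) (v : V g),
      rho f g (c *: x + y) v = c *: rho f g x v + rho f g y v;
    rep_mul : forall f g h (x : A f g) (y : A g h) (v : V h),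
      rho f h (gmul x y) v = rho f g x (rho g h y v);
    rep_one : forall f (v : V f), rho f f (gone A f) v = v }.

Definition Vlabel (f : arrow) := {x : label R n ell | deg x == f}.

Definition Vrsos (f : arrow) : lmodType C := {ffun Vlabel f -> C^o}.

Definition Vbasis (f : arrow) (x : Vlabel f) : Vrsos f :=
  [ffun y => (y == x)%:R].

End GradedAlgebras.

Section Presentation.
Variables (R : realType) (n ell : nat).
Local Notation C := (cplx R).
Local Notation L := (Lev R n ell).
Local Notation arrow := (arrow R n ell).
Local Notation label := (label R n ell).
Local Notation square := (square R n ell).
Local Notation ser := (ser R).
Local Notation lam := (lam R n).

(* Coefficients [m, n] of T_b^c(u), of (T^* )_b^c(u), and of xi^+_{2,f}(u)
   (boolean true) or xi^-_{2,f}(u) (boolean false). *)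
Inductive generator :=
| gT of label & label & nat & nat
| gTs of label & label & nat & nat
| gxi of bool & arrow & nat & nat.

Definition gdeg (x : generator) : square :=
  match x with
  | gT b c _ _ => sqLR (deg b) (deg c)
  | gTs b c _ _ => sqLR (inv_arrow (deg b)) (inv_arrow (deg c))
  | gxi _ f _ _ => sqid f
  end.

Definition gtop (x : generator) : arrow := (gdeg x).1.
Definition gbot (x : generator) : arrow := (gdeg x).2.

Inductive term : arrow -> arrow -> Type :=
| tgen (x : generator) : term (gtop x) (gbot x)
| tone f : term f f
| tzero f g : term f g
| tadd f g : term f g -> term f g -> term f g
| tscale f g : C -> term f g -> term f g
| tmul f g h : term f g -> term g h -> term f h.

(* Finite sums of homogeneous terms of various degrees, as families of
   homogeneous components; in products, the pairs which are not composable
   are omitted. *)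
Definition tot := forall f g, term f g.

Definition tot_of f g (x : term f g) : tot := fun f' g' =>
  match f =P f', g =P g' with
  | ReflectT ef, ReflectT eg =>
      ecast k (term f' k) eg (ecast k (term k g) ef x)
  | _, _ => tzero f' g'
  end.

Definition tot0 : tot := tzero.
Definition tot_add (x y : tot) : tot := fun f g => tadd (x f g) (y f g).
Definition tot_scale (c : C) (x : tot) : tot := fun f g => tscale c (x f g).
Definition tot_mul (x y : tot) : tot := fun f h =>
  \big[@tadd f h/tzero f h]_(g : arrow) tmul (x f g) (y g h).

(* Series in (z, w); as for ser, X m n is the coefficient of z^n w^m. *)
Definition tser := nat -> nat -> tot.

Definition Tser (b c : label) : tser := fun m k => tot_of (tgen (gT b c m k)).
Definition Tsser (b c : label) : tser := fun m k => tot_of (tgen (gTs b c m k)).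
Definition xiser (e : bool) (f : arrow) : tser :=
  fun m k => tot_of (tgen (gxi e f m k)).
Definition etaser (f : arrow) : tser :=
  fun m k => if (m == 0%N) && (k == 0%N) then tot_of (tone f) else tot0.

(* X(u + c) *)
Definition shift (c : C) (X : tser) : tser := fun m k =>
  tot_scale (cexp (twopii R * c / L%:C * (k%:R - m%:R))) (X m k).

Definition conv2 (A B : Type) (op : A -> B -> tot)
    (X : nat -> nat -> A) (Y : nat -> nat -> B) : tser := fun m k =>
  \big[tot_add/tot0]_(m1 < m.+1) \big[tot_add/tot0]_(k1 < k.+1)
    op (X m1 k1) (Y (m - m1)%N (k - k1)%N).

Local Notation scal2 := (conv2 tot_scale).
Local Notation mul2 := (conv2 tot_mul).

(* Series in (z_1, z_2, w); X a b c is the coefficient of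
   z_1^a z_2^b w^c. *)
Definition tser3 := nat -> nat -> nat -> tot.

Definition conv3 (A B : Type) (op : A -> B -> tot)
    (X : nat -> nat -> nat -> A) (Y : nat -> nat -> nat -> B) : tser3 :=
  fun a b c =>
  \big[tot_add/tot0]_(a1 < a.+1) \big[tot_add/tot0]_(b1 < b.+1)
  \big[tot_add/tot0]_(c1 < c.+1)
    op (X a1 b1 c1) (Y (a - a1)%N (b - b1)%N (c - c1)%N).

Local Notation scal3 := (conv3 tot_scale).
Local Notation mul3 := (conv3 tot_mul).

(* Substitutions (z, w) := (z_1, z_2 w), (z_1 z_2, w), (z_2, z_1 w) for series
   in u_1 - u_2, u_1, u_2 respectively. *)
Definition at_u12 (X : ser) (a b c : nat) : C :=
  if b == c then X b a else 0.
Definition at_u1 (X : tser) : tser3 := fun a b c =>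
  if a == b then X c a else tot0.
Definition at_u2 (X : tser) : tser3 := fun a b c =>
  if a == c then X a b else tot0.

Section ExchangeRelation.
Variables (Rs : label -> label -> label -> label -> ser).
Variables (X Y : label -> label -> tser).

(* Both sides of
   sum_{k,l} Rs_{kl}^{pq}(u_1 - u_2) X_i^k(u_1) Y_j^l(u_2)
     = sum_{k,l} Y_k^p(u_2) X_l^q(u_1) Rs_{ij}^{kl}(u_1 - u_2) *)
Definition exchange_lhs (i j p q : label) : tser3 := fun a b c =>
  \big[tot_add/tot0]_(k : label) \big[tot_add/tot0]_(l : label)
    scal3 (at_u12 (Rs k l p q)) (mul3 (at_u1 (X i k)) (at_u2 (Y j l))) a b c.

Definition exchange_rhs (i j p q : label) : tser3 := fun a b c =>
  \big[tot_add/tot0]_(k : label) \big[tot_add/tot0]_(l : label)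
    scal3 (at_u12 (Rs i j k l)) (mul3 (at_u2 (Y k p)) (at_u1 (X l q))) a b c.

End ExchangeRelation.

(* The defining relations: each coefficient (indices a, b, c or m, k) of each
   homogeneous component (top f, bottom h). *)
Inductive defrel : forall f g, term f g -> term f g -> Prop :=
| rel_xi_central (e : bool) f g (x : term f g) m k :
    defrel (tmul (tgen (gxi e f m k)) x) (tmul x (tgen (gxi e g m k)))
| rel_xi_inv (e : bool) f0 m k f h :
    defrel (mul2 (xiser e f0) (xiser (~~ e) f0) m k f h) (etaser f0 m k f h)
| rel_TT i j p q a b c f h :
    defrel (exchange_lhs (@Rvv_ser R n ell) Tser Tser i j p q a b c f h)
           (exchange_rhs (@Rvv_ser R n ell) Tser Tser i j p q a b c f h)
| rel_TsTs i j p q a b c f h :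
    defrel (exchange_lhs (@Rdd_ser R n ell) Tsser Tsser i j p q a b c f h)
           (exchange_rhs (@Rdd_ser R n ell) Tsser Tsser i j p q a b c f h)
| rel_TsT i j p q a b c f h :
    defrel (exchange_lhs (@Rdv_ser R n ell) Tsser Tser i j p q a b c f h)
           (exchange_rhs (@Rdv_ser R n ell) Tsser Tser i j p q a b c f h)
| rel_omega i j o m k f h : tgt i = tgt j ->
    defrel
      ((\big[tot_add/tot0]_(p : label | src p == o)
        \big[tot_add/tot0]_(q : label)
          scal2 (omega_ser p q) (mul2 (shift lam (Tser i p)) (Tsser j q)) m k)
       f h)
      (scal2 (omega_ser i j) (xiser true (src i, o)) m k f h)
| rel_omegas i j o m k f h : src i = src j ->
    defrel
      ((\big[tot_add/tot0]_(p : label | tgt p == o)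
        \big[tot_add/tot0]_(q : label)
          scal2 (omegas_ser p q) (mul2 (shift lam (Tsser i p)) (Tser j q)) m k)
       f h)
      (scal2 (omegas_ser i j) (etaser (tgt i, o)) m k f h)
| rel_sigma i j o m k f h : src i = src j ->
    defrel
      ((\big[tot_add/tot0]_(p : label | tgt p == o)
        \big[tot_add/tot0]_(q : label)
          scal2 (sigma_ser p q) (mul2 (Tsser p i) (shift lam (Tser q j))) m k)
       f h)
      (scal2 (sigma_ser i j) (xiser true (o, tgt i)) m k f h)
| rel_sigmas i j o m k f h : tgt i = tgt j ->
    defrel
      ((\big[tot_add/tot0]_(p : label | src p == o)
        \big[tot_add/tot0]_(q : label)
          scal2 (sigmas_ser p q) (mul2 (Tser p i) (shift lam (Tsser q j))) m k)
       f h)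
      (scal2 (sigmas_ser i j) (etaser (o, src i)) m k f h).

(* The congruence generated by the axioms of unital pi^2-graded algebras over
   the complex numbers and by the defining relations. *)
Inductive cong : forall f g, term f g -> term f g -> Prop :=
| cong_defrel f g (x y : term f g) : defrel x y -> cong x y
| cong_refl f g (x : term f g) : cong x x
| cong_sym f g (x y : term f g) : cong x y -> cong y x
| cong_trans f g (x y z : term f g) : cong x y -> cong y z -> cong x z
| cong_add f g (x x' y y' : term f g) :
    cong x x' -> cong y y' -> cong (tadd x y) (tadd x' y')
| cong_scale f g c (x x' : term f g) :
    cong x x' -> cong (tscale c x) (tscale c x')
| cong_mul f g h (x x' : term f g) (y y' : term g h) :
    cong x x' -> cong y y' -> cong (tmul x y) (tmul x' y')
| cong_addA f g (x y z : term f g) :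
    cong (tadd x (tadd y z)) (tadd (tadd x y) z)
| cong_addC f g (x y : term f g) : cong (tadd x y) (tadd y x)
| cong_add0 f g (x : term f g) : cong (tadd (tzero f g) x) x
| cong_addN f g (x : term f g) : cong (tadd (tscale (- 1) x) x) (tzero f g)
| cong_scaleA f g a b (x : term f g) :
    cong (tscale a (tscale b x)) (tscale (a * b) x)
| cong_scale1 f g (x : term f g) : cong (tscale 1 x) x
| cong_scaleDr f g a (x y : term f g) :
    cong (tscale a (tadd x y)) (tadd (tscale a x) (tscale a y))
| cong_scaleDl f g a b (x : term f g) :
    cong (tscale (a + b) x) (tadd (tscale a x) (tscale b x))
| cong_mulA f g h k (x : term f g) (y : term g h) (z : term h k) :
    cong (tmul x (tmul y z)) (tmul (tmul x y) z)
| cong_mul1l f g (x : term f g) : cong (tmul (tone f) x) x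
| cong_mul1r f g (x : term f g) : cong (tmul x (tone g)) x
| cong_mulDl f g h (x y : term f g) (z : term g h) :
    cong (tmul (tadd x y) z) (tadd (tmul x z) (tmul y z))
| cong_mulDr f g h (x : term f g) (y z : term g h) :
    cong (tmul x (tadd y z)) (tadd (tmul x y) (tmul x z))
| cong_mulZl f g h c (x : term f g) (y : term g h) :
    cong (tmul (tscale c x) y) (tscale c (tmul x y))
| cong_mulZr f g h c (x : term f g) (y : term g h) :
    cong (tmul x (tscale c y)) (tscale c (tmul x y)).

HB.instance Definition _ f g := gen_eqMixin (term f g).
HB.instance Definition _ f g := gen_choiceMixin (term f g).

Definition congb f g (x y : term f g) : bool := `[< cong x y >].

Lemma congb_refl f g : reflexive (@congb f g).
Proof. by move=> x; apply/asboolP/cong_refl. Qed.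

Lemma congb_sym f g : symmetric (@congb f g).
Proof. by move=> x y; apply/asboolP/asboolP; exact: cong_sym. Qed.

Lemma congb_trans f g : transitive (@congb f g).
Proof.
by move=> y x z /asboolP xy /asboolP yz; apply/asboolP/(cong_trans xy).
Qed.

Canonical cong_equiv f g :=
  EquivRel (@congb f g) (@congb_refl f g) (@congb_sym f g) (@congb_trans f g).

(* The components of E_l(A_{n-1}^{(1)}). *)
Definition Ecomp f g := {eq_quot cong_equiv f g}%qT.
HB.instance Definition _ f g := Choice.on (Ecomp f g).
HB.instance Definition _ f g := EqQuotient.on (Ecomp f g).

Definition Eclass f g (x : term f g) : Ecomp f g := (\pi_(Ecomp f g) x)%qT.

Lemma EclassP f g (x y : term f g) : Eclass x = Eclass y <-> cong x y.
Proof. by split => [/eqmodP/asboolP|xy] //; apply/eqmodP/asboolP. Qed.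

Lemma Eclass_repr f g (x : Ecomp f g) : Eclass (repr x) = x.
Proof. exact: reprK. Qed.

Lemma cong_repr f g (x : term f g) : cong (repr (Eclass x)) x.
Proof. by apply/EclassP; rewrite Eclass_repr. Qed.

Definition Ezero f g : Ecomp f g := Eclass (tzero f g).
Definition Eadd f g (x y : Ecomp f g) : Ecomp f g :=
  Eclass (tadd (repr x) (repr y)).
Definition Escale f g (c : C) (x : Ecomp f g) : Ecomp f g :=
  Eclass (tscale c (repr x)).
Definition Eopp f g (x : Ecomp f g) : Ecomp f g := Escale (- 1) x.
Definition Emul f g h (x : Ecomp f g) (y : Ecomp g h) : Ecomp f h :=
  Eclass (tmul (repr x) (repr y)).
Definition Eone f : Ecomp f f := Eclass (tone f).

Lemma EaddE f g (x y : term f g) :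
  Eadd (Eclass x) (Eclass y) = Eclass (tadd x y).
Proof. by apply/EclassP/cong_add; apply: cong_repr. Qed.
Lemma EscaleE f g c (x : term f g) : Escale c (Eclass x) = Eclass (tscale c x).
Proof. by apply/EclassP/cong_scale/cong_repr. Qed.
Lemma EmulE f g h (x : term f g) (y : term g h) :
  Emul (Eclass x) (Eclass y) = Eclass (tmul x y).
Proof. by apply/EclassP/cong_mul; apply: cong_repr. Qed.

Section Laws.
Variables f g : arrow.
Implicit Types x y z : Ecomp f g.

Lemma EaddA : associative (@Eadd f g).
Proof.
move=> x y z; rewrite -(Eclass_repr x) -(Eclass_repr y) -(Eclass_repr z).
by rewrite !EaddE; apply/EclassP/cong_addA.
Qed.
Lemma EaddC : commutative (@Eadd f g).
Proof.
move=> x y; rewrite -(Eclass_repr x) -(Eclass_repr y).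
by rewrite !EaddE; apply/EclassP/cong_addC.
Qed.
Lemma Eadd0 : left_id (Ezero f g) (@Eadd f g).
Proof.
by move=> x; rewrite -(Eclass_repr x) EaddE; apply/EclassP/cong_add0.
Qed.
Lemma EaddN : left_inverse (Ezero f g) (@Eopp f g) (@Eadd f g).
Proof.
move=> x; rewrite -(Eclass_repr x) /Eopp EscaleE EaddE.
exact/EclassP/cong_addN.
Qed.
HB.instance Definition _ := GRing.isZmodule.Build (Ecomp f g)
  EaddA EaddC Eadd0 EaddN.

Lemma EscaleA (a b : C) x : Escale a (Escale b x) = Escale (a * b) x.
Proof.
by rewrite -(Eclass_repr x) !EscaleE; apply/EclassP/cong_scaleA.
Qed.
Lemma Escale1 : left_id (1 : C) (@Escale f g).
Proof.
by move=> x; rewrite -(Eclass_repr x) EscaleE; apply/EclassP/cong_scale1.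
Qed.
Lemma EscaleDr : right_distributive (@Escale f g) +%R.
Proof.
move=> a x y; rewrite -(Eclass_repr x) -(Eclass_repr y).
rewrite [X in Escale _ X]EaddE !EscaleE [RHS]EaddE.
exact/EclassP/cong_scaleDr.
Qed.
Lemma EscaleDl x : {morph (@Escale f g)^~ x : a b / a + b}.
Proof.
move=> a b /=; rewrite -(Eclass_repr x) !EscaleE [RHS]EaddE.
exact/EclassP/cong_scaleDl.
Qed.
HB.instance Definition _ := GRing.Zmodule_isLmodule.Build C (Ecomp f g)
  EscaleA Escale1 EscaleDr EscaleDl.
End Laws.

Lemma EmulA f g h k (x : Ecomp f g) (y : Ecomp g h) (z : Ecomp h k) :
  Emul x (Emul y z) = Emul (Emul x y) z.
Proof.
rewrite -(Eclass_repr x) -(Eclass_repr y) -(Eclass_repr z) !EmulE.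
exact/EclassP/cong_mulA.
Qed.
Lemma Emul1l f g (x : Ecomp f g) : Emul (Eone f) x = x.
Proof. by rewrite -(Eclass_repr x) EmulE; apply/EclassP/cong_mul1l. Qed.
Lemma Emul1r f g (x : Ecomp f g) : Emul x (Eone g) = x.
Proof. by rewrite -(Eclass_repr x) EmulE; apply/EclassP/cong_mul1r. Qed.
Lemma EmulDl f g h (x y : Ecomp f g) (z : Ecomp g h) :
  Emul (x + y) z = Emul x z + Emul y z.
Proof.
rewrite -(Eclass_repr x) -(Eclass_repr y) -(Eclass_repr z).
by rewrite [X in Emul X _]EaddE !EmulE [RHS]EaddE; apply/EclassP/cong_mulDl.
Qed.
Lemma EmulDr f g h (x : Ecomp f g) (y z : Ecomp g h) :
  Emul x (y + z) = Emul x y + Emul x z.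
Proof.
rewrite -(Eclass_repr x) -(Eclass_repr y) -(Eclass_repr z).
by rewrite [X in Emul _ X]EaddE !EmulE [RHS]EaddE; apply/EclassP/cong_mulDr.
Qed.
Lemma EmulZl f g h (c : C) (x : Ecomp f g) (y : Ecomp g h) :
  Emul (c *: x) y = c *: Emul x y.
Proof.
rewrite -(Eclass_repr x) -(Eclass_repr y).
by rewrite [X in Emul X _]EscaleE !EmulE [RHS]EscaleE; apply/EclassP/cong_mulZl.
Qed.
Lemma EmulZr f g h (c : C) (x : Ecomp f g) (y : Ecomp g h) :
  Emul x (c *: y) = c *: Emul x y.
Proof.
rewrite -(Eclass_repr x) -(Eclass_repr y).
by rewrite [X in Emul _ X]EscaleE !EmulE [RHS]EscaleE; apply/EclassP/cong_mulZr.
Qed.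

Definition Eell : pi2_algebra R n ell :=
  @Pi2Algebra R n ell (fun f g => Ecomp f g) Emul Eone
    EmulA Emul1l Emul1r EmulDl EmulDr EmulZl EmulZr.

Definition Egen (x : generator) : Eell (gtop x) (gbot x) := Eclass (tgen x).

End Presentation.

(* Main.v *)
(* Applied to e_x, each defining relation becomes an identity between matrix
   elements.  Up to the gauge factors up and down, R_{V*V}(u) is the weight
   matrix W(lam - u) with its four labels turned by a quarter, and R_{V*V*}(u)
   is W(u) turned by a half.  Hence the three exchange relations are all
   instances of the Yang-Baxter equation of W, the relations of omega^* and
   sigma^* say that W(u) W(-u) = 1, and those of omega and sigma are the
   crossing unitarity of W, whose scalar is rho_2.

   The Yang-Baxter equation and unitarity follow from the three-term relation
   of the theta function; crossing unitarity is a vanishing sum of theta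
   quotients over the poles of an elliptic function of degree zero.  Staying in
   P_{++} costs nothing, because a bracket vanishes on each wall of the alcove.

   The identities hold for purely imaginary tau and small z, w, where all the
   weights are sums of convergent power series in z and w; such series are
   determined by their values there, so the identities hold coefficientwise. *)

Require Import Defs.
From HB Require Import structures.
From mathcomp Require Import all_boot all_order all_algebra.
From mathcomp Require Import generic_quotient complex.
From mathcomp Require Import boolp classical_sets reals topology normedtype.
From mathcomp Require Import sequences derive exp trigo.
From mathcomp Require Import ring lra zify.
Set Implicit Arguments.
Unset Strict Implicit.
Unset Printing Implicit Defensive.
Import Order.TTheory GRing.Theory Num.Theory.
Import numFieldNormedType.Exports.
Local Open Scope ring_scope.

(** * Unordered absolutely convergent sums *)

Section Summation.
Variable R : realType.
Local Notation C := (cplx R).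

Implicit Types I J : eqType.

(** [expansion] is a choice, so every coefficient in the statement is arbitrary until a convergent
    expansion has been exhibited. A single bracket has none, because theta carries the factor
    z^(-1/2) p^(1/8). In a quotient of brackets at real shifts of u these factors cancel up to a
    phase and leave a power series in z, w with nonzero constant term, which can be inverted. Square
    roots are taken of functions of tau that vanish identically or have a positive constant term;
    the positivity comes from the trigonometric limits 2 sin(pi d / L) with 0 < d < L, and this is
    where the alcove enters the analysis.

    No complex analysis is used. The three-term relation is a Pluecker relation obtained by
    rearranging Gaussian sums, and the vanishing sum of residues behind crossing unitarity is proved
    from it by induction on the number of poles. All infinite sums are unordered, so that
    rearranging, grouping and multiplying need no control of the order of summation.

    The dynamical weights are first studied on words of directions, where all permutations of a word
    are present; paths in the alcove are treated afterwards. *)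

Definition rc (x : R) : C := x%:C%C.

Lemma rcD x y : rc (x + y) = rc x + rc y.
Proof. by rewrite /rc rmorphD. Qed.
Lemma rcM x y : rc (x * y) = rc x * rc y.
Proof. by rewrite /rc rmorphM. Qed.
Lemma rcN x : rc (- x) = - rc x.
Proof. by rewrite /rc rmorphN. Qed.
Lemma rcB x y : rc (x - y) = rc x - rc y.
Proof. by rewrite rcD rcN. Qed.
Lemma rc0 : rc 0 = 0.
Proof. by []. Qed.
Lemma rc1 : rc 1 = 1.
Proof. by []. Qed.
Lemma rcV x : rc x^-1 = (rc x)^-1.
Proof. by rewrite /rc fmorphV. Qed.
Lemma rc_nat n : rc n%:R = n%:R.
Proof. by rewrite /rc rmorph_nat. Qed.
Lemma rc_int n : rc n%:~R = n%:~R.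
Proof. by rewrite /rc rmorph_int. Qed.
Lemma rcX x n : rc (x ^+ n) = rc x ^+ n.
Proof. by rewrite /rc rmorphXn. Qed.
Lemma rc_sum (I : Type) (r : seq I) (P : pred I) (F : I -> R) :
  rc (\sum_(i <- r | P i) F i) = \sum_(i <- r | P i) rc (F i).
Proof. by rewrite /rc rmorph_sum. Qed.
Lemma rc_le x y : (rc x <= rc y) = (x <= y).
Proof. by rewrite /rc lecR. Qed.
Lemma rc_lt x y : (rc x < rc y) = (x < y).
Proof. by rewrite /rc ltcR. Qed.
Lemma rc_inj : injective rc.
Proof. exact: complexI. Qed.
Lemma rc_eq0 x : (rc x == 0) = (x == 0).
Proof. by rewrite -rc0 (inj_eq rc_inj). Qed.

(** The norm on C takes its values in C itself; this is the modulus as a real number, to which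
    [lra], [nra] and suprema apply. *)
Definition nm (x : C) : R := complex.Re `|x|.

Lemma nmE (x : C) : `|x| = rc (nm x).
Proof. by rewrite /nm /rc normc_def. Qed.
Lemma nm_ge0 x : 0 <= nm x.
Proof. by rewrite -rc_le -nmE normr_ge0. Qed.
Lemma nmD x y : nm (x + y) <= nm x + nm y.
Proof. by rewrite -rc_le rcD -!nmE ler_normD. Qed.
Lemma nmM x y : nm (x * y) = nm x * nm y.
Proof. by apply: rc_inj; rewrite rcM -!nmE normrM. Qed.
Lemma nmN x : nm (- x) = nm x.
Proof. by rewrite /nm normrN. Qed.
Lemma nmB x y : nm (x - y) = nm (y - x).
Proof. by rewrite /nm distrC. Qed.
Lemma nm0 : nm 0 = 0.
Proof. by rewrite /nm normr0. Qed.
Lemma nm1 : nm 1 = 1.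
Proof. by rewrite /nm normr1. Qed.
Lemma nmX x n : nm (x ^+ n) = nm x ^+ n.
Proof. by elim: n => [|n IH]; rewrite ?expr0 ?nm1// !exprS nmM IH. Qed.
Lemma nmV x : nm x^-1 = (nm x)^-1.
Proof. by apply: rc_inj; rewrite rcV -!nmE normfV. Qed.
Lemma nm_eq0 x : (nm x == 0) = (x == 0).
Proof. by rewrite -rc_eq0 -nmE normr_eq0. Qed.
Lemma nm_rc x : nm (rc x) = `|x|.
Proof. by apply: rc_inj; rewrite -nmE /rc normc_def /= expr0n addr0 sqrtr_sqr. Qed.
Lemma nm_sum (I : Type) (r : seq I) (P : pred I) (F : I -> C) :
  nm (\sum_(i <- r | P i) F i) <= \sum_(i <- r | P i) nm (F i).
Proof.
by rewrite -rc_le rc_sum -nmE (le_trans (ler_norm_sum _ _ _))//; apply: ler_sum => i _; rewrite nmE.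
Qed.
Lemma nm_gt0 x : (0 < nm x) = (x != 0).
Proof. by rewrite lt0r nm_ge0 andbT nm_eq0. Qed.
Lemma nm_tri x y z : nm (x - z) <= nm (x - y) + nm (y - z).
Proof. by have := nmD (x - y) (y - z); rewrite addrA subrK. Qed.
Lemma nm_small x : (forall e, 0 < e -> nm x < e) -> x = 0.
Proof.
move=> h; apply/eqP; rewrite -nm_eq0; apply/negPn/negP => n0.
by have := h (nm x); rewrite lt0r n0 nm_ge0 ltxx => /(_ isT).
Qed.

Definition bsum (I : eqType) (f : I -> C) (M : R) :=
  forall B, uniq B -> \sum_(i <- B) nm (f i) <= M.

Definition asum (I : eqType) (f : I -> C) := exists M, bsum f M.

(** Convergence along the net of finite subsets, represented by duplicate-free lists. Absolute
    summability is part of the definition because products and regroupings consume it. *)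
Definition hsum (I : eqType) (f : I -> C) (s : C) :=
  asum f /\ forall e : R, 0 < e -> exists A : seq I, forall B, uniq B ->
    {subset A <= B} -> nm (\sum_(i <- B) f i - s) < e.

Lemma sum_split (V : nmodType) (I : eqType) (A B : seq I) (f : I -> V) :
  uniq A -> uniq B -> {subset A <= B} ->
  \sum_(i <- B) f i = \sum_(i <- A) f i + \sum_(i <- B | i \notin A) f i.
Proof.
move=> uA uB sAB; rewrite (bigID (mem A))/=; congr (_ + _).
rewrite -big_filter; apply: perm_big; apply: uniq_perm => //.
  exact: filter_uniq.
by move=> i; rewrite mem_filter; case: (boolP (i \in A)) => //= /sAB.
Qed.

Lemma sum_sub (I : eqType) (A B : seq I) (g : I -> R) :
  uniq A -> uniq B -> {subset A <= B} -> (forall i, 0 <= g i) ->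
  \sum_(i <- A) g i <= \sum_(i <- B) g i.
Proof. by move=> uA uB sAB g0; rewrite (sum_split _ uA uB sAB) lerDl sumr_ge0. Qed.

Lemma bsum_ge0 I (f : I -> C) M : bsum f M -> 0 <= M.
Proof. by move=> /(_ [::] isT); rewrite big_nil. Qed.

Lemma asum_le I (f g : I -> C) :
  (forall i, nm (f i) <= nm (g i)) -> asum g -> asum f.
Proof. by move=> fg [M h]; exists M => B /h; apply: le_trans; apply: ler_sum => i _. Qed.

Lemma asum_inj (I J : eqType) (e : I -> J) (f : J -> C) :
  injective e -> asum f -> asum (f \o e).
Proof.
move=> ie [M h]; exists M => B uB; rewrite -(big_map e xpredT (fun j => nm (f j))).
by apply: h; rewrite map_inj_uniq.
Qed.

Lemma asumZ I (f : I -> C) c : asum f -> asum (fun i => c * f i).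
Proof.
move=> [M h]; exists (nm c * M) => B /h hB.
under eq_bigr do rewrite nmM.
by rewrite -mulr_sumr ler_wpM2l ?nm_ge0.
Qed.

Lemma asumD I (f g : I -> C) : asum f -> asum g -> asum (fun i => f i + g i).
Proof.
move=> [M h] [N k]; exists (M + N) => B uB.
rewrite (le_trans _ (lerD (h B uB) (k B uB)))// -big_split/=.
by apply: ler_sum => i _; exact: nmD.
Qed.

Lemma asum_prod (I J : eqType) (f : I -> C) (g : J -> C) : asum f -> asum g ->
  asum (fun ij : I * J => f ij.1 * g ij.2).
Proof.
move=> [M h] [N k]; exists (M * N) => B uB.
set B1 := undup (map fst B); set B2 := undup (map snd B).
apply: le_trans (_ : \sum_(ij <- [seq (i, j) | i <- B1, j <- B2]) nm (f ij.1 * g ij.2) <= _).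
  apply: sum_sub => //; first by apply: allpairs_uniq; rewrite ?undup_uniq// => -[? ?] [].
    move=> [i j] ij; apply/allpairsP; exists (i, j); split=> //=; rewrite mem_undup; apply/mapP; by exists (i, j).
  by move=> i; exact: nm_ge0.
rewrite big_allpairs_dep/=.
under eq_bigr do under eq_bigr do rewrite nmM.
under eq_bigr do rewrite -mulr_sumr.
rewrite -mulr_suml ler_pM ?sumr_ge0// => *; rewrite ?nm_ge0//.
  by apply: h; rewrite undup_uniq.
by apply: k; rewrite undup_uniq.
Qed.

Lemma hsum_unique I (f : I -> C) s t : hsum f s -> hsum f t -> s = t.
Proof.
move=> [_ h] [_ k]; apply/eqP; rewrite -subr_eq0; apply/eqP/nm_small => e e0.
have e2 : 0 < e / 2 by rewrite divr_gt0.
have [A hA] := h _ e2; have [B kB] := k _ e2.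
set D := undup (A ++ B).
have uD : uniq D by rewrite undup_uniq.
have sA : {subset A <= D} by move=> i iB; rewrite mem_undup mem_cat iB.
have sB : {subset B <= D} by move=> i iB; rewrite mem_undup mem_cat iB orbT.
have h1 := hA D uD sA; have k1 := kB D uD sB; have := nm_tri s (\sum_(i <- D) f i) t.
by rewrite [nm (s - bigop _ _ _)]nmB; move: h1 k1; lra.
Qed.

Lemma hsum_asum I (f : I -> C) s : hsum f s -> asum f.
Proof. by case. Qed.

Lemma eq_hsum I (f g : I -> C) s : f =1 g -> hsum f s -> hsum g s.
Proof. by move=> /funext ->. Qed.

Lemma hsum_fin I (A : seq I) (f : I -> C) : uniq A ->
  (forall i, i \notin A -> f i = 0) -> hsum f (\sum_(i <- A) f i).
Proof.
move=> uA f0; split.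
  exists (\sum_(i <- A) nm (f i)) => B uB.
  rewrite (bigID (mem A))/= [X in _ + X]big1 ?addr0; last first.
    by move=> i /f0 ->; rewrite nm0.
  rewrite -big_filter; apply: sum_sub; rewrite ?filter_uniq//.
    by move=> i; rewrite mem_filter => /andP[].
  by move=> i; rewrite nm_ge0.
move=> e e0; exists A => B uB sAB; rewrite (sum_split _ uA uB sAB).
by rewrite addrC addKr big1 ?nm0// => i; exact: f0.
Qed.

Lemma hsum0 I : hsum (fun _ : I => 0) 0.
Proof. by have := @hsum_fin I [::] (fun=> 0) isT; rewrite big_nil; apply. Qed.

Lemma hsumD I (f g : I -> C) s t :
  hsum f s -> hsum g t -> hsum (fun i => f i + g i) (s + t).
Proof.
move=> [af h] [ag k]; split; first exact: asumD.
move=> e e0; have e2 : 0 < e / 2 by rewrite divr_gt0.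
have [A hA] := h _ e2; have [B kB] := k _ e2.
exists (A ++ B) => D uD sD; rewrite big_split/=.
have sA : {subset A <= D} by move=> i iB; apply: sD; rewrite mem_cat iB.
have sB : {subset B <= D} by move=> i iB; apply: sD; rewrite mem_cat iB orbT.
have h1 := hA D uD sA; have k1 := kB D uD sB; set x := bigop _ _ _ in h1 *; set y := bigop _ _ _ in k1 *.
have := nmD (x - s) (y - t); rewrite [X in nm X <= _](_ : _ = x + y - (s + t)); last by ring.
by move: h1 k1; lra.
Qed.

Lemma hsumZ I (f : I -> C) c s : hsum f s -> hsum (fun i => c * f i) (c * s).
Proof.
move=> [af h]; split; first exact: asumZ.
move=> e e0; have c0 : 0 < nm c + 1 by have := nm_ge0 c; lra.
have [A hA] := h (e / (nm c + 1)) (divr_gt0 e0 c0).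
exists A => B uB sB; rewrite -mulr_sumr -mulrBr nmM.
have := hA B uB sB; rewrite ltr_pdivlMr//.
set x := nm (_ - _); have x0 : 0 <= x by exact: nm_ge0.
by move: x0; have := nm_ge0 c; nra.
Qed.

Lemma hsumN I (f : I -> C) s : hsum f s -> hsum (fun i => - f i) (- s).
Proof. by move=> /(hsumZ (-1)); rewrite mulN1r; apply: eq_hsum => i; rewrite mulN1r. Qed.

Lemma hsumB I (f g : I -> C) s t :
  hsum f s -> hsum g t -> hsum (fun i => f i - g i) (s - t).
Proof. by move=> hf /hsumN; exact: hsumD. Qed.

Lemma hsum_sum (J : Type) (r : seq J) (P : pred J) I (f : J -> I -> C) (s : J -> C) :
  (forall j, P j -> hsum (f j) (s j)) ->
  hsum (fun i => \sum_(j <- r | P j) f j i) (\sum_(j <- r | P j) s j).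
Proof.
move=> h; elim: r => [|j r IH].
  by rewrite big_nil; apply: eq_hsum (hsum0 I) => i; rewrite big_nil.
rewrite big_cons; case: ifP => Pj; last by apply: eq_hsum IH => i; rewrite big_cons Pj.
by apply: eq_hsum (hsumD (h _ Pj) IH) => i; rewrite big_cons Pj.
Qed.

Lemma hsum_le I (f : I -> C) s M : hsum f s -> bsum f M -> nm s <= M.
Proof.
move=> [_ h] fM; rewrite leNgt; apply/negP => Ms.
have sM0 : 0 < nm s - M by rewrite subr_gt0.
have [A hA] := h _ sM0.
have sA : {subset A <= undup A} by move=> i; rewrite mem_undup.
have := hA _ (undup_uniq A) sA; have := fM _ (undup_uniq A).
set x := bigop _ _ _; set y := bigop _ _ _ => xM.
have yx : nm y <= x by exact: nm_sum.
have := nmD (s - y) y; rewrite subrK [nm (s - y)]nmB.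
by move: xM yx; lra.
Qed.

Lemma uniq_fibers (I J : eqType) (p : I -> J) (fib : J -> seq I) (B : seq J) :
  (forall j, uniq (fib j)) -> (forall i j, (i \in fib j) = (p i == j)) ->
  uniq B -> uniq [seq i | j <- B, i <- fib j].
Proof.
move=> ufib mfib; elim: B => //= j B IH /andP[jB uB].
rewrite cat_uniq map_id ufib IH// andbT; apply/hasPn => i /allpairsPdep[k [i' [kB]]].
by rewrite mfib => /eqP ki ->; rewrite mfib ki; apply: contra jB => /eqP <-.
Qed.

Lemma asum_fiber (I J : eqType) (p : I -> J) (fib : J -> seq I) (f : I -> C) :
  (forall j, uniq (fib j)) -> (forall i j, (i \in fib j) = (p i == j)) ->
  asum f -> asum (fun j => \sum_(i <- fib j) f i).
Proof.
move=> ufib mfib [M h]; exists M => B uB.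
rewrite (le_trans _ (h [seq i | j <- B, i <- fib j] _))//.
  by rewrite big_allpairs_dep; apply: ler_sum => j _; exact: nm_sum.
exact: uniq_fibers.
Qed.

(** Grouping along a map with finite fibres, listed by [fib]. Cauchy products arise when the map
    adds exponents, series in zw when it sends an integer to its triangular number. *)
Lemma hsum_fiber (I J : eqType) (p : I -> J) (fib : J -> seq I) (f : I -> C) s :
  (forall j, uniq (fib j)) -> (forall i j, (i \in fib j) = (p i == j)) ->
  hsum f s -> hsum (fun j => \sum_(i <- fib j) f i) s.
Proof.
move=> ufib mfib [af h]; split; first exact: asum_fiber mfib af.
move=> e /h[A hA]; exists (map p A) => B uB sB.
rewrite -big_allpairs_dep; apply: hA; first exact: uniq_fibers mfib uB.
move=> i iA; apply/allpairsPdep; exists (p i), i; split=> //; last by rewrite mfib.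
by apply: sB; apply: map_f.
Qed.

Lemma hsum_bij (I J : eqType) (g : J -> I) (f : I -> C) s :
  bijective g -> hsum f s -> hsum (f \o g) s.
Proof.
move=> [p gK pK] h.
have := @hsum_fiber I J p (fun j => [:: g j]) f s (fun=> isT) _ h.
have mfib i j : (i \in [:: g j]) = (p i == j).
  by rewrite inE; apply/eqP/eqP => [->|<-].
by move=> /(_ mfib); apply: eq_hsum => j; rewrite big_seq1.
Qed.

(** Reindexing along an injection outside whose image the terms vanish. The partial inverse [q]
    turns the fibres, of at most one point each, into lists, which makes this a case of
    [hsum_fiber]. *)
Lemma hsum_inj (I J : eqType) (g : J -> I) (q : I -> option J) (f : I -> C) s :
  pcancel g q -> (forall i, (forall j, g j != i) -> f i = 0) ->
  hsum (f \o g) s -> hsum f s.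
Proof.
move=> gK f0 h.
pose fib i := if q i is Some j then if g j == i then [:: j] else [::] else [::].
have ufib i : uniq (fib i) by rewrite /fib; case: (q i) => // j; case: ifP.
have mfib j i : (j \in fib i) = (g j == i).
  rewrite /fib; apply/idP/eqP => [|<-]; last by rewrite gK eqxx inE.
  by case: (q i) => // j'; case: eqP => // <-; rewrite inE => /eqP ->.
have := hsum_fiber ufib mfib h; apply: eq_hsum => i.
have [[j /eqP <-]|no] := pselect (exists j, g j == i); first by rewrite /fib gK eqxx big_seq1.
rewrite f0; last by move=> j; apply/negP => gj; apply: no; exists j.
by rewrite big1_seq// => j; rewrite mfib => gj; case: no; exists j.
Qed.

Lemma has_sup_bsum (I : eqType) (f : I -> C) M : bsum f M ->
  has_sup [set x : R | exists2 B, uniq B & x = \sum_(i <- B) nm (f i)]%classic.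
Proof.
move=> h; split; first by exists 0; exists [::] => //; rewrite big_nil.
by exists M => x [B uB ->]; exact: h.
Qed.

(** The sum is the supremum of the finite partial sums; real and complex families reduce to this
    case through positive and negative parts, then real and imaginary parts. *)
Lemma asum_nneg I (g : I -> R) : (forall i, 0 <= g i) -> asum (rc \o g) ->
  exists s, hsum (rc \o g) s.
Proof.
move=> g0 af; have [M h] := af; pose E := [set x : R | exists2 B, uniq B & x = \sum_(i <- B) nm (rc (g i))]%classic.
have hE : has_sup E by exact: has_sup_bsum h.
exists (rc (sup E)); split => // e e0; have [x [A uA ->] hx] := sup_adherent e0 hE.
exists A => B uB sAB; rewrite -rc_sum -rcB nm_rc.
have gE D : \sum_(i <- D) nm (rc (g i)) = \sum_(i <- D) g i.
  by apply: eq_bigr => i _; rewrite nm_rc ger0_norm.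
rewrite gE in hx; have := sum_sub uA uB sAB g0.
have : \sum_(i <- B) g i <= sup E by apply: sup_upper_bound => //; exists B; rewrite ?gE.
by rewrite ltr_norml; lra.
Qed.

Lemma Re_le_nm (x : C) : `|complex.Re x| <= nm x.
Proof. by rewrite -rc_le -nmE; exact: normc_ge_Re. Qed.

Lemma nmi : nm ('i%C : C) = 1.
Proof. by rewrite /nm normc_def /= expr0n add0r expr1n sqrtr1. Qed.

Lemma ReIm (x : C) : x = rc (complex.Re x) + 'i%C * rc (complex.Im x).
Proof.
by case: x => a b; apply/eqP; rewrite eq_complex /=; apply/andP; split; apply/eqP; ring.
Qed.

Lemma Im_le_nm (x : C) : `|complex.Im x| <= nm x.
Proof.
have := Re_le_nm (- 'i%C * x); rewrite nmM nmN nmi mul1r.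
by case: x => a b /=; rewrite oppr0 mul0r mulN1r sub0r opprK.
Qed.

Lemma asum_real I (g : I -> R) : asum (rc \o g) -> exists s, hsum (rc \o g) s.
Proof.
move=> ag.
have [s1 h1] : exists s, hsum (rc \o (fun i => Num.max (g i) 0)) s.
  apply: asum_nneg; first by move=> i; rewrite le_max lexx orbT.
  apply: asum_le ag => i; rewrite /= !nm_rc.
  by case: (lerP (g i) 0) => g0; rewrite ?normr0.
have [s2 h2] : exists s, hsum (rc \o (fun i => Num.max (- g i) 0)) s.
  apply: asum_nneg; first by move=> i; rewrite le_max lexx orbT.
  apply: asum_le ag => i; rewrite /= !nm_rc.
  by case: (lerP (- g i) 0) => g0; rewrite ?normr0 ?normrN.
exists (s1 - s2); apply: eq_hsum (hsumB h1 h2) => i /=.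
rewrite -rcB; congr rc.
by case: (lerP (g i) 0) => g0; case: (lerP (- g i) 0) => g1; lra.
Qed.

Lemma asum_hsum I (f : I -> C) : asum f -> exists s, hsum f s.
Proof.
move=> af.
have [s1 h1] : exists s, hsum (rc \o (fun i => complex.Re (f i))) s.
  by apply: asum_real; apply: asum_le af => i; rewrite /= nm_rc Re_le_nm.
have [s2 h2] : exists s, hsum (rc \o (fun i => complex.Im (f i))) s.
  by apply: asum_real; apply: asum_le af => i; rewrite /= nm_rc Im_le_nm.
exists (s1 + 'i%C * s2).
by apply: eq_hsum (hsumD h1 (hsumZ 'i%C h2)) => i /=; rewrite -ReIm.
Qed.

(** The product family is summable, with some sum [v]. Then [v] and [s * t] are compared on one
    rectangle large enough for [f], for [g] and for the product family at once. *)
Lemma hsum_prod (I J : eqType) (f : I -> C) (g : J -> C) s t :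
  hsum f s -> hsum g t -> hsum (fun ij : I * J => f ij.1 * g ij.2) (s * t).
Proof.
move=> [af hf] [ag hg]; have [v hv] := asum_hsum (asum_prod af ag).
rewrite (_ : s * t = v)//; apply/eqP; rewrite -subr_eq0; apply/eqP/nm_small => e e0.
have [N gN] := ag; have N0 := bsum_ge0 gN; have s0 := nm_ge0 s.
(* Chosen from |st - xy| <= |s - x| |y| + |s| |t - y| with |y| <= N; the added 1 keeps the
   denominator positive. *)
have D0 : 0 < 2 * (N + nm s + 1) by lra.
have d0 := divr_gt0 e0 D0; set d := e / _ in d0.
have [A hA] := hf _ d0; have [B hB] := hg _ d0.
have e2 : 0 < e / 2 by lra.
have [E hE] := hv.2 _ e2.
pose A1 := undup (A ++ map fst E); pose B1 := undup (B ++ map snd E).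
have uD : uniq [seq (i, j) | i <- A1, j <- B1].
  by apply: allpairs_uniq; rewrite ?undup_uniq// => -[? ?] [].
have := hE _ uD; rewrite big_allpairs_dep/=.
under eq_bigr do rewrite -mulr_sumr.
rewrite -mulr_suml.
have := hA A1 (undup_uniq _); have := hB B1 (undup_uniq _).
have := gN B1 (undup_uniq _); have := nm_sum B1 xpredT g.
set x := \sum_(i <- A1) _; set y := \sum_(i <- B1) g _; set y' := bigop _ _ _.
move=> yy' y'N h1 h2 h3.
have {}h1 : nm (y - t) < d by apply: h1 => i iB; rewrite mem_undup mem_cat iB.
have {}h2 : nm (x - s) < d by apply: h2 => i iB; rewrite mem_undup mem_cat iB.
have {}h3 : nm (x * y - v) < e / 2.
  apply: h3 => -[i j] ij; apply/allpairsP; exists (i, j); split => //=.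
    by rewrite mem_undup mem_cat; apply/orP; right; apply/mapP; exists (i, j).
  by rewrite mem_undup mem_cat; apply/orP; right; apply/mapP; exists (i, j).
have := nm_tri (s * t) (x * y) v.
have := nmD ((s - x) * y) (s * (t - y)); rewrite !nmM (nmB s x) (nmB t y).
rewrite [X in nm X <= _](_ : _ = s * t - x * y); last by ring.
have : d * (N + nm s + 1) = e / 2 by rewrite /d; field; lra.
by have := nm_ge0 (x - s); have := nm_ge0 (y - t); have := nm_ge0 y; nra.
Qed.

End Summation.

(** * Sums over the natural numbers and the integers, and ordinary limits *)

Section SumNatInt.
Variable R : realType.
Local Notation C := (cplx R).
Local Notation rc := (@rc R).
Local Notation nm := (@nm R).

Lemma mem_bound (B : seq nat) : exists N, {subset B <= index_iota 0 N}.
Proof.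
exists (\max_(i <- B) i).+1 => i iB; rewrite mem_index_iota /= ltnS.
exact: (@leq_bigmax_seq _ B xpredT (fun i => i) i).
Qed.

Lemma bsum_geo (x : R) : 0 <= x < 1 -> bsum (fun k : nat => rc (x ^+ k)) (1 - x)^-1.
Proof.
move=> /andP[x0 x1] B uB; have [N sB] := mem_bound B.
apply: le_trans (sum_sub uB (iota_uniq _ _) sB _) _; first by move=> i; exact: nm_ge0.
have -> : \sum_(i <- index_iota 0 N) nm (rc (x ^+ i)) = \sum_(i < N) x ^+ i.
  by rewrite -(big_mkord xpredT) ; apply: eq_bigr => i _; rewrite nm_rc ger0_norm// exprn_ge0.
rewrite -[X in _ <= X]div1r ler_pdivlMr ?subr_gt0//.
have -> : (\sum_(i < N) x ^+ i) * (1 - x) = 1 - x ^+ N.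
  by rewrite -opprB mulrN mulrC -subrX1 opprB.
by rewrite gerBl exprn_ge0.
Qed.

Lemma asum_geo (x : R) : 0 <= x < 1 -> asum (fun k : nat => rc (x ^+ k)).
Proof. by move=> /bsum_geo; exists (1 - x)^-1. Qed.

Lemma asum_int (f : int -> C) : asum (f \o Posz) -> asum (f \o Negz) -> asum f.
Proof.
move=> [M h] [N k]; exists (M + N) => B uB.
set B1 := undup (map absz B); set B2 := undup (map (fun i => (absz i).-1) B).
apply: le_trans (_ : \sum_(i <- map Posz B1 ++ map Negz B2) nm (f i) <= _).
  apply: sum_sub => //; last by move=> i; exact: nm_ge0.
    rewrite cat_uniq !map_inj_uniq ?undup_uniq//= ?andbT; try by move=> ? ? [].
    by apply/hasPn => i /mapP[n _ ->]; apply/mapP => -[].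
  case=> n nB; rewrite mem_cat; apply/orP.
    by left; apply/mapP; exists n => //; rewrite mem_undup; apply/mapP; exists (Posz n).
  by right; apply/mapP; exists n => //; rewrite mem_undup; apply/mapP; exists (Negz n).
by rewrite big_cat !big_map/=; apply: lerD; [apply: h|apply: k]; rewrite undup_uniq.
Qed.

Lemma hsum_int (f : int -> C) s t :
  hsum (f \o Posz) s -> hsum (f \o Negz) t -> hsum f (s + t).
Proof.
move=> h k.
have h1 : hsum (fun i => if i is Posz n then f i else 0) s.
  by apply: (@hsum_inj _ _ _ Posz (fun i => if i is Posz n then Some n else None)) => // -[n|n]//= /(_ n)/eqP.
have h2 : hsum (fun i => if i is Negz n then f i else 0) t.
  by apply: (@hsum_inj _ _ _ Negz (fun i => if i is Negz n then Some n else None)) => // -[n|n]//= /(_ n)/eqP.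
by apply: eq_hsum (hsumD h1 h2) => -[n|n] /=; rewrite ?addr0 ?add0r.
Qed.

Lemma hsum_int_inv (f : int -> C) s : hsum f s ->
  exists s1 s2, [/\ hsum (f \o Posz) s1, hsum (f \o Negz) s2 & s = s1 + s2].
Proof.
move=> h; have af := hsum_asum h.
have [s1 h1] : exists s, hsum (f \o Posz) s by apply: asum_hsum; apply: asum_inj => // ? ? [].
have [s2 h2] : exists s, hsum (f \o Negz) s by apply: asum_hsum; apply: asum_inj => // ? ? [].
by exists s1, s2; split => //; apply: hsum_unique h (hsum_int h1 h2).
Qed.

(** The epsilon of the filter statement is a positive element of C, hence a real number; this passes
    between the two formats. *)
Lemma cvg_nm (u : nat -> C) (s : C) :
  (forall e, 0 < e -> exists N, forall n, (N <= n)%N -> nm (u n - s) < e) <->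
  (u @ \oo --> s)%classic.
Proof.
split => [h|].
  apply/cvgrPdist_lt => e e0.
  have eR : e = rc (complex.Re e).
    by move: e0; case: (e) => a b; rewrite ltcE /= => /andP[/eqP -> _].
  have [|N hN] := h (complex.Re e); first by rewrite -rc_lt -eR.
  by exists N => // n /hN; rewrite -rc_lt -eR -nmE distrC.
move=> /cvgrPdist_lt h e e0.
have [|N _ hN] := h (rc e); first by rewrite -rc0 rc_lt.
by exists N => n /hN /=; rewrite distrC nmE rc_lt.
Qed.

Lemma hsum_series (f : nat -> C) s : hsum f s -> (series f @ \oo --> s)%classic.
Proof.
move=> [_ h]; apply/cvg_nm => e /h[A hA]; have [N sA] := mem_bound A.
exists N => n Nn; apply: hA; first exact: iota_uniq.
by move=> i /sA; rewrite !mem_index_iota /= => /leq_trans; apply.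
Qed.

Lemma hsum_limn (f : nat -> C) s : hsum f s -> limn (series f) = s.
Proof. by move=> /hsum_series; apply: cvg_lim; exact: norm_hausdorff. Qed.

End SumNatInt.

(** * The theta function *)

Section ComplexExp.
Variable R : realType.
Local Notation C := (cplx R).
Local Notation rc := (@rc R).
Local Notation nm := (@nm R).

Lemma Re_rcM (x : R) (y : C) : complex.Re (rc x * y) = x * complex.Re y.
Proof. by case: y => a b /=; rewrite mul0r subr0. Qed.

Lemma cexpD (x y : C) : cexp (x + y) = cexp x * cexp y.
Proof.
case: x y => a b [c d]; rewrite /cexp /= expRD cosD sinD.
by apply/eqP; rewrite eq_complex /=; apply/andP; split; apply/eqP; ring.
Qed.

Lemma cexp0 : cexp (0 : C) = 1.
Proof. by rewrite /cexp /= expR0 cos0 sin0 mul1r. Qed.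

Lemma nm_cexp (x : C) : nm (cexp x) = expR (complex.Re x).
Proof.
rewrite nmM nm_rc ger0_norm ?expR_ge0//.
rewrite [X in _ * X](_ : _ = 1) ?mulr1//.
by rewrite /nm normc_def /= cos2Dsin2 sqrtr1.
Qed.

Lemma cexp_neq0 (x : C) : cexp x != 0.
Proof. by rewrite -nm_gt0 nm_cexp expR_gt0. Qed.

Lemma cexpN (x : C) : cexp (- x) = (cexp x)^-1.
Proof.
apply: (mulIf (cexp_neq0 x)); rewrite -cexpD addNr cexp0 mulVf//; exact: cexp_neq0.
Qed.

Lemma cexpMn (x : C) n : cexp (n%:R * x) = cexp x ^+ n.
Proof.
elim: n => [|n IH]; first by rewrite mul0r cexp0 expr0.
by rewrite -natr1 mulrDl mul1r cexpD IH exprSr.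
Qed.

Lemma cexp_rc (x : R) : cexp (rc x) = rc (expR x).
Proof. by rewrite /cexp /= cos0 sin0 mulr1. Qed.

Lemma cexp_pii : cexp (rc pi * 'i%C) = -1 :> C.
Proof.
have -> : rc pi * 'i%C = (0 +i* pi)%C :> C.
  by apply/eqP; rewrite eq_complex /=; apply/andP; split; apply/eqP; ring.
rewrite /cexp /= expR0 cospi sinpi mul1r.
by apply/eqP; rewrite eq_complex /= oppr0 !eqxx.
Qed.

Lemma twopiiE : twopii R = 2 * (rc pi * 'i%C).
Proof. by rewrite /twopii -/(rc _) rcM rc_nat mulrA. Qed.

Lemma cexp_twopii_int (m : int) : cexp (twopii R * m%:~R) = 1.
Proof.
have h n : cexp (twopii R * n%:R) = 1.
  by rewrite mulrC cexpMn twopiiE mulr_natl mulr2n cexpD cexp_pii mulN1r opprK expr1n.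
by case: m => n; rewrite ?NegzE ?mulrNz ?mulrN ?cexpN h ?invr1.
Qed.

Lemma conj_cexp (x : C) : (cexp x)^*%C = cexp (x^*%C).
Proof.
case: x => a b; rewrite /cexp /= cosN sinN.
by apply/eqP; rewrite eq_complex /=; apply/andP; split; apply/eqP; ring.
Qed.

End ComplexExp.

(** * Gaussian sums over the integers *)

Section Gauss.
Variable R : realType.
Local Notation C := (cplx R).
Local Notation rc := (@rc R).
Local Notation nm := (@nm R).

(** The offset c is 1/2 for the theta function itself and 0 for the companion series that appears in
    its product formula. *)
Definition gauss (a c : R) (b : C) (m : int) : C :=
  cexp (- rc a * (m%:~R + rc c) ^+ 2 + b * (m%:~R + rc c)).

Lemma nm_gauss a c b m : nm (gauss a c b m) =
  expR (- a * (m%:~R + c) ^+ 2 + complex.Re b * (m%:~R + c)).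
Proof.
rewrite /gauss nm_cexp; congr expR; rewrite -rc_int -rcD -rcX -rcN -rcM.
by case: b => x y /=; rewrite mulr0 subr0.
Qed.

(** Domination by a multiple of e^(-|m|). Completing the square bounds (|y| + 1) h - a h^2 by (|y| +
    1)^2 / (4a), where h = |m + c|, and |m| <= h + |c| accounts for the other summand of [K]. *)
Lemma asum_gauss a c b : 0 < a -> asum (gauss a c b).
Proof.
move=> a0; set y := complex.Re b.
pose K := (`|y| + 1) ^+ 2 / (4 * a) + `|c|.
pose g (m : int) : C := rc (expR K) * rc (expR (-1) ^+ absz m).
have x1 : 0 <= expR (-1 : R) < 1 by rewrite expR_ge0 /= expR_lt1; lra.
have ag : asum g.
  apply: asumZ; apply: asum_int; first exact: asum_geo.
  have := asumZ (rc (expR (-1))) (asum_geo x1); apply: asum_le => i /=.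
  by rewrite -rcM exprS.
apply: asum_le ag => m; rewrite nm_gauss -/y nmM !nm_rc !ger0_norm ?exprn_ge0 ?expR_ge0//.
rewrite -expRM_natl -expRD ler_expR mulrN1.
have -> : `|m|%N%:R = `|m%:~R| :> R by rewrite natr_absz intr_norm.
set x : R := m%:~R; rewrite /K.
have e1 : y * (x + c) <= `|y| * `|x + c| by rewrite -normrM ler_norm.
have e2 : `|x| <= `|x + c| + `|c| by rewrite -[X in `|X| <= _](addrK c) ler_normB.
have e3 : (x + c) ^+ 2 = `|x + c| ^+ 2 by rewrite real_normK// num_real.
rewrite e3; set h := `|x + c| in e1 e2 *.
have e4 : (`|y| + 1) * h - a * h ^+ 2 <= (`|y| + 1) ^+ 2 / (4 * a).
  rewrite ler_pdivlMr ?mulr_gt0//.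
  have hh := sqr_ge0 (2 * a * h - (`|y| + 1)).
  by rewrite -subr_ge0; apply: le_trans hh _; rewrite le_eqVlt; apply/orP; left; apply/eqP; ring.
by lra.
Qed.

Definition gsum a c b : C := get (hsum (gauss a c b)).

Lemma gsumP a c b : 0 < a -> hsum (gauss a c b) (gsum a c b).
Proof. by move=> /(asum_gauss c b)/asum_hsum[s hs]; apply: getPex; exists s. Qed.

Lemma gsumN a b : 0 < a -> gsum a 2^-1 (- b) = gsum a 2^-1 b.
Proof.
move=> a0; apply: hsum_unique (gsumP _ _ a0) _.
have bj : bijective (fun m : int => - 1 - m).
  by exists (fun m : int => - 1 - m) => m; ring.
apply: eq_hsum (hsum_bij bj (gsumP _ _ a0)) => m /=; rewrite /gauss; congr cexp.
rewrite rmorphB rmorphN /= rcV rc_nat.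
have : (2 : C) != 0 by rewrite pnatr_eq0.
by move=> ?; field.
Qed.

Lemma gsum_shift0 a b : 0 < a -> gsum a 0 (b + twopii R) = gsum a 0 b.
Proof.
move=> a0; apply: hsum_unique (gsumP _ _ a0) _.
apply: eq_hsum (gsumP _ _ a0) => m /=; rewrite /gauss rc0 addr0 [in RHS]mulrDl [in RHS]addrA [in RHS]cexpD.
by rewrite cexp_twopii_int mulr1.
Qed.

Lemma gsum_shift a b : 0 < a -> gsum a 2^-1 (b + twopii R) = - gsum a 2^-1 b.
Proof.
move=> a0; apply: hsum_unique (gsumP _ _ a0) _.
apply: eq_hsum (hsumN (gsumP _ _ a0)) => m /=; rewrite /gauss [in RHS]mulrDl [in RHS]addrA [in RHS]cexpD.
rewrite [in twopii R * _]mulrDr [cexp (twopii R * _ + _)]cexpD cexp_twopii_int mul1r twopiiE rcV rc_nat.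
by rewrite (_ : 2 * _ / 2 = rc pi * 'i%C) ?cexp_pii ?mulrN1//; field.
Qed.

(* h = m + 1/2 and h' = n + 1/2 are replaced by h + h' and h - h', which are
   integers of opposite parities. *)
Lemma gsum_mul a b1 b2 : 0 < a -> gsum a 2^-1 b1 * gsum a 2^-1 b2 =
  gsum (2 * a) 0 (b1 + b2) * gsum (2 * a) 2^-1 (b1 - b2) +
  gsum (2 * a) 2^-1 (b1 + b2) * gsum (2 * a) 0 (b1 - b2).
Proof.
move=> a0; have a20 : 0 < 2 * a by lra.
pose F (x : int * int) := gauss a 2^-1 b1 x.1 * gauss a 2^-1 b2 x.2.
have hF : hsum F (gsum a 2^-1 b1 * gsum a 2^-1 b2) by apply: hsum_prod; exact: gsumP.
pose ev (x : int * int) : bool := (2 %| x.1 - x.2)%Z.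
apply: hsum_unique hF _.
have h1 : hsum (fun x => if ev x then 0 else F x)
    (gsum (2 * a) 0 (b1 + b2) * gsum (2 * a) 2^-1 (b1 - b2)).
  pose g (x : int * int) : int * int := (x.1 + x.2, x.1 - x.2 - 1).
  pose q (x : int * int) : option (int * int) :=
    Some (((x.1 + x.2 + 1) %/ 2)%Z, ((x.1 - x.2) %/ 2)%Z).
  apply: (@hsum_inj _ _ _ g q).
  - by move=> [j k]; rewrite /q /g /=; congr (Some (_, _)); lia.
  - move=> [m n] h; rewrite /ev /=; case: ifP => // mn; exfalso.
    have /eqP := h (((m + n + 1) %/ 2)%Z, ((m - n) %/ 2)%Z); apply.
    by rewrite /g /=; congr (_, _); move: mn; lia.
  - have := hsum_prod (gsumP 0 (b1 + b2) a20) (gsumP 2^-1 (b1 - b2) a20).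
    apply: eq_hsum => -[j k]; rewrite /= /ev /F /g /=.
    case: ifP => [|_]; first by lia.
    rewrite /gauss -!cexpD; congr cexp; rewrite !(rmorphD, rmorphB, rmorphN) /=.
    rewrite rcM rcV rc_nat.
    by field.
have h2 : hsum (fun x => if ev x then F x else 0)
    (gsum (2 * a) 2^-1 (b1 + b2) * gsum (2 * a) 0 (b1 - b2)).
  pose g (x : int * int) : int * int := (x.1 + x.2, x.1 - x.2).
  pose q (x : int * int) : option (int * int) :=
    Some (((x.1 + x.2) %/ 2)%Z, ((x.1 - x.2) %/ 2)%Z).
  apply: (@hsum_inj _ _ _ g q).
  - by move=> [j k]; rewrite /q /g /=; congr (Some (_, _)); lia.
  - move=> [m n] h; rewrite /ev /=; case: ifP => // mn; exfalso.
    have /eqP := h (((m + n) %/ 2)%Z, ((m - n) %/ 2)%Z); apply.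
    by rewrite /g /=; congr (_, _); move: mn; lia.
  - have := hsum_prod (gsumP 2^-1 (b1 + b2) a20) (gsumP 0 (b1 - b2) a20).
    apply: eq_hsum => -[j k]; rewrite /= /ev /F /g /=.
    case: ifP => [_|]; last by lia.
    rewrite /gauss -!cexpD; congr cexp; rewrite !(rmorphD, rmorphB, rmorphN) /=.
    rewrite rcM rcV rc_nat.
    by field.
apply: eq_hsum (hsumD h1 h2) => x; by case: ifP; rewrite ?add0r ?addr0.
Qed.

End Gauss.

(** * A second-order Taylor estimate for the complex exponential *)

Section Taylor.
Variable R : realType.
Local Notation C := (cplx R).
Local Notation rc := (@rc R).
Local Notation nm := (@nm R).

Lemma mvt_le (f df : R -> R) (y K : R) : (forall x : R, is_derive x 1 f (df x)) ->
  f 0 = 0 -> (forall c, `|c| <= `|y| -> `|df c| <= K) -> `|f y| <= K * `|y|.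
Proof.
move=> fd f0 dK.
have fc (a b : R) : ({within `[a, b], continuous f})%classic.
  apply: continuous_subspaceT => x.
  by apply: differentiable_continuous; apply/derivable1_diffP; apply: ex_derive.
have [y0|y0] := lerP 0 y.
  have [c] := MVT_segment y0 (fun x _ => fd x) (fc 0 y).
  rewrite in_itv /= f0 !subr0 => /andP[c0 cy] ->.
  by rewrite normrM ler_wpM2r// dK// !ger0_norm.
have [c] := MVT_segment (ltW y0) (fun x _ => fd x) (fc y 0).
rewrite in_itv /= f0 !sub0r => /andP[c0 cy] e.
rewrite -normrN e normrM normrN ler_wpM2r// dK//.
by rewrite !ler0_norm ?lerN2// ltW.
Qed.

Lemma expR_le_norm (c y : R) : `|c| <= `|y| -> expR c <= expR `|y|.
Proof. by move=> cy; rewrite ler_expR (le_trans _ cy)// ler_norm. Qed.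

Lemma expR1_le (y : R) : `|expR y - 1| <= expR `|y| * `|y|.
Proof.
apply: (@mvt_le (fun y => expR y - 1) expR).
- by move=> x; rewrite -[X in is_derive _ _ _ X]subr0; apply: is_deriveB.
- by rewrite expR0 subrr.
- by move=> c cy; rewrite ger0_norm ?expR_ge0// expR_le_norm.
Qed.

Lemma expR2_le (y : R) : `|expR y - 1 - y| <= expR `|y| * `|y| * `|y|.
Proof.
apply: (@mvt_le (fun y => expR y - 1 - y) (fun y => expR y - 0 - 1)).
- by rewrite expR0 !subr0 subrr.
- move=> c cy; rewrite subr0 (le_trans (expR1_le c))// ler_pM ?expR_ge0//.
  by rewrite ler_expR.
Qed.

Lemma sin_le (y : R) : `|sin y| <= `|y|.
Proof.
rewrite -[X in _ <= X]mul1r; apply: (@mvt_le sin cos).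
- exact: sin0.
- by move=> c _; exact: cos_max.
Qed.

Lemma cos1_le (y K : R) : (forall c, `|c| <= `|y| -> `|sin c| <= K) ->
  `|cos y - 1| <= K * `|y|.
Proof.
move=> h; apply: (@mvt_le (fun y => cos y - 1) (fun y => - sin y - 0)).
- by rewrite cos0 subrr.
- by move=> c cy; rewrite subr0 normrN h.
Qed.

Lemma sin1_le (y : R) : `|sin y - y| <= `|y| * `|y|.
Proof.
apply: (@mvt_le (fun y => sin y - y) (fun y => cos y - 1)).
- by rewrite sin0 subrr.
- move=> c cy; rewrite (le_trans (@cos1_le c 1 _))// ?mul1r// => *; exact: sin_max.
Qed.

(** Real and imaginary part split into the four remainders of [b1] to [b4], each at most |w|^2
    e^|w|. *)
Lemma cexp_taylor (w : C) : nm (cexp w - 1 - w) <= 5 * nm w ^+ 2 * expR (nm w).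
Proof.
have := Re_le_nm w; have := Im_le_nm w; set r := nm w.
case: w @r => x y r /= yr xr.
have E0 := expR_gt0 r.
have ex : expR `|x| <= expR r by rewrite ler_expR.
have E1 : 1 <= expR r by rewrite -expR0 ler_expR /r nm_ge0.
have -> : cexp (x +i* y)%C - 1 - (x +i* y)%C =
  rc ((expR x - 1 - x) + expR x * (cos y - 1)) +
  'i%C * rc ((expR x - 1) * sin y + (sin y - y)) :> C.
  by apply/eqP; rewrite /cexp eq_complex /=; apply/andP; split; apply/eqP; ring.
apply: le_trans (nmD _ _) _; rewrite nmM nmi mul1r !nm_rc.
have h1 := expR2_le x; have h2 : `|cos y - 1| <= `|y| * `|y|.
  by apply: cos1_le => c cy; exact: le_trans (sin_le c) cy.
have h3 := expR1_le x; have h4 := sin_le y; have h5 := sin1_le y.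
have a1 := ler_normD (expR x - 1 - x) (expR x * (cos y - 1)).
have a2 := ler_normD ((expR x - 1) * sin y) (sin y - y).
rewrite !normrM (ger0_norm (expR_ge0 x)) in a1 a2.
have ex' : expR x <= expR r by rewrite (le_trans _ ex)// ler_expR ler_norm.
have r0 : 0 <= r by rewrite /r nm_ge0.
have x2 : `|x| * `|x| <= r * r by rewrite ler_pM.
have y2 : `|y| * `|y| <= r * r by rewrite ler_pM.
have xy : `|x| * `|y| <= r * r by rewrite ler_pM.
have rr : 0 <= r * r by rewrite mulr_ge0.
have b1 : `|expR x - 1 - x| <= expR r * (r * r).
  by apply: le_trans h1 _; rewrite -mulrA ler_pM// ?expR_ge0// mulr_ge0.
have b2 : expR x * `|cos y - 1| <= expR r * (r * r).
  by rewrite ler_pM ?expR_ge0// (le_trans h2).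
have b3 : `|expR x - 1| * `|sin y| <= expR r * (r * r).
  apply: le_trans (_ : expR `|x| * `|x| * `|y| <= _).
    by rewrite ler_pM.
  by rewrite -mulrA ler_pM// ?expR_ge0// mulr_ge0.
have b4 : `|sin y - y| <= expR r * (r * r).
  apply: le_trans h5 _; apply: le_trans y2 _; by rewrite ler_peMl.
rewrite expr2; move: b1 b2 b3 b4 a1 a2.
set q := expR r * _; have q0 : 0 <= q by rewrite mulr_ge0// expR_ge0.
have -> : 5 * (r * r) * expR r = 5 * q by rewrite /q; ring.
lra.
Qed.

End Taylor.

(** * Symmetries, product formula and derivative of theta *)

Section ThetaFacts.
Variable R : realType.
Local Notation C := (cplx R).
Local Notation rc := (@rc R).
Local Notation nm := (@nm R).

Definition itau (t : R) : C := t%:C%C * 'i%C.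

Lemma theta_termE (u : C) (t : R) m :
  theta_term u (itau t) m = gauss (pi * t) 2^-1 (twopii R * (u + 2^-1)) m.
Proof.
rewrite /theta_term /gauss; congr cexp.
rewrite /itau -!/(rc _) rcM rcV rc_nat.
have i2 : ('i%C : C) * 'i%C = -1 by rewrite -expr2; exact: sqr_i.
transitivity (rc pi * rc t * ('i%C * 'i%C) * (m%:~R + 2^-1) ^+ 2 +
  twopii R * (u + 2^-1) * (m%:~R + 2^-1)); first by ring.
by rewrite i2; ring.
Qed.

Lemma thetaE (u : C) (t : R) : 0 < t ->
  theta u (itau t) = - gsum (pi * t) 2^-1 (twopii R * (u + 2^-1)).
Proof.
move=> t0; have a0 : 0 < pi * t by rewrite mulr_gt0// pi_gt0.
have [s1 [s2 [h1 h2 ->]]] := hsum_int_inv (gsumP 2^-1 (twopii R * (u + 2^-1)) a0).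
rewrite /theta; congr (- (_ + _)).
  rewrite -(hsum_limn h1); congr (lim (series _ @ \oo)%classic).
  by apply/funext => k; rewrite theta_termE.
rewrite -(hsum_limn h2); congr (lim (series _ @ \oo)%classic).
by apply/funext => k; rewrite theta_termE.
Qed.

Lemma theta_hsum (u : C) (t : R) : 0 < t ->
  hsum (theta_term u (itau t)) (- theta u (itau t)).
Proof.
move=> t0; rewrite thetaE// opprK; have a0 : 0 < pi * t by rewrite mulr_gt0// pi_gt0.
by apply: eq_hsum (gsumP _ _ a0) => m; rewrite theta_termE.
Qed.

Lemma thetaN (u : C) (t : R) : 0 < t -> theta (- u) (itau t) = - theta u (itau t).
Proof.
move=> t0; have a0 : 0 < pi * t by rewrite mulr_gt0// pi_gt0.
have two : (2 : C) != 0 by rewrite pnatr_eq0.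
rewrite !thetaE// [in LHS](_ : twopii R * _ = - (twopii R * (u + 2^-1)) + twopii R).
  by rewrite gsum_shift// gsumN.
by field.
Qed.

Lemma thetaD1 (u : C) (t : R) : 0 < t -> theta (u + 1) (itau t) = - theta u (itau t).
Proof.
move=> t0; have a0 : 0 < pi * t by rewrite mulr_gt0// pi_gt0.
rewrite !thetaE// [in LHS](_ : twopii R * _ = twopii R * (u + 2^-1) + twopii R).
  by rewrite gsum_shift.
by ring.
Qed.

(** The product is a 2 x 2 determinant in x and y. [P] and [Q] are theta series with doubled
    quadratic form, that is of modulus 2 tau; half a period in the first argument of [gsum_mul]
    produces the sign that makes the expression antisymmetric. *)
Lemma theta_mul (t : R) : 0 < t -> exists P Q : C -> C, forall x y,
  theta (x + y) (itau t) * theta (x - y) (itau t) = P x * Q y - Q x * P y.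
Proof.
move=> t0; have a0 : 0 < pi * t by rewrite mulr_gt0// pi_gt0.
have a20 : 0 < 2 * (pi * t) by lra.
exists (fun x => gsum (2 * (pi * t)) 0 (twopii R * (2 * x))),
  (fun x => gsum (2 * (pi * t)) 2^-1 (twopii R * (2 * x))) => x y.
rewrite !thetaE// mulrNN gsum_mul//.
have two : (2 : C) != 0 by rewrite pnatr_eq0.
have -> : twopii R * (x + y + 2^-1) + twopii R * (x - y + 2^-1) =
  twopii R * (2 * x) + twopii R by field.
have -> : twopii R * (x + y + 2^-1) - twopii R * (x - y + 2^-1) =
  twopii R * (2 * y) by field.
by rewrite gsum_shift0// gsum_shift//; ring.
Qed.

(* Termwise first-order Taylor expansion; the remainders are dominated by a
   Gaussian series. *)
Lemma theta_derive (t : R) (c : C) : 0 < t ->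
  hsum (fun m : int => twopii R * (m%:~R + 2^-1) * theta_term 0 (itau t) m) (- c) ->
  derive1 (fun v : C => theta v (itau t) : C^o) 0 = c.
Proof.
move=> t0 hc; have a0 : 0 < pi * t by rewrite mulr_gt0// pi_gt0.
pose h (m : int) : R := m%:~R + 2^-1.
have hE m : m%:~R + 2^-1 = rc (h m) :> C by rewrite /h rcD rc_int rcV rc_nat.
pose g (m : int) : R := nm (theta_term 0 (itau t) m) * (5 * (2 * pi * `|h m|) ^+ 2 * expR (2 * pi * `|h m|)).
have pi0 : 0 < pi :> R := pi_gt0 R.
have ag : asum (rc \o g).
  (* With X = 2 pi |h| and E = e^X, the estimate X^2 <= 2 E gives 5 X^2 E <= 10 E^2, and E^2 <= e^(4
     pi h) + e^(-4 pi h). Hence the constants 10 and 4 pi. *)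
  have A1 := asumD (asumZ 10 (asum_gauss 2^-1 (rc (4 * pi)) a0)) (asumZ 10 (asum_gauss 2^-1 (rc (- (4 * pi))) a0)).
  apply: asum_le A1 => m /=.
  set z1 := gauss _ _ _ _; set z2 := gauss _ _ _ _.
  have zr (b : R) : gauss (pi * t) 2^-1 (rc b) m = rc (expR (- (pi * t) * (h m) ^+ 2 + b * h m)).
    by rewrite /gauss !rcV !rc_nat hE -rcX -rcN -!rcM -rcD cexp_rc.
  rewrite /z1 /z2 !zr -[10]rc_nat -!rcM -rcD !nm_rc !ger0_norm; last 2 first.
  - by rewrite addr_ge0 ?mulr_ge0 ?expR_ge0.
  - by rewrite !mulr_ge0 ?nm_ge0 ?expR_ge0 ?exprn_ge0// pi_ge0.
  rewrite /g theta_termE add0r nm_gauss -/(h m).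
  have -> : complex.Re (twopii R * 2^-1) = 0.
    rewrite twopiiE (_ : 2 * (rc pi * 'i%C) / 2 = rc pi * 'i%C); first by rewrite Re_rcM /= mulr0.
    by field.
  rewrite mul0r addr0.
  have e1 (x : R) : 0 <= x -> x ^+ 2 <= 2 * expR x.
    by move=> x0; have := expR_ge1Dxn 1 x0; rewrite (_ : 2`! = 2)%N//; lra.
  set A := expR (- (pi * t) * _); have A0 : 0 <= A by exact: expR_ge0.
  set k := `|h m|; have k0 : 0 <= k by exact: normr_ge0.
  have e2 := e1 (2 * pi * k) (mulr_ge0 (mulr_ge0 (ler0n _ 2) (ltW pi0)) k0).
  have e3 : expR (2 * pi * k) * expR (2 * pi * k) <= expR (4 * pi * h m) + expR (- (4 * pi) * h m).
    rewrite -expRD /k; case: (ger0P (h m)) => _.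
      by rewrite (_ : 2 * pi * h m + _ = 4 * pi * h m) ?lerDl ?expR_ge0//; ring.
    by rewrite (_ : 2 * pi * - h m + _ = - (4 * pi) * h m) ?lerDr ?expR_ge0//; ring.
  rewrite !expRD -!/A -!mulrDr.
  rewrite [X in _ <= X](_ : _ = A * (10 * (expR (4 * pi * h m) + expR (- (4 * pi) * h m)))); last by ring.
  rewrite ler_wpM2l//.
  have := expR_ge0 (2 * pi * k); move: e2 e3.
  set E := expR (2 * pi * k); set X := (_ * k) ^+ 2; nra.
have [M gM] := ag; have M0 := bsum_ge0 gM.
have th0 : theta 0 (itau t) = 0 :> C.
  have := thetaN 0 t0; rewrite oppr0 => /eqP; rewrite -subr_eq0 opprK -mulr2n.
  by rewrite mulrn_eq0 /= => /eqP.
have bnd v : nm v <= 1 -> nm (theta v (itau t) - c * v) <= M * nm v ^+ 2.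
  move=> v1; have h1 := hsumB (theta_hsum v t0) (hsumD (theta_hsum 0 t0) (hsumZ v hc)).
  rewrite th0 in h1; rewrite -nmN.
  rewrite [X in nm X](_ : _ = - theta v (itau t) - (- 0 + v * - c)); last by ring.
  apply: hsum_le h1 _ => B uB.
  rewrite mulrC; apply: le_trans (ler_wpM2l _ (gM B uB)); last by rewrite exprn_ge0 ?nm_ge0.
  rewrite mulr_sumr; apply: ler_sum => m _; rewrite /= nm_rc.
  pose w := twopii R * (m%:~R + 2^-1) * v.
  have tE : theta_term v (itau t) m = theta_term 0 (itau t) m * cexp w.
    rewrite !theta_termE /gauss -cexpD; congr cexp; rewrite /w rcV rc_nat; ring.
  rewrite tE [X in nm X](_ : _ = theta_term 0 (itau t) m * (cexp w - 1 - w)); last by rewrite /w; ring.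
  rewrite nmM ger0_norm; last first.
    by rewrite /g !mulr_ge0 ?nm_ge0 ?expR_ge0 ?exprn_ge0// pi_ge0.
  rewrite /g mulrCA ler_wpM2l ?nm_ge0//; apply: le_trans (cexp_taylor w) _.
  have nw : nm w = 2 * pi * `|h m| * nm v.
    rewrite /w hE 2!nmM nm_rc; congr (_ * _ * _).
    by rewrite /twopii nmM nmi mulr1 nm_rc ger0_norm// mulr_ge0// pi_ge0.
  rewrite nw; set k := 2 * pi * _; have k0 : 0 <= k by rewrite mulr_ge0// mulr_ge0// pi_ge0.
  have v0 := nm_ge0 v.
  have -> : 5 * (k * nm v) ^+ 2 * expR (k * nm v) = nm v ^+ 2 * (5 * k ^+ 2 * expR (k * nm v)) by ring.
  apply: ler_wpM2l; first by rewrite exprn_ge0.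
  apply: ler_wpM2l; first by rewrite mulr_ge0 ?exprn_ge0.
  by rewrite ler_expR ler_piMr.
rewrite /derive1; apply: cvg_lim; first exact: norm_hausdorff.
apply/cvgrPdist_lt => e e0.
have eR : e = rc (complex.Re e).
  by move: e0; case: (e) => a b; rewrite ltcE /= => /andP[/eqP -> _].
set e' := complex.Re e in eR; have e'0 : 0 < e' by rewrite -rc_lt -eR.
have d0 : 0 < Num.min 1 (e' / (M + 1)) by rewrite lt_min ltr01 divr_gt0//; lra.
near=> v.
have v0 : v != 0 by near: v; exact: nbhs_dnbhs_neq.
have : `|v| < rc (Num.min 1 (e' / (M + 1))).
  by near: v; apply: dnbhs0_lt; rewrite -rc0 rc_lt.
rewrite nmE rc_lt lt_min => /andP[v1 v2].
rewrite eR nmE rc_lt addr0 th0 subr0.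
have -> : c - v^-1 *: (theta v (itau t) : C^o) = - (v^-1 * (theta v (itau t) - c * v)).
  by rewrite /GRing.scale /=; field.
rewrite nmN nmM nmV; have nv : 0 < nm v by rewrite nm_gt0.
rewrite mulrC ltr_pdivrMr//; apply: le_lt_trans (bnd _ (ltW v1)) _.
move: v2; rewrite ltr_pdivlMr; last by lra.
rewrite expr2 mulrA ltr_pM2r// => v2; nra.
Unshelve. all: by end_near.
Qed.

End ThetaFacts.

(** * Expansions in z and w *)

Section Uniqueness.
Variable R : realType.
Local Notation C := (cplx R).
Local Notation rc := (@rc R).
Local Notation nm := (@nm R).

(** If the coefficients below n vanish, the terms above n are at most (t / t0)^(n+1) times an
    absolute bound at t0, so |c n| t^n = O(t^(n+1)). Only positive real t are available, which is
    enough for this argument. *)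
Lemma pow_unique (c : nat -> C) (r : R) : 0 < r ->
  (forall t, 0 < t < r -> hsum (fun n => c n * rc (t ^+ n)) 0) -> forall n, c n = 0.
Proof.
move=> r0 h n; elim/ltn_ind: n => n IH; apply: nm_small => e e0.
have t00 : 0 < r / 2 by lra.
have [M hM] := (h (r / 2) ltac:(lra)).1; set t0 := r / 2 in t00 hM.
have M0 := bsum_ge0 hM.
have key t : 0 < t < t0 -> nm (c n) <= t * (M / t0 ^+ n.+1).
  move=> /andP[tp tt0].
  have tp' := ltW tp; have t00' := ltW t00.
  have ht := h t ltac:(rewrite /t0 in tt0; lra).
  have h1 := @hsum_fin R _ [:: n] (fun k => if k == n then c n * rc (t ^+ n) else 0) isT.
  have {}h1 := hsumB ht (h1 ltac:(by move=> k; rewrite inE => /negbTE ->)).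
  rewrite big_seq1 eqxx sub0r in h1.
  have := @hsum_le _ _ _ _ ((t / t0) ^+ n.+1 * M) h1; rewrite nmN nmM nm_rc ger0_norm ?exprn_ge0// => h2.
  have {}h2 : nm (c n) * t ^+ n <= (t / t0) ^+ n.+1 * M.
    apply: h2 => B uB; apply: le_trans (ler_wpM2l _ (hM B uB)); last by rewrite exprn_ge0// divr_ge0.
    rewrite mulr_sumr; apply: ler_sum => k _; rewrite -subr_ge0.
    case: eqP => [->|/eqP kn]; first by rewrite subrr nm0 subr0 mulr_ge0 ?nm_ge0// exprn_ge0// divr_ge0.
    rewrite subr0 subr_ge0.
    case: (ltnP k n) => [/IH ->|nk]; first by rewrite !mul0r nm0 mulr0.
    rewrite !nmM !nm_rc mulrCA ler_wpM2l ?nm_ge0//.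
    rewrite !ger0_norm ?exprn_ge0//.
    rewrite -[t in X in X <= _](@divfK _ t0) ?gt_eqF// exprMn ler_wpM2r ?exprn_ge0//.
    apply: ler_wiXn2l; [exact: divr_ge0| |by rewrite ltn_neqAle eq_sym kn].
    by rewrite ler_pdivrMr ?mul1r// ltW.
  have tn : 0 < t ^+ n by rewrite exprn_gt0.
  rewrite -(ler_pM2r tn); apply: le_trans h2 _.
  by rewrite expr_div_n exprS le_eqVlt; apply/orP; left; apply/eqP; field; rewrite gt_eqF// exprn_gt0.
have K0 : 0 <= M / t0 ^+ n.+1 by rewrite divr_ge0// exprn_ge0// ltW.
set K := M / _ in K0 key.
have K1 : 0 < K + 1 by lra.
have t1 : 0 < Num.min (t0 / 2) (e / (K + 1)) by rewrite lt_min divr_gt0//= divr_gt0.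
set t := Num.min _ _ in t1.
have tt0 : t <= t0 / 2 by rewrite /t ge_min lexx.
have te : t <= e / (K + 1) by rewrite /t ge_min lexx orbT.
have := key t ltac:(lra).
move: te; rewrite ler_pdivlMr// => te k1; nra.
Qed.

(* The substitution z1 = t, z2 = t^M, w = t^(M^2) with M large separates a given
   monomial from those which are not lexicographically smaller. *)
Lemma tri_unique (F : nat -> nat -> nat -> C) (r : R) : 0 < r ->
  (forall z1 z2 w : R, 0 < z1 < r -> 0 < z2 < r -> 0 < w < r ->
    hsum (fun i : nat * nat * nat => F i.1.1 i.1.2 i.2 *
      rc (z1 ^+ i.1.1 * z2 ^+ i.1.2 * w ^+ i.2)) 0) ->
  forall a b c, F a b c = 0.
Proof.
move=> r0 h a b c; elim/ltn_ind: c a b => c IHc a b; elim/ltn_ind: b a => b IHb a.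
pose M := (maxn a b).+1.
pose p (i : nat * nat * nat) := (i.1.1 + i.1.2 * M + i.2 * (M * M))%N.
pose fib N := [seq i <- [seq (j, k) | j <- [seq (x, y) | x <- iota 0 N.+1, y <- iota 0 N.+1], k <- iota 0 N.+1] | p i == N].
have ufib N : uniq (fib N).
  rewrite filter_uniq// allpairs_uniq ?iota_uniq//; last by move=> [? ?] [? ?] _ _ [-> ->].
  by rewrite allpairs_uniq ?iota_uniq//; move=> [? ?] [? ?] _ _ [-> ->].
have mfib i N : (i \in fib N) = (p i == N).
  rewrite mem_filter; case: eqP => [pN|//]; rewrite andTb.
  have [h1 h2 h3] : [/\ i.1.1 <= N, i.1.2 <= N & i.2 <= N]%N.
    have := leq_pmulr i.1.2 (isT : 0 < M)%N; have := leq_pmulr i.2 (isT : 0 < M * M)%N.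
    rewrite -pN /p; move: (_ * M)%N (_ * (M * M))%N => u v /= h1 h2.
    by split; move: h1 h2; clear; lia.
  case: i {pN} h1 h2 h3 => -[x y] z h1 h2 h3.
  have io k : (k <= N)%N -> k \in iota 0 N.+1 by rewrite mem_iota ltnS.
  apply/allpairsP; exists ((x, y), z); split; [|exact: io|by []].
  by apply/allpairsP; exists (x, y); split; [exact: io|exact: io|].
have r1 : 0 < Num.min r 1 by rewrite lt_min r0 ltr01.
have := @pow_unique (fun N => \sum_(i <- fib N) F i.1.1 i.1.2 i.2) _ r1.
move=> /(_ _ (p (a, b, c))) H.
have {H} : \sum_(i <- fib (p (a, b, c))) F i.1.1 i.1.2 i.2 = 0.
  apply: H => t /andP[t0]; rewrite lt_min => /andP[tr t1].
  have tk k : (0 < k)%N -> 0 < t ^+ k < r.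
    move=> k0; rewrite exprn_gt0//=; apply: le_lt_trans tr.
    by rewrite -[X in _ <= X]expr1 ler_wiXn2l// ltW.
  have := h (t ^+ 1) (t ^+ M) (t ^+ (M * M)) (tk 1%N isT) (tk M isT) (tk (M * M)%N isT).
  move=> /(hsum_fiber ufib mfib).
  apply: eq_hsum => N; rewrite mulr_suml; apply: eq_big_seq => i.
  rewrite mfib => /eqP <-; rewrite /p -!exprM -!exprD.
  by rewrite mul1n (mulnC M) (mulnC (M * M)%N).
rewrite (bigD1_seq (a, b, c)) ?mfib ?eqxx//= big1_seq ?addr0//.
move=> [[x y] z] /andP[ne]; rewrite mfib /p /= => /eqP e.
have aM : (a < M)%N by rewrite /M ltnS leq_maxl.
have bM : (b < M)%N by rewrite /M ltnS leq_maxr.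
(* Since a and b are below M, the part a + b M is below M^2; so an equal value of [p] cannot have a
   larger w-exponent. The same comparison modulo one more digit bounds y. *)
have zc : (z <= c)%N by rewrite leqNgt; apply/negP => zc; move: e aM bM zc; clear; nia.
move: zc; rewrite leq_eqVlt => /orP[/eqP zc|/IHc //]; subst z.
have yb : (y <= b)%N by rewrite leqNgt; apply/negP => yb; move: e aM yb; clear; nia.
move: yb; rewrite leq_eqVlt => /orP[/eqP yb|/IHb //]; subst y.
by move: ne; rewrite (_ : x = a) ?eqxx//; move: e; clear; lia.
Qed.

End Uniqueness.

(** * Power series in z and w: regions of convergence and uniqueness *)

Section Expansions.
Variables (R : realType) (L : R).
Hypothesis L0 : 0 < L.
Local Notation C := (cplx R).
Local Notation rc := (@rc R).
Local Notation nm := (@nm R).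
Local Notation zvar := (zvar L).
Local Notation wvar := (wvar L).

Definition small (rho : R) (u : C) (t : R) :=
  [/\ 0 < t, nm (zvar u) < rho & nm (wvar u (itau t)) < rho].

Definition mon (z w : C) (i : nat * nat) : C := z ^+ i.2 * w ^+ i.1.

(** Sharper than [is_expansion]: a majorant at one radius rho is recorded, not only convergence at
    the points reached by u and t. Inverses and square roots of series are estimated through such
    majorants. *)
Definition expands (f : C -> C -> C) (X : ser R) := exists rho : R,
  [/\ 0 < rho, asum (fun i : nat * nat => X i.1 i.2 * rc (rho ^+ (i.1 + i.2))) &
    forall u t, small rho u t ->
      hsum (fun i => X i.1 i.2 * mon (zvar u) (wvar u (itau t)) i) (f u (itau t))].

Definition expandable (f : C -> C -> C) (c : C) :=
  exists2 X, expands f X & X 0%N 0%N = c.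

Definition near0 (P : C -> R -> Prop) :=
  exists2 rho, 0 < rho & forall u t, small rho u t -> P u t.

Lemma small_le r s u t : r <= s -> small r u t -> small s u t.
Proof. by move=> rs [t0 z0 w0]; split=> //; exact: lt_le_trans rs. Qed.

Lemma near0_and P Q : near0 P -> near0 Q ->
  near0 (fun u t => P u t /\ Q u t).
Proof.
move=> [r r0 hr] [s s0 hs]; exists (Num.min r s); first by rewrite lt_min r0.
move=> u t h; split; [apply: hr|apply: hs]; apply: small_le h; by rewrite ge_min lexx ?orbT.
Qed.

Lemma near0_imp (P Q : C -> R -> Prop) :
  (forall u t, 0 < t -> P u t -> Q u t) -> near0 P -> near0 Q.
Proof. by move=> PQ [r r0 h]; exists r => // u t st; apply: PQ; [case: st|exact: h]. Qed.

Lemma near0_all (I : finType) (P : I -> C -> R -> Prop) :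
  (forall i, near0 (P i)) -> near0 (fun u t => forall i, P i u t).
Proof.
move=> h.
suff : near0 (fun u t => forall i, i \in enum I -> P i u t).
  by apply: near0_imp => u t _ H i; apply: H; rewrite mem_enum.
elim: (enum I) => [|i s IH]; first by exists 1 => // *.
apply: near0_imp (near0_and (h i) IH) => u t _ [Pi Ps] j.
by rewrite inE => /orP[/eqP ->|/Ps].
Qed.

Lemma near0_true (P : C -> R -> Prop) : (forall u t, 0 < t -> P u t) -> near0 P.
Proof. by move=> h; exists 1 => // u t [t0 _ _]; exact: h. Qed.

Lemma nm_mon z w (rho : R) i : nm z <= rho -> nm w <= rho -> nm (mon z w i) <= rho ^+ (i.1 + i.2).
Proof.
move=> zr wr; have r0 : 0 <= rho by exact: le_trans (nm_ge0 z) zr.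
rewrite /mon nmM !nmX addnC exprD.
by rewrite ler_pM ?exprn_ge0 ?nm_ge0// lerXn2r ?nnegrE ?nm_ge0.
Qed.

Lemma asum_mon (X : ser R) (rho : R) z w : nm z <= rho -> nm w <= rho ->
  asum (fun i : nat * nat => X i.1 i.2 * rc (rho ^+ (i.1 + i.2))) ->
  asum (fun i => X i.1 i.2 * mon z w i).
Proof.
move=> zr wr; apply: asum_le => i; rewrite nmM [X in _ <= X]nmM ler_wpM2l ?nm_ge0// nm_rc.
by apply: le_trans (nm_mon i zr wr) _; exact: ler_norm.
Qed.

Lemma asum_shrink (X : ser R) (rho rho' : R) : 0 <= rho' <= rho ->
  asum (fun i : nat * nat => X i.1 i.2 * rc (rho ^+ (i.1 + i.2))) ->
  asum (fun i : nat * nat => X i.1 i.2 * rc (rho' ^+ (i.1 + i.2))).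
Proof.
move=> /andP[r0 rr]; apply: asum_le => i; rewrite !nmM ler_wpM2l ?nm_ge0// !nm_rc.
by rewrite !ger0_norm ?exprn_ge0// ?(le_trans r0)// lerXn2r ?nnegrE// (le_trans r0).
Qed.

Lemma expands_at (X : ser R) f (r : R) : 0 < r ->
  asum (fun i : nat * nat => X i.1 i.2 * rc (r ^+ (i.1 + i.2))) ->
  near0 (fun u t => hsum (fun i => X i.1 i.2 * mon (zvar u) (wvar u (itau t)) i) (f u (itau t))) ->
  expands f X.
Proof.
move=> r0 aX [s s0 hs]; exists (Num.min r s); split.
- by rewrite lt_min r0.
- by apply: asum_shrink aX; rewrite le_min (ltW r0) (ltW s0) ge_min lexx.
- by move=> u t h; apply: hs; apply: small_le h; rewrite ge_min lexx orbT.
Qed.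

Lemma expands_ev f X : expands f X ->
  near0 (fun u t => hsum (fun i => X i.1 i.2 * mon (zvar u) (wvar u (itau t)) i) (f u (itau t))).
Proof. by move=> [r [r0 _ h]]; exists r. Qed.

Lemma expands_ext f g X : near0 (fun u t => f u (itau t) = g u (itau t)) ->
  expands f X -> expands g X.
Proof.
move=> e [r [r0 aX h]]; apply: expands_at aX _ => //.
have : near0 (fun u t => hsum (fun i => X i.1 i.2 * mon (zvar u) (wvar u (itau t)) i) (f u (itau t))) by exists r.
by move=> /(near0_and e); apply: near0_imp => u t _ [<-].
Qed.

Lemma zvarE u : zvar u = cexp (twopii R * (u / rc L)).
Proof. by []. Qed.
Lemma wvarE u t : wvar u t = cexp (twopii R * (t - u / rc L)).
Proof. by []. Qed.

Lemma rcL0 : rc L != 0.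
Proof. by rewrite rc_eq0 gt_eqF. Qed.

Lemma zvarD u v : zvar (u + v) = zvar u * zvar v.
Proof. by rewrite !zvarE -cexpD; congr cexp; ring. Qed.
Lemma wvarD u v t : wvar (u + v) t = wvar u t * zvar (- v).
Proof. by rewrite !zvarE !wvarE -cexpD; congr cexp; ring. Qed.

Lemma zvar_real (c : R) : nm (zvar (rc c)) = 1.
Proof.
rewrite zvarE nm_cexp /twopii -rcV -rcM -!/(rc _) mulrAC -rcM Re_rcM /= mulr0.
exact: expR0.
Qed.

Lemma wvar_mul u t : zvar u * wvar u t = cexp (twopii R * t).
Proof. by rewrite zvarE wvarE -cexpD; congr cexp; ring. Qed.

(** A real shift of u multiplies z by a phase and w by the inverse phase, so the region is
    invariant. Expansions at u and at u + c therefore converge on the same polydisc. *)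
Lemma small_shift rho u t c : small rho (u + rc c) t <-> small rho u t.
Proof.
have h : nm (zvar (u + rc c)) = nm (zvar u) by rewrite zvarD nmM zvar_real mulr1.
have k : nm (wvar (u + rc c) (itau t)) = nm (wvar u (itau t)).
  by rewrite wvarD nmM -rcN zvar_real mulr1.
by rewrite /small h k.
Qed.

Lemma expands_shift f X (c : R) : expands f X ->
  expands (fun u t => f (u + rc c) t)
    (fun m n => zvar (rc c) ^+ n * (zvar (- rc c)) ^+ m * X m n).
Proof.
move=> [r [r0 aX h]]; exists r; split=> //.
  apply: asum_le aX => i; rewrite !nmM !nmX zvar_real -rcN zvar_real.
  by rewrite !expr1n !mul1r.
move=> u t /(small_shift _ _ _ c).2/h; apply: eq_hsum => i.
by rewrite /mon zvarD wvarD !exprMn; ring.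
Qed.

(* Purely imaginary u makes z and w independent positive reals. *)
Lemma real_point (z : R) : 0 < z -> zvar (- 'i%C * rc (L * ln z / (2 * pi))) = rc z.
Proof.
move=> z0; rewrite zvarE -[RHS](congr1 rc (lnK _))// -cexp_rc; congr cexp.
rewrite /twopii -!/(rc _) !rcM rcV rcM.
have ii : ('i%C : C) * 'i%C = -1 by rewrite -expr2; exact: sqr_i.
have p0 : rc pi != 0 by rewrite rc_eq0 gt_eqF// pi_gt0.
have t0 : rc 2 != 0 by rewrite rc_eq0 pnatr_eq0.
have l0 := rcL0.
transitivity (- ('i%C * 'i%C) * rc (ln z) : C); last by rewrite ii opprK mul1r.
by move: l0 p0 t0; move: (rc L) (rc pi) (rc 2) (rc (ln z)) 'i%C => ? ? ? ? ? *; field; apply/and3P.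
Qed.

Lemma real_tau (p : R) : 0 < p < 1 -> exists2 t, 0 < t & cexp (twopii R * itau t) = rc p.
Proof.
move=> /andP[p0 p1]; have pi0 := pi_gt0 R.
exists (- ln p / (2 * pi)).
  by rewrite divr_gt0 ?mulr_gt0// oppr_gt0 ln_lt0// p0.
rewrite -[RHS](congr1 rc (lnK _))// -cexp_rc; congr cexp.
rewrite /twopii /itau -!/(rc _) !rcM rcN rcV rcM.
have ii : ('i%C : C) * 'i%C = -1 by rewrite -expr2; exact: sqr_i.
have q0 : rc pi != 0 by rewrite rc_eq0 gt_eqF.
have t0 : rc 2 != 0 by rewrite rc_eq0 pnatr_eq0.
transitivity (- ('i%C * 'i%C) * rc (ln p) : C); last by rewrite ii opprK mul1r.
by move: q0 t0; move: (rc pi) (rc 2) (rc (ln p)) 'i%C => ? ? ? ? *; field; apply/andP.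
Qed.

(** Purely imaginary u1, u2 and tau reach every small positive triple (z1, z2, w). The product z1 z2
    w is e^(2 pi i tau), which must be below 1 for tau = it with t > 0; hence the radius min(r,
    1). *)
Lemma expansion_unique3 (F : nat -> nat -> nat -> C) (r : R) : 0 < r ->
  (forall u1 u2 t, 0 < t -> nm (zvar (u1 - u2)) < r -> nm (zvar u2) < r ->
    nm (wvar u1 (itau t)) < r ->
    hsum (fun i : nat * nat * nat => F i.1.1 i.1.2 i.2 *
      (zvar (u1 - u2) ^+ i.1.1 * zvar u2 ^+ i.1.2 * wvar u1 (itau t) ^+ i.2)) 0) ->
  forall a b c, F a b c = 0.
Proof.
move=> r0 h; have r1 : 0 < Num.min r 1 by rewrite lt_min r0 ltr01.
apply: (tri_unique r1) => z1 z2 w; rewrite !lt_min.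
move=> /and3P[z10 z1r z11] /and3P[z20 z2r z21] /and3P[w0 wr w1].
have p01 : 0 < z1 * z2 * w < 1.
  by rewrite !mulr_gt0// mulr_ilt1 ?mulr_ge0 1?ltW// mulr_ilt1 1?ltW.
have [t t0 tE] := real_tau p01.
set u2 := - 'i%C * rc (L * ln z2 / (2 * pi)).
set u12 := - 'i%C * rc (L * ln z1 / (2 * pi)).
have e1 : zvar u12 = rc z1 by exact: real_point.
have e2 : zvar u2 = rc z2 by exact: real_point.
have e3 : wvar (u12 + u2) (itau t) = rc w.
  have := wvar_mul (u12 + u2) (itau t); rewrite tE zvarD e1 e2 -rcM (rcM (z1 * z2)).
  by apply: mulfI; rewrite rc_eq0 mulf_neq0// gt_eqF.
have := h (u12 + u2) u2 t t0; rewrite addrK e1 e2 e3 !nm_rc !gtr0_norm//.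
by move=> /(_ z1r z2r wr); apply: eq_hsum => i; rewrite -!rcX -!rcM.
Qed.

(** Deduced from the three-variable statement by writing w as a product z2 w': the difference of the
    two series is spread over the exponents with b = c, as for a function of u1 - u2. *)
Lemma hsum_unique2 (X Y : ser R) (f : C -> C -> C) :
  near0 (fun u t => hsum (fun i => X i.1 i.2 * mon (zvar u) (wvar u (itau t)) i) (f u (itau t))) ->
  near0 (fun u t => hsum (fun i => Y i.1 i.2 * mon (zvar u) (wvar u (itau t)) i) (f u (itau t))) ->
  X = Y.
Proof.
move=> hX hY; have [r r0 h] := near0_and hX hY.
pose F a b c : C := if b == c then X c a - Y c a else 0.
suff H : forall a b c, F a b c = 0.
  apply/funext => m; apply/funext => n; apply/eqP; rewrite -subr_eq0; apply/eqP.
  by have := H n m m; rewrite /F eqxx.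
apply: (@expansion_unique3 _ (Num.min r 1)); first by rewrite lt_min r0 ltr01.
move=> u1 u2 t t0; rewrite !lt_min => /andP[z1r z11] /andP[z2r z21] /andP[wr w1].
have wE : wvar (u1 - u2) (itau t) = zvar u2 * wvar u1 (itau t) by rewrite wvarD opprK mulrC.
have st : small r (u1 - u2) t.
  by split=> //; rewrite wE nmM; apply: le_lt_trans wr; rewrite ler_piMl ?nm_ge0// ltW.
have [h1 h2] := h _ _ st; have := hsumB h1 h2; rewrite subrr => h3.
pose g (i : nat * nat) := ((i.2, i.1), i.1).
pose q (i : nat * nat * nat) := Some (i.2, i.1.1).
apply: (@hsum_inj _ _ _ g q) => [[m n]//|[[a b] c] /= hg|].
  rewrite /F; case: eqP => [bc|_]; last by rewrite mul0r.
  by have := hg (c, a); rewrite /g /= bc eqxx.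
apply: eq_hsum h3 => -[m n] /=; rewrite /F eqxx /mon /= wE [(zvar u2 * _) ^+ _]exprMn; ring.
Qed.

Lemma expands_unique f X Y : expands f X -> expands f Y -> X = Y.
Proof. by move=> /expands_ev hX /expands_ev hY; exact: hsum_unique2 hX hY. Qed.

Lemma psumE (X : ser R) z w N :
  ser_psum X z w N = \sum_(i <- [seq (m, n) | m <- index_iota 0 N, n <- index_iota 0 N]) X i.1 i.2 * mon z w i.
Proof.
rewrite big_allpairs_dep /ser_psum big_mkord; apply: eq_bigr => m _.
by rewrite big_mkord; apply: eq_bigr => n _; rewrite /mon mulrA.
Qed.

Lemma norm_psumE (X : ser R) z w N :
  ser_norm_psum X z w N = rc (\sum_(i <- [seq (m, n) | m <- index_iota 0 N, n <- index_iota 0 N]) nm (X i.1 i.2 * mon z w i)).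
Proof.
rewrite big_allpairs_dep /ser_norm_psum big_mkord rc_sum; apply: eq_bigr => m _.
rewrite big_mkord rc_sum; apply: eq_bigr => n _.
by rewrite -nmE /mon mulrA.
Qed.

Lemma uniq_square N : uniq [seq (m, n) | m <- index_iota 0 N, n <- index_iota 0 N].
Proof. by apply: allpairs_uniq; rewrite ?iota_uniq// => -[? ?] []. Qed.

Lemma sub_square (B : seq (nat * nat)) : exists N0, forall N, (N0 <= N)%N ->
  {subset B <= [seq (m, n) | m <- index_iota 0 N, n <- index_iota 0 N]}.
Proof.
have [N1 h1] := mem_bound (map fst B); have [N2 h2] := mem_bound (map snd B).
exists (maxn N1 N2) => N; rewrite geq_max => /andP[le1 le2] [m n] mn.
have := h1 _ (map_f fst mn); have := h2 _ (map_f snd mn).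
rewrite !mem_index_iota /= => n2 m1.
apply/allpairsP; exists (m, n); rewrite !mem_index_iota /=; split => //.
  exact: leq_trans m1 _.
exact: leq_trans n2 _.
Qed.

Lemma hsum_psum (X : ser R) z w s : hsum (fun i => X i.1 i.2 * mon z w i) s ->
  (exists M : C, forall N, ser_norm_psum X z w N <= M) /\
  (ser_psum X z w @ \oo --> s)%classic.
Proof.
move=> [[M hM] h]; split.
  by exists (rc M) => N; rewrite norm_psumE rc_le hM ?uniq_square.
apply/cvg_nm => e /h[A hA]; have [N0 sA] := sub_square A.
by exists N0 => n /sA sn; rewrite psumE; apply: hA; rewrite ?uniq_square.
Qed.

Lemma psum_hsum (X : ser R) z w s :
  (exists M : C, forall N, ser_norm_psum X z w N <= M) ->
  (ser_psum X z w @ \oo --> s)%classic -> hsum (fun i => X i.1 i.2 * mon z w i) s.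
Proof.
move=> [M hM] cX.
have [s' hs'] : exists s', hsum (fun i => X i.1 i.2 * mon z w i) s'.
  apply: asum_hsum; exists (complex.Re M) => B uB.
  have [N sB] := sub_square B.
  apply: le_trans (sum_sub uB (uniq_square N) (sB _ (leqnn N)) _) _ => [i|]; first exact: nm_ge0.
  have := hM N; rewrite norm_psumE; case: (M) => a b /=.
  by rewrite /rc lecE /= => /andP[].
have := (hsum_psum hs').2.
by move=> /(cvg_unique (@norm_hausdorff _ _))/(_ cX) <-.
Qed.

Lemma expands_is_expansion f X : expands f X -> is_expansion L f X.
Proof.
move=> [r [r0 _ h]]; exists (rc r); first by rewrite -rc0 rc_lt.
by move=> u t tau t0; rewrite !nmE !rc_lt => z0 w0; apply: hsum_psum; exact: h.
Qed.

Lemma is_expansion_hsum f X : is_expansion L f X ->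
  near0 (fun u t => hsum (fun i => X i.1 i.2 * mon (zvar u) (wvar u (itau t)) i) (f u (itau t))).
Proof.
move=> [r]; rewrite ltcE; case: r => a b /= /andP[/eqP -> a0] h.
exists a => // u t [t0 zr wr].
by have [] := h u t t0; rewrite ?nmE ?rc_lt//; exact: psum_hsum.
Qed.

(** As soon as one expansion exists, the choice made by [expansion] is itself an expansion, and
    uniqueness identifies the two. *)
Lemma expansionE f X : expands f X -> expansion L f = X.
Proof.
move=> eX; have iX := expands_is_expansion eX.
have : is_expansion L f (expansion L f) by apply: (@getPex _ (is_expansion L f)); exists X.
by move=> /is_expansion_hsum/hsum_unique2; apply; exact: expands_ev.
Qed.

End Expansions.

(** * Splittings of exponents *)

Section Convolution.
Local Open Scope nat_scope.

Definition spl (k : nat * nat) : seq ((nat * nat) * (nat * nat)) :=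
  [seq ((i, j), (k.1 - i, k.2 - j)) | i <- iota 0 k.1.+1, j <- iota 0 k.2.+1].

Definition add2 (x : (nat * nat) * (nat * nat)) := (x.1.1 + x.2.1, x.1.2 + x.2.2).

Lemma uniq_spl k : uniq (spl k).
Proof. by apply: allpairs_uniq; rewrite ?iota_uniq// => -[? ?] [? ?] _ _ [-> ->]. Qed.

Lemma mem_spl x k : (x \in spl k) = (add2 x == k).
Proof.
apply/idP/eqP.
  case/allpairsP => -[i j]; rewrite !mem_iota /= !add0n !ltnS => -[ik jk ->].
  by rewrite /add2 /= !subnKC//; case: k {ik jk}.
move=> <-; case: x => -[a b] [c d]; apply/allpairsP; exists (a, b).
by rewrite !mem_iota /= !add0n !ltnS !leq_addr !addKn.
Qed.

(** Exponents of total degree below D, the exhaustion along which majorants are bounded by induction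
    on D. *)
Definition tri (D : nat) : seq (nat * nat) :=
  [seq x <- [seq (i, j) | i <- iota 0 D, j <- iota 0 D] | x.1 + x.2 < D].

Lemma uniq_tri D : uniq (tri D).
Proof. by apply/filter_uniq/allpairs_uniq; rewrite ?iota_uniq// => -[? ?] []. Qed.

Lemma mem_tri D x : (x \in tri D) = (x.1 + x.2 < D).
Proof.
rewrite mem_filter; case: (ltnP (x.1 + x.2) D) => //= h.
case: x h => i j /= h; apply/allpairsP; exists (i, j).
by rewrite !mem_iota /= !add0n (leq_ltn_trans (leq_addr _ _) h) (leq_ltn_trans (leq_addl _ _) h).
Qed.

Lemma sub_tri (B : seq (nat * nat)) : exists D, {subset B <= tri D}.
Proof.
have [N h] := mem_bound (map (fun x => x.1 + x.2) B); exists N => x xB.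
by have := h _ (map_f (fun x => x.1 + x.2) xB); rewrite mem_index_iota mem_tri.
Qed.

End Convolution.

(** * Closure of expandable functions under products, inverses and square roots *)

Section Closure.
Variables (R : realType) (L : R).
Local Notation C := (cplx R).
Local Notation rc := (@rc R).
Local Notation nm := (@nm R).
Local Notation zvar := (zvar L).
Local Notation wvar := (wvar L).
Local Notation expands := (expands L).
Local Notation expandable := (expandable L).
Local Notation near0 := (near0 L).

(** The splittings of the exponents in D are pairwise distinct pairs, so those selected by [P] form
    a subset of the rectangle A x B. It is the majorant estimate for Cauchy products restricted to
    some of their terms. *)
Lemma conv_le (g h : nat * nat -> R) (P : pred ((nat * nat) * (nat * nat)))
    (D A B : seq (nat * nat)) :
  (forall i, 0 <= g i) -> (forall i, 0 <= h i) -> uniq D -> uniq A -> uniq B ->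
  (forall x, add2 x \in D -> P x -> (x.1 \in A) && (x.2 \in B)) ->
  \sum_(k <- D) \sum_(x <- spl k | P x) g x.1 * h x.2 <=
  (\sum_(i <- A) g i) * (\sum_(i <- B) h i).
Proof.
move=> g0 h0 uD uA uB PAB.
have -> : \sum_(k <- D) \sum_(x <- spl k | P x) g x.1 * h x.2 =
    \sum_(x <- [seq x <- [seq x | k <- D, x <- spl k] | P x]) g x.1 * h x.2.
  rewrite big_filter [RHS]big_mkcond big_allpairs_dep.
  by apply: eq_bigr => k _; rewrite [LHS]big_mkcond.
have -> : (\sum_(i <- A) g i) * (\sum_(i <- B) h i) =
    \sum_(x <- [seq (i, j) | i <- A, j <- B]) g x.1 * h x.2.
  by rewrite big_allpairs_dep mulr_suml; apply: eq_bigr => i _; rewrite mulr_sumr.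
apply: sum_sub.
- by apply/filter_uniq/uniq_fibers => //; [exact: uniq_spl|exact: mem_spl].
- by apply: allpairs_uniq => // -[? ?] [].
- move=> x; rewrite mem_filter => /andP[Px /allpairsPdep[k [y [kD yk xy]]]].
  move: yk; rewrite -xy mem_spl => /eqP e; have := PAB x; rewrite e kD Px => /(_ isT isT) /andP[a b].
  by apply/allpairsP; exists (x.1, x.2); split => //; case: (x).
- by move=> x; rewrite mulr_ge0.
Qed.

Definition conv (X Y : ser R) : ser R := fun m n =>
  \sum_(x <- spl (m, n)) X x.1.1 x.1.2 * Y x.2.1 x.2.2.

Lemma conv_at (X Y : ser R) z w s t : hsum (fun i => X i.1 i.2 * mon z w i) s ->
  hsum (fun i => Y i.1 i.2 * mon z w i) t ->
  hsum (fun i => conv X Y i.1 i.2 * mon z w i) (s * t).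
Proof.
move=> h1 h2; have := hsum_fiber uniq_spl mem_spl (hsum_prod h1 h2).
apply: eq_hsum => k; rewrite /conv mulr_suml; apply: eq_big_seq => x.
case: k => k1 k2; rewrite mem_spl => /eqP[<- <-] /=.
by rewrite /mon /= !exprD; ring.
Qed.

Lemma expands_mul f g X Y : expands f X -> expands g Y ->
  expands (fun u t => f u t * g u t) (conv X Y).
Proof.
move=> [r [r0 aX hX]] [s [s0 aY hY]].
have rs0 : 0 < Num.min r s by rewrite lt_min r0.
exists (Num.min r s); split => //.
  have := asum_fiber uniq_spl mem_spl (asum_prod
    (asum_shrink (rho' := Num.min r s) _ aX) (asum_shrink (rho' := Num.min r s) _ aY)).
  rewrite !(ltW rs0) !ge_min !lexx /= orbT => /(_ isT isT).
  apply: asum_le => k; rewrite le_eqVlt; apply/orP; left; apply/eqP; congr nm.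
  rewrite /conv mulr_suml; apply: eq_big_seq => x.
  case: k => k1 k2; rewrite mem_spl => /eqP[<- <-] /=.
  rewrite mulrACA -rcM -exprD; congr (_ * rc (_ ^+ _)); lia.
move=> u t st.
have rr : Num.min r s <= r by rewrite ge_min lexx.
have ss : Num.min r s <= s by rewrite ge_min lexx orbT.
by apply: conv_at; [exact: hX (small_le rr st)|exact: hY (small_le ss st)].
Qed.

Definition cst_ser (c : C) : ser R := fun m n => if (m == 0%N) && (n == 0%N) then c else 0.

Lemma cst_at c z w : hsum (fun i => cst_ser c i.1 i.2 * mon z w i) c.
Proof.
have u1 : uniq [:: (0%N, 0%N)] by [].
have := @hsum_fin R _ _ (fun i => cst_ser c i.1 i.2 * mon z w i) u1.
rewrite big_seq1 /cst_ser /mon /= !expr0 !mulr1; apply => -[m n].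
by rewrite inE xpair_eqE => /negbTE -> /=; rewrite mul0r.
Qed.

Lemma expands_cst (c : C) : expands (fun _ _ => c) (cst_ser c).
Proof.
exists 1; split => //; last by move=> u t _; exact: cst_at.
by apply: asum_le (hsum_asum (cst_at c 1 1)) => i; rewrite /mon !expr1n mulr1.
Qed.

Lemma expands_add f g X Y : expands f X -> expands g Y ->
  expands (fun u t => f u t + g u t) (fun m n => X m n + Y m n).
Proof.
move=> [r [r0 aX hX]] [s [s0 aY hY]].
have rs0 : 0 < Num.min r s by rewrite lt_min r0.
have rsr : 0 <= Num.min r s <= r by rewrite (ltW rs0) ge_min lexx.
have rss : 0 <= Num.min r s <= s by rewrite (ltW rs0) ge_min lexx orbT.
exists (Num.min r s); split => //.
  apply: asum_le (asumD (asum_shrink rsr aX) (asum_shrink rss aY)) => k.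
  by rewrite mulrDl.
move=> u t st; move/andP: rsr rss => [_ rsr] /andP[_ rss].
apply: eq_hsum (hsumD (hX _ _ (small_le rsr st)) (hY _ _ (small_le rss st))) => k.
by rewrite mulrDl.
Qed.

Lemma expands_scale c f X : expands f X ->
  expands (fun u t => c * f u t) (fun m n => c * X m n).
Proof.
move=> [r [r0 aX hX]]; exists r; split => //.
  by apply: asum_le (asumZ c aX) => k; rewrite mulrA.
by move=> u t /hX /(hsumZ c); apply: eq_hsum => k; rewrite mulrA.
Qed.

Lemma expandable_cst c : expandable (fun _ _ => c) c.
Proof. by exists (cst_ser c); [exact: expands_cst|]. Qed.

Lemma expandable_mul f g a b : expandable f a -> expandable g b ->
  expandable (fun u t => f u t * g u t) (a * b).
Proof.
move=> [X eX <-] [Y eY <-]; exists (conv X Y); first exact: expands_mul.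
by rewrite /conv /spl /= big_seq1.
Qed.

Lemma expandable_shift f a (c : R) : expandable f a ->
  expandable (fun u t => f (u + rc c) t) a.
Proof.
move=> [X eX <-]; exists (fun m n => zvar (rc c) ^+ n * (zvar (- rc c)) ^+ m * X m n).
  exact: expands_shift.
by rewrite !expr0 !mul1r.
Qed.

Lemma expandable_ext f g a : near0 (fun u t => f u (itau t) = g u (itau t)) ->
  expandable f a -> expandable g a.
Proof. by move=> e [X eX Xa]; exists X => //; exact: expands_ext eX. Qed.

Definition wt (X : ser R) (rho : R) (i : nat * nat) : R := nm (X i.1 i.2) * rho ^+ (i.1 + i.2).

Lemma wt_ge0 X rho i : 0 <= rho -> 0 <= wt X rho i.
Proof. by move=> r0; rewrite /wt mulr_ge0 ?nm_ge0 ?exprn_ge0. Qed.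

Lemma wtE X rho i : 0 <= rho -> nm (X i.1 i.2 * rc (rho ^+ (i.1 + i.2))) = wt X rho i.
Proof. by move=> r0; rewrite nmM nm_rc ger0_norm ?exprn_ge0. Qed.

(** Shrinking the radius by d <= 1 multiplies every nonconstant monomial by at most d, so the tail
    is at most d M. *)
Lemma asum_tail (X : ser R) r : 0 < r ->
  asum (fun i : nat * nat => X i.1 i.2 * rc (r ^+ (i.1 + i.2))) -> forall e, 0 < e ->
  exists2 rho, 0 < rho <= r & forall B, uniq B -> (0%N, 0%N) \notin B ->
    \sum_(i <- B) wt X rho i <= e.
Proof.
move=> r0 [M hM] e e0; have M0 := bsum_ge0 hM; have M1 : 0 < M + 1 by lra.
pose d := Num.min 1 (e / (M + 1)).
have d0 : 0 < d by rewrite lt_min ltr01 divr_gt0.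
have d1 : d <= 1 by rewrite ge_min lexx.
exists (d * r); first by rewrite mulr_gt0//= ler_piMl// ltW.
move=> B uB B0; apply: le_trans (_ : d * M <= _); last first.
  apply: le_trans (_ : e / (M + 1) * M <= _).
    by rewrite ler_wpM2r// /d ge_min lexx orbT.
  by rewrite mulrAC ler_pdivrMr// ler_wpM2l ?(ltW e0)//; lra.
apply: le_trans (ler_wpM2l (ltW d0) (hM B uB)).
rewrite mulr_sumr big_seq [X in _ <= X]big_seq; apply: ler_sum => i iB.
rewrite wtE ?(ltW r0)// /wt mulrCA ler_wpM2l ?nm_ge0// exprMn ler_wpM2r ?exprn_ge0 ?(ltW r0)//.
case: i iB => -[|m] [|n] iB /=; first by rewrite iB in B0.
all: by rewrite ?addSn ?addnS exprS ler_piMr ?(ltW d0)// exprn_ile1// ltW.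
Qed.

Lemma tail_hsum (X : ser R) rho u t s : 0 <= rho -> nm (zvar u) <= rho -> nm (wvar u (itau t)) <= rho ->
  hsum (fun i => X i.1 i.2 * mon (zvar u) (wvar u (itau t)) i) s ->
  forall e, (forall B, uniq B -> (0%N, 0%N) \notin B -> \sum_(i <- B) wt X rho i <= e) ->
  nm (s - X 0%N 0%N) <= e.
Proof.
move=> r0 zr wr hs e he.
pose f0 (i : nat * nat) : C := if i == (0%N, 0%N) then X 0%N 0%N else 0.
have h0 : hsum f0 (X 0%N 0%N).
  have := @hsum_fin R _ [:: (0%N, 0%N)] f0 isT; rewrite big_seq1 /f0 eqxx; apply => i.
  by rewrite inE => /negbTE ->.
apply: (hsum_le (hsumB hs h0)) => B uB.
rewrite (bigID (pred1 (0%N, 0%N)))/= big1 ?add0r; last first.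
  by move=> i /eqP ->; rewrite /f0 eqxx /mon !expr0 !mulr1 subrr nm0.
rewrite -big_filter; apply: le_trans (he [seq i <- B | i != (0%N, 0%N)] _ _); last 2 first.
- exact: filter_uniq.
- by rewrite mem_filter eqxx.
rewrite [X in X <= _]big_seq [X in _ <= X]big_seq; apply: ler_sum => i.
rewrite mem_filter /f0 => /andP[/negbTE -> _]; rewrite subr0 nmM /wt.
by rewrite ler_wpM2l ?nm_ge0// nm_mon.
Qed.

Lemma expandable_near f c : expandable f c -> forall e, 0 < e ->
  near0 (fun u t => nm (f u (itau t) - c) < e).
Proof.
move=> [X [r [r0 aX hX]] <-] e e0; have e2 : 0 < e / 2 by lra.
have [rho /andP[rho0 rhor] ht] := asum_tail r0 aX e2.
exists rho => // u t st; have [t0 zr wr] := st.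
have := tail_hsum (ltW rho0) (ltW zr) (ltW wr) (hX _ _ (small_le rhor st)) ht.
by move=> ?; lra.
Qed.

Lemma expandable_neq0 f c : expandable f c -> c != 0 ->
  near0 (fun u t => f u (itau t) != 0).
Proof.
move=> fc; rewrite -nm_gt0 => c0; have := expandable_near fc c0.
apply: near0_imp => u t _; apply: contraTneq => ->.
by rewrite sub0r nmN ltxx.
Qed.

(** A recursion whose right-hand side sees only coefficients of lower total degree: the iterates
    from 0 stabilise at (m, n) after m + n + 1 rounds. *)
Lemma solve_rec (Phi : nat -> nat -> ser R -> C) :
  (forall m n Y Y', (forall i j, (i + j < m + n)%N -> Y i j = Y' i j) -> Phi m n Y = Phi m n Y') ->
  exists Y : ser R, forall m n, Y m n = Phi m n Y.
Proof.
move=> hPhi; pose it k : ser R := iter k (fun Y m n => Phi m n Y) (fun _ _ => 0).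
have st k : forall l m n, (m + n < k)%N -> (m + n < l)%N -> it k m n = it l m n.
  elim: k => // k IH [|l] m n //; rewrite !ltnS => mk ml /=.
  by apply: hPhi => i j ij; apply: IH; [exact: leq_trans ij mk|exact: leq_trans ij ml].
exists (fun m n => it (m + n).+1 m n) => m n.
change (Phi m n (it (m + n)%N) = Phi m n (fun i j => it (i + j).+1 i j)).
by apply: hPhi => i j ij; apply: st.
Qed.

Lemma asum_tri (X : ser R) rho M : 0 <= rho -> (forall D, \sum_(i <- tri D) wt X rho i <= M) ->
  asum (fun i : nat * nat => X i.1 i.2 * rc (rho ^+ (i.1 + i.2))).
Proof.
move=> r0 h; exists M => B uB; have [D sB] := sub_tri B.
apply: le_trans (h D); apply: le_trans (sum_sub uB (uniq_tri D) sB _) _.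
  by move=> i; exact: nm_ge0.
by apply: ler_sum => i _; rewrite wtE.
Qed.

Lemma spl_fst (F : (nat * nat) * (nat * nat) -> C) k :
  \sum_(x <- spl k | x.1 == (0%N, 0%N)) F x = F ((0%N, 0%N), k).
Proof.
have u1 : ((0%N, 0%N), k) \in spl k by rewrite mem_spl; case: k.
rewrite big_mkcond (bigD1_seq _ u1 (uniq_spl k)) /= big1_seq ?addr0//.
move=> [[a b] d] /andP[ne]; rewrite mem_spl => /eqP dk /=; case: eqP => //= -[? ?]; subst a b.
by case/negP: ne; rewrite -dk /add2 /=; case: (d).
Qed.

Lemma spl_snd (F : (nat * nat) * (nat * nat) -> C) k :
  \sum_(x <- spl k | x.2 == (0%N, 0%N)) F x = F (k, (0%N, 0%N)).
Proof.
have u1 : (k, (0%N, 0%N)) \in spl k by rewrite mem_spl /add2 /= !addn0; case: k.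
rewrite big_mkcond (bigD1_seq _ u1 (uniq_spl k)) /= big1_seq ?addr0//.
move=> [d [a b]] /andP[ne]; rewrite mem_spl => /eqP dk /=; case: eqP => //= -[? ?]; subst a b.
by case/negP: ne; rewrite -dk /add2 /= !addn0; case: (d).
Qed.

Lemma nm_conv_le (X Y : ser R) (P : pred _) rho m n : 0 <= rho ->
  nm (\sum_(x <- spl (m, n) | P x) X x.1.1 x.1.2 * Y x.2.1 x.2.2) * rho ^+ (m + n) <=
  \sum_(x <- spl (m, n) | P x) wt X rho x.1 * wt Y rho x.2.
Proof.
move=> r0; apply: le_trans (ler_wpM2r _ (nm_sum _ _ _)) _; first by rewrite exprn_ge0.
rewrite mulr_suml big_seq_cond [X in _ <= X]big_seq_cond; apply: ler_sum => x.
rewrite mem_spl => /andP[/eqP[<- <-] _]; rewrite nmM /wt le_eqVlt; apply/orP; left; apply/eqP.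
by rewrite mulrACA -exprD; congr (_ * _ ^+ _); lia.
Qed.

(** The coefficients of the inverse solve a triangular recursion. At a radius where the tail of X is
    at most |c| / 2, the partial norms S_D of the inverse satisfy |c| S_(D+1) <= 1 + (|c| / 2) S_D,
    so the bound 2 / |c| propagates. *)
Lemma expandable_inv f c : expandable f c -> c != 0 -> expandable (fun u t => (f u t)^-1) c^-1.
Proof.
move=> [X [r [r0 aX hX]] Xc] c0; have nc0 : 0 < nm c by rewrite nm_gt0.
have nc2 : 0 < nm c / 2 by lra.
have [rho /andP[rho0 rhor] ht] := asum_tail r0 aX nc2.
pose P (x : (nat * nat) * (nat * nat)) := x.1 != (0%N, 0%N).
have [m n Y Y' YY|Y YE] := @solve_rec (fun m n Y => c^-1 * (((m == 0%N) && (n == 0%N))%:R -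
  \sum_(x <- spl (m, n) | P x) X x.1.1 x.1.2 * Y x.2.1 x.2.2)).
  congr (_ * (_ - _)); rewrite big_seq_cond [RHS]big_seq_cond.
  apply: eq_bigr => -[[a b] [a' b']]; rewrite mem_spl /P /= => /andP[/eqP[ma nb] ab].
  by rewrite YY//= -ma -nb; case: a b ab {ma nb} => [|a] [|b] //= _; lia.
have YX : conv X Y = cst_ser 1.
  apply/funext => m; apply/funext => n; rewrite /conv (bigID P)/=.
  rewrite (eq_bigl (fun x => x.1 == (0%N, 0%N)) _ (fun x => negbK _)) spl_fst /= Xc.
  by rewrite YE mulVKf// addrC subrK /cst_ser; case: ifP.
have bY D : \sum_(i <- tri D) wt Y rho i <= 2 / nm c.
  elim: D => [|D IH]; first by rewrite big_nil divr_ge0// ltW.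
  rewrite ler_pdivlMr// mulrC mulr_sumr.
  apply: le_trans (_ : \sum_(k <- tri D.+1) ((k == (0%N, 0%N))%:R +
    \sum_(x <- spl k | P x) wt X rho x.1 * wt Y rho x.2) <= _).
    apply: ler_sum => -[m n] _; rewrite {1}/wt /= YE nmM nmV mulrA (mulVKf (lt0r_neq0 nc0)).
    apply: le_trans (ler_wpM2r _ (nmD _ _)) _; first by rewrite exprn_ge0// ltW.
    rewrite mulrDl nmN xpair_eqE; apply: lerD.
      by case: m n => [|m] [|n] /=; rewrite ?nm0 ?nm1 ?mul0r ?mul1r.
    by apply: nm_conv_le; exact: ltW.
  rewrite big_split /=.
  have -> : \sum_(k <- tri D.+1) (k == (0%N, 0%N))%:R = 1 :> R.
    by rewrite (bigD1_seq (0%N, 0%N)) ?mem_tri ?uniq_tri//= big1 ?addr0// => i /negbTE ->.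
  pose A := [seq i <- tri D.+1 | i != (0%N, 0%N)].
  have uA : uniq A by exact/filter_uniq/uniq_tri.
  have := @conv_le (wt X rho) (wt Y rho) P (tri D.+1) A (tri D) _ _ (uniq_tri _) uA (uniq_tri _).
  move=> /(_ (fun i => wt_ge0 _ _ (ltW rho0)) (fun i => wt_ge0 _ _ (ltW rho0))) H.
  have {}H := H _; apply: le_trans (lerD (lexx 1) (H _)) _.
    move=> [[a b] [a' b']]; rewrite !mem_tri mem_filter mem_tri /P /= => h ab.
    by rewrite ab /=; move: ab h; clear; case: a b => [|a] [|b] //= _; lia.
  have A0 : \sum_(i <- A) wt X rho i <= nm c / 2 by apply: ht => //; rewrite mem_filter eqxx.
  have : (\sum_(i <- A) wt X rho i) * (\sum_(i <- tri D) wt Y rho i) <= nm c / 2 * (2 / nm c).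
    by apply: ler_pM => //; apply: sumr_ge0 => i _; apply: wt_ge0; exact: ltW.
  have -> : nm c / 2 * (2 / nm c) = 1 by field; rewrite gt_eqF.
  lra.
have aY := asum_tri (ltW rho0) bY.
exists Y; last first.
  by rewrite YE /= /spl /= big_cons big_nil /P /= subr0 mulr1.
apply: (expands_at rho0 aY); exists rho => // u t st; have [t0 zr wr] := st.
have [g hg] := asum_hsum (asum_mon (ltW zr) (ltW wr) aY).
have := conv_at (hX _ _ (small_le rhor st)) hg.
rewrite YX => /(hsum_unique (cst_at 1 _ _)) fg.
suff -> : (f u (itau t))^-1 = g by [].
have f0 : f u (itau t) != 0 by apply: contra_eq_neq fg => ->; rewrite mul0r oner_neq0.
by apply: (mulfI f0); rewrite mulfV.
Qed.

(** Comparing coefficients in Y^2 = X gives a recursion with leading factor 2c. At a radius where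
    the tail of X is at most c^2 / 2, the bound c / 2 on the tail of Y propagates, because c^2 / 2 +
    (c / 2)^2 <= 2c (c / 2). *)
Lemma expandable_sqrt f (c : R) : expandable f (rc (c ^+ 2)) -> 0 < c ->
  near0 (fun u t => 0 <= f u (itau t)) ->
  expandable (fun u t => sqrtC (f u t)) (rc c).
Proof.
move=> [X [r [r0 aX hX]] Xc] c0 fpos.
have c2 : 0 < c ^+ 2 / 2 by rewrite divr_gt0// exprn_gt0.
have rc0' : rc c != 0 by rewrite rc_eq0 gt_eqF.
have [rho /andP[rho0 rhor] ht] := asum_tail r0 aX c2.
pose P (x : (nat * nat) * (nat * nat)) := (x.1 != (0%N, 0%N)) && (x.2 != (0%N, 0%N)).
have [m n Y Y' YY|Y YE] := @solve_rec (fun m n Y => if (m == 0%N) && (n == 0%N) then rc c else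
  (2 * rc c)^-1 * (X m n - \sum_(x <- spl (m, n) | P x) Y x.1.1 x.1.2 * Y x.2.1 x.2.2)).
  case: ifP => // _; congr (_ * (_ - _)); rewrite big_seq_cond [RHS]big_seq_cond.
  apply: eq_bigr => -[[a b] [a' b']]; rewrite mem_spl /P /= => /andP[/eqP[ma nb]] /andP[ab ab'].
  rewrite !YY//= -ma -nb; first by case: a b ab {ma nb} => [|a] [|b] //= _; lia.
  by case: a' b' ab' {ma nb} => [|a'] [|b'] //= _; lia.
have Y00 : Y 0%N 0%N = rc c by rewrite YE.
have two : (2 : C) != 0 by rewrite pnatr_eq0.
have YX : conv Y Y = X.
  apply/funext => m; apply/funext => n; case: (boolP ((m == 0%N) && (n == 0%N))).
    by move=> /andP[/eqP -> /eqP ->]; rewrite /conv /spl /= big_seq1 /= Y00 Xc expr2 rcM.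
  move=> mn; rewrite /conv (bigID (fun x => x.1 == (0%N, 0%N)))/= spl_fst /= Y00.
  rewrite (bigID (fun x => x.2 == (0%N, 0%N)))/=.
  rewrite (eq_bigl (fun x => (x.2 == (0%N, 0%N)) && (x.1 != (0%N, 0%N))) _ (fun x => andbC _ _)).
  rewrite big_mkcondr /= spl_snd /= Y00 xpair_eqE mn YE (negbTE mn).
  set S := bigop _ _ _; move: (X m n) S (rc c) rc0' => x S y y0.
  by field.
pose A D := [seq i <- tri D | i != (0%N, 0%N)].
have uA D : uniq (A D) by exact/filter_uniq/uniq_tri.
have mA D x : (x \in A D) = (x != (0%N, 0%N)) && (x.1 + x.2 < D)%N by rewrite mem_filter mem_tri.
have bA D : \sum_(i <- A D) wt Y rho i <= c / 2.
  elim: D => [|D IH]; first by rewrite big_nil divr_ge0// ltW.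
  have c2' : 0 < 2 * c by lra.
  have n2c : nm (2 * rc c) = 2 * c by rewrite -(rc_nat R 2) -rcM nm_rc gtr0_norm.
  rewrite -(ler_pM2l c2') mulr_sumr.
  apply: le_trans (_ : \sum_(k <- A D.+1) (wt X rho k +
    \sum_(x <- spl k | P x) wt Y rho x.1 * wt Y rho x.2) <= _).
    rewrite big_seq [X in _ <= X]big_seq; apply: ler_sum => -[m n].
    rewrite mem_filter xpair_eqE => /andP[mn _].
    rewrite {1}/wt /= YE (negbTE mn) nmM nmV n2c mulrA (mulVKf (lt0r_neq0 c2')).
    apply: le_trans (ler_wpM2r _ (nmD _ _)) _; first by rewrite exprn_ge0// ltW.
    by rewrite mulrDl nmN; apply: lerD => //; apply: nm_conv_le; exact: ltW.
  rewrite big_split /=.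
  have := @conv_le (wt Y rho) (wt Y rho) P (A D.+1) (A D) (A D) _ _ (uA _) (uA _) (uA _).
  move=> /(_ (fun i => wt_ge0 _ _ (ltW rho0)) (fun i => wt_ge0 _ _ (ltW rho0))) H.
  have {}H := H _; apply: le_trans (lerD (lexx _) (H _)) _.
    move=> [[a b] [a' b']]; rewrite !mA /P /= => /andP[_ h] /andP[ab ab'].
    rewrite ab ab' /=; apply/andP; split.
      by move: ab' h; clear; case: a' b' => [|a'] [|b'] //= _; lia.
    by move: ab h; clear; case: a b => [|a] [|b] //= _; lia.
  have A0 : \sum_(i <- A D.+1) wt X rho i <= c ^+ 2 / 2 by apply: ht => //; rewrite mem_filter eqxx.
  have : (\sum_(i <- A D) wt Y rho i) * (\sum_(i <- A D) wt Y rho i) <= c / 2 * (c / 2).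
    by apply: ler_pM => //; apply: sumr_ge0 => i _; apply: wt_ge0; exact: ltW.
  by rewrite expr2 in A0 *; nra.
have hB B : uniq B -> (0%N, 0%N) \notin B -> \sum_(i <- B) wt Y rho i <= c / 2.
  move=> uB B0; have [D sB] := sub_tri B; apply: le_trans (bA D); apply: sum_sub => //.
    by move=> i iB; rewrite mem_filter sB// andbT; apply: contraNneq B0 => <-.
  by move=> i; apply: wt_ge0; exact: ltW.
have aY : asum (fun i : nat * nat => Y i.1 i.2 * rc (rho ^+ (i.1 + i.2))).
  apply: (@asum_tri _ _ (c + c / 2)); first exact: ltW.
  move=> D; rewrite (bigID (fun i => i == (0%N, 0%N)))/=; apply: lerD; last first.
    by rewrite -big_filter; exact: bA.
  rewrite -big_filter; apply: le_trans (_ : \sum_(i <- [:: (0%N, 0%N)]) wt Y rho i <= _).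
    apply: sum_sub => //; first exact/filter_uniq/uniq_tri.
      by move=> i; rewrite mem_filter inE => /andP[].
    by move=> i; apply: wt_ge0; exact: ltW.
  by rewrite big_seq1 /wt /= Y00 nm_rc gtr0_norm// expr0 mulr1.
exists Y => //; apply: (expands_at rho0 aY).
have [s s0 hs] := fpos.
exists (Num.min rho s); first by rewrite lt_min rho0.
move=> u t st.
have st1 : small L rho u t by apply: small_le st; rewrite ge_min lexx.
have f0 : 0 <= f u (itau t) by apply: hs; apply: small_le st; rewrite ge_min lexx orbT.
have [t0 zr wr] := st1.
have [g hg] := asum_hsum (asum_mon (ltW zr) (ltW wr) aY).
have := conv_at hg hg; rewrite YX => /(hsum_unique (hX _ _ (small_le rhor st1))) fg.
suff -> : sqrtC (f u (itau t)) = g by [].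
have gc := tail_hsum (ltW rho0) (ltW zr) (ltW wr) hg hB; rewrite Y00 in gc.
(* The sign is decided by size: [g] lies within c / 2 of c > 0, so it cannot be the opposite of a
   nonnegative root. *)
have : sqrtC (f u (itau t)) ^+ 2 == g ^+ 2 by rewrite sqrtCK fg expr2.
rewrite eqf_sqr => /orP[/eqP //|/eqP sg].
have s0' : 0 <= sqrtC (f u (itau t)) by rewrite sqrtC_ge0.
rewrite sg in s0' *; move: s0' gc; case: (g) => a b.
rewrite lecE /= => /andP[/eqP b0 a0]; rewrite oppr_ge0 in a0.
have -> : b = 0 by apply/eqP; rewrite -oppr_eq0 -b0.
have -> : (a +i* 0)%C - rc c = rc (a - c) by rewrite rcB.
by rewrite nm_rc => gc; exfalso; move: c0 a0 gc; clear; rewrite ler_norml; lra.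
Qed.

End Closure.

(** * Expansions, reality and positivity of theta and of the brackets *)

Section ThetaExpansion.
Variables (R : realType) (L : R).
Hypothesis L0 : 0 < L.
Local Notation C := (cplx R).
Local Notation rc := (@rc R).
Local Notation nm := (@nm R).
Local Notation zvar := (zvar L).
Local Notation wvar := (wvar L).
Local Notation expandable := (expandable L).
Local Notation near0 := (near0 L).
Local Notation brac := (brac L).

(** By invariance of the region under real shifts, one radius serves all c at once; the simultaneous
    nonvanishing at all real shifts rests on this. *)
Lemma near0_shift_all P : near0 P -> near0 (fun u t => forall c : R, P (u + rc c) t).
Proof. by move=> [r r0 h]; exists r => // u t st c; apply: h; apply/small_shift. Qed.

(** The term of index -1 of theta(u/L), overall sign included: minus p^(1/8) z^(-1/2) e^(-i pi / 2).
    Dividing by it leaves a power series with constant term 1. *)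
Definition pref (u tau : C) : C :=
  - (cexp (twopii R * tau / 8) * cexp (- (twopii R * (u / rc L)) / 2) * cexp (- (rc pi * 'i%C) / 2)).

Lemma pref_neq0 u tau : pref u tau != 0.
Proof.
rewrite /pref oppr_eq0.
exact: mulf_neq0 (mulf_neq0 (cexp_neq0 _) (cexp_neq0 _)) (cexp_neq0 _).
Qed.

Definition alt (k : int) : C := cexp (- (rc pi * 'i%C) * k%:~R).

(** With k = m - n this encodes the sum over k of (-1)^k z^(k(k-1)/2) w^(k(k+1)/2), the sum side of
    the Jacobi triple product. The index k corresponds to the term -1 - k of theta. *)
Definition theta_ser : ser R := fun m n =>
  if (n%:Z * 2 == (m%:Z - n%:Z) * (m%:Z - n%:Z - 1)) then alt (m%:Z - n%:Z) else 0.

Lemma nm_alt k : nm (alt k) = 1.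
Proof.
have -> : alt k = cexp (rc (- pi * k%:~R) * 'i%C).
  by rewrite /alt rcM rcN rc_int; congr cexp; ring.
by rewrite nm_cexp Re_rcM /= mulr0 expR0.
Qed.

Definition tri_num (k : int) : nat := (absz (k * (k + 1))%R %/ 2)%N.

Lemma tri_numE k : (tri_num k)%:Z * 2 = k * (k + 1).
Proof.
have h : 0 <= k * (k + 1) by nia.
have [c ce] : exists c, k * (k + 1) = c * 2.
  have [e|e] : k = (k %/ 2)%Z * 2 \/ k = (k %/ 2)%Z * 2 + 1 by lia.
    by exists ((k %/ 2)%Z * (k + 1)); rewrite {1}e; ring.
  by exists (k * ((k %/ 2)%Z + 1)); rewrite {2}e; ring.
by move: h; rewrite /tri_num ce; lia.
Qed.

Lemma theta_ser_hsum u t : 0 < t ->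
  hsum (fun i => theta_ser i.1 i.2 * mon (zvar u) (wvar u (itau t)) i)
    (theta (u / rc L) (itau t) / pref u (itau t)).
Proof.
move=> t0; have := hsumZ (- (pref u (itau t))^-1) (theta_hsum (u / rc L) t0).
rewrite mulrNN [_ * theta _ _]mulrC => h.
pose g (k : int) : nat * nat := (tri_num k, tri_num (k - 1)).
pose q (i : nat * nat) : option int := Some (i.1%:Z - i.2%:Z).
have bj : bijective (fun m : int => - 1 - m).
  by exists (fun m : int => - 1 - m) => m; ring.
apply: (@hsum_inj _ _ _ g q).
- by move=> k; congr Some; have := tri_numE k; have := tri_numE (k - 1); rewrite /g /=; nia.
- move=> [m n] hg; rewrite /theta_ser /=; case: eqP => [e|]; last by rewrite mul0r.
  have /eqP := hg (m%:Z - n%:Z); case; rewrite /g.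
  have h1 := tri_numE (m%:Z - n%:Z); have h2 := tri_numE (m%:Z - n%:Z - 1).
  by congr (_, _); nia.
- apply: eq_hsum (hsum_bij bj h) => k; rewrite /= /theta_ser /g /=.
  have h1 := tri_numE k; have h2 := tri_numE (k - 1).
  have kE : (tri_num k)%:Z - (tri_num (k - 1))%:Z = k by nia.
  rewrite kE ifT; last by apply/eqP; nia.
  rewrite /mon /= zvarE wvarE -!cexpMn /alt /pref invrN opprK -!cexpD -cexpN -!cexpD.
  rewrite /theta_term -!/(rc _); congr cexp.
  have e1 : (tri_num k)%:R * 2 = k%:~R * (k%:~R + 1) :> C.
    by rewrite -[2]/((2 : int)%:~R : C) -[(tri_num k)%:R]/((tri_num k)%:Z%:~R : C) -intrM h1 intrM intrD.
  have e2 : (tri_num (k - 1))%:R * 2 = (k%:~R - 1) * k%:~R :> C.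
    rewrite -[2]/((2 : int)%:~R : C) -[(tri_num (k - 1))%:R]/((tri_num (k - 1))%:Z%:~R : C) -intrM h2 intrM.
    by rewrite subrK intrB.
  have two : (2 : C) != 0 by rewrite pnatr_eq0.
  have {}e1 : (tri_num k)%:R = k%:~R * (k%:~R + 1) / 2 :> C by rewrite -e1 mulfK.
  have {}e2 : (tri_num (k - 1))%:R = (k%:~R - 1) * k%:~R / 2 :> C by rewrite -e2 mulfK.
  rewrite e1 e2 twopiiE rmorphB rmorphN /=; move: (k%:~R) (rc pi) 'i%C (itau t) (u / _) => *.
  by field.
Qed.

Lemma bare_expandable : expandable (fun u tau => theta (u / rc L) tau / pref u tau) 1.
Proof.
exists theta_ser; last by rewrite /theta_ser /= /alt mulr0 cexp0.
have h1 : 0 <= (2^-1 : R) < 1 by apply/andP; split; lra.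
exists 2^-1; split; first by rewrite invr_gt0.
  apply: asum_le (asum_prod (asum_geo h1) (asum_geo h1)) => i.
  rewrite -rcM -exprD nmM -[X in _ <= X]mul1r ler_wpM2r ?nm_ge0// /theta_ser.
  by case: ifP; rewrite ?nm_alt ?nm0.
by move=> u t [t0 _ _]; exact: theta_ser_hsum.
Qed.

Lemma theta_shift_neq0 : near0 (fun u t => forall c : R, theta ((u + rc c) / rc L) (itau t) != 0).
Proof.
apply: (@near0_shift_all (fun u t => theta (u / rc L) (itau t) != 0)).
have := expandable_neq0 bare_expandable (oner_neq0 _).
by apply: near0_imp => u t t0; apply: contra => /eqP ->; rewrite mul0r.
Qed.

(** The prefactors at two real shifts of u differ by the constant phase [ph], so the powers z^(-1/2)
    and p^(1/8) disappear from the quotient. *)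
Lemma theta_ratio_expandable (a b : R) : exists2 c : C, c != 0 &
  expandable (fun u tau => theta ((u + rc a) / rc L) tau / theta ((u + rc b) / rc L) tau) c.
Proof.
pose ph : C := cexp (- (twopii R * (rc a / rc L)) / 2 + (twopii R * (rc b / rc L)) / 2).
exists (ph * (1 * 1^-1)); first by rewrite invr1 !mulr1 cexp_neq0.
have := expandable_mul (expandable_cst L ph) (expandable_mul (expandable_shift a bare_expandable)
  (expandable_inv (expandable_shift b bare_expandable) (oner_neq0 _))).
apply: expandable_ext; apply: near0_true => u t t0.
have -> : ph = pref (u + rc a) (itau t) / pref (u + rc b) (itau t).
  rewrite /pref invrN mulrNN -!cexpD -cexpN -!cexpD; congr cexp.
  by have := rcL0 L0; move: (rc L) (rc a) (rc b) => l x y l0; field.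
have := pref_neq0 (u + rc a) (itau t); have := pref_neq0 (u + rc b) (itau t).
rewrite invf_div; move: (pref _ _) (pref _ _) => x y x0 y0.
move: (theta _ _) ((theta _ _)^-1) => p q.
by field; rewrite x0 y0.
Qed.

(* Functions of tau alone: Fourier series in p with triangular exponents. *)
Lemma diag_expandable (g : int -> C) (f : C -> C) :
  (forall t, 0 < t -> hsum (fun m => g m * cexp (twopii R * itau t) ^+ tri_num m) (f (itau t))) ->
  expandable (fun _ tau => f tau) (g 0 + g (-1)).
Proof.
move=> h.
pose cand (a : nat) : seq int := map Posz (iota 0 a.+1) ++ map Negz (iota 0 a.+1).
pose fib (i : nat * nat) := if i.1 == i.2 then [seq m <- cand i.1 | tri_num m == i.1] else [::].
have ucand a : uniq (cand a).
  rewrite cat_uniq !map_inj_uniq ?iota_uniq ?andbT; try by move=> ? ? [].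
  by rewrite andTb; apply/hasPn => i /mapP[n _ ->]; apply/mapP => -[].
have ufib i : uniq (fib i) by rewrite /fib; case: ifP => // _; exact: filter_uniq.
have mcand m : m \in cand (tri_num m).
  rewrite mem_cat; have := tri_numE m; case: m => k e.
    apply/orP; left; rewrite mem_map ?mem_iota /= ?add0n ?ltnS; last by move=> ? ? [].
    by nia.
  apply/orP; right; rewrite mem_map ?mem_iota /= ?add0n ?ltnS; last by move=> ? ? [].
  by nia.
have mfib m i : (m \in fib i) = ((tri_num m, tri_num m) == i).
  case: i => a b; rewrite xpair_eqE; case: (eqVneq a b) => [->|ab]; last first.
    rewrite (_ : fib (a, b) = [::]); last by rewrite /fib (negbTE ab).
    by rewrite in_nil; symmetry; apply/negbTE/negP => /andP[/eqP ta /eqP tb]; move: ab; rewrite -ta -tb eqxx.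
  rewrite (_ : fib (b, b) = [seq m <- cand b | tri_num m == b]); last by rewrite /fib eqxx.
  rewrite mem_filter andbb; case: eqP => [<-|//]; exact: mcand.
(* The integers 0 and -1 are the two with triangular number 0, hence two summands in the constant
   coefficient. *)
exists (fun a b => \sum_(m <- fib (a, b)) g m); last first.
  by rewrite /fib /= /cand /= !big_cons big_nil addr0.
(* At t = 1 the variable p is e^(-2 pi), the value of zw at z = w = e^(-pi); convergence at this
   single point supplies the majorant. *)
have p1 := h 1 ltr01.
exists (expR (- pi)); split; first exact: expR_gt0.
  apply: asum_le (asum_fiber ufib mfib (hsum_asum p1)) => -[a b].
  rewrite le_eqVlt; apply/orP; left; apply/eqP; congr nm.
  rewrite mulr_suml; apply: eq_big_seq => m; rewrite mfib => /eqP[<- <-] /=.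
  congr (_ * _); rewrite addnn -mul2n exprM rcX; congr (_ ^+ _).
  rewrite -expRM_natl -cexp_rc; congr cexp.
  rewrite rcM rcN rc_nat /itau twopiiE -/(rc 1) mul1r.
  have ii : ('i%C : C) * 'i%C = -1 by rewrite -expr2; exact: sqr_i.
  by rewrite -[RHS]mulrA -[X in _ = _ * X]mulrA ii; ring.
move=> u t [t0 _ _]; apply: eq_hsum (hsum_fiber ufib mfib (h t t0)) => -[a b].
rewrite mulr_suml; apply: eq_big_seq => m; rewrite mfib => /eqP[<- <-] /=.
by rewrite /mon /= -(wvar_mul L u) exprMn.
Qed.

Lemma hsum_conj (I : eqType) (f : I -> C) s : hsum f s ->
  hsum (fun i => (f i)^*%C) (s^*%C).
Proof.
have nmc (x : C) : nm x^*%C = nm x by case: x => a b; rewrite /nm !normc_def /= sqrrN.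
move=> [af h]; split; first by apply: asum_le af => i; rewrite nmc.
move=> e /h[A hA]; exists A => B uB sAB.
by rewrite -rmorph_sum -rmorphB nmc; exact: hA.
Qed.

Lemma realP (x : C) : x^*%C = x -> x = rc (complex.Re x).
Proof.
case: x => a b [/eqP]; rewrite -subr_eq0 -opprD oppr_eq0 -mulr2n mulrn_eq0 /= => /eqP ->.
by [].
Qed.

(** Near the origin the values lie within c of c > 0, and real values within c of c are positive. *)
Lemma near0_pos (f : C -> C) (c : R) : 0 < c -> expandable (fun _ tau => f tau) (rc c) ->
  (forall t, 0 < t -> (f (itau t))^*%C = f (itau t)) -> near0 (fun _ t => 0 < f (itau t)).
Proof.
move=> c0 ef fr; have := expandable_near ef c0.
apply: near0_imp => u t t0; rewrite (realP (fr t t0)) -rcB nm_rc -rc0 rc_lt.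
by rewrite ltr_norml; lra.
Qed.

Lemma half_rc m : m%:~R + 2^-1 = rc (m%:~R + 2^-1) :> C.
Proof. by rewrite rcD rc_int rcV rc_nat. Qed.

Lemma theta_term_real (x t : R) m : theta_term (rc x) (itau t) m =
  cexp (rc (- pi * t * (m%:~R + 2^-1) ^+ 2) + rc (2 * pi * (m%:~R + 2^-1) * (x + 2^-1)) * 'i%C).
Proof.
rewrite theta_termE /gauss; congr cexp.
by rewrite /twopii /rc; field.
Qed.

Lemma conj_rc (x : R) : (rc x)^*%C = rc x.
Proof. by apply/eqP; rewrite eq_complex /= oppr0 !eqxx. Qed.

Lemma conjcM (x y : C) : (x * y)^*%C = x^*%C * y^*%C.
Proof. exact: rmorphM. Qed.

Lemma conj_cexp_real (a b : R) :
  (cexp (rc a + rc b * 'i%C))^*%C = cexp (rc a - rc b * 'i%C) :> C.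
Proof.
rewrite conj_cexp; congr cexp.
by apply/eqP; rewrite eq_complex /=; apply/andP; split; apply/eqP; ring.
Qed.

Lemma conj_theta_term (x t : R) m :
  (theta_term (rc x) (itau t) m)^*%C = theta_term (rc x) (itau t) (- 1 - m).
Proof.
rewrite !theta_term_real conj_cexp_real; congr cexp.
rewrite -!mulNr -rcN rmorphB rmorphN /=.
by congr (rc _ + rc _ * _); field.
Qed.

Lemma bij_half : bijective (fun m : int => - 1 - m).
Proof. by exists (fun m : int => - 1 - m) => m; ring. Qed.

(** Complex conjugation exchanges the terms of index m and -1 - m. *)
Lemma conj_theta (x t : R) : 0 < t ->
  (theta (rc x) (itau t))^*%C = theta (rc x) (itau t).
Proof.
move=> t0; apply: oppr_inj; rewrite -rmorphN.
apply: (hsum_unique (hsum_conj (theta_hsum (rc x) t0))).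
apply: eq_hsum (hsum_bij bij_half (theta_hsum (rc x) t0)) => m.
by rewrite conj_theta_term.
Qed.

Definition dtheta (tau : C) : C := derive1 (fun v : C => theta v tau : C^o) 0.

(** [theta_derive] needs the differentiated series to be summable; |h| <= e^h + e^(-h) dominates it
    by two Gaussian series. *)
Lemma dtheta_hsum t : 0 < t ->
  hsum (fun m : int => twopii R * (m%:~R + 2^-1) * theta_term 0 (itau t) m)
    (- dtheta (itau t)).
Proof.
move=> t0; have a0 : 0 < pi * t by rewrite mulr_gt0// pi_gt0.
suff /asum_hsum[s hs] : asum (fun m : int => twopii R * (m%:~R + 2^-1) * theta_term 0 (itau t) m).
  by rewrite /dtheta (theta_derive (c := - s) t0) ?opprK.
pose k : C := twopii R; have A1 := asumD (asumZ k (asum_gauss 2^-1 (rc 1) a0)) (asumZ k (asum_gauss 2^-1 (rc (-1)) a0)).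
apply: asum_le A1 => m; rewrite -rc0 theta_term_real half_rc.
set h : R := m%:~R + 2^-1; set b : C := _ * 'i%C.
have zr (c : R) : gauss (pi * t) 2^-1 (rc c) m = rc (expR (- pi * t * h ^+ 2) * expR (c * h)).
  by rewrite /gauss rcV rc_nat half_rc -/h -rcX -rcN -!rcM -rcD cexp_rc -mulNr expRD.
rewrite !zr -mulrDr -rcD -mulrDr nmM (nmM _ (rc _)) (nmM (twopii R)) -mulrA.
rewrite ler_wpM2l ?nm_ge0// !nm_rc cexpD nmM cexp_rc nm_rc nm_cexp Re_rcM /= mulr0 expR0 mulr1.
rewrite normrM mulrC ler_wpM2l// mul1r mulN1r.
rewrite [X in _ <= X]ger0_norm ?addr_ge0 ?expR_ge0//.
have e1 := expR_ge1Dxn 0; rewrite /= in e1.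
have := expR_ge0 h; have := expR_ge0 (- h).
case: (ger0P h) => h0.
  by have := e1 R h h0; rewrite expr1 divr1; lra.
by have := e1 R (- h) ltac:(lra); rewrite expr1 divr1; lra.
Qed.

Lemma conj_dtheta t : 0 < t -> (dtheta (itau t))^*%C = dtheta (itau t).
Proof.
move=> t0; apply: oppr_inj; rewrite -rmorphN.
apply: (hsum_unique (hsum_conj (dtheta_hsum t0))).
apply: eq_hsum (hsum_bij bij_half (dtheta_hsum t0)) => m.
have e := conj_theta_term 0 t m; rewrite rc0 in e.
rewrite [RHS]conjcM e; congr (_ * _).
rewrite !half_rc /twopii -!/(rc _).
by apply/eqP; rewrite eq_complex /= rmorphB rmorphN /=; apply/andP; split; apply/eqP; field.
Qed.

(** The factor p^(1/8) common to theta at a constant argument and to its derivative at 0; the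
    quotients are series in p with triangular exponents. *)
Definition nome8 (tau : C) : C := cexp (twopii R * tau / 8).

Lemma nome8E t : nome8 (itau t) = rc (expR (- (pi * t / 4))).
Proof.
rewrite -cexp_rc; congr cexp; rewrite twopiiE /itau -/(rc t) rcN !rcM rcV rc_nat.
have ii : ('i%C : C) * 'i%C = -1 by rewrite -expr2; exact: sqr_i.
transitivity (rc pi * rc t * ('i%C * 'i%C) / 4); last by rewrite ii; ring.
by move: (rc pi) (rc t) 'i%C => a b j; field.
Qed.

Lemma theta_term_nome (x : C) t m : theta_term x (itau t) m =
  nome8 (itau t) * (cexp (twopii R * (m%:~R + 2^-1) * (x + 2^-1)) * cexp (twopii R * itau t) ^+ tri_num m).
Proof.
rewrite /theta_term -cexpMn -!cexpD; congr cexp; rewrite -/(rc pi).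
have e1 : (tri_num m)%:R * 2 = m%:~R * (m%:~R + 1) :> C.
  by rewrite -[2]/((2 : int)%:~R : C) -[(tri_num m)%:R]/((tri_num m)%:Z%:~R : C) -intrM tri_numE intrM intrD.
have two : (2 : C) != 0 by rewrite pnatr_eq0.
have {}e1 : (tri_num m)%:R = m%:~R * (m%:~R + 1) / 2 :> C by rewrite -e1 mulfK.
by rewrite e1 twopiiE; move: (m%:~R) (rc pi) 'i%C (itau t) => *; field.
Qed.

Lemma nome8_neq0 tau : nome8 tau != 0.
Proof. exact: cexp_neq0. Qed.

Lemma cexp_rci (y : R) : cexp (rc y * 'i%C) = (cos y +i* sin y)%C :> C.
Proof.
have -> : rc y * 'i%C = (0 +i* y)%C :> C.
  by apply/eqP; rewrite eq_complex /=; apply/andP; split; apply/eqP; ring.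
by rewrite /cexp /= expR0 mul1r.
Qed.

(** The constant term is the trigonometric limit, contributed by the indices 0 and -1. It is
    positive for 0 < x < 1, which is the source of all positivity statements on brackets. *)
Lemma theta_diag (x : R) :
  expandable (fun _ tau => theta (rc x) tau / nome8 tau) (rc (2 * sin (pi * x))).
Proof.
pose g (m : int) : C := - cexp (twopii R * (m%:~R + 2^-1) * (rc x + 2^-1)).
suff <- : g 0 + g (-1) = rc (2 * sin (pi * x)).
  apply: diag_expandable => t t0; have := hsumZ (- (nome8 (itau t))^-1) (theta_hsum (rc x) t0).
  rewrite mulrNN [_ * theta _ _]mulrC; apply: eq_hsum => m.
  by rewrite theta_term_nome /g mulNr mulKf ?nome8_neq0// mulNr.
rewrite /g.
have -> : twopii R * (0%:~R + 2^-1) * (rc x + 2^-1) = rc (pi * x + pi / 2) * 'i%C.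
  by rewrite /twopii /rc; field.
have -> : twopii R * ((-1)%:~R + 2^-1) * (rc x + 2^-1) = rc (- (pi * x + pi / 2)) * 'i%C.
  by rewrite /twopii /rc; field.
rewrite !cexp_rci cosN sinN cosDpihalf.
by apply/eqP; rewrite eq_complex /=; apply/andP; split; apply/eqP; ring.
Qed.

Lemma dtheta_diag : expandable (fun _ tau => dtheta tau / nome8 tau) (rc (2 * pi)).
Proof.
pose g (m : int) : C := - (twopii R * (m%:~R + 2^-1) * cexp (twopii R * (m%:~R + 2^-1) * (0 + 2^-1))).
suff <- : g 0 + g (-1) = rc (2 * pi).
  apply: diag_expandable => t t0; have := hsumZ (- (nome8 (itau t))^-1) (dtheta_hsum t0).
  rewrite mulrNN [_ * dtheta _]mulrC; apply: eq_hsum => m.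
  by rewrite theta_term_nome /g; field; exact: nome8_neq0.
rewrite /g.
have -> : twopii R * (0%:~R + 2^-1) * (0 + 2^-1) = rc (pi / 2) * 'i%C.
  by rewrite /twopii /rc; field.
have -> : twopii R * ((-1)%:~R + 2^-1) * (0 + 2^-1) = rc (- (pi / 2)) * 'i%C.
  by rewrite /twopii /rc; field.
rewrite !cexp_rci cosN sinN cos_pihalf sin_pihalf.
have -> : (0 +i* 1)%C = 'i%C :> C by [].
have -> : (0 +i* -1)%C = - 'i%C :> C by apply/eqP; rewrite eq_complex /= oppr0 !eqxx.
have ii : ('i%C : C) * 'i%C = -1 by rewrite -expr2; exact: sqr_i.
rewrite twopiiE rcM rc_nat.
transitivity (- (2 * rc pi * ('i%C * 'i%C))); last by rewrite ii; ring.
by move: (rc pi) 'i%C => *; field.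
Qed.

Lemma near0_nome f c : 0 < c -> expandable (fun _ tau => f tau / nome8 tau) (rc c) ->
  (forall t, 0 < t -> (f (itau t))^*%C = f (itau t)) -> near0 (fun _ t => 0 < f (itau t)).
Proof.
move=> c0 ef fr; have := near0_pos c0 ef _.
have n0 t : 0 < nome8 (itau t) by rewrite nome8E -rc0 rc_lt expR_gt0.
have H t : 0 < t -> (f (itau t) / nome8 (itau t))^*%C = f (itau t) / nome8 (itau t).
  by move=> t0; rewrite conjcM fr// nome8E -rcV conj_rc.
by move=> /(_ H); apply: near0_imp => u t t0; rewrite pmulr_lgt0// invr_gt0.
Qed.

Lemma dtheta_pos : near0 (fun _ t => 0 < dtheta (itau t)).
Proof.
apply: (near0_nome _ dtheta_diag); first by rewrite mulr_gt0// pi_gt0.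
exact: conj_dtheta.
Qed.

Lemma bracE u tau : brac u tau = theta (u / rc L) tau / ((rc L)^-1 * dtheta tau).
Proof. by []. Qed.

Lemma rcL_gt0 : 0 < rc L.
Proof. by rewrite -rc0 rc_lt. Qed.

Lemma brac_pos (d : R) : 0 < d < L -> near0 (fun _ t => 0 < brac (rc d) (itau t)).
Proof.
move=> /andP[d0 dL].
have s0 : 0 < 2 * sin (pi * (d / L)).
  rewrite mulr_gt0// sin_gt0_pi// mulr_gt0 ?pi_gt0 ?divr_gt0//=.
  by rewrite gtr_pMr ?pi_gt0// ltr_pdivrMr// mul1r.
have := near0_and (near0_nome s0 (theta_diag _) (fun t => @conj_theta _ t)) dtheta_pos.
apply: near0_imp => u t t0 [a b]; rewrite bracE -rcV -rcM.
by rewrite divr_gt0// mulr_gt0// rcV invr_gt0 rcL_gt0.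
Qed.

Lemma brac_shift_neq0 : near0 (fun u t => forall c : R, brac (u + rc c) (itau t) != 0).
Proof.
have := near0_and theta_shift_neq0 dtheta_pos.
apply: near0_imp => u t t0 [h d0] c; rewrite bracE mulf_neq0// invr_eq0.
by rewrite mulf_neq0 ?gt_eqF// invr_gt0 rcL_gt0.
Qed.

Lemma divf_cancel (a b x : C) : x != 0 -> a / x / (b / x) = a / b.
Proof. by move=> x0; rewrite invf_div mulrA divfK. Qed.

Lemma brac_ratio_expandable (a b : R) : exists2 c : C, c != 0 &
  expandable (fun u tau => brac (u + rc a) tau / brac (u + rc b) tau) c.
Proof.
have [c c0 h] := theta_ratio_expandable a b; exists c => //.
apply: expandable_ext h; apply: near0_imp dtheta_pos => u t t0 d0; rewrite !bracE.
have k0 : (rc L)^-1 * dtheta (itau t) != 0.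
  by rewrite mulf_neq0 ?gt_eqF// invr_gt0 rcL_gt0.
by rewrite divf_cancel.
Qed.

Lemma brac_cst_expandable (d d' : R) : 0 < d < L -> 0 < d' < L -> exists2 c : R, 0 < c &
  expandable (fun _ tau => brac (rc d) tau / brac (rc d') tau) (rc c).
Proof.
have s0 (e : R) : 0 < e < L -> 0 < 2 * sin (pi * (e / L)).
  move=> /andP[e0 eL]; rewrite mulr_gt0// sin_gt0_pi// mulr_gt0 ?pi_gt0 ?divr_gt0//=.
  by rewrite gtr_pMr ?pi_gt0// ltr_pdivrMr// mul1r.
move=> /s0 h1 /s0 h2.
have n2 : rc (2 * sin (pi * (d' / L))) != 0 by rewrite rc_eq0 gt_eqF.
exists (2 * sin (pi * (d / L)) * (2 * sin (pi * (d' / L)))^-1); first by rewrite mulr_gt0// invr_gt0.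
rewrite rcM rcV; have := expandable_mul (theta_diag (d / L)) (expandable_inv (theta_diag (d' / L)) n2).
apply: expandable_ext; apply: near0_imp dtheta_pos => u t t0 d0; rewrite !bracE -!rcV -!rcM.
have k0 : rc L^-1 * dtheta (itau t) != 0.
  by rewrite mulf_neq0 ?gt_eqF// rcV invr_gt0 rcL_gt0.
have n0 := nome8_neq0 (itau t).
by rewrite !divf_cancel.
Qed.

Lemma brac_addL u t : 0 < t -> brac (u + rc L) (itau t) = - brac u (itau t).
Proof.
move=> t0; rewrite !bracE mulrDl divff ?(rcL0 L0)// thetaD1//.
by rewrite mulNr.
Qed.

Lemma bracN u t : 0 < t -> brac (- u) (itau t) = - brac u (itau t).
Proof. by move=> t0; rewrite !bracE (mulNr u) thetaN// mulNr. Qed.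

(** By [theta_mul], s(a + b) s(a - b) is proportional to the 2 x 2 minor of the vectors (P, Q) at a
    and b. The claim is the Pluecker relation between the six minors of four such vectors. *)
Lemma brac_three t : 0 < t -> forall x y z w,
  let s u := brac u (itau t) in
  s (x + y) * s (x - y) * (s (z + w) * s (z - w)) -
  s (x + z) * s (x - z) * (s (y + w) * s (y - w)) +
  s (x + w) * s (x - w) * (s (y + z) * s (y - z)) = 0.
Proof.
move=> t0 x y z w s; have [P [Q h]] := theta_mul t0.
pose k : C := ((rc L)^-1 * dtheta (itau t))^-1.
have e a b : s (a + b) * s (a - b) = k ^+ 2 * (P (a / rc L) * Q (b / rc L) - Q (a / rc L) * P (b / rc L)).
  by rewrite -h -mulrDl -mulrBl /s !bracE -/k; ring.
by rewrite !e; ring.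
Qed.

End ThetaExpansion.

(** * Consequences of the three-term relation *)

Section ThetaAlgebra.
Variables (K : numFieldType) (s : K -> K).
Hypothesis sN : forall x, s (- x) = - s x.
Hypothesis s3 : forall x y z w,
  s (x + y) * s (x - y) * (s (z + w) * s (z - w)) -
  s (x + z) * s (x - z) * (s (y + w) * s (y - w)) +
  s (x + w) * s (x - w) * (s (y + z) * s (y - z)) = 0.

Lemma sC x y : s (x - y) = - s (y - x).
Proof. by rewrite -opprB sN. Qed.

Lemma s0 : s 0 = 0.
Proof.
have := sN 0; rewrite oppr0 => /eqP; rewrite -subr_eq0 opprK -mulr2n mulrn_eq0 /=.
by move/eqP.
Qed.

(** The three-term relation at half sums and half differences of A, B, E and D = 2S - A - B - E. It
    has no halves left, so it can be applied to given products of four brackets. *)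
Lemma s4 S A B E : s A * s B * s E * s (2 * S - A - B - E) =
  s S * s (A + B - S) * s (A + E - S) * s (S - B - E) +
  s (S - A) * s (S - B) * s (S - E) * s (A + B + E - S).
Proof.
have two : (2 : K) != 0 by rewrite pnatr_eq0.
pose D := 2 * S - A - B - E.
have := s3 ((A + B) / 2) ((A - B) / 2) ((E + D) / 2) ((E - D) / 2).
have e (x y x' : K) : x + y = 2 * x' -> x / 2 + y / 2 = x' by move=> h; rewrite -mulrDl h; field.
rewrite (e _ _ A); last by ring.
rewrite -[- ((A - B) / 2)]mulNr (e _ _ B); last by ring.
rewrite (e _ _ E); last by ring.
rewrite -[- ((E - D) / 2)]mulNr (e _ _ D); last by ring.
rewrite (e _ _ S); last by rewrite /D; ring.
rewrite -[- ((E + D) / 2)]mulNr (e _ _ (A + B - S)); last by rewrite /D; ring.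
rewrite (e _ _ (A + E - S)); last by rewrite /D; ring.
rewrite (e _ _ (S - B - E)); last by rewrite /D; ring.
rewrite (e _ _ (A + B + E - S)); last by rewrite /D; ring.
rewrite (e _ _ (S - E)); last by rewrite /D; ring.
rewrite (e _ _ (S - B)); last by rewrite /D; ring.
rewrite (e _ _ (A - S)); last by rewrite /D; ring.
rewrite (sC A S) => h; apply/eqP; rewrite -subr_eq0 -h; apply/eqP; ring.
Qed.

(* The three-term relation for eight arguments prescribed up to linear
   relations. *)
Lemma s4e S A B E D p1 p2 p3 q1 q2 q3 q4 : A + B + E + D = 2 * S ->
  p1 = A + B - S -> p2 = A + E - S -> p3 = S - B - E ->
  q1 = S - A -> q2 = S - B -> q3 = S - E -> q4 = A + B + E - S ->
  s A * s B * s E * s D = s S * s p1 * s p2 * s p3 + s q1 * s q2 * s q3 * s q4.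
Proof.
move=> h -> -> -> -> -> -> ->; rewrite -s4 -h; congr (_ * s _); ring.
Qed.

(** A certificate: [ring] or [field] checks that the goal is [c] times a known relation. *)
Lemma by_rel (p q c x y : K) : p = q -> x - y = (p - q) * c -> x = y.
Proof. by move=> ->; rewrite subrr mul0r => /eqP; rewrite subr_eq0 => /eqP. Qed.

(** * Scalar identities between the weights *)

Section YangBaxter.
Variables (Q : K -> K).
Hypothesis QN : forall d, Q (- d) = Q d.
Hypothesis Q2 : forall d, s d != 0 -> Q d ^+ 2 = s (d + 1) * s (d - 1) / s d ^+ 2.

(** For d = a_i - a_j, [wst] is the weight that keeps the order of two distinct directions, and
    [wsw] times [Q d] the one that exchanges them. [Q] stays abstract, known by its square and its
    parity, so that the identities to be proved are rational. *)
Definition wst (d u : K) : K := s 1 * s (d - u) / (s (1 + u) * s d).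
Definition wsw (u : K) : K := s u / s (1 + u).

Lemma wstN d u : wst (- d) u = s 1 * s (d + u) / (s (1 + u) * s d).
Proof. by rewrite /wst -opprD !sN mulrN mulrN invrN mulrNN. Qed.

Lemma unitarity_diag d u : s d != 0 -> s (1 + u) != 0 -> s (1 - u) != 0 ->
  wst d u * wst d (- u) + wsw u * wsw (- u) * Q d ^+ 2 = 1.
Proof.
move=> d0 u0 u1; rewrite /wst /wsw Q2// opprK sN.
have h : s (1 + u) * s (1 - u) * s d * s d =
  s (d + 1) * s (1 - d) * s u * s u + s (d - u) * s (d + u) * s 1 * s 1.
  by apply: s4e; ring.
rewrite (sC 1 d) in h.
apply: (by_rel (esym h) (c := (s (1 + u) * s (1 - u) * s d * s d)^-1)).
by field; rewrite d0 u0 u1.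
Qed.

Lemma unitarity_off d u : s d != 0 -> s (1 + u) != 0 -> s (1 - u) != 0 ->
  wst d u * wsw (- u) + wsw u * wst (- d) (- u) = 0.
Proof.
move=> d0 u0 u1; rewrite wstN /wst /wsw sN.
by field; rewrite d0 u0 u1.
Qed.

Section Identities.
Variables a b : K.
Hypotheses (a0 : s (1 + a) != 0) (b0 : s (1 + b) != 0) (ab0 : s (1 + (a + b)) != 0).

(** Replacing the squares of [Q] by brackets leaves a combination of two three-term relations: [h1]
    involves the spectral parameters, while [h2] treats the difference of the two squares. *)
Lemma ybe_distinct_diag x y : s x != 0 -> s y != 0 -> s (x + y) != 0 ->
  wst x a * wst y (a + b) * wst x b + wsw a * wsw b * wst (x + y) (a + b) * Q x ^+ 2 =
  wst y b * wst x (a + b) * wst y a + wsw b * wsw a * wst (x + y) (a + b) * Q y ^+ 2.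
Proof.
move=> x0 y0 xy0; rewrite /wst /wsw !Q2//.
have h1 : s (x - a) * s (y - (a + b)) * s (x - b) * s y =
  s (x + y - (a + b)) * s (- a) * s (x - y) * s b +
  s (y - b) * s x * s (y - a) * s (x - (a + b)).
  by apply: s4e; ring.
have h2 : s (x + 1) * s (x - 1) * s y * s y =
  s (x + y) * s (x - y) * s 1 * s 1 + s (y - 1) * s (y + 1) * s x * s x.
  by apply: s4e; ring.
rewrite sN in h1.
pose k := (s (1 + a) * s (1 + b) * s (1 + (a + b)))^-1.
have k1 : s 1 ^+ 3 * (s (x - a) * s (y - (a + b)) * s (x - b) * s y) * k / (s x ^+ 2 * s y ^+ 2) =
  s 1 ^+ 3 * (s (x + y - (a + b)) * - s a * s (x - y) * s b +
  s (y - b) * s x * s (y - a) * s (x - (a + b))) * k / (s x ^+ 2 * s y ^+ 2) by rewrite h1.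
have k2 : s a * s b * s (x + y - (a + b)) * s 1 * (s (x + 1) * s (x - 1) * s y * s y) * k / (s x ^+ 2 * s y ^+ 2 * s (x + y)) =
  s a * s b * s (x + y - (a + b)) * s 1 * (s (x + y) * s (x - y) * s 1 * s 1 + s (y - 1) * s (y + 1) * s x * s x) * k / (s x ^+ 2 * s y ^+ 2 * s (x + y)) by rewrite h2.
apply: (by_rel (congr2 +%R k1 k2) (c := 1)); rewrite /k.
by field; rewrite ?x0 ?y0 ?xy0 ?a0 ?b0 ?ab0.
Qed.

Lemma ybe_distinct_off x y : s x != 0 -> s y != 0 -> s (x + y) != 0 ->
  wsw a * wst (x + y) (a + b) * wst (- x) b + wst x a * wst y (a + b) * wsw b =
  wst y b * wsw (a + b) * wst (x + y) a.
Proof.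
move=> x0 y0 xy0; rewrite wstN /wst /wsw.
have h : s (a + b) * s x * s (y - b) * s (x + y - a) =
  s (x + y) * s (a + b - y) * s (a - x) * s b +
  s (x + y - (a + b)) * s y * s (x + b) * s a.
  by apply: s4e; ring.
rewrite (sC _ y) (sC _ x) in h.
apply: (by_rel (esym h) (c := s 1 ^+ 2 / (s (1 + a) * s (1 + b) * s (1 + (a + b)) * (s x * s y * s (x + y))))).
by field; rewrite ?x0 ?y0 ?xy0 ?a0 ?b0 ?ab0.
Qed.

(* The factor [d - 1] may vanish: it cancels between Q d and the weight. *)
Lemma ybe_two_diag d : s d != 0 -> s (d - 1) != 0 ->
  wst d (a + b) = wst d b * wst d a + wsw b * wsw a * wst (d - 1) (a + b) * Q d ^+ 2.
Proof.
move=> d0 d10; rewrite /wst /wsw Q2//.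
have h : s (d - (a + b)) * s (1 + a) * s (1 + b) * s d =
  s (d + 1) * s (- b) * s (- a) * s (d - 1 - (a + b)) +
  s (1 + (a + b)) * s (d - a) * s (d - b) * s 1.
  by apply: s4e; ring.
rewrite !sN in h.
apply: (by_rel h (c := s 1 / (s (1 + a) * s (1 + b) * s (1 + (a + b)) * s d ^+ 2))).
by field; rewrite ?d0 ?d10 ?a0 ?b0 ?ab0.
Qed.

Lemma ybe_two_off d : s d != 0 -> s (d + 1) != 0 ->
  wsw (a + b) * wst d b = wst (d + 1) b * wsw a + wsw b * wst d (a + b) * wst (- (d + 1)) a.
Proof.
move=> d0 d10; rewrite wstN /wst /wsw.
have h : s (a + b) * s (d - b) * s (1 + a) * s (d + 1) =
  s (d + 1 + a) * s (- 1) * s (a + b - d) * s b +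
  s (d + 1 - b) * s (1 + (a + b)) * s d * s a.
  by apply: s4e; ring.
rewrite sN (sC _ d) in h.
apply: (by_rel h (c := s 1 / (s (1 + a) * s (1 + b) * s (1 + (a + b)) * s d * s (d + 1)))).
by field; rewrite ?d0 ?d10 ?a0 ?b0 ?ab0.
Qed.

(** The coefficient that keeps the word iji; again two three-term relations, [h1] free of spectral
    parameters and coming from the squares of [Q] at d and d + 1, [h2] from the products of three
    weights. *)
Lemma ybe_two_mid d : s d != 0 -> s (d + 1) != 0 ->
  wst d a * wst (- (d + 1)) (a + b) * wst d b + wsw a * wsw b * Q d ^+ 2 =
  wst (- (d + 1)) b * wst d (a + b) * wst (- (d + 1)) a + wsw b * wsw a * Q (d + 1) ^+ 2.
Proof.
move=> d0 d10; rewrite !wstN /wst /wsw !Q2// (addrK 1 d).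
have h1 : s (d + 1) * s (d + 1) * s (d + 1) * s (d - 1) =
  s (d + (d + 1)) * s 1 * s 1 * s (- 1) + s d * s d * s d * s (d + 1 + 1).
  by apply: s4e; ring.
have h2 : s (d - a) * s (d + 1 + (a + b)) * s (d - b) * s (d + 1) =
  s (d + (d + 1)) * s b * s (- (1 + (a + b))) * s (- a) +
  s (d + 1 + a) * s (d - (a + b)) * s (d + 1 + b) * s d.
  by apply: s4e; ring.
rewrite !sN in h1 h2.
pose k := (s (1 + a) * s (1 + b) * s (1 + (a + b)) * s d ^+ 2 * s (d + 1) ^+ 2)^-1.
pose m := s a * s b * s (1 + (a + b)).
have k1 : m * k * (s (d + 1) * s (d + 1) * s (d + 1) * s (d - 1)) =
  m * k * (s (d + (d + 1)) * s 1 * s 1 * - s 1 + s d * s d * s d * s (d + 1 + 1)) by rewrite h1.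
have k2 : s 1 ^+ 3 * k * (s (d - a) * s (d + 1 + (a + b)) * s (d - b) * s (d + 1)) =
  s 1 ^+ 3 * k * (s (d + (d + 1)) * s b * - s (1 + (a + b)) * - s a +
  s (d + 1 + a) * s (d - (a + b)) * s (d + 1 + b) * s d) by rewrite h2.
apply: (by_rel (congr2 +%R k1 k2) (c := 1)); rewrite /k /m.
by field; rewrite ?d0 ?d10 ?a0 ?b0 ?ab0.
Qed.

End Identities.

(** * The dynamical Yang-Baxter equation on words of three directions *)

Section Directions.
Variables a b : K.
Hypotheses (a0 : s (1 + a) != 0) (b0 : s (1 + b) != 0) (ab0 : s (1 + (a + b)) != 0).
Variables (I : eqType) (D : I -> I -> K).
Hypothesis DN : forall i j, D j i = - D i j.
Hypothesis DD : forall i j k, D i k = D i j + D j k.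

(** The coordinate difference after a first step in direction e1: the dynamical shift seen by the
    second pair of letters. *)
Definition D3 (e1 e2 e3 : I) : K := D e2 e3 + (e1 == e2)%:R - (e1 == e3)%:R.

Definition wact (d u : K) (e f : I) (G : I -> I -> K) : K :=
  if e == f then G e f else wst d u * G e f + wsw u * Q d * G f e.

Definition R12 u (F : I -> I -> I -> K) e1 e2 e3 : K :=
  wact (D e1 e2) u e1 e2 (fun x y => F x y e3).
Definition R23 u (F : I -> I -> I -> K) e1 e2 e3 : K :=
  wact (D3 e1 e2 e3) u e2 e3 (fun x y => F e1 x y).

Lemma R12_eq u F i k : R12 u F i i k = F i i k.
Proof. by rewrite /R12 /wact eqxx. Qed.
Lemma R23_eq u F i k : R23 u F k i i = F k i i.
Proof. by rewrite /R23 /wact eqxx. Qed.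
Lemma R12_neq u F i j k : i != j ->
  R12 u F i j k = wst (D i j) u * F i j k + wsw u * Q (D i j) * F j i k.
Proof. by move=> ij; rewrite /R12 /wact (negbTE ij). Qed.
Lemma R23_neq u F i j k : i != j ->
  R23 u F k i j = wst (D3 k i j) u * F k i j + wsw u * Q (D3 k i j) * F k j i.
Proof. by move=> ij; rewrite /R23 /wact (negbTE ij). Qed.

Lemma D3_iij i j : i != j -> D3 i i j = D i j + 1.
Proof. by move=> ij; rewrite /D3 eqxx (negbTE ij) subr0. Qed.
Lemma D3_iji i j : i != j -> D3 i j i = - (D i j + 1).
Proof. by move=> ij; rewrite /D3 eqxx (negbTE ij) addr0 DN opprD. Qed.
Lemma D3_ijk i j k : i != j -> i != k -> D3 i j k = D j k.
Proof. by move=> ij ik; rewrite /D3 (negbTE ij) (negbTE ik) addr0 subr0. Qed.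

(** One case for each pattern of equal letters (iii, iij, jii, iji, ijk); in each, the coefficients
    of [F] at the permuted words are compared. Nonvanishing at D i j + 1 is asked only when i is
    repeated, since only then does a path visit such a difference. *)
Lemma ybe_fun F e1 e2 e3 :
  (forall i j, i != j -> i \in [:: e1; e2; e3] -> j \in [:: e1; e2; e3] -> s (D i j) != 0) ->
  (forall i j, i != j -> (count_mem i [:: e1; e2; e3] == 2)%N -> j \in [:: e1; e2; e3] ->
    s (D i j + 1) != 0) ->
  R23 b (R12 (a + b) (R23 a F)) e1 e2 e3 = R12 a (R23 (a + b) (R12 b F)) e1 e2 e3.
Proof.
move=> h1 h2; have bac : s (1 + (b + a)) != 0 by rewrite (addrC b).
have [e12|e12] := eqVneq e1 e2; have [e23|e23] := eqVneq e2 e3.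
- by subst e1 e2; rewrite !(R12_eq, R23_eq).
- subst e1; move: e2 e3 h1 h2 e23 => i j h1 h2 ij; have ji : j != i by rewrite eq_sym.
  have d0 : s (D i j) != 0 by apply: h1; rewrite ?inE ?eqxx ?orbT.
  have d1 : s (D i j + 1) != 0 by apply: h2; rewrite ?inE /= ?eqxx ?orbT// (negbTE ji).
  rewrite !(R12_eq, R23_eq, R12_neq _ _ _ ij, R12_neq _ _ _ ji, R23_neq _ _ _ ij, R23_neq _ _ _ ji).
  rewrite !(D3_iij ij, D3_iji ij) !QN; move: (D i j) d0 d1 => d d0 d1.
  have d1' : s (d + 1 - 1) != 0 by rewrite addrK.
  have k1 := ybe_two_diag a0 b0 ab0 d1 d1'; rewrite addrK in k1.
  have k2 := ybe_two_off a0 b0 ab0 d0 d1.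
  apply: (by_rel (congr2 +%R (congr1 (fun x => x * F i i j) (esym k1))
    (congr1 (fun x => x * (Q (d + 1) * F i j i)) (esym k2))) (c := 1)).
  by ring.
- subst e3; move: e1 e2 h1 h2 e12 => j i h1 h2 ji; have ij : i != j by rewrite eq_sym.
  have d0 : s (D i j) != 0 by apply: h1; rewrite ?inE ?eqxx ?orbT.
  have d1 : s (D i j + 1) != 0 by apply: h2; rewrite ?inE /= ?eqxx ?orbT// (negbTE ji).
  rewrite !(R12_eq, R23_eq, R12_neq _ _ _ ij, R12_neq _ _ _ ji, R23_neq _ _ _ ij, R23_neq _ _ _ ji).
  rewrite !(D3_iij ij, D3_iji ij) (DN i j) !QN; move: (D i j) d0 d1 => d d0 d1.
  have n0 : s (- d) != 0 by rewrite sN oppr_eq0.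
  have n1 : s (- d - 1) != 0 by rewrite -opprD sN oppr_eq0.
  have n2 : s (- (d + 1) + 1) != 0 by rewrite opprD addrNK.
  have n3 : s (- (d + 1)) != 0 by rewrite sN oppr_eq0.
  have k1 := ybe_two_diag a0 b0 ab0 n0 n1; rewrite QN -(opprD d 1) in k1.
  have k2 := ybe_two_off b0 a0 bac n3 n2.
  rewrite (_ : - (d + 1) + 1 = - d) ?opprK ?(addrC b a) in k2; last by ring.
  apply: (by_rel (congr2 +%R (congr1 (fun x => x * F j i i) k1)
    (congr1 (fun x => x * (Q d * F i j i)) k2)) (c := 1)).
  by ring.
- have [e13|e13] := eqVneq e1 e3.
    subst e3; move: e1 e2 h1 h2 e12 {e23} => i j h1 h2 ij; have ji : j != i by rewrite eq_sym.
    have d0 : s (D i j) != 0 by apply: h1; rewrite ?inE ?eqxx ?orbT.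
    have d1 : s (D i j + 1) != 0 by apply: h2; rewrite ?inE /= ?eqxx ?orbT// (negbTE ji).
    rewrite !(R12_eq, R23_eq, R12_neq _ _ _ ij, R12_neq _ _ _ ji, R23_neq _ _ _ ij, R23_neq _ _ _ ji).
    rewrite !(D3_iij ij, D3_iji ij) (DN i j) !QN; move: (D i j) d0 d1 => d d0 d1.
    have n2 : s (- (d + 1) + 1) != 0 by rewrite opprD addrNK sN oppr_eq0.
    have n3 : s (- (d + 1)) != 0 by rewrite sN oppr_eq0.
    have k1 := ybe_two_off b0 a0 bac d0 d1; rewrite (addrC b a) in k1.
    have k2 := ybe_two_mid a0 b0 ab0 d0 d1.
    have k3 := ybe_two_off a0 b0 ab0 n3 n2.
    rewrite (_ : - (d + 1) + 1 = - d) ?opprK in k3; last by ring.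
    apply: (by_rel (congr2 +%R (congr2 +%R (congr1 (fun x => x * (Q (d + 1) * F i i j)) (esym k1))
      (congr1 (fun x => x * F i j i) (esym k2)))
      (congr1 (fun x => x * (Q d * F j i i)) k3)) (c := 1)).
    by ring.
  move: e1 e2 e3 h1 {h2} e12 e23 e13 => i j k h1 ij jk ik.
  have [ji kj ki] : [/\ j != i, k != j & k != i] by split; rewrite eq_sym.
  have x0 : s (D i j) != 0 by apply: h1; rewrite ?inE ?eqxx ?orbT.
  have y0 : s (D j k) != 0 by apply: h1; rewrite ?inE ?eqxx ?orbT.
  have z0 : s (D i j + D j k) != 0 by rewrite -DD; apply: h1; rewrite ?inE ?eqxx ?orbT.
  rewrite !(R12_neq _ _ _ ij, R12_neq _ _ _ ji, R23_neq _ _ _ ij, R23_neq _ _ _ ji,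
    R12_neq _ _ _ ik, R12_neq _ _ _ ki, R23_neq _ _ _ ik, R23_neq _ _ _ ki,
    R12_neq _ _ _ jk, R12_neq _ _ _ kj, R23_neq _ _ _ jk, R23_neq _ _ _ kj).
  rewrite !D3_ijk// (DN i j) (DN j k) (DD i j k) ?(DN i k) ?(DD i j k) !QN.
  move: (D i j) (D j k) x0 y0 z0 => x y x0 y0 z0.
  have zc : s (y + x) != 0 by rewrite (addrC y).
  have k1 := ybe_distinct_diag a0 b0 ab0 x0 y0 z0.
  have k2 := ybe_distinct_off a0 b0 ab0 x0 y0 z0.
  have k3 := ybe_distinct_off b0 a0 bac y0 x0 zc; rewrite (addrC y x) (addrC b a) in k3.
  apply: (by_rel (congr2 +%R (congr2 +%R (congr1 (fun t => t * F i j k) (esym k1))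
      (congr1 (fun t => t * (Q x * F j i k)) (esym k2)))
      (congr1 (fun t => t * (Q y * F i k j)) k3)) (c := 1)).
  by ring.
Qed.
End Directions.

End YangBaxter.

(** * Vanishing sums of residues and the scalar form of crossing unitarity *)

Section PartialFractions.
Variables (re : K -> Prop) (u : K).
Hypothesis reB : forall x y, re x -> re y -> re (x - y).
Hypothesis reD : forall x y, re x -> re y -> re (x + y).
Hypothesis u_generic : forall c, re c -> s (u + c) != 0.

(** Up to the constant s'(0), the sum of the residues at [xs] of the product of s(z - y) divided by
    the product of s(z - x). *)
Definition pf (xs ys : seq K) : K :=
  \sum_(x <- xs) (\prod_(y <- ys) s (x - y)) / \prod_(x' <- xs | x' != x) s (x - x').

(** Theta functions of degree two with given sum of zeros form a two-dimensional space; this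
    interpolates s(x - y1) s(x - y2) in x from its values at a and b. *)
Lemma s_split a b y1 y2 x :
  s (a - b) * s (a + b - (y1 + y2)) * (s (x - y1) * s (x - y2)) =
  s (a - y1) * s (a - y2) * (s (x - b) * s (x - (y1 + y2 - b))) -
  s (b - y1) * s (b - y2) * (s (x - a) * s (x - (y1 + y2 - a))).
Proof.
have h : s (a - b) * s (a + b - (y1 + y2)) * s (x - y1) * s (x - y2) =
  s (x - (y1 + y2 - a)) * s (a - x) * s (y2 - b) * s (y1 - b) +
  s (x - (y1 + y2 - b)) * s (x - b) * s (a - y2) * s (a - y1).
  by apply: s4e; ring.
rewrite (sC a x) (sC y2) (sC y1) in h.
by apply: (by_rel h (c := 1)); ring.
Qed.

(** [s_split] trades one pole and one zero: at the points of [r] the two halves give the terms of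
    both shorter sums, while at a and at b one half vanishes. *)
Lemma pf_rec a b r y1 y2 ys : uniq [:: a, b & r] -> s (a - b) != 0 ->
  (forall x, x \in r -> s (x - a) != 0 /\ s (x - b) != 0) ->
  s (a - b) * s (a + b - (y1 + y2)) * pf [:: a, b & r] [:: y1, y2 & ys] =
  s (a - y1) * s (a - y2) * pf (a :: r) ((y1 + y2 - b) :: ys) -
  s (b - y1) * s (b - y2) * pf (b :: r) ((y1 + y2 - a) :: ys).
Proof.
rewrite /= !inE negb_or => /and3P[/andP[ab ar] br ur] ab0 h.
have ba0 : s (b - a) != 0 by rewrite sC oppr_eq0.
have den0 (x : K) (l : seq K) (c : K) : c != x ->
    \prod_(x' <- c :: l | x' != x) s (x - x') = s (x - c) * \prod_(x' <- l | x' != x) s (x - x').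
  by move=> cx; rewrite big_cons cx.
have den1 (x : K) (l : seq K) :
    \prod_(x' <- x :: l | x' != x) s (x - x') = \prod_(x' <- l | x' != x) s (x - x').
  by rewrite big_cons eqxx.
rewrite /pf !(big_cons _ _ _ _ xpredT) /= den1 den0 1?eq_sym//.
rewrite den0// !den1.
set Na := \prod_(y <- ys) s (a - y); set Nb := \prod_(y <- ys) s (b - y).
set Pa := \prod_(x' <- r | x' != a) _; set Pb := \prod_(x' <- r | x' != b) _.
have e : s (a - b) * s (a + b - (y1 + y2)) *
    \sum_(x <- r) \prod_(y <- [:: y1, y2 & ys]) s (x - y) / \prod_(x' <- [:: a, b & r] | x' != x) s (x - x') =
  s (a - y1) * s (a - y2) * (\sum_(x <- r) \prod_(y <- (y1 + y2 - b) :: ys) s (x - y) /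
    \prod_(x' <- a :: r | x' != x) s (x - x')) -
  s (b - y1) * s (b - y2) * (\sum_(x <- r) \prod_(y <- (y1 + y2 - a) :: ys) s (x - y) /
    \prod_(x' <- b :: r | x' != x) s (x - x')).
  rewrite !mulr_sumr -sumrB; apply: eq_big_seq => x xr.
  have ax : a != x by apply: contraNneq ar => ->.
  have bx : b != x by apply: contraNneq br => ->.
  have [xa0 xb0] := h x xr.
  rewrite !den0// !big_cons !(invfM (s (x - _))).
  set N := \prod_(y <- ys) _; set P := (\prod_(x' <- r | x' != x) _)^-1.
  have k := s_split a b y1 y2 x.
  apply: (by_rel k (c := N * P / (s (x - a) * s (x - b)))).
  by field; rewrite xa0 xb0.
rewrite mulrDr [in X in _ + X]mulrDr e.
have ka := s_split a b y1 y2 a; have kb := s_split a b y1 y2 b.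
rewrite subrr s0 mul0r mulr0 subr0 in ka; rewrite subrr s0 mul0r mulr0 sub0r in kb.
have ea : s (a - b) * s (a + b - (y1 + y2)) * (s (a - y1) * (s (a - y2) * Na) / (s (a - b) * Pa)) =
  s (a - y1) * s (a - y2) * (s (a - (y1 + y2 - b)) * Na / Pa).
  rewrite invfM; move: (Pa^-1) => P.
  by apply: (by_rel ka (c := Na * P / s (a - b))); field.
have eb : s (a - b) * s (a + b - (y1 + y2)) * (s (b - y1) * (s (b - y2) * Nb) / (s (b - a) * Pb)) =
  - (s (b - y1) * s (b - y2) * (s (b - (y1 + y2 - a)) * Nb / Pb)).
  rewrite invfM; move: (Pb^-1) => P.
  by apply: (by_rel kb (c := Nb * P / s (b - a))); field.
rewrite ea eb; ring.
Qed.

(** As many zeros as poles with equal sums describe an elliptic function, whose residues add up to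
    0. The proof replaces the residue theorem by induction with [pf_rec]; balance is preserved, and
    two poles can be checked directly. *)
Lemma pf_eq0 ys : (forall y, y \in ys -> re y) -> forall xs c1 c2, re c1 -> re c2 ->
  (forall x, x \in xs -> re x) -> uniq xs ->
  (forall x x', x \in xs -> x' \in xs -> x != x' -> s (x - x') != 0) ->
  size xs = (size ys).+2 ->
  \sum_(x <- xs) x = c1 + c2 + \sum_(y <- ys) y ->
  pf xs [:: c1 - u, c2 + u & ys] = 0.
Proof.
have pf_perm xs y1 y2 l : pf xs [:: y1, y2 & l] = pf xs [:: y2, y1 & l].
  by apply: eq_bigr => x _; rewrite !big_cons mulrCA.
elim: ys => [_|y ys IH rey] xs c1 c2 r1 r2 rx ux nx.
  case: xs rx ux nx => [|a [|b []]] //= rx; rewrite inE andbT => ab nx _.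
  rewrite !big_cons !big_nil !addr0 => e.
  have b0 : s (a - b) != 0 by apply: nx; rewrite ?inE ?eqxx ?orbT.
  have e2 : c2 + u = a + b - (c1 - u) by rewrite e; ring.
  have ba : b != a by rewrite eq_sym.
  rewrite e2 /pf !(big_cons, big_nil) !eqxx ab ba /= !mulr1 addr0.
  rewrite (_ : a - (a + b - (c1 - u)) = c1 - u - b); last by ring.
  rewrite (_ : b - (a + b - (c1 - u)) = c1 - u - a); last by ring.
  rewrite (sC _ b) (sC _ a) (sC b a); by field.
case: xs rx ux nx => [|a [|b xs]] //= rx ux nx [sz] e.
have [ra rb] : re a /\ re b by split; apply: rx; rewrite !inE eqxx ?orbT.
have ry : re y by apply: rey; rewrite inE eqxx.
have ab : a != b by move: ux; rewrite inE negb_or => /andP[/andP[]].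
have b0 : s (a - b) != 0 by apply: nx; rewrite ?inE ?eqxx ?orbT.
(* [pf_rec] is applied to the zeros c1 - u and y, so the factor to divide by is a bracket at u plus
   a real number. Both shorter sums again have one zero shifted by -u and one by +u. *)
have g0 : s (a + b - (c1 - u + y)) != 0.
  rewrite (_ : _ - _ = u + (a + b - (c1 + y))); last by ring.
  by apply: u_generic; apply: reB; apply: reD.
apply: (mulfI (mulf_neq0 b0 g0)); rewrite mulr0.
have -> : pf [:: a, b & xs] [:: c1 - u, c2 + u, y & ys] = pf [:: a, b & xs] [:: c1 - u, y, c2 + u & ys].
  by apply: eq_bigr => x _; rewrite !big_cons; congr (_ * _ / _); rewrite mulrCA.
have /and3P[axs bxs uxs] : [&& a \notin xs, b \notin xs & uniq xs].
  by move: ux; rewrite inE negb_or => /and3P[/andP[_ ->] -> ->].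
rewrite pf_rec//=; last first.
  move=> x xr; split; apply: nx; rewrite ?inE ?xr ?eqxx ?orbT//; [apply: contraNneq axs|apply: contraNneq bxs]; by move=> <-.
have sub c : c \in [:: a; b] -> {subset c :: xs <= [:: a, b & xs]}.
  move=> cab x; rewrite !inE => /orP[/eqP ->|->]; last by rewrite !orbT.
  by move: cab; rewrite !inE => /orP[->|->]; rewrite ?orbT.
have H c d : c \in [:: a; b] -> re d -> c + d = a + b -> uniq (c :: xs) ->
    pf (c :: xs) (c1 - u + y - d :: c2 + u :: ys) = 0.
  move=> cab rd cd uc; rewrite (_ : c1 - u + y - d = c1 + y - d - u); last by ring.
  apply: IH => //.
  - by move=> z zy; apply: rey; rewrite inE zy orbT.
  - by apply: reB => //; apply: reD.
  - by move=> x /(sub _ cab); exact: rx.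
  - by move=> x x' /(sub _ cab) xx /(sub _ cab) xx'; exact: nx.
  - by rewrite /= sz.
  - rewrite big_cons; move: e; rewrite !big_cons => e; apply: (addIr d).
    transitivity (a + (b + \sum_(j <- xs) j)); first by rewrite (addrA a) -cd; ring.
    by rewrite e; ring.
rewrite (H a b) ?(H b a) ?mulr0 ?subrr//= ?inE ?eqxx ?orbT ?uxs ?axs ?bxs//.
by rewrite addrC.
Qed.

Variables (n : nat) (lam : K).
Hypotheses (re1 : re 1) (re_lam : re lam) (lamE : 2 * lam = - n%:R) (s1 : s 1 != 0).

Section Crossing.
Variable c : 'I_n -> K.
Hypothesis rec : forall k, re (c k).
Hypothesis cneq : forall k l, k != l -> s (c k - c l) != 0.

(** For the coordinates c of a point a this is G_(a + eps_k) / G_a, the square of the gauge factor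
    [up]. *)
Definition gfac (k : 'I_n) : K := \prod_(l | l != k) (s (c k - c l + 1) / s (c k - c l)).

Let xs := [seq c k | k <- enum 'I_n].

Lemma c_inj : injective c.
Proof.
by move=> k l kl; apply/eqP/negPn/negP => /cneq; rewrite kl subrr s0 eqxx.
Qed.

Lemma uniq_xs : uniq xs.
Proof. by rewrite map_inj_uniq ?enum_uniq//; exact: c_inj. Qed.

Lemma sum_xs : \sum_(x <- xs) x = \sum_k c k.
Proof. by rewrite big_map big_enum. Qed.

Lemma prod_xs k (x : K) : \prod_(x' <- xs | x' != c k) s (x - x') = \prod_(l | l != k) s (x - c l).
Proof.
by rewrite big_map big_enum_cond; apply: eq_bigl => l; rewrite (inj_eq c_inj).
Qed.

Lemma prod_xsT (x : K) : \prod_(x' <- xs) s (x - x') = \prod_l s (x - c l).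
Proof. by rewrite big_map big_enum. Qed.

Lemma generic_plus : s (1 + (lam + u)) != 0.
Proof.
rewrite (_ : 1 + (lam + u) = u + (1 + lam)); last by ring.
exact/u_generic/reD.
Qed.

Lemma generic_minus : s (1 + (lam - u)) != 0.
Proof.
rewrite (_ : 1 + (lam - u) = - (u - (1 + lam))); last by ring.
rewrite sN oppr_eq0.
have r0 : re 0 by rewrite -(subrr 1); exact: reB.
rewrite (_ : u - _ = u + (0 - (1 + lam))); last by ring.
by apply: u_generic; apply: reB => //; exact: reD.
Qed.

Lemma prodE k (P : pred 'I_n) (F : 'I_n -> K) :
  \prod_(y <- [seq F l | l <- enum 'I_n & P l]) s (c k - y) = \prod_(l | P l) s (c k - F l).
Proof. by rewrite big_map big_filter big_enum_cond. Qed.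

Lemma gfacE k : gfac k * s 1 = (\prod_l s (c k - c l + 1)) / \prod_(l | l != k) s (c k - c l).
Proof.
rewrite /gfac big_split /= prodfV [in RHS](bigD1 k)//= subrr add0r mulrC.
by rewrite mulrA.
Qed.

Lemma mem_xs x : x \in xs -> exists k, x = c k.
Proof. by move=> /mapP[k _ ->]; exists k. Qed.

(** The poles are the c k, the zeros c i - 1 - lam - u, c j - 1 - lam + u and c l - 1 for the
    remaining l. Their sums agree exactly because 2 lam = -n. *)
Lemma crossing_off i j : i != j -> (forall k, s (c i - 1 - c k) != 0) ->
  (forall k, s (c j - 1 - c k) != 0) ->
  \sum_k gfac k * wst (c i - 1 - c k) (lam + u) * wst (c j - 1 - c k) (lam - u) = 0.
Proof.
move=> ij i0 j0.
pose P l := (l != i) && (l != j).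
pose ys := [seq c l - 1 | l <- enum 'I_n & P l].
have cnt (V : nmodType) (F : 'I_n -> V) : \sum_l F l = F i + (F j + \sum_(l | P l) F l).
  by rewrite (bigD1 i)//= (bigD1 j)//= eq_sym.
have cntM (F : 'I_n -> K) : \prod_l F l = F i * F j * \prod_(l | P l) F l.
  by rewrite (bigD1 i)//= (bigD1 j)//= 1?eq_sym// mulrA.
have sC1 m k : s (c k - c m + 1) = - s (c m - 1 - c k) by rewrite -sN; congr s; ring.
have sz : n = (size ys).+2.
  rewrite size_map size_filter -sum1_count big_enum_cond /=.
  have := sum_nat_const 'I_n 1; rewrite card_ord muln1 (bigD1 i)//= (bigD1 j) 1?eq_sym//= => /esym.
have nE : n%:R = 2 + \sum_(l | P l) 1 :> K.
  have := cnt K (fun=> 1); rewrite sumr_const card_ord => ->.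
  by rewrite addrA.
have H := @pf_eq0 ys _ xs (c i - 1 - lam) (c j - 1 - lam) _ _ _ uniq_xs.
have {}H : pf xs [:: c i - 1 - lam - u, c j - 1 - lam + u & ys] = 0.
  apply: H.
  - by move=> y /mapP[l _ ->]; exact: reB.
  - by do !apply: reB.
  - by do !apply: reB.
  - by move=> x /mem_xs[k ->].
  - by move=> x x' /mem_xs[k ->] /mem_xs[l ->]; rewrite (inj_eq c_inj) => /cneq.
  - by rewrite size_map size_enum_ord.
  - rewrite sum_xs cnt big_map big_filter big_enum_cond /= sumrB.
    have := lamE; rewrite nE => e.
    transitivity (c i + c j + \sum_(l | P l) c l - (2 * lam + (2 + \sum_(l | P l) 1))); last by ring.
    by rewrite e addNr subr0 addrA.
have gp := generic_plus; have gm := generic_minus.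
transitivity (s 1 / (s (1 + (lam + u)) * s (1 + (lam - u))) *
    pf xs [:: c i - 1 - lam - u, c j - 1 - lam + u & ys]); last by rewrite H mulr0.
rewrite /pf big_map big_enum mulr_sumr.
apply: eq_bigr => k _; rewrite prod_xs !big_cons prodE.
have -> : gfac k = s (c i - 1 - c k) * s (c j - 1 - c k) *
    (\prod_(l | P l) s (c k - (c l - 1))) / s 1 / \prod_(l | l != k) s (c k - c l).
  apply: (mulIf s1); rewrite gfacE cntM sC1 (sC1 j) mulrNN.
  rewrite (eq_bigr (fun l => s (c k - (c l - 1)))) => [|l _]; last by congr s; ring.
  by rewrite [RHS]mulrAC mulfVK.
rewrite /wst (sC _ (lam + u)) (sC _ (lam - u)).
rewrite (_ : lam + u - (c i - 1 - c k) = c k - (c i - 1 - lam - u)); last by ring.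
rewrite (_ : lam - u - (c j - 1 - c k) = c k - (c j - 1 - lam + u)); last by ring.
move: (\prod_(l | P l) _) (\prod_(l | l != k) _)^-1 (i0 k) (j0 k) => p q ik jk.
by field; rewrite s1 gp gm ik jk.
Qed.

(* Here the extra node c i - 1 contributes the right-hand side. *)
Lemma crossing_diag i : (forall k, s (c i - 1 - c k) != 0) ->
  \sum_k gfac k * (if k == i then 1 else wst (c i - 1 - c k) (lam + u) * wst (c i - 1 - c k) (lam - u)) =
  \prod_(l | l != i) (s (c i - c l) / s (c i - c l - 1)) * (wsw (lam + u) * wsw (lam - u)).
Proof.
move=> i0.
have gp := generic_plus; have gm := generic_minus.
(* At d = -1 the order-preserving weight equals 1, so the exceptional term k = i has the same shape
   as the others. *)
have wi v : s (1 + v) != 0 -> wst (c i - 1 - c i) v = 1.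
  move=> v0; rewrite /wst (_ : c i - 1 - c i = - 1); last by ring.
  by rewrite -opprD !sN; field; rewrite v0 s1.
rewrite (eq_bigr (fun k => gfac k * (wst (c i - 1 - c k) (lam + u) * wst (c i - 1 - c k) (lam - u)))); last first.
  by move=> k _; case: eqP => [->|//]; rewrite !wi// !mulr1.
pose ys := [seq c l - 1 | l <- enum 'I_n & l != i].
pose x0 := c i - 1; pose c1 := x0 - lam.
have x0c k : x0 != c k by apply: contraNneq (i0 k); rewrite -/x0 => ->; rewrite subrr s0.
have x0xs : x0 \notin xs by apply/negP => /mem_xs[k /eqP]; apply/negP; exact: x0c.
have sz : n = (size ys).+1.
  rewrite size_map size_filter -sum1_count big_enum_cond /=.
  have := sum_nat_const 'I_n 1; rewrite card_ord muln1 (bigD1 i)//= => /esym.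
have nE : n%:R = 1 + \sum_(l | l != i) 1 :> K.
  have := sumr_const 'I_n (1 : K); rewrite card_ord => <-.
  by rewrite (bigD1 i).
have rx0 : re x0 by exact: reB.
have rc1 : re c1 by exact: reB.
have H := @pf_eq0 ys _ (x0 :: xs) c1 c1 rc1 rc1 _ _ _ _ _.
have {}H : pf (x0 :: xs) [:: c1 - u, c1 + u & ys] = 0.
  apply: H.
  - by move=> y /mapP[l _ ->]; exact: reB.
  - by move=> x; rewrite inE => /orP[/eqP ->//|/mem_xs[k ->]].
  - by rewrite /= x0xs uniq_xs.
  - move=> x x'; rewrite !inE => /orP[/eqP ->|/mem_xs[k ->]] /orP[/eqP ->|/mem_xs[l ->]].
    + by rewrite eqxx.
    + by move=> _; exact: i0.
    + by move=> _; rewrite sC oppr_eq0; exact: i0.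
    + by rewrite (inj_eq c_inj) => /cneq.
  - by rewrite /= size_map size_enum_ord -sz.
  - rewrite big_cons sum_xs (bigD1 i)//= big_map big_filter big_enum_cond /= sumrB.
    have := lamE; rewrite nE => e.
    transitivity (c i + c i - 1 - (2 * lam + (1 + \sum_(l | l != i) 1)) + \sum_(l | l != i) c l); last by rewrite /c1 /x0; ring.
    by rewrite e addNr subr0 /x0; ring.
pose C0 := s 1 / (s (1 + (lam + u)) * s (1 + (lam - u))).
have := congr1 (fun x => C0 * x) H; rewrite /= mulr0 /pf big_cons mulrDr => /eqP.
rewrite addrC addr_eq0 => /eqP e.
transitivity (C0 * \sum_(x <- xs) (\prod_(y <- [:: c1 - u, c1 + u & ys]) s (x - y)) /
    \prod_(x' <- x0 :: xs | x' != x) s (x - x')).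
  rewrite big_map big_enum mulr_sumr; apply: eq_bigr => k _.
  rewrite !big_cons prodE x0c prod_xs.
  have -> : gfac k = - s (c i - 1 - c k) *
      (\prod_(l | l != i) s (c k - (c l - 1))) / s 1 / \prod_(l | l != k) s (c k - c l).
    apply: (mulIf s1); rewrite gfacE (bigD1 i)//=.
    rewrite (_ : c k - c i + 1 = - (c i - 1 - c k)) ?sN; last by ring.
    rewrite (eq_bigr (fun l => s (c k - (c l - 1)))) => [|l _]; last by congr s; ring.
    by rewrite [RHS]mulrAC mulfVK.
  rewrite /wst (sC _ (lam + u)) (sC _ (lam - u)) (sC (c k) x0) -/x0.
  rewrite (_ : lam + u - (x0 - c k) = c k - (c1 - u)); last by rewrite /c1; ring.
  rewrite (_ : lam - u - (x0 - c k) = c k - (c1 + u)); last by rewrite /c1; ring.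
  rewrite (invfM (- s (x0 - c k))).
  move: (\prod_(l | l != i) _) (\prod_(l | l != k) _)^-1 (i0 k) => p q ik.
  by rewrite /C0; field; rewrite s1 gp gm ik.
rewrite e /wsw !big_cons eqxx -[\prod_(j <- xs | j != x0) _]big_filter.
have -> : [seq j <- xs | j != x0] = xs.
  by apply/all_filterP/allP => x /mem_xs[k ->]; rewrite eq_sym.
rewrite prod_xsT (bigD1 i)//= big_map big_filter big_enum_cond /=.
rewrite big_split /= prodfV.
have -> : \prod_(l | l != i) s (x0 - (c l - 1)) = \prod_(l | l != i) s (c i - c l).
  by apply: eq_bigr => l _; rewrite /x0; congr s; ring.
have -> : \prod_(l | l != i) s (x0 - c l) = \prod_(l | l != i) s (c i - c l - 1).
  by apply: eq_bigr => l _; rewrite /x0; congr s; ring.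
rewrite (_ : x0 - (c1 - u) = lam + u); last by rewrite /c1; ring.
rewrite (_ : x0 - (c1 + u) = lam - u); last by rewrite /c1; ring.
rewrite (_ : x0 - c i = - 1); last by rewrite /x0; ring.
rewrite sN (invfM (- s 1)).
move: (\prod_(l | l != i) s (c i - c l)) (\prod_(l | l != i) _)^-1 => p q.
by rewrite /C0; field; rewrite s1 gp gm.
Qed.

End Crossing.
End PartialFractions.
End ThetaAlgebra.

(** * Weights on labels *)

Section TripleSums.
Variables (K : comNzRingType) (T : finType) (v p q : T).

Definition delta3 (v' p' q' : T) : K := ((v' == v) && (p' == p) && (q' == q))%:R.

Lemma sum_delta3 (f : T -> T -> T -> K) :
  \sum_v' \sum_p' \sum_q' f v' p' q' * delta3 v' p' q' = f v p q.
Proof.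
rewrite (bigD1 v)//= [X in _ + X]big1 ?addr0; last first.
  move=> v' ne; rewrite big1// => p' _; rewrite big1// => q' _.
  by rewrite /delta3 (negbTE ne) mulr0.
rewrite (bigD1 p)//= [X in _ + X]big1 ?addr0; last first.
  by move=> p' ne; rewrite big1// => q' _; rewrite /delta3 (negbTE ne) andbF mulr0.
rewrite (bigD1 q)//= [X in _ + X]big1 ?addr0 /delta3 ?eqxx ?mulr1//.
by move=> q' ne; rewrite (negbTE ne) andbF mulr0.
Qed.

(** Writes a matrix element as three nested actions on a delta function, the form in which the
    weights can be evaluated one at a time. *)
Lemma triple_sum_l (A : T -> T -> T -> T -> K) (B : T -> T -> T -> K) (E : T -> T -> K) :
  \sum_k \sum_l \sum_y A k l p q * B y v k * E y l =
  \sum_y \sum_l E y l * (\sum_v' \sum_k B y v' k *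
    (\sum_p' \sum_q' A k l p' q' * delta3 v' p' q')).
Proof.
under eq_bigr do rewrite exchange_big.
rewrite exchange_big; apply: eq_bigr => y _; rewrite exchange_big; apply: eq_bigr => l _.
transitivity (\sum_k E y l * (B y v k * A k l p q)).
  by apply: eq_bigr => k _; rewrite mulrC [A _ _ _ _ * _]mulrC.
rewrite -mulr_sumr; congr (_ * _); rewrite exchange_big; apply: eq_bigr => k _.
rewrite -(sum_delta3 (fun v' p' q' => B y v' k * A k l p' q')); apply: eq_bigr => v' _.
rewrite mulr_sumr; apply: eq_bigr => p' _; rewrite mulr_sumr; apply: eq_bigr => q' _.
by rewrite mulrA.
Qed.

Lemma triple_sum_r (A : T -> T -> T -> T -> K) (B : T -> T -> T -> K) (E : T -> T -> K) :
  \sum_k \sum_l \sum_y A k y v p * B l y q * E k l =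
  \sum_k \sum_l E k l * (\sum_y \sum_q' B l y q' *
    (\sum_v' \sum_p' A k y v' p' * delta3 v' p' q')).
Proof.
apply: eq_bigr => k _; apply: eq_bigr => l _.
transitivity (\sum_y E k l * (B l y q * A k y v p)).
  by apply: eq_bigr => y _; rewrite mulrC [A _ _ _ _ * _]mulrC.
rewrite -mulr_sumr; congr (_ * _); apply: eq_bigr => y _.
rewrite -(sum_delta3 (fun v' p' q' => B l y q' * A k y v' p')).
transitivity (\sum_v' \sum_q' \sum_p' B l y q' * A k y v' p' * delta3 v' p' q').
  by apply: eq_bigr => v' _; rewrite exchange_big.
rewrite exchange_big; apply: eq_bigr => q' _; rewrite mulr_sumr; apply: eq_bigr => v' _.
rewrite mulr_sumr; apply: eq_bigr => p' _.
by rewrite mulrA.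
Qed.

End TripleSums.

(** * From words of directions to paths of labels: Yang-Baxter and unitarity *)

Section Paths.
Variables (K : numFieldType) (s Q : K -> K).
Hypothesis sN : forall x, s (- x) = - s x.
Hypothesis s3 : forall x y z w,
  s (x + y) * s (x - y) * (s (z + w) * s (z - w)) -
  s (x + z) * s (x - z) * (s (y + w) * s (y - w)) +
  s (x + w) * s (x - w) * (s (y + z) * s (y - z)) = 0.
Hypothesis QN : forall d, Q (- d) = Q d.
Hypothesis Q2 : forall d, s d != 0 -> Q d ^+ 2 = s (d + 1) * s (d - 1) / s d ^+ 2.
Variables (T : finType) (O I : eqType) (src tgt : T -> O) (dir : T -> I).
Hypothesis label_eq : forall b c, src b = src c -> dir b = dir c -> b = c.
Variable D : O -> I -> I -> K.
Hypothesis DN : forall o i j, D o j i = - D o i j.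
Hypothesis DD : forall o i j k, D o i k = D o i j + D o j k.
Hypothesis Dtgt : forall b i j, D (tgt b) i j = D (src b) i j + (dir b == i)%:R - (dir b == j)%:R.
Hypothesis D0 : forall o i j, i != j -> s (D o i j) != 0.
Variable W : K -> T -> T -> T -> T -> K.
Hypothesis Wsupp : forall b c k l u, W u b c k l != 0 ->
  [/\ src c = tgt b, src k = src b, src l = tgt k & tgt l = tgt c].
Hypothesis Wact : forall (b c : T) u (G : T -> T -> K) (Ge : I -> I -> K),
  src c = tgt b ->
  (forall k l, src k = src b -> src l = tgt k -> tgt l = tgt c -> G k l = Ge (dir k) (dir l)) ->
  \sum_k \sum_l W u b c k l * G k l = wact s Q (D (src b) (dir b) (dir c)) u (dir b) (dir c) Ge.

(** [Wact] turns each sum over labels into the operator on words, provided the function summed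
    depends on directions alone along composable labels; this property is passed from the innermost
    sum outwards. *)
Lemma yang_baxter (i j x v p q : T) (a b : K) :
  s (1 + a) != 0 -> s (1 + b) != 0 -> s (1 + (a + b)) != 0 ->
  \sum_k \sum_l \sum_y W a k l p q * W (a + b) i y v k * W b j x y l =
  \sum_k \sum_l \sum_y W b k y v p * W (a + b) l x y q * W a i j k l.
Proof.
move=> a0 b0 ab0.
pose G := @delta3 K T v p q.
refine (etrans (triple_sum_l v p q (W a) (W (a + b) i) (W b j x)) _).
refine (etrans _ (esym (triple_sum_r v p q (W b) ((W (a + b))^~ x) (W a i j)))).
rewrite -/G; symmetry.
(* If i, j, x do not form a path, the supports of the weights annihilate both sides. *)
have [/andP[/eqP ji /eqP xj]|nc] := boolP ((src j == tgt i) && (src x == tgt j)); last first.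
  rewrite big1 => [|k _]; last first.
    rewrite big1// => l _; apply/eqP/negPn/negP; rewrite mulf_eq0 negb_or => /andP[/Wsupp[ji _ _ lj] n0].
    case/negP: n0; rewrite big1// => y _; rewrite big1// => q' _; apply/eqP/negPn/negP.
    rewrite mulf_eq0 negb_or => /andP[/Wsupp[xl _ _ _] _].
    by case/negP: nc; rewrite ji xl lj !eqxx.
  rewrite big1// => y _; rewrite big1// => l _; apply/eqP/negPn/negP.
  rewrite mulf_eq0 negb_or => /andP[/Wsupp[xj yj _ _] n0].
  case/negP: n0; rewrite big1// => v' _; rewrite big1// => k _; apply/eqP/negPn/negP.
  rewrite mulf_eq0 negb_or => /andP[/Wsupp[yi _ _ _] _].
  by case/negP: nc; rewrite xj -yj yi !eqxx.
pose Di := D (src i).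
pose cond := [&& src v == src i, src p == tgt v & src q == tgt p].
(* The delta function at (v, p, q) as a function of words: a path is determined by its origin and
   its directions. *)
pose F (e1 e2 e3 : I) : K := (cond && [&& e1 == dir v, e2 == dir p & e3 == dir q])%:R.
have GF v' p' q' : src v' = src i -> src p' = tgt v' -> src q' = tgt p' ->
    G v' p' q' = F (dir v') (dir p') (dir q').
  move=> sv sp sq; rewrite /G /delta3 /F /cond; congr ((_ : bool)%:R).
  apply/andP/andP => [[/andP[/eqP ev /eqP ep] /eqP eq]|].
    by rewrite -ev -ep -eq sv sp sq !eqxx.
  case=> /and3P[/eqP cv /eqP cp /eqP cq] /and3P[/eqP dv /eqP dp /eqP dq].
  have ev : v' = v by apply: label_eq => //; rewrite sv.
  have ep : p' = p by apply: label_eq => //; rewrite sp ev.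
  have eq : q' = q by apply: label_eq => //; rewrite sq ep.
  by rewrite ev ep eq !eqxx.
have dif3 c e2 e3 : src c = src i -> D (tgt c) e2 e3 = D3 Di (dir c) e2 e3.
  by move=> ci; rewrite Dtgt ci.
have -> : \sum_k \sum_l W a i j k l * (\sum_y \sum_q' W (a + b) l x y q' *
    (\sum_v' \sum_p' W b k y v' p' * G v' p' q')) =
    R12 s Q Di a (R23 s Q Di (a + b) (R12 s Q Di b F)) (dir i) (dir j) (dir x).
  apply: (@Wact _ _ _ _ (fun x1 x2 => R23 s Q Di (a + b) (R12 s Q Di b F) x1 x2 (dir x))) => //.
  move=> k l sk sl tl; rewrite /R23 -dif3// -sl.
  apply: (@Wact _ _ _ _ (fun x1 x2 => R12 s Q Di b F (dir k) x1 x2)); first by rewrite xj.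
  move=> y q' sy sq tq; rewrite /R12 /Di -sk.
  apply: (@Wact _ _ _ _ (fun x1 x2 => F x1 x2 (dir q'))); first by rewrite sy sl.
  by move=> v' p' sv sp tp; apply: GF; rewrite ?sv ?sk// sq tp.
have -> : \sum_y \sum_l W b j x y l * (\sum_v' \sum_k W (a + b) i y v' k *
    (\sum_p' \sum_q' W a k l p' q' * G v' p' q')) =
    R23 s Q Di b (R12 s Q Di (a + b) (R23 s Q Di a F)) (dir i) (dir j) (dir x).
  rewrite /R23 -dif3// -ji.
  apply: (@Wact _ _ _ _ (fun x1 x2 => R12 s Q Di (a + b) (R23 s Q Di a F) (dir i) x1 x2)) => //.
  move=> y l sy sl tl; rewrite /R12.
  apply: (@Wact _ _ _ _ (fun x1 x2 => R23 s Q Di a F x1 x2 (dir l))); first by rewrite sy ji.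
  move=> v' k sv sk tk; rewrite /R23 -dif3// -sk.
  apply: (@Wact _ _ _ _ (fun x1 x2 => F (dir v') x1 x2)); first by rewrite sl tk.
  by move=> p' q' sp sq tq; apply: GF; rewrite ?sv// sp.
symmetry; apply: ybe_fun => //.
- by move=> k l; rewrite /Di DN.
- by move=> k l m; rewrite /Di; exact: DD.
- by move=> k l kl _ _; apply: D0.
(* Of the three letters two are k and one is l, so the difference at the end of the path is the
   initial one plus 2 - 1; [D0] at that end point gives the nonvanishing. *)
- move=> k l kl /eqP ck lin.
  have := D0 (tgt x) kl; rewrite Dtgt xj Dtgt ji Dtgt.
  suff e : (count_mem k [:: dir i; dir j; dir x])%:R = 2%:R :> K /\
    (count_mem l [:: dir i; dir j; dir x])%:R = 1 :> K.
    case: e; rewrite /= !natrD => e1 e2 h; move: h; congr (is_true (s _ != 0)).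
    transitivity (D (src i) k l + ((dir i == k)%:R + ((dir j == k)%:R + ((dir x == k)%:R + 0%:R))) -
      ((dir i == l)%:R + ((dir j == l)%:R + ((dir x == l)%:R + 0%:R)))); first by ring.
    by rewrite e1 e2 /Di; ring.
  split; first by rewrite ck.
  rewrite (_ : count_mem l _ = 1%N)//; move: ck lin; rewrite /= !inE ![l == _]eq_sym.
  have ne z : (z == k) && (z == l) = false.
    by apply/negP => /andP[/eqP -> /eqP e]; rewrite e eqxx in kl.
  move: (ne (dir i)) (ne (dir j)) (ne (dir x)).
  by do 3!case: (_ == k) (_ == l) => -[].
Qed.

Lemma unitarity (i j x v : T) u : s (1 + u) != 0 -> s (1 - u) != 0 ->
  \sum_y \sum_p W u j x y p * W (- u) y p i v =
  [&& i == j, v == x & src x == tgt j]%:R.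
Proof.
move=> u0 u1; have [/eqP xj|nc] := boolP (src x == tgt j); last first.
  rewrite !andbF big1// => y _; rewrite big1// => p _; apply/eqP/negPn/negP.
  by rewrite mulf_eq0 negb_or => /andP[/Wsupp[xj]]; rewrite xj eqxx in nc.
rewrite andbT; pose del (i' v' : T) : K := ((i' == i) && (v' == v))%:R.
pose cond := (src i == src j) && (src v == tgt i).
pose F (e f : I) : K := (cond && (e == dir i) && (f == dir v))%:R.
have E y p : W (- u) y p i v = \sum_i' \sum_v' W (- u) y p i' v' * del i' v'.
  rewrite pair_bigA /= (bigD1 (i, v))//= big1 ?addr0 /del ?eqxx ?mulr1// => -[i' v'] /= ne.
  by rewrite (_ : _ && _ = false) ?mulr0//; apply: contraNF ne => /andP[/eqP -> /eqP ->].
under eq_bigr do under eq_bigr do rewrite E.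
have d (e f : I) : e != f -> s (D (src j) e f) != 0 by exact: D0.
rewrite (@Wact _ _ _ _ (fun e f => wact s Q (D (src j) e f) (- u) e f F))//; last first.
  move=> y p sy sp tp; rewrite -sy; apply: Wact => // i' v' si sv tv.
  rewrite /del /F /cond -sy -si; congr ((_ : bool)%:R).
  apply/andP/andP => [[/eqP <- /eqP <-]|]; first by rewrite sv !eqxx.
  case=> /andP[/andP[/eqP ci /eqP cv] /eqP di] /eqP dv.
  have ei : i' = i by apply: label_eq.
  by rewrite ei eqxx; split=> //; apply/eqP/label_eq => //; rewrite sv ei cv.
have -> : [&& i == j & v == x]%:R = F (dir j) (dir x).
  rewrite /F /cond; congr ((_ : bool)%:R).
  apply/andP/andP => [[/eqP -> /eqP ->]|]; first by rewrite xj !eqxx.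
  case=> /andP[/andP[/eqP ci /eqP cv] /eqP di] /eqP dv.
  have ei : i = j by apply: label_eq.
  by rewrite ei eqxx; split=> //; apply/eqP/label_eq => //; rewrite cv ei xj.
rewrite /wact [dir x == dir j]eq_sym; have [->//|ne] := eqVneq (dir j) (dir x).
have ne' : dir x != dir j by rewrite eq_sym.
have d0 := d _ _ ne; rewrite (DN _ (dir j) (dir x)) QN.
have h1 := unitarity_diag sN s3 Q2 d0 u0 u1; have h2 := unitarity_off sN d0 u0 u1.
move: (D _ _ _) d0 h1 h2 => z d0 h1 h2.
transitivity (F (dir j) (dir x) * (wst s z u * wst s z (- u) + wsw s u * wsw s (- u) * Q z ^+ 2) +
  Q z * F (dir x) (dir j) * (wst s z u * wsw s (- u) + wsw s u * wst s (- z) (- u))); first by ring.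
by rewrite h1 h2 mulr1 mulr0 addr0.
Qed.
End Paths.

(** * Crossing unitarity on paths of labels *)

Section CrossingPaths.
Variables (K : numFieldType) (s Q : K -> K).
Hypothesis sN : forall x, s (- x) = - s x.
Hypothesis s3 : forall x y z w,
  s (x + y) * s (x - y) * (s (z + w) * s (z - w)) -
  s (x + z) * s (x - z) * (s (y + w) * s (y - w)) +
  s (x + w) * s (x - w) * (s (y + z) * s (y - z)) = 0.
Hypothesis QN : forall d, Q (- d) = Q d.
Hypothesis Q2 : forall d, s d != 0 -> Q d ^+ 2 = s (d + 1) * s (d - 1) / s d ^+ 2.
Variables (re : K -> Prop) (u lam : K) (n : nat).
Hypothesis reB : forall x y, re x -> re y -> re (x - y).
Hypothesis reD : forall x y, re x -> re y -> re (x + y).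
Hypothesis u_generic : forall c, re c -> s (u + c) != 0.
Hypotheses (re1 : re 1) (re_lam : re lam) (lamE : 2 * lam = - n%:R) (s1 : s 1 != 0).
Variables (T : finType) (O : eqType) (src tgt : T -> O) (dir : T -> 'I_n).
Hypothesis label_eq : forall b c, src b = src c -> dir b = dir c -> b = c.
Hypothesis label_eq_tgt : forall b c, src b = src c -> tgt b = tgt c -> b = c.
Hypothesis label_eq_dir : forall b c, tgt b = tgt c -> dir b = dir c -> b = c.
Variable crd : O -> 'I_n -> K.
Hypothesis re_crd : forall o k, re (crd o k).
Let D o i j := crd o i - crd o j.
Hypothesis Dtgt : forall b i j, D (tgt b) i j = D (src b) i j + (dir b == i)%:R - (dir b == j)%:R.
Hypothesis D0 : forall o i j, i != j -> s (D o i j) != 0.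
Hypothesis wall : forall o k, (exists2 b, src b = o & dir b = k) \/
  exists2 l, l != k & s (D o k l + 1) = 0.
Variable W : K -> T -> T -> T -> T -> K.
Hypothesis Wsupp : forall b c k l u, W u b c k l != 0 ->
  [/\ src c = tgt b, src k = src b, src l = tgt k, tgt l = tgt c &
    (k = b /\ l = c) \/ [/\ dir b != dir c, dir k = dir c & dir l = dir b]].
Hypothesis Wdiag : forall b c u, src c = tgt b ->
  W u b c b c = if dir b == dir c then 1 else wst s (D (src b) (dir b) (dir c)) u.
Hypothesis Woff : forall b c k l u, src c = tgt b -> src k = src b -> src l = tgt k ->
  dir b != dir c -> dir k = dir c -> dir l = dir b ->
  W u b c k l = wsw s u * Q (D (src b) (dir b) (dir c)).

Let gf o := gfac s (crd o).

(** A direction without a label is blocked by a wall, and there the numerator of [gf] contains a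
    vanishing bracket; so the sum over labels extends to all directions. *)
Lemma sum_labels o (F : 'I_n -> K) : (forall k, gf o k = 0 -> F k = 0) ->
  \sum_(p | src p == o) F (dir p) = \sum_k F k.
Proof.
move=> F0; rewrite (partition_big dir predT)//=; apply: eq_bigr => k _.
have [[b sb db]|[l lk sl]] := wall o k.
  rewrite (bigD1 b)/= ?sb ?db ?eqxx// big1 ?addr0// => p /andP[/andP[/eqP sp /eqP dp] pb].
  by case/eqP: pb; apply: label_eq; rewrite ?sb ?db.
have e0 : F k = 0 by apply: F0; rewrite /gf /gfac (bigD1 l)//= -/(D o k l) sl mul0r mul0r.
by rewrite e0 big1// => p /andP[_ /eqP ->].
Qed.

(** For o = tgt i the supports force v = i, x = j and y = p, and the sum over p is the partial
    fraction identity. For another o both weights exchange directions, which determines p and y, and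
    the only term is evaluated by the square of [Q]. *)
Lemma crossing (i j v x : T) o : tgt i = tgt j ->
  \sum_(p | src p == o) \sum_y gf (src p) (dir p) * W (lam + u) i y v p * W (lam - u) x p j y =
  [&& i == j, v == x, src v == src i & tgt v == o]%:R *
    (gf (src i) (dir i) * (wsw s (lam + u) * wsw s (lam - u))).
Proof.
move=> tij; have [oc|oc] := eqVneq o (tgt i).
  subst o; have [/andP[/eqP vi /eqP xj]|nc] := boolP ((v == i) && (x == j)); last first.
    rewrite (_ : [&& _, _, _ & _] = false) ?mul0r; last first.
      apply/negP => /and4P[/eqP ij /eqP vx /eqP sv /eqP tv]; case/negP: nc.
      have vi : v = i by exact: label_eq_tgt.
      by rewrite -vx vi ij !eqxx.
    rewrite big1// => p /eqP sp; rewrite big1// => y _; apply/eqP/negPn/negP.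
    rewrite !mulf_eq0 !negb_or => /andP[/andP[_ /Wsupp[_ vi pv _ _]] /Wsupp[px jx _ _ _]].
    case/negP: nc; apply/andP; split; apply/eqP/label_eq_tgt => //.
      by rewrite -pv.
    by rewrite -px sp.
  subst v x; pose w k l (b : K) := if k == l then 1 else wst s (crd (tgt i) k - 1 - crd (tgt i) l) b.
  have wE (k p : T) b : tgt k = tgt i -> src p = tgt i -> W b k p k p = w (dir k) (dir p) b.
    move=> tk sp; rewrite Wdiag ?tk// /w; case: eqVneq => // ne.
    congr (wst s _ b); have := Dtgt k (dir k) (dir p).
    rewrite eqxx (negbTE ne) subr0 tk => e.
    by rewrite addrAC -/(D _ _ _) e addrK.
  transitivity (\sum_(p | src p == tgt i) gf (tgt i) (dir p) * w (dir i) (dir p) (lam + u) * w (dir j) (dir p) (lam - u)).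
    apply: eq_bigr => p /eqP sp; rewrite (bigD1 p)//= big1 ?addr0 ?wE ?sp// => y yp.
    apply/eqP/negPn/negP; rewrite !mulf_eq0 !negb_or => /andP[/andP[_ /Wsupp[iy _ _ ty _]] _].
    by case/eqP: yp; apply: label_eq_tgt; rewrite // iy.
  rewrite (sum_labels (F := fun k => gf (tgt i) k * w (dir i) k (lam + u) * w (dir j) k (lam - u))); last first.
    by move=> k ->; rewrite !mul0r.
  have cn k l : k != l -> s (crd (tgt i) k - crd (tgt i) l) != 0 by exact: D0.
  have nz (k : T) l : tgt k = tgt i -> s (crd (tgt i) (dir k) - 1 - crd (tgt i) l) != 0.
    move=> tk; have [->|ne] := eqVneq (dir k) l.
      by rewrite (_ : _ - _ = - 1) ?sN ?oppr_eq0//; rewrite addrAC subrr add0r.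
    have := D0 (src k) ne; have := Dtgt k (dir k) l; rewrite eqxx (negbTE ne) subr0 tk => e.
    by rewrite addrAC -/(D _ _ _) e addrK.
  have w1 k b : s (1 + b) != 0 -> w k k b = wst s (crd (tgt i) k - 1 - crd (tgt i) k) b.
    move=> b0; rewrite /w eqxx /wst (_ : crd (tgt i) k - 1 - crd (tgt i) k = - 1); last by ring.
    by rewrite -opprD !sN; field; rewrite b0 s1.
  have gp := generic_plus reD u_generic re1 re_lam.
  have gm := generic_minus sN reB reD u_generic re1 re_lam.
  have [ij|ij] := eqVneq i j.
    subst j; rewrite !eqxx mul1r.
    have := crossing_diag sN s3 reB reD u_generic re1 re_lam lamE s1 (re_crd (tgt i)) cn (fun l => nz i l erefl).
    rewrite -/(gf _) => h; transitivity (\prod_(l | l != dir i) (s (crd (tgt i) (dir i) - crd (tgt i) l) /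
      s (crd (tgt i) (dir i) - crd (tgt i) l - 1)) * (wsw s (lam + u) * wsw s (lam - u))).
      rewrite -h; apply: eq_bigr => k _; rewrite -mulrA /w eq_sym; case: eqP => //= _; by rewrite mulr1.
    congr (_ * _); apply: eq_bigr => l li; have := Dtgt i (dir i) l.
    by rewrite eqxx eq_sym (negbTE li) subr0 /D => ->; rewrite addrK.
  rewrite /= mul0r.
  have dij : dir i != dir j by apply: contra_neq ij; exact: label_eq_dir.
  rewrite -[RHS](crossing_off sN s3 reB reD u_generic re1 re_lam lamE s1 (re_crd (tgt i)) cn dij
    (fun l => nz i l erefl) (fun l => nz j l (esym tij))).
  have wk k l b : s (1 + b) != 0 -> w k l b = wst s (crd (tgt i) k - 1 - crd (tgt i) l) b.
    by move=> b0; have [<-|ne] := eqVneq k l; [exact: w1|rewrite /w (negbTE ne)].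
  by apply: eq_bigr => k _; rewrite !wk.
have [/and4P[/eqP ij /eqP vx /eqP sv /eqP tv]|nc] := boolP [&& _, _, _ & _]; last first.
  rewrite mul0r big1// => p /eqP sp; rewrite big1// => y _; apply/eqP/negPn/negP.
  rewrite !mulf_eq0 !negb_or => /andP[/andP[_ /Wsupp[yi vi pv ty h1]] /Wsupp[px jx yj _ h2]].
  case: h1 => [[ev _]|[diy dv dp]]; first by case/eqP: oc; rewrite -sp pv ev.
  case: h2 => [[ej ep]|[_ dj dy]]; first by case/eqP: oc; rewrite -sp px -ej.
  have ij : i = j by apply: label_eq_dir; rewrite ?dj.
  case/negP: nc; rewrite ij eqxx vi ij -sp -pv !eqxx !andbT; apply/eqP/label_eq.
    by rewrite vi ij jx.
  by rewrite dv.
subst j x; rewrite mul1r.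
have ne : dir i != dir v by apply: contra_neq oc => e; rewrite -tv; congr tgt; exact/esym/label_eq.
(* Two distinct steps from one vertex complete to a square: a wall met after [i] in direction
   [dir v] would make a bracket vanish already at [src v] or at [tgt v]. *)
have [y sy dy] : exists2 y, src y = tgt i & dir y = dir v.
  have [//|[l lv sl]] := wall (tgt i) (dir v).
  move: sl; rewrite Dtgt (negbTE ne) addr0 -sv.
  have [<-|li] := eqVneq (dir i) l; first by rewrite subrK => e; have := D0 (src v) (_ : dir v != dir i); rewrite e eqxx eq_sym => /(_ ne).
  rewrite subr0 => e; have vl : dir v != l by rewrite eq_sym.
  by have := D0 (tgt v) vl; rewrite Dtgt eqxx (negbTE vl) subr0 e eqxx.
have [p sp dp] : exists2 p, src p = tgt v & dir p = dir i.
  have ne' : dir v != dir i by rewrite eq_sym.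
  have [//|[l li sl]] := wall (tgt v) (dir i).
  move: sl; rewrite Dtgt (negbTE ne') addr0 sv.
  have [<-|lv] := eqVneq (dir v) l; first by rewrite subrK => e; have := D0 (src i) ne; rewrite e eqxx.
  rewrite subr0 => e; have il : dir i != l by rewrite eq_sym.
  by have := D0 (tgt i) il; rewrite Dtgt eqxx (negbTE il) subr0 e eqxx.
have dne : dir i != dir y by rewrite dy.
have dne' : dir v != dir p by rewrite dp eq_sym.
rewrite (bigD1 p) /= ?sp ?tv// [X in _ + X]big1 ?addr0 => [|p' /andP[/eqP sp' pp']]; last first.
  rewrite big1// => y' _; apply/eqP/negPn/negP.
  rewrite !mulf_eq0 !negb_or => /andP[/andP[_ /Wsupp[_ _ _ _ h1]] _].
  case: h1 => [[ev _]|[_ _ dp']]; first by case/eqP: oc; rewrite -tv ev.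
  by case/eqP: pp'; apply: label_eq; rewrite ?dp ?dp' ?sp ?sp'.
rewrite (bigD1 y)//= [X in _ + X]big1 ?addr0 => [|y' yy']; last first.
  apply/eqP/negPn/negP.
  rewrite !mulf_eq0 !negb_or => /andP[/andP[_ /Wsupp[yi _ _ _ h1]] _].
  case: h1 => [[ev _]|[_ dy' _]]; first by case/eqP: oc; rewrite -tv ev.
  by case/eqP: yy'; apply: label_eq; rewrite ?dy ?dy' ?sy ?yi.
rewrite (Woff (b := i))// (Woff (b := v))//.
have -> : D (src v) (dir v) (dir p) = - D (src i) (dir i) (dir y) by rewrite sv dp dy /D opprB.
rewrite QN dp dy.
transitivity (gf o (dir i) * Q (D (src i) (dir i) (dir v)) ^+ 2 * (wsw s (lam + u) * wsw s (lam - u))); first by ring.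
congr (_ * _); rewrite /gf /gfac -tv Q2 ?D0//.
have vi : dir v != dir i by rewrite eq_sym.
rewrite (bigD1 (dir v))//= [in RHS](bigD1 (dir v))//= -!/(D _ _ _) Dtgt (negbTE vi) eqxx addr0 sv subrK.
rewrite (eq_bigr (fun l => s (D (src i) (dir i) l + 1) / s (D (src i) (dir i) l))); last first.
  by move=> l /andP[li lv]; rewrite -!/(D _ _ _) Dtgt (negbTE vi) addr0 sv [dir v == l]eq_sym (negbTE lv) subr0.
have d0 := D0 (src i) ne.
have d1 : s (D (src i) (dir i) (dir v) - 1) != 0.
  by have := D0 (tgt v) ne; rewrite Dtgt (negbTE vi) eqxx addr0 sv.
move: (\prod_(_ | _) _) (D _ _ _) d0 d1 => P d d0 d1.
by field; rewrite d0 d1.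
Qed.

End CrossingPaths.

(** * Gauge factors and rotated weights: exchange relations and pairings *)

Section Rotations.
Variables (K : comNzRingType) (T : finType) (O : eqType) (src tgt : T -> O).
Variables (W : K -> T -> T -> T -> T -> K) (up down : T -> K) (lam : K).
Hypothesis up_down : forall b, up b * down b = 1.
Hypothesis upW : forall u b c k l, up b * up c * W u b c k l = up k * up l * W u b c k l.
Hypothesis Wsupp : forall b c k l u, W u b c k l != 0 -> src k = src b /\ tgt l = tgt c.

(** The matrix element of the quarter turn once both contractions with the diagonal pairings have
    been carried out. *)
Definition Wdual u b c k l := down b * up l * W (lam - u) c l b k.
Definition dg (f : T -> K) p q := if p == q then f p else 0.
Definition ybe a b := forall i j x v p q,
  \sum_k \sum_l \sum_y W a k l p q * W (a + b) i y v k * W b j x y l =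
  \sum_k \sum_l \sum_y W b k y v p * W (a + b) l x y q * W a i j k l.

Let rot (F : T -> T -> T -> K) : \sum_k \sum_l \sum_y F k l y = \sum_y \sum_k \sum_l F k l y.
Proof. by rewrite exchange_big /=; under eq_bigr do rewrite exchange_big /=; rewrite exchange_big; under [in RHS]eq_bigr do rewrite exchange_big. Qed.

Let rev (F : T -> T -> T -> K) : \sum_k \sum_l \sum_y F k l y = \sum_y \sum_l \sum_k F k l y.
Proof. by rewrite rot; apply: eq_bigr => y _; exact: exchange_big. Qed.

Let mul3 c (F : T -> T -> T -> K) : c * \sum_k \sum_l \sum_y F k l y = \sum_k \sum_l \sum_y c * F k l y.
Proof.
by rewrite mulr_sumr; apply: eq_bigr => k _; rewrite mulr_sumr; apply: eq_bigr => l _; rewrite mulr_sumr.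
Qed.

Let eq3 (F G : T -> T -> T -> K) : (forall k l y, F k l y = G k l y) ->
  \sum_k \sum_l \sum_y F k l y = \sum_k \sum_l \sum_y G k l y.
Proof. by move=> e; do 3!apply: eq_bigr => ? _. Qed.

Lemma exchange_vv u1 u2 i j p q v x : ybe (u1 - u2) u2 ->
  \sum_k \sum_l \sum_y W (u1 - u2) k l p q * (W u1 i y v k * W u2 j x y l) =
  \sum_k \sum_l \sum_y W (u1 - u2) i j k l * (W u2 k y v p * W u1 l x y q).
Proof.
move=> /(_ i j x v p q); rewrite subrK => h.
transitivity (\sum_k \sum_l \sum_y W (u1 - u2) k l p q * W u1 i y v k * W u2 j x y l).
  by apply: eq3 => k l y; rewrite mulrA.
by rewrite h; apply: eq3 => k l y; rewrite [RHS]mulrC.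
Qed.

(** The Yang-Baxter equation at u2 and lam - u1, whose sum is lam - (u1 - u2), with its external
    labels read in another order. The gauge factors at the summed label cancel, and those left over
    sit on i and q. *)
Lemma exchange_dv u1 u2 i j p q v x : ybe u2 (lam - u1) ->
  \sum_k \sum_l \sum_y Wdual (u1 - u2) k l p q * (Wdual u1 i y v k * W u2 j x y l) =
  \sum_k \sum_l \sum_y Wdual (u1 - u2) i j k l * (W u2 k y v p * Wdual u1 l x y q).
Proof.
move=> /(_ j x q i v p); rewrite (_ : u2 + (lam - u1) = lam - (u1 - u2)); last by rewrite opprB addrCA.
move=> h; transitivity (down i * up q * \sum_k \sum_l \sum_y
   W (lam - u1) k y i v * W (lam - (u1 - u2)) l q y p * W u2 j x k l).
  rewrite mul3 [RHS]rev; apply: eq3 => k l y.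
  transitivity (up k * down k * (down i * up q * (W (lam - u1) y k i v * W (lam - (u1 - u2)) l q k p * W u2 j x y l))).
    by rewrite /Wdual; ring.
  by rewrite up_down mul1r.
rewrite -h mul3; apply: eq_bigr => k _; rewrite exchange_big; apply: eq_bigr => l _; apply: eq_bigr => y _.
rewrite -[LHS]mul1r -(up_down l) /Wdual; ring.
Qed.

Lemma downW u b c k l : down k * down l * W u b c k l = down b * down c * W u b c k l.
Proof.
transitivity (down k * down l * (up b * up c * W u b c k l) * (down b * down c)).
  transitivity (down k * down l * W u b c k l * (up b * down b) * (up c * down c)); last by ring.
  by rewrite !up_down !mulr1.
rewrite upW; transitivity (down b * down c * W u b c k l * (up k * down k) * (up l * down l)); first by ring.
by rewrite !up_down !mulr1.
Qed.

(** The Yang-Baxter equation at lam - u1 and u1 - u2. Here the summed labels carry two factors of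
    the same kind; gauge invariance of the half-turned weight ([upW] on one side, [downW] on the
    other) moves them to external labels. *)
Lemma exchange_dd u1 u2 i j p q v x : ybe (lam - u1) (u1 - u2) ->
  \sum_k \sum_l \sum_y W (u1 - u2) q p l k * (Wdual u1 i y v k * Wdual u2 j x y l) =
  \sum_k \sum_l \sum_y W (u1 - u2) l k j i * (Wdual u2 k y v p * Wdual u1 l x y q).
Proof.
move=> /(_ x q p j i v); rewrite (_ : lam - u1 + (u1 - u2) = lam - u2); last by rewrite addrA subrK.
move=> h; transitivity (down i * down j * (up q * up p) * \sum_k \sum_l \sum_y
   W (lam - u1) k l i v * W (lam - u2) x y j k * W (u1 - u2) q p y l).
  rewrite rot mul3; apply: eq_bigr => y _; apply: eq_bigr => k _; apply: eq_bigr => l _.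
  have e := upW (u1 - u2) q p l k.
  transitivity (down i * down j * (up l * up k * W (u1 - u2) q p l k) * (W (lam - u1) y k i v * W (lam - u2) x l j y)).
    by rewrite /Wdual; ring.
  by rewrite -e; ring.
rewrite h mul3 rot; apply: eq3 => y k l.
have e := downW (u1 - u2) k y j i.
transitivity (up q * up p * (down j * down i * W (u1 - u2) k y j i) * (W (lam - u2) l p y v * W (lam - u1) x q k l)).
  by ring.
by rewrite e /Wdual; ring.
Qed.

Section Pairings.
Variables (u rho : K).
Hypothesis unit : forall e, e = u \/ e = - u -> forall i j x v,
  \sum_y \sum_p W e j x y p * W (- e) y p i v = [&& i == j, v == x & src x == tgt j]%:R.
Hypothesis crossing_up : forall i j v x o, tgt i = tgt j ->
  \sum_(p | src p == o) \sum_y up p ^+ 2 * W (lam + u) i y v p * W (lam - u) x p j y =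
  [&& i == j, v == x, src v == src i & tgt v == o]%:R * (up i ^+ 2 * rho).
Hypothesis crossing_down : forall i j v x o, src i = src j ->
  \sum_(p | tgt p == o) \sum_y down p ^+ 2 * W (lam - u) y i p v * W (lam + u) p x y j =
  [&& i == j, v == x, tgt v == tgt i & src v == o]%:R * (down i ^+ 2 * rho).

Let dgE (f : T -> K) p (F : T -> T -> K) :
  \sum_q \sum_y dg f p q * F q y = \sum_y f p * F p y.
Proof.
rewrite (bigD1 p)//= [X in _ + X]big1 ?addr0 /dg ?eqxx// => q qp.
by rewrite big1// => y _; rewrite eq_sym (negbTE qp) mul0r.
Qed.

(** The factor [up p] of the pairing and the one inside [Wdual] combine into the square with which
    crossing unitarity is weighted. *)
Lemma pairing_omega i j o v x : tgt i = tgt j ->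
  \sum_(p | src p == o) \sum_q \sum_y dg up p q * (W (u + lam) i y v p * Wdual u j x y q) =
  dg up i j * (rho * [&& v == x, src v == src i & tgt v == o]%:R).
Proof.
move=> ij; transitivity (down j * \sum_(p | src p == o) \sum_y up p ^+ 2 * W (lam + u) i y v p * W (lam - u) x p j y).
  rewrite mulr_sumr; apply: eq_bigr => p _; rewrite dgE mulr_sumr; apply: eq_bigr => y _.
  by rewrite /Wdual (addrC u lam); ring.
rewrite crossing_up// /dg; case: (eqVneq i j) => [<-|_] /=; last by rewrite !mul0r mulr0.
set e := _%:R; transitivity (up i * down i * (up i * (rho * e))); first by ring.
by rewrite up_down mul1r.
Qed.

Lemma pairing_sigma i j o v x : src i = src j ->
  \sum_(p | tgt p == o) \sum_q \sum_y dg down p q * (Wdual u p y v i * W (u + lam) q x y j) =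
  dg down i j * (rho * [&& v == x, src v == o & tgt v == tgt i]%:R).
Proof.
move=> ij; transitivity (up i * \sum_(p | tgt p == o) \sum_y down p ^+ 2 * W (lam - u) y i p v * W (lam + u) p x y j).
  rewrite mulr_sumr; apply: eq_bigr => p _; rewrite dgE mulr_sumr; apply: eq_bigr => y _.
  by rewrite /Wdual (addrC u lam); ring.
rewrite crossing_down// /dg; case: (eqVneq i j) => [_|_] /=; last by rewrite !mul0r mulr0.
rewrite (andbC (tgt v == _)).
set e := _%:R; transitivity (up i * down i * (down i * (rho * e))); first by ring.
by rewrite up_down mul1r.
Qed.

(** The shift by lam turns [Wdual] back into W at - u and the gauge factors at p cancel, leaving the
    inversion relation; fixing [tgt p] amounts to fixing [tgt v]. *)
Lemma pairing_omegas i j o v x : src i = src j ->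
  \sum_(p | tgt p == o) \sum_q \sum_y dg down p q * (Wdual (u + lam) i y v p * W u j x y q) =
  dg down i j * [&& v == x, src v == tgt i & tgt v == o]%:R.
Proof.
move=> ij; transitivity (down i * \sum_(p | tgt p == o) \sum_y W u j x y p * W (- u) y p i v).
  rewrite mulr_sumr; apply: eq_bigr => p _; rewrite dgE mulr_sumr; apply: eq_bigr => y _.
  rewrite /Wdual (_ : lam - (u + lam) = - u); last by rewrite opprD addrCA subrr addr0.
  by rewrite -[RHS]mul1r -(up_down p); ring.
have -> : \sum_(p | tgt p == o) \sum_y W u j x y p * W (- u) y p i v =
    (tgt v == o)%:R * \sum_y \sum_p W u j x y p * W (- u) y p i v.
  rewrite [in RHS]exchange_big /= mulr_sumr [LHS]big_mkcond; apply: eq_bigr => p _.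
  rewrite mulr_sumr; case: ifP => po.
    apply: eq_bigr => y _; have [->|/Wsupp[_ vp]] := eqVneq (W (- u) y p i v) 0; first by rewrite !mulr0.
    by rewrite vp po mul1r.
  rewrite big1// => y _; have [->|/Wsupp[_ vp]] := eqVneq (W (- u) y p i v) 0; first by rewrite !mulr0.
  by rewrite vp po mul0r.
rewrite unit /dg; last by left.
case: (eqVneq i j) => [e|_] /=; last by rewrite !mulr0 mul0r.
subst j; congr (_ * _); case: (eqVneq v x) => [<-|_] /=; last by rewrite mulr0.
by rewrite -natrM mulnb andbC.
Qed.

Lemma pairing_sigmas i j o v x : tgt i = tgt j ->
  \sum_(p | src p == o) \sum_q \sum_y dg up p q * (W u p y v i * Wdual (u + lam) q x y j) =
  dg up i j * [&& v == x, src v == o & tgt v == src i]%:R.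
Proof.
move=> ij; transitivity (up j * \sum_(p | src p == o) \sum_y W (- u) x j p y * W u p y v i).
  rewrite mulr_sumr; apply: eq_bigr => p _; rewrite dgE mulr_sumr; apply: eq_bigr => y _.
  rewrite /Wdual (_ : lam - (u + lam) = - u); last by rewrite opprD addrCA subrr addr0.
  by rewrite -[RHS]mul1r -(up_down p); ring.
have -> : \sum_(p | src p == o) \sum_y W (- u) x j p y * W u p y v i =
    (src x == o)%:R * \sum_p \sum_y W (- u) x j p y * W (- - u) p y v i.
  rewrite mulr_sumr big_mkcond /=; apply: eq_bigr => p _; rewrite mulr_sumr opprK.
  case: ifP => po.
    apply: eq_bigr => y _; have [->|/Wsupp[px _]] := eqVneq (W (- u) x j p y) 0; first by rewrite !mul0r mulr0.
    by rewrite -px po mul1r.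
  rewrite big1// => y _; have [->|/Wsupp[px _]] := eqVneq (W (- u) x j p y) 0; first by rewrite !mul0r mulr0.
  by rewrite -px po mul0r.
rewrite unit /dg; last by right.
have [vx|_] := eqVneq v x; last by rewrite /= !mulr0.
subst x; have [ijE|_] := eqVneq i j; last by rewrite /= !mulr0 mul0r.
by subst j; rewrite -natrM mulnb (eq_sym (src i)).
Qed.

End Pairings.
End Rotations.
Lemma sum_sub_type (V : nmodType) (T : finType) (P : pred T) (F : T -> V) :
  \sum_(z | P z) F z = \sum_(z : {z | P z}) F (val z).
Proof. by rewrite big_sub. Qed.

Section Products.
Variable K : comNzRingType.
Implicit Types a b c d e : K.

Lemma mul_rot a b c : a * b * c = c * a * b.
Proof. by ring. Qed.

Lemma mul_regroup a b c d e : a * b * (c * d * e) = a * c * (b * d * e).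
Proof. by ring. Qed.

Lemma mul_cancel a b c d e : a * b = 1 -> c * d = 1 -> b * d * (c * a * e) = e.
Proof. by move=> ab cd; transitivity (a * b * (c * d) * e); [ring|rewrite ab cd !mul1r]. Qed.

Lemma mulr_eq0l a b c : c = 0 -> a * c = b * c.
Proof. by move=> ->; rewrite !mulr0. Qed.

End Products.

(** * Labels, alcove walls and the concrete weights *)

Section Labels.
Variables (R : realType) (n ell : nat).
Local Notation C := (cplx R).
Local Notation rc := (@rc R).
Local Notation L := (Lev R n ell).
Local Notation label := (label R n ell).
Local Notation alcove := (alcove R n ell).
Local Notation in_alcove := (@in_alcove R n ell).
Hypothesis n2 : (2 <= n)%N.

Lemma L0 : 0 < L.
Proof. by rewrite /Lev ltr0n addn_gt0 (leq_trans _ n2) ?orbT. Qed.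

Lemma in_alcoveP (a : 'rV[R]_n) : reflect
  [/\ \sum_i a 0 i = 0, forall i j, (a 0 i - a 0 j) \is a Num.int,
    forall i j : 'I_n, (i < j)%N -> a 0 j < a 0 i &
    forall i j : 'I_n, val i = 0%N -> val j = n.-1 -> a 0 i - a 0 j < L]
  (in_alcove a).
Proof.
apply: (iffP and4P) => -[h1 h2 h3 h4].
  split; first exact/eqP.
  - by move=> i j; have /forallP/(_ i)/forallP/(_ j) := h2.
  - by move=> i j ij; have /forallP/(_ i)/forallP/(_ j)/implyP/(_ ij) := h3.
  - by move=> i j /eqP i0 /eqP jn; have /forallP/(_ i)/forallP/(_ j) := h4; rewrite i0 jn.
split; first exact/eqP.
- by apply/forallP => i; apply/forallP => j.
- by apply/forallP => i; apply/forallP => j; apply/implyP; exact: h3.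
- by apply/forallP => i; apply/forallP => j; apply/implyP => /andP[/eqP i0 /eqP jn]; exact: h4.
Qed.

Lemma alcove_gap (a : 'rV[R]_n) (i j : 'I_n) : in_alcove a -> (i < j)%N ->
  exists2 d : nat, (0 < d < ell + n)%N & a 0 i - a 0 j = d%:R.
Proof.
move=> /in_alcoveP[_ aI dec lev] ij.
have le (k l : 'I_n) : (k <= l)%N -> a 0 l <= a 0 k.
  by rewrite leq_eqVlt => /orP[/eqP kl|/dec/ltW//]; rewrite (val_inj kl).
have p0 : 0 < a 0 i - a 0 j by rewrite subr_gt0 dec.
have n0 : (0 < n)%N by exact: leq_trans n2.
have n1 : (n.-1 < n)%N by rewrite prednK.
have pL : a 0 i - a 0 j < L.
  apply: le_lt_trans (lev (Ordinal n0) (Ordinal n1) erefl erefl).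
  by apply: lerB; apply: le => //=; rewrite -ltnS prednK.
have /natrP[d dE] : a 0 i - a 0 j \is a Num.nat by rewrite natrEint aI ltW.
exists d => //; move: p0 pL; rewrite dE /Lev ltr0n ltr_nat.
by move=> -> ->.
Qed.

Lemma epsE (k i j : 'I_n) : eps R k 0 i - eps R k 0 j = (k == i)%:R - (k == j)%:R.
Proof. by rewrite !mxE; ring. Qed.

Lemma shiftE (e : R) (a : 'rV[R]_n) (k i j : 'I_n) : (a + e *: eps R k) 0 i - (a + e *: eps R k) 0 j =
  a 0 i - a 0 j + e * ((k == i)%:R - (k == j)%:R).
Proof. by rewrite -epsE [(a + _) 0 i]mxE [(a + _) 0 j]mxE !(mxE _ _ 0 _) ; ring. Qed.

Section Good.
Variable t : R.
Hypothesis t0 : 0 < t.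
Local Notation s := (fun x : C => brac L x (itau t)).
Hypothesis s_pos : forall d : nat, (0 < d < ell + n)%N -> 0 < s (rc d%:R).

Lemma sN x : s (- x) = - s x.
Proof. exact: bracN. Qed.

(** The bracket changes sign under translation by L, so its zero at 0 repeats at L; this is the zero
    on the affine wall. *)
Lemma sL : s (rc L) = 0.
Proof.
have := brac_addL L0 0 t0; rewrite add0r => ->.
by have := s0 sN; move=> /= ->; rewrite oppr0.
Qed.

Lemma s_alcove (a : 'rV[R]_n) (i j : 'I_n) : in_alcove a -> i != j -> s (rc (a 0 i - a 0 j)) != 0.
Proof.
move=> aP; rewrite neq_ltn => /orP[] /(alcove_gap aP)[d dL e].
  by rewrite e gt_eqF// s_pos.
by rewrite -opprB e rcN sN oppr_eq0 gt_eqF// s_pos.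
Qed.

Lemma s_alcove_pos (a : 'rV[R]_n) (i j : 'I_n) : in_alcove a -> (i < j)%N -> 0 < s (rc (a 0 i - a 0 j)).
Proof. by move=> aP /(alcove_gap aP)[d dL e]; rewrite e s_pos. Qed.

Lemma s_one : s 1 != 0.
Proof.
rewrite -rc1 gt_eqF//; apply: (s_pos (d := 1)).
by rewrite /= (leq_trans n2)// leq_addl.
Qed.

Lemma sum_eps (k : 'I_n) : \sum_i eps R k 0 i = 0.
Proof.
under eq_bigr do rewrite mxE.
rewrite sumrB sumr_const card_ord -[_ *+ n]mulr_natl mulfV; last first.
  by rewrite pnatr_eq0 -lt0n (leq_trans _ n2).
by rewrite (bigD1 k)//= eqxx big1 ?addr0 ?subrr// => i; rewrite eq_sym => /negbTE ->.
Qed.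

(* Leaving the alcove means hitting one of its walls, where a bracket vanishes. *)
Lemma alcove_wall (e : R) (a : 'rV[R]_n) (k : 'I_n) : (e == 1) || (e == -1) ->
  in_alcove a -> ~~ in_alcove (a + e *: eps R k) ->
  exists2 l, l != k & s (rc (a 0 k - a 0 l + e)) = 0.
Proof.
move=> he aP; have [s1 aI dec lev] := in_alcoveP _ aP.
have eI : e \is a Num.int by case/orP: (he) => /eqP ->; rewrite ?rpredN rpred1.
(* A finite wall: the gap is an integer at least 1 and changes by at most 1, so failing positivity
   means that it drops exactly to 0. *)
have [[[i j] /= ij h]|no1] := pselect (exists2 ij : 'I_n * 'I_n, (ij.1 < ij.2)%N &
    a 0 ij.1 - a 0 ij.2 + e * ((k == ij.1)%:R - (k == ij.2)%:R) <= 0).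
  move=> _; have [d /andP[d0 _] dE] := alcove_gap aP ij.
  have d1 : (1 : R) <= d%:R by rewrite ler1n.
  have ji : j != i by rewrite neq_ltn ij orbT.
  have s00 := s0 sN.
  case: (eqVneq k i) h => [ki|ki]; case: (eqVneq k j) => [kj|kj] //=; rewrite dE.
  - by rewrite subrr mulr0 addr0; lra.
  - rewrite subr0 mulr1 => h; exists j; rewrite ki//.
    by rewrite dE (_ : _ + e = 0) ?s00//; case/orP: (he) => /eqP he1; lra.
  - rewrite sub0r mulrN1 => h; exists i; rewrite kj; first by rewrite neq_ltn ij.
    rewrite -opprB dE (_ : _ + e = 0) ?s00//; case/orP: (he) => /eqP he1; lra.
  - by rewrite subrr mulr0 addr0; lra.
(* The affine wall: the gap between the first and the last coordinate reaches exactly L, where the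
   bracket vanishes by [sL]. *)
have [[[i j] /= [i0 jn] h]|no2] := pselect (exists2 ij : 'I_n * 'I_n, (val ij.1 = 0%N /\ val ij.2 = n.-1) &
    L <= a 0 ij.1 - a 0 ij.2 + e * ((k == ij.1)%:R - (k == ij.2)%:R)).
  move=> _; have ij : (i < j)%N by rewrite i0 jn -ltnS prednK// (leq_trans _ n2).
  have [d /andP[_ dL] dE] := alcove_gap aP ij.
  have d1 : d%:R + 1 <= L :> R by rewrite /Lev natr1 ler_nat.
  have ji : j != i by rewrite neq_ltn ij orbT.
  have sNL : s (rc (- L)) = 0 by rewrite rcN sN sL oppr0.
  case: (eqVneq k i) h => [ki|ki]; case: (eqVneq k j) => [kj|kj] //=; rewrite dE.
  - by rewrite subrr mulr0 addr0; lra.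
  - rewrite subr0 mulr1 => h; exists j; rewrite ki//.
    by rewrite dE (_ : _ + e = L) ?sL//; case/orP: (he) => /eqP he1; lra.
  - rewrite sub0r mulrN1 => h; exists i; rewrite kj; first by rewrite neq_ltn ij.
    by rewrite -opprB dE (_ : _ + e = - L) ?sNL//; case/orP: (he) => /eqP he1; lra.
  - by rewrite subrr mulr0 addr0; lra.
case/negP; apply/in_alcoveP; split.
- under eq_bigr do rewrite mxE [X in _ + X]mxE.
  by rewrite big_split /= -mulr_sumr sum_eps mulr0 addr0.
- move=> i j; by rewrite shiftE rpredD// rpredM// rpredB// rpred_nat.
- move=> i j ij; rewrite -subr_gt0 shiftE ltNge; apply/negP => h; apply: no1; by exists (i, j).
- move=> i j i0 jn; rewrite shiftE ltNge; apply/negP => h; apply: no2; by exists (i, j).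
Qed.

Local Notation tau := (itau t).
Local Notation Wt := (@Wt R n ell).
Local Notation Rvv := (@Rvv R n ell).
Local Notation Gfun := (@Gfun R n ell).

Definition crd (a : 'rV[R]_n) (i : 'I_n) : C := rc (a 0 i).
Definition dif (a : 'rV[R]_n) (i j : 'I_n) : C := rc (a 0 i - a 0 j).
Definition Qf (d : C) : C := sqrtC (s (d + 1) * s (d - 1) / s d ^+ 2).

Lemma difE a i j : dif a i j = crd a i - crd a j.
Proof. exact: rcB. Qed.
Lemma difN a i j : dif a j i = - dif a i j.
Proof. by rewrite /dif -rcN opprB. Qed.
Lemma difD a i j k : dif a i k = dif a i j + dif a j k.
Proof. by rewrite /dif -rcD; congr rc; ring. Qed.

Lemma dif_shift (a : 'rV[R]_n) k i j :
  dif (a + eps R k) i j = dif a i j + (k == i)%:R - (k == j)%:R.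
Proof.
rewrite /dif -[eps R k]scale1r shiftE mul1r rcD !rcB !rc_nat; ring.
Qed.

Lemma QfN d : Qf (- d) = Qf d.
Proof.
rewrite /Qf; congr sqrtC; rewrite (_ : - d + 1 = - (d - 1)); last by ring.
by rewrite (_ : - d - 1 = - (d + 1)) ?sN ?mulrNN ?sqrrN 1?[s (d - 1) * _]mulrC//; ring.
Qed.

Lemma Qf2 d : s d != 0 -> Qf d ^+ 2 = s (d + 1) * s (d - 1) / s d ^+ 2.
Proof. by move=> _; rewrite /Qf sqrtCK. Qed.

Lemma WtE k l i j u a : Wt k l i j u a tau =
  if i == j then ((k == i) && (l == i))%:R
  else if (k == i) && (l == j) then wst s (dif a i j) u
  else if (k == j) && (l == i) then wsw s u * Qf (dif a i j) else 0.
Proof. by []. Qed.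

Lemma Wt_tgt k l i j u a : Wt k l i j u a tau != 0 ->
  (k = i /\ l = j) \/ [/\ i != j, k = j & l = i].
Proof.
rewrite WtE; case: (eqVneq i j) => [<-|ij].
  by case: (eqVneq k i) => [->|]; case: (eqVneq l i) => [->|]; rewrite /= ?eqxx//; left.
case: ifP => [/andP[/eqP -> /eqP ->]|_]; first by left.
by case: ifP => [/andP[/eqP -> /eqP ->]|_]; [right|rewrite eqxx].
Qed.

Lemma tgtE (b : label) : aval (tgt b) = aval (src b) + eps R (dir b).
Proof. by []. Qed.

Lemma label_eq (b c : label) : src b = src c -> dir b = dir c -> b = c.
Proof.
have pair_eq (x y : alcove * 'I_n) : x.1 = y.1 -> x.2 = y.2 -> x = y.
  by case: x y => [? ?] [? ?] /= -> ->.
by move=> sb db; apply: val_inj; exact: pair_eq.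
Qed.

Lemma eps_inj : injective (@eps R n).
Proof.
move=> k l kl; apply/eqP/negPn/negP => nkl.
have := congr1 (fun v : 'rV[R]_n => v 0 k) kl; rewrite !mxE eqxx eq_sym (negbTE nkl) => /addIr /eqP.
by rewrite oner_eq0.
Qed.

Lemma label_eq_tgt (b c : label) : src b = src c -> tgt b = tgt c -> b = c.
Proof.
move=> sb tb; apply: label_eq => //; apply: eps_inj.
by have := congr1 (@aval R n ell) tb; rewrite !tgtE sb => /addrI.
Qed.

Lemma label_eq_dir (b c : label) : tgt b = tgt c -> dir b = dir c -> b = c.
Proof.
move=> tb db; apply: label_eq => //; apply: val_inj.
by have := congr1 (@aval R n ell) tb; rewrite !tgtE db => /addIr.
Qed.

Lemma Rvv_supp (b c k l : label) u : Rvv b c k l u tau != 0 ->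
  [/\ src c = tgt b, src k = src b, src l = tgt k, tgt l = tgt c &
    (k = b /\ l = c) \/ [/\ dir b != dir c, dir k = dir c & dir l = dir b]].
Proof.
rewrite /Rvv; case: ifP => [/and3P[/eqP cb /eqP kb /eqP lk]|_]; last by rewrite eqxx.
move=> /Wt_tgt[[kd ld]|[ne kd ld]].
  have kE : k = b by exact: label_eq.
  subst k; have lE : l = c by apply: label_eq => //; rewrite lk cb.
  by subst l; split => //; left.
split=> //; last by right.
apply: val_inj; change (aval (tgt l) = aval (tgt c)).
by rewrite !tgtE lk cb !tgtE kb kd ld addrAC.
Qed.

Lemma RvvE (b c k l : label) u : src c = tgt b -> src k = src b -> src l = tgt k ->
  Rvv b c k l u tau = Wt (dir k) (dir l) (dir b) (dir c) u (aval (src b)) tau.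
Proof. by move=> cb kb lk; rewrite /Rvv cb kb lk !eqxx. Qed.

(** Some wall blocks the step j at a, but not after the step i. Only a wall between i and j is
    affected by that step, so the vanishing bracket is the one at the difference of i and j. *)
Lemma s_neq_path (a : 'rV[R]_n) (i j : 'I_n) : in_alcove a -> in_alcove (a + eps R i) ->
  in_alcove (a + eps R i + eps R j) -> ~~ in_alcove (a + eps R j) -> i != j ->
  s (dif a i j - 1) = 0.
Proof.
move=> aP aiP aijP ajP ij.
have ajP1 : ~~ in_alcove (a + 1 *: eps R j) by rewrite scale1r.
have e1 : (1 == 1 :> R) || (1 == - 1 :> R) by rewrite eqxx.
have [l lj sl] := alcove_wall e1 aP ajP1.
rewrite rcD rc1 -/(dif a j l) in sl.
have [li|li] := eqVneq l i.
  move: sl; rewrite li (difN a i j) (_ : - dif a i j + 1 = - (dif a i j - 1)); last by ring.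
  by rewrite sN => /eqP; rewrite oppr_eq0 => /eqP.
have jl : j != l by rewrite eq_sym.
have := s_alcove aijP jl; rewrite -/(dif _ j l) !dif_shift eqxx (negbTE ij) [i == l]eq_sym (negbTE li) (negbTE jl).
by rewrite !addr0 !subr0 sl eqxx.
Qed.

Lemma Qf_wall (a : 'rV[R]_n) (i j : 'I_n) : in_alcove a -> in_alcove (a + eps R i) ->
  in_alcove (a + eps R i + eps R j) -> ~~ in_alcove (a + eps R j) -> i != j ->
  Qf (dif a i j) = 0.
Proof.
by move=> *; rewrite /Qf s_neq_path// mulr0 mul0r sqrtC0.
Qed.

(** When the alcove forbids the switched path, the sum over labels lacks a term that the operator on
    words has; [Qf_wall] shows that its coefficient is 0. *)
Lemma Rvv_act (b c : label) u (G : label -> label -> C) (Ge : 'I_n -> 'I_n -> C) :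
  src c = tgt b ->
  (forall k l, src k = src b -> src l = tgt k -> tgt l = tgt c -> G k l = Ge (dir k) (dir l)) ->
  \sum_k \sum_l Rvv b c k l u tau * G k l =
  wact s Qf (dif (aval (src b)) (dir b) (dir c)) u (dir b) (dir c) Ge.
Proof.
move=> cb GE; rewrite pair_bigA /= (bigD1 (b, c))//=.
have Gbc : G b c = Ge (dir b) (dir c) by apply: GE.
rewrite RvvE// Gbc WtE /wact.
have [bc|bc] := eqVneq (dir b) (dir c).
  rewrite big1 ?addr0 ?eqxx ?mul1r ?bc//.
  move=> [k l] /= ne; apply/eqP/negPn/negP; rewrite mulf_eq0 negb_or => /andP[/Rvv_supp[_ _ _ _ [[kb lc]|[nbc _ _]]]] _.
    by rewrite kb lc eqxx in ne.
  by rewrite bc eqxx in nbc.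
rewrite !eqxx /=; congr (_ + _).
have [h|h] := boolP (in_alcove (aval (src b) + eps R (dir c))).
  pose k' : label := @Label R n ell (src b, dir c) h.
  have e : aval (tgt k') + eps R (dir b) = aval (tgt c).
    rewrite (_ : aval (tgt k') = aval (src b) + eps R (dir c))//.
    by rewrite [RHS]tgtE cb tgtE addrAC.
  have h' : in_alcove (aval (tgt k') + eps R (dir b)) by rewrite e; exact: alcoveP.
  pose l' : label := @Label R n ell (tgt k', dir b) h'.
  have tl : tgt l' = tgt c by apply: val_inj; exact: e.
  rewrite (bigD1 (k', l'))/=; last first.
    by apply: contraNneq bc => -[] /(congr1 (@dir R n ell)) /= <-.
  rewrite RvvE// WtE (negbTE bc) /= [dir c == dir b]eq_sym (negbTE bc) /= !eqxx /= GE//.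
  rewrite big1 ?addr0 ?mulrA//.
  move=> [k l] /= /andP[ne1 ne2]; apply/eqP/negPn/negP; rewrite mulf_eq0 negb_or => /andP[/Rvv_supp[_ kb lk _ [[kb' lc]|[_ kd ld]]]] _.
    by rewrite kb' lc eqxx in ne1.
  have kE : k = k' by apply: label_eq.
  have lE : l = l' by apply: label_eq => //; rewrite lk kE.
  by rewrite kE lE eqxx in ne2.
rewrite Qf_wall ?mulr0 ?mul0r//; last 3 first.
- exact: alcoveP.
- exact: (labelP b).
- by have := labelP c; rewrite -[(lval c).1]/(src c) cb.
rewrite big1// => -[k l] /= ne; apply/eqP/negPn/negP; rewrite mulf_eq0 negb_or => /andP[/Rvv_supp[_ kb lk _ [[kb' lc]|[_ kd ld]]]] _.
  by rewrite kb' lc eqxx in ne.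
by case/negP: h; rewrite -kd -kb; exact: (labelP k).
Qed.

Lemma s3 : forall x y z w,
  s (x + y) * s (x - y) * (s (z + w) * s (z - w)) -
  s (x + z) * s (x - z) * (s (y + w) * s (y - w)) +
  s (x + w) * s (x - w) * (s (y + z) * s (y - z)) = 0.
Proof. by move=> x y z w; exact: (brac_three L t0). Qed.

Lemma crd_tgt (b : label) i j : crd (tgt b) i - crd (tgt b) j =
  crd (src b) i - crd (src b) j + (dir b == i)%:R - (dir b == j)%:R.
Proof. by rewrite -!difE tgtE dif_shift. Qed.

Lemma crd_neq0 (o : alcove) (i j : 'I_n) : i != j -> s (crd o i - crd o j) != 0.
Proof. by move=> ij; rewrite -difE; apply: s_alcove => //; exact: alcoveP. Qed.

Lemma rvv_yang_baxter (i j x v p q : label) (a b : C) :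
  s (1 + a) != 0 -> s (1 + b) != 0 -> s (1 + (a + b)) != 0 ->
  \sum_k \sum_l \sum_y Rvv k l p q a tau * Rvv i y v k (a + b) tau * Rvv j x y l b tau =
  \sum_k \sum_l \sum_y Rvv k y v p b tau * Rvv l x y q (a + b) tau * Rvv i j k l a tau.
Proof.
apply: (@yang_baxter _ s Qf sN s3 QfN Qf2 label alcove 'I_n (@src R n ell) (@tgt R n ell)
  (@dir R n ell) label_eq (fun o i j => dif o i j) _ _ _ _ (fun u b c k l => Rvv b c k l u tau)).
- by move=> o k l; exact: difN.
- by move=> o k l m; exact: difD.
- by move=> c k l; rewrite tgtE dif_shift.
- by move=> o k l kl; rewrite difE crd_neq0.
- by move=> c d k l u /Rvv_supp[].
- by move=> c d u G Ge; exact: Rvv_act.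
Qed.

Lemma rvv_unitarity (i j x v : label) u : s (1 + u) != 0 -> s (1 - u) != 0 ->
  \sum_y \sum_p Rvv j x y p u tau * Rvv y p i v (- u) tau =
  [&& i == j, v == x & src x == tgt j]%:R.
Proof.
apply: (@unitarity _ s Qf sN s3 QfN Qf2 label alcove 'I_n (@src R n ell) (@tgt R n ell)
  (@dir R n ell) label_eq (fun o i j => dif o i j) _ _ (fun u b c k l => Rvv b c k l u tau)).
- by move=> o k l; exact: difN.
- by move=> o k l kl; rewrite difE crd_neq0.
- by move=> c d k l w /Rvv_supp[].
- by move=> c d w G Ge; exact: Rvv_act.
Qed.

Definition isreal (x : C) := exists c : R, x = rc c.

Lemma isrealB x y : isreal x -> isreal y -> isreal (x - y).
Proof. by move=> [c ->] [d ->]; exists (c - d); rewrite rcB. Qed.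
Lemma isrealD x y : isreal x -> isreal y -> isreal (x + y).
Proof. by move=> [c ->] [d ->]; exists (c + d); rewrite rcD. Qed.

Local Notation lam := (lam R n).

Lemma lam_rc : lam = rc (- (n%:R / 2)).
Proof. by rewrite /lam rcN rcM rcV !rc_nat. Qed.

Lemma lam2 : 2 * lam = - n%:R.
Proof. by rewrite /lam; field. Qed.

Lemma label_step (e : R) (o : alcove) (k : 'I_n) : (e == 1) || (e == -1) ->
  in_alcove (aval o + e *: eps R k) \/ exists2 l, l != k & s (crd o k - crd o l + rc e) = 0.
Proof.
move=> he; have [h|h] := boolP (in_alcove (aval o + e *: eps R k)); [by left|right].
by have [l lk h2] := alcove_wall he (alcoveP o) h; exists l => //; rewrite -difE -rcD.
Qed.

Definition generic (u : C) := forall c : R, s (u + rc c) != 0.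

Lemma genericN u : generic u -> generic (- u).
Proof. by move=> g c; rewrite -[rc c]opprK -opprD -rcN sN oppr_eq0. Qed.

Lemma generic1 u : generic u -> s (1 + u) != 0.
Proof. by move=> g; rewrite addrC -rc1. Qed.

Lemma generic_lam u : generic u -> generic (lam + u).
Proof. by move=> g c; rewrite lam_rc addrAC -rcD addrC. Qed.

Definition rho2C (u : C) := wsw s (lam + u) * wsw s (lam - u).

Definition gup (o : alcove) := gfac s (crd o).
(** Along reversed arrows a step adds - eps_k; negated coordinates bring this to the shape of a
    forward step, and the value is G_(a - eps_k) / G_a. *)
Definition gdown (o : alcove) := gfac s (fun k => - crd o k).

Lemma rvv_crossing (i j v x : label) o u : generic u -> tgt i = tgt j ->
  \sum_(p | src p == o) \sum_y
    gup (src p) (dir p) * Rvv i y v p (lam + u) tau * Rvv x p j y (lam - u) tau =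
  [&& i == j, v == x, src v == src i & tgt v == o]%:R *
    (gup (src i) (dir i) * rho2C u).
Proof.
move=> gu; apply: (@crossing _ s Qf sN s3 QfN Qf2 isreal u lam n isrealB isrealD _ _ _ lam2 s_one
  label alcove (@src R n ell) (@tgt R n ell) (@dir R n ell)
  label_eq label_eq_tgt label_eq_dir (fun o => crd o) _ crd_tgt crd_neq0 _
  (fun u b c k l => Rvv b c k l u tau)) => //.
- by move=> _ [c ->].
- by exists 1; rewrite rc1.
- by rewrite lam_rc; exists (- (n%:R / 2)).
- by move=> a k; exists (aval a 0 k).
- move=> a k; have [|h|h] := @label_step 1 a k; first by rewrite eqxx.
    rewrite scale1r in h; left; by exists (@Label R n ell (a, k) h).
  by right; rewrite -rc1.
- by move=> b c k l w; exact: Rvv_supp.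
- by move=> b c w cb; rewrite RvvE// WtE; case: eqVneq => [->|ne]; rewrite ?eqxx//= -difE.
- move=> b c k l w cb kb lk ne kd ld; rewrite RvvE// WtE kd ld (negbTE ne) eq_sym (negbTE ne) /=.
  by rewrite !eqxx -difE.
Qed.

Lemma crd_tgt2 (b c : label) : src b = tgt c -> dir c != dir b ->
  dif (aval (src c)) (dir c) (dir b) = - crd (tgt b) (dir b) - - crd (tgt b) (dir c).
Proof.
move=> bc ne; rewrite difE; have := crd_tgt b (dir c) (dir b); rewrite bc (crd_tgt c) !eqxx.
rewrite [dir b == _]eq_sym (negbTE ne) => h; apply: (by_rel h (c := -1)); ring.
Qed.

(** [crossing] applied to reversed paths: sources and targets exchanged, coordinates negated, and u
    replaced by - u, which swaps the parameters lam + u and lam - u. *)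
Lemma rvv_crossing_rev (i j v x : label) o u : generic u -> src i = src j ->
  \sum_(p | tgt p == o) \sum_y
    gdown (tgt p) (dir p) * Rvv y i p v (lam - u) tau * Rvv p x y j (lam + u) tau =
  [&& i == j, v == x, tgt v == tgt i & src v == o]%:R *
    (gdown (tgt i) (dir i) * rho2C u).
Proof.
move=> gu ij; have -> : lam + u = lam - (- u) by rewrite opprK.
have -> : rho2C u = wsw s (lam + (- u)) * wsw s (lam - (- u)) by rewrite opprK mulrC.
move: ij; apply: (@crossing _ s Qf sN s3 QfN Qf2 isreal (- u) lam n isrealB isrealD _ _ _ lam2 s_one
  label alcove (@tgt R n ell) (@src R n ell) (@dir R n ell)
  label_eq_dir _ label_eq (fun o k => - crd o k) _ _ _ _
  (fun u b c k l => Rvv c b l k u tau)) => //.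
- by move=> _ [c ->]; exact: genericN.
- by exists 1; rewrite rc1.
- by rewrite lam_rc; exists (- (n%:R / 2)).
- by move=> b c tb sb; exact: label_eq_tgt.
- by move=> a k; exists (- aval a 0 k); rewrite -rcN.
- by move=> b k l; apply: (by_rel (crd_tgt b k l) (c := 1)); ring.
- by move=> a k l kl; rewrite -opprD sN oppr_eq0 crd_neq0.
- move=> a k; have [|h|[l lk h]] := @label_step (-1) a k; first by rewrite eqxx orbT.
    left; pose a' : alcove := Alcove h.
    have h' : in_alcove (aval a' + eps R k) by rewrite /= scaleN1r addrNK; exact: alcoveP.
    exists (@Label R n ell (a', k) h') => //; apply: val_inj; rewrite /= scaleN1r addrNK//.
  right; exists l => //; have -> : - crd a k - - crd a l + 1 = - (crd a k - crd a l + rc (-1)).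
    by rewrite rcN rc1; ring.
  by rewrite sN h oppr0.
- move=> b c k l w /Rvv_supp[bc lc kl tk h]; split => //.
  by case: h => [[]|[ne e1 e2]]; [left|right; split=> //; rewrite eq_sym].
- move=> b c w cb; rewrite RvvE// WtE !eqxx /=; case: (eqVneq (dir c) (dir b)) => [e|ne]; first by rewrite ?e ?eqxx.
  by rewrite (crd_tgt2 (esym cb) ne).
- move=> b c k l w cb kb lk ne kd ld.
  have lc : src l = src c.
    have e1 := tgtE l; rewrite lk ld in e1; have e2 := tgtE k; rewrite kb kd in e2.
    have e3 := tgtE b; have e4 := tgtE c; rewrite cb in e4.
    apply: val_inj; change (aval (src l) = aval (src c)).
    apply: (addIr (eps R (dir b))); apply: (addIr (eps R (dir c))).
    by rewrite -e1 -e2 e3 e4 addrAC.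
  rewrite RvvE// WtE kd ld [dir c == _]eq_sym (negbTE ne) /=.
  by rewrite !eqxx -(crd_tgt2 (esym cb)) 1?eq_sym.
Qed.

Local Notation up := (fun b => @Defs.up R n ell b tau).
Local Notation down := (fun b => @Defs.down R n ell b tau).
Local Notation G := (fun a : alcove => Gfun (aval a) tau).

Lemma Gfun_gt0 (a : alcove) : 0 < G a.
Proof.
apply: prodr_gt0 => i _; apply: prodr_gt0 => j ij.
exact: (s_alcove_pos (alcoveP a) ij).
Qed.

(** Only the factors involving the direction k of the step change. The quotient [f] is symmetric in
    its indices, so the pairs with k in first and in second place merge into one product over l
    different from k. *)
Lemma Gfun_tgt (b : label) : G (tgt b) = gup (src b) (dir b) * G (src b).
Proof.
set k := dir b; pose d i j := crd (src b) i - crd (src b) j.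
pose d' i j := crd (tgt b) i - crd (tgt b) j.
have d'E i j : d' i j = d i j + (k == i)%:R - (k == j)%:R by exact: crd_tgt.
pose f i j := s (d' i j) / s (d i j).
have GE (a : alcove) : G a = \prod_(i < n) \prod_(j < n | (i < j)%N) s (crd a i - crd a j).
  by apply: eq_bigr => i _; apply: eq_bigr => j _; rewrite -rcB.
have -> : G (tgt b) = (\prod_(i < n) \prod_(j < n | (i < j)%N) f i j) * G (src b).
  rewrite !GE -big_split /=; apply: eq_bigr => i _; rewrite -big_split /=; apply: eq_bigr => j ij.
  have ne : i != j by rewrite neq_ltn ij.
  by rewrite /f mulfVK//; exact: crd_neq0.
congr (_ * _).
have fC i j : f i j = f j i.
  by rewrite /f /d /d' -opprB sN -(opprB (crd _ j)) sN invrN mulrNN.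
have f1 (i j : 'I_n) : (i < j)%N -> i != k -> j != k -> f i j = 1.
  move=> ij ik jk; rewrite /f d'E ![k == _]eq_sym (negbTE ik) (negbTE jk) addr0 subr0.
  by rewrite divff// crd_neq0// neq_ltn ij.
rewrite (bigD1 k)//= [X in _ * X = _](eq_bigr (fun i : 'I_n => if (i < k)%N then f k i else 1)); last first.
  move=> i ik; case: ifP => [ltk|nlt].
    rewrite (bigD1 k)//= fC big1 ?mulr1// => j /andP[ij jk]; exact: f1.
  by rewrite big1// => j ij; apply: f1 => //; apply: contraFneq nlt => <-.
transitivity (\prod_(l | l != k) f k l); last first.
  apply: eq_bigr => l lk; rewrite /f d'E eqxx [k == l]eq_sym (negbTE lk) subr0.
  by [].
rewrite [RHS](bigID (fun l : 'I_n => (k < l)%N))/=; congr (_ * _).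
  by apply: eq_bigl => l; rewrite neq_ltn; case: ltngtP.
rewrite -big_mkcondr; apply: eq_bigl => l; rewrite -leqNgt neq_ltn.
by case: (ltngtP l k).
Qed.

Lemma gup_gt0 (b : label) : 0 < gup (src b) (dir b).
Proof. by have := Gfun_gt0 (tgt b); rewrite Gfun_tgt pmulr_lgt0// Gfun_gt0. Qed.

Lemma up2 (b : label) : up b ^+ 2 = gup (src b) (dir b).
Proof. by rewrite sqrtCK Gfun_tgt mulfK// gt_eqF// Gfun_gt0. Qed.

Lemma gdown_gup (b : label) : gdown (tgt b) (dir b) = (gup (src b) (dir b))^-1.
Proof.
rewrite /gdown /gup /gfac -prodfV; apply: eq_bigr => l lb.
have e : crd (tgt b) (dir b) - crd (tgt b) l = crd (src b) (dir b) - crd (src b) l + 1.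
  by rewrite crd_tgt eqxx eq_sym (negbTE lb) subr0.
have -> : - crd (tgt b) (dir b) - - crd (tgt b) l + 1 = - (crd (src b) (dir b) - crd (src b) l).
  by apply: (by_rel e (c := -1)); ring.
have -> : - crd (tgt b) (dir b) - - crd (tgt b) l = - (crd (src b) (dir b) - crd (src b) l + 1).
  by rewrite -e; ring.
by rewrite !sN invrN mulrNN [RHS]invf_div.
Qed.

Lemma up_down (b : label) : up b * down b = 1.
Proof.
have ge (a c : alcove) : 0 <= G a / G c by rewrite divr_ge0 ?ltW ?Gfun_gt0.
rewrite /Defs.up /Defs.down -sqrtCM ?nnegrE//.
by rewrite mulrA mulfVK ?divff ?sqrtC1// gt_eqF ?Gfun_gt0.
Qed.

Lemma down2 (b : label) : down b ^+ 2 = gdown (tgt b) (dir b).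
Proof.
rewrite gdown_gup -up2; apply: (mulfI (_ : up b ^+ 2 != 0)).
  by rewrite up2 gt_eqF// gup_gt0.
by rewrite -exprMn up_down expr1n divff// up2 gt_eqF// gup_gt0.
Qed.

(** Both products telescope to the square root of G at the end divided by G at the start of the
    two-step path. *)
Lemma up_path (b c k l : label) : src c = tgt b -> src k = src b -> src l = tgt k ->
  tgt l = tgt c -> up b * up c = up k * up l.
Proof.
have ge (a c' : alcove) : 0 <= G a / G c' by rewrite divr_ge0 ?ltW ?Gfun_gt0.
have E (b' c' : label) : src c' = tgt b' -> up b' * up c' = sqrtC (G (tgt c') / G (src b')).
  move=> bc; rewrite /Defs.up -sqrtCM ?nnegrE// bc mulrC mulrA mulfVK// gt_eqF// Gfun_gt0//.
move=> cb kb lk lc; refine (etrans (E _ _ cb) (esym (etrans (E _ _ lk) _))).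
by rewrite kb lc.
Qed.

Lemma up_Rvv (b c k l : label) u : up b * up c * Rvv b c k l u tau = up k * up l * Rvv b c k l u tau.
Proof.
have [e|/Rvv_supp[cb kb lk lc _]] := eqVneq (Rvv b c k l u tau) 0.
  exact: mulr_eq0l e.
exact: (congr1 (fun z => z * Rvv b c k l u tau) (up_path cb kb lk lc)).
Qed.

Lemma RdvE (b c k l : label) u :
  Rdv b c k l u tau = down b * up l * Rvv c l b k (lam - u) tau.
Proof.
rewrite /Rdv (bigD1 l)//= [X in _ + X]big1 ?addr0 => [|m ml]; last first.
  by rewrite big1// => j _; rewrite /sigmas (negbTE ml) mulr0.
rewrite (bigD1 b)//= big1 ?addr0 => [|j jb]; last first.
  by rewrite /omegas eq_sym (negbTE jb) !mul0r.
by rewrite /omegas /sigmas !eqxx mulrAC.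
Qed.

Lemma RvdE (b c k l : label) u :
  Rvd b c k l u tau = down k * up c * Rvv k b l c (lam - u) tau.
Proof.
rewrite /Rvd (bigD1 k)//= [X in _ + X]big1 ?addr0 => [|j jk]; last first.
  by rewrite big1// => m _; rewrite /sigma eq_sym (negbTE jk) mulr0.
rewrite (bigD1 c)//= big1 ?addr0 => [|m mc]; last by rewrite /omega (negbTE mc) !mul0r.
rewrite /omega /sigma !eqxx; exact: mul_rot.
Qed.

(** Two quarter turns restore the parameter, lam - (lam - u) = u, and the four gauge factors cancel
    because the products of [up] along the two paths agree. *)
Lemma RddE (b c k l : label) u : Rdd b c k l u tau = Rvv l k c b u tau.
Proof.
transitivity (down k * up c * Rvd k b l c (lam - u) tau).
  rewrite /Rdd (bigD1 k)//= [X in _ + X]big1 ?addr0 => [|j jk]; last first.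
    by rewrite big1// => m _; rewrite /sigma eq_sym (negbTE jk) mulr0.
  rewrite (bigD1 c)//= big1 ?addr0 => [|m mc]; last by rewrite /omega (negbTE mc) !mul0r.
  rewrite /omega /sigma !eqxx; exact: mul_rot.
rewrite RvdE subKr; refine (etrans (mul_regroup _ _ _ _ _) _).
refine (etrans (congr1 (fun z => _ * z) (esym (up_Rvv l k c b u))) _).
exact: mul_cancel (up_down k) (up_down l).
Qed.

Definition exchange (Rs X Y : label -> label -> label -> label -> C -> C -> C) (u1 u2 tau : C) :=
  forall i j p q v x,
  \sum_k \sum_l \sum_y Rs k l p q (u1 - u2) tau * (X i y v k u1 tau * Y j x y l u2 tau) =
  \sum_k \sum_l \sum_y Rs i j k l (u1 - u2) tau * (Y k y v p u2 tau * X l x y q u1 tau).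

Local Notation W := (fun u b c k l => Rvv b c k l u tau).

Lemma ybeW a b : s (1 + a) != 0 -> s (1 + b) != 0 -> s (1 + (a + b)) != 0 -> ybe W a b.
Proof. by move=> a0 b0 ab0 i j x v p q; exact: rvv_yang_baxter. Qed.

Lemma WsuppW b c k l u : W u b c k l != 0 -> src k = src b /\ tgt l = tgt c.
Proof. by case/Rvv_supp. Qed.

Lemma exchangeVV u1 u2 : generic u1 -> generic u2 -> generic (u1 - u2) ->
  exchange Rvv Rvv Rvv u1 u2 tau.
Proof.
move=> g1 g2 g12 i j p q v x; apply: (exchange_vv (W := W)); apply: ybeW; rewrite ?subrK generic1//.
Qed.

Lemma exchangeDV u1 u2 : generic u1 -> generic u2 -> generic (u1 - u2) ->
  exchange (@Rdv R n ell) (@Rdv R n ell) Rvv u1 u2 tau.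
Proof.
move=> g1 g2 g12 i j p q v x.
have h : ybe W u2 (lam - u1).
  apply: ybeW; rewrite ?generic1//; first exact/generic_lam/genericN.
  by rewrite (_ : u2 + _ = lam + - (u1 - u2)) ?generic1//; [exact/generic_lam/genericN|ring].
have := exchange_dv up_down i j p q v x h; rewrite /Wdual => e.
transitivity (\sum_k \sum_l \sum_y down k * up q * Rvv l q k p (lam - (u1 - u2)) tau *
  (down i * up k * Rvv y k i v (lam - u1) tau * Rvv j x y l u2 tau)).
  by do 3!apply: eq_bigr => ? _; rewrite !RdvE.
by rewrite e; do 3!apply: eq_bigr => ? _; rewrite !RdvE.
Qed.

Lemma exchangeDD u1 u2 : generic u1 -> generic u2 -> generic (u1 - u2) ->
  exchange (@Rdd R n ell) (@Rdv R n ell) (@Rdv R n ell) u1 u2 tau.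
Proof.
move=> g1 g2 g12 i j p q v x.
have h : ybe W (lam - u1) (u1 - u2).
  apply: ybeW; rewrite ?generic1//; first exact/generic_lam/genericN.
  by rewrite (_ : lam - u1 + _ = lam + - u2) ?generic1//; [exact/generic_lam/genericN|ring].
have := exchange_dd up_down (fun u b c k l => @up_Rvv b c k l u) i j p q v x h; rewrite /Wdual => e.
transitivity (\sum_k \sum_l \sum_y Rvv q p l k (u1 - u2) tau *
  (down i * up k * Rvv y k i v (lam - u1) tau * (down j * up l * Rvv x l j y (lam - u2) tau))).
  by do 3!apply: eq_bigr => ? _; rewrite !RdvE RddE.
by rewrite e; do 3!apply: eq_bigr => ? _; rewrite !RdvE RddE.
Qed.

Lemma rho2E u : @rho2 R n ell u tau = rho2C u.
Proof.
rewrite /rho2 /rho2C /wsw !addrA; move: (s (1 + lam + u)) (s (1 + lam - u)) => a b.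
by rewrite invfM; ring.
Qed.

Lemma unitW u e : generic u -> e = u \/ e = - u -> forall i j x v : label,
  \sum_y \sum_p W e j x y p * W (- e) y p i v = [&& i == j, v == x & src x == tgt j]%:R.
Proof.
move=> gu h i j x v; apply: rvv_unitarity; apply: generic1.
  by case: h => ->; [exact: gu|exact: genericN].
by case: h => ->; [exact: genericN|rewrite opprK; exact: gu].
Qed.

Lemma crossW u : generic u -> forall (i j v x : label) (o : alcove), tgt i = tgt j ->
  \sum_(p | src p == o) \sum_y up p ^+ 2 * W (lam + u) i y v p * W (lam - u) x p j y =
  [&& i == j, v == x, src v == src i & tgt v == o]%:R * (up i ^+ 2 * @rho2 R n ell u tau).
Proof.
move=> gu i j v x o ij.
refine (etrans _ (etrans (rvv_crossing v x o gu ij) _)); last first.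
  exact: (congr2 (fun a b => _ * (a * b)) (esym (up2 i)) (esym (rho2E u))).
apply: eq_bigr => p _; apply: eq_bigr => y _.
exact: (congr1 (fun a => a * _ * _) (up2 p)).
Qed.

Lemma crossW_rev u : generic u -> forall (i j v x : label) (o : alcove), src i = src j ->
  \sum_(p | tgt p == o) \sum_y down p ^+ 2 * W (lam - u) y i p v * W (lam + u) p x y j =
  [&& i == j, v == x, tgt v == tgt i & src v == o]%:R * (down i ^+ 2 * @rho2 R n ell u tau).
Proof.
move=> gu i j v x o ij.
refine (etrans _ (etrans (rvv_crossing_rev v x o gu ij) _)); last first.
  exact: (congr2 (fun a b => _ * (a * b)) (esym (down2 i)) (esym (rho2E u))).
apply: eq_bigr => p _; apply: eq_bigr => y _.
exact: (congr1 (fun a => a * _ * _) (down2 p)).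
Qed.

Lemma rel_omegaE u (i j v x : label) (o : alcove) : generic u -> tgt i = tgt j ->
  \sum_(p | src p == o) \sum_q \sum_y Defs.omega p q tau * (Rvv i y v p (u + lam) tau * Rdv j x y q u tau) =
  Defs.omega i j tau * (@rho2 R n ell u tau * [&& v == x, src v == src i & tgt v == o]%:R).
Proof.
move=> gu ij.
refine (etrans _ (pairing_omega (W := W) (lam := lam) (up := up) (down := down) up_down (crossW gu) o v x ij)).
do 3!apply: eq_bigr => ? _; exact: (congr1 (fun z => _ * (_ * z)) (RdvE _ _ _ _ _)).
Qed.

Lemma rel_sigmaE u (i j v x : label) (o : alcove) : generic u -> src i = src j ->
  \sum_(p | tgt p == o) \sum_q \sum_y Defs.sigma p q tau * (Rdv p y v i u tau * Rvv q x y j (u + lam) tau) =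
  Defs.sigma i j tau * (@rho2 R n ell u tau * [&& v == x, src v == o & tgt v == tgt i]%:R).
Proof.
move=> gu ij.
refine (etrans _ (pairing_sigma (W := W) (lam := lam) (up := up) (down := down) up_down (crossW_rev gu) o v x ij)).
do 3!apply: eq_bigr => ? _; exact: (congr1 (fun z => _ * (z * _)) (RdvE _ _ _ _ _)).
Qed.

Lemma rel_omegasE u (i j v x : label) (o : alcove) : generic u -> src i = src j ->
  \sum_(p | tgt p == o) \sum_q \sum_y Defs.omegas p q tau * (Rdv i y v p (u + lam) tau * Rvv j x y q u tau) =
  Defs.omegas i j tau * [&& v == x, src v == tgt i & tgt v == o]%:R.
Proof.
move=> gu ij.
refine (etrans _ (pairing_omegas (W := W) (up := up) (down := down) lam up_down WsuppW (fun e => @unitW u e gu) o v x ij)).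
do 3!apply: eq_bigr => ? _; exact: (congr1 (fun z => _ * (z * _)) (RdvE _ _ _ _ _)).
Qed.

Lemma rel_sigmasE u (i j v x : label) (o : alcove) : generic u -> tgt i = tgt j ->
  \sum_(p | src p == o) \sum_q \sum_y Defs.sigmas p q tau * (Rvv p y v i u tau * Rdv q x y j (u + lam) tau) =
  Defs.sigmas i j tau * [&& v == x, src v == o & tgt v == src i]%:R.
Proof.
move=> gu ij.
refine (etrans _ (pairing_sigmas (W := W) (up := up) (down := down) lam up_down WsuppW (fun e => @unitW u e gu) o v x ij)).
do 3!apply: eq_bigr => ? _; exact: (congr1 (fun z => _ * (_ * z)) (RdvE _ _ _ _ _)).
Qed.

End Good.
End Labels.

(** * Identities between coefficients *)

Section TripleSeries.
Variables (R : realType) (L : R).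
Hypothesis L0 : 0 < L.
Local Notation C := (cplx R).
Local Notation rc := (@rc R).
Local Notation nm := (@nm R).
Local Notation zvar := (zvar L).
Local Notation wvar := (wvar L).
Local Notation expands := (expands L).
Local Notation near0 := (near0 L).
Local Notation small := (small L).

Definition cv2 (X Y : ser R) : ser R := fun m k =>
  \sum_(m1 < m.+1) \sum_(k1 < k.+1) X m1 k1 * Y (m - m1)%N (k - k1)%N.

Definition cv3 (F G : nat -> nat -> nat -> C) a b c : C :=
  \sum_(a1 < a.+1) \sum_(b1 < b.+1) \sum_(c1 < c.+1)
    F a1 b1 c1 * G (a - a1)%N (b - b1)%N (c - c1)%N.

Definition at1 (X : ser R) (a b c : nat) : C := if a == b then X c a else 0.
Definition at2 (X : ser R) (a b c : nat) : C := if a == c then X a b else 0.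

Lemma sum_spl (V : nmodType) (k : nat * nat) (F : nat * nat -> nat * nat -> V) :
  \sum_(x <- spl k) F x.1 x.2 =
  \sum_(i < k.1.+1) \sum_(j < k.2.+1) F (val i, val j) ((k.1 - i)%N, (k.2 - j)%N).
Proof.
rewrite /spl big_allpairs_dep -[k.1.+1]subn0 -/(index_iota 0 _) big_mkord subn0.
by apply: eq_bigr => i _; rewrite -[k.2.+1]subn0 -/(index_iota 0 _) big_mkord subn0.
Qed.

Lemma convE X Y m k : conv X Y m k = cv2 X Y m k.
Proof. exact: (sum_spl (m, k) (fun x y => X x.1 x.2 * Y y.1 y.2)). Qed.

Definition spl3 (k : nat * nat * nat) : seq ((nat * nat * nat) * (nat * nat * nat)) :=
  [seq ((x.1, c), (x.2, (k.2 - c)%N)) | x <- spl k.1, c <- iota 0 k.2.+1].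

Definition add3 (x : (nat * nat * nat) * (nat * nat * nat)) : nat * nat * nat :=
  (add2 (x.1.1, x.2.1), (x.1.2 + x.2.2)%N).

Lemma uniq_spl3 k : uniq (spl3 k).
Proof.
apply: allpairs_uniq; rewrite ?uniq_spl ?iota_uniq//.
by move=> [[x1 x2] c] [[y1 y2] d] _ _ [-> -> ->].
Qed.

Lemma mem_spl3 x k : (x \in spl3 k) = (add3 x == k).
Proof.
apply/idP/eqP.
  case/allpairsP => -[y c] [yk ck ->]; move: yk ck.
  rewrite mem_spl mem_iota /= add0n ltnS => /eqP yk ck.
  by rewrite /add3 /= -surjective_pairing yk subnKC//; case: k {yk ck}.
case: x => -[x1 c1] [x2 c2] <-; apply/allpairsP; exists ((x1, x2), c1).
by rewrite mem_spl eqxx mem_iota /= add0n ltnS leq_addr addKn.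
Qed.

Lemma sum_spl3 (V : nmodType) a b c (F : nat * nat * nat -> nat * nat * nat -> V) :
  \sum_(x <- spl3 (a, b, c)) F x.1 x.2 =
  \sum_(i < a.+1) \sum_(j < b.+1) \sum_(l < c.+1)
    F (val i, val j, val l) ((a - i)%N, (b - j)%N, (c - l)%N).
Proof.
rewrite /spl3 big_allpairs_dep.
rewrite -(sum_spl (a, b) (fun x y => \sum_(l < c.+1) F (x, val l) (y, (c - l)%N))).
apply: eq_bigr => x _.
by rewrite -[c.+1]subn0 -/(index_iota 0 _) big_mkord subn0.
Qed.

Definition mon3 (z1 z2 w : C) (i : nat * nat * nat) : C :=
  z1 ^+ i.1.1 * z2 ^+ i.1.2 * w ^+ i.2.

Definition sum3 (F : nat -> nat -> nat -> C) z1 z2 w (s : C) :=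
  hsum (fun i : nat * nat * nat => F i.1.1 i.1.2 i.2 * mon3 z1 z2 w i) s.

Lemma sum3_cv3 F G z1 z2 w s t : sum3 F z1 z2 w s -> sum3 G z1 z2 w t ->
  sum3 (cv3 F G) z1 z2 w (s * t).
Proof.
move=> h1 h2; have := hsum_fiber uniq_spl3 mem_spl3 (hsum_prod h1 h2).
apply: eq_hsum => -[[a b] c].
rewrite /cv3 -(sum_spl3 a b c (fun x y => F x.1.1 x.1.2 x.2 * G y.1.1 y.1.2 y.2)) mulr_suml.
apply: eq_big_seq => x; rewrite mem_spl3 => /eqP[<- <- <-].
by rewrite /mon3 !exprD; ring.
Qed.

Lemma sum3_at12 X z1 z2 w s : hsum (fun i => X i.1 i.2 * mon z1 (z2 * w) i) s ->
  sum3 (at_u12 X) z1 z2 w s.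
Proof.
move=> h; apply: (hsum_inj (g := fun j : nat * nat => (j.2, j.1, j.1))
  (q := fun i => if i.1.2 == i.2 then Some (i.2, i.1.1) else None)).
- by move=> [m k] /=; rewrite eqxx.
- move=> [[a b] c] /= ne; rewrite /at_u12; case: eqP => [bc|_]; last by rewrite mul0r.
  by have := ne (c, a); rewrite bc eqxx.
- apply: eq_hsum h => -[m k]; rewrite /= /at_u12 eqxx /mon /mon3 /= exprMn.
  by ring.
Qed.

Lemma sum3_at1 X z1 z2 w s : hsum (fun i => X i.1 i.2 * mon (z1 * z2) w i) s ->
  sum3 (at1 X) z1 z2 w s.
Proof.
move=> h; apply: (hsum_inj (g := fun j : nat * nat => (j.2, j.2, j.1))
  (q := fun i => if i.1.1 == i.1.2 then Some (i.2, i.1.1) else None)).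
- by move=> [m k] /=; rewrite eqxx.
- move=> [[a b] c] /= ne; rewrite /at1; case: eqP => [ab|_]; last by rewrite mul0r.
  by have := ne (c, a); rewrite ab eqxx.
- apply: eq_hsum h => -[m k]; rewrite /= /at1 eqxx /mon /mon3 /= exprMn.
  by ring.
Qed.

Lemma sum3_at2 X z1 z2 w s : hsum (fun i => X i.1 i.2 * mon z2 (z1 * w) i) s ->
  sum3 (at2 X) z1 z2 w s.
Proof.
move=> h; apply: (hsum_inj (g := fun j : nat * nat => (j.1, j.2, j.1))
  (q := fun i => if i.1.1 == i.2 then Some (i.1.1, i.1.2) else None)).
- by move=> [m k] /=; rewrite eqxx.
- move=> [[a b] c] /= ne; rewrite /at2; case: eqP => [ac|_]; last by rewrite mul0r.
  by have := ne (a, b); rewrite ac eqxx.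
- apply: eq_hsum h => -[m k]; rewrite /= /at2 eqxx /mon /mon3 /= exprMn.
  by ring.
Qed.

(* The three substitutions of the exchange relations: u1 - u2, u1 and u2 are
   small as soon as zvar (u1 - u2), zvar u2 and wvar u1 are. *)
Definition small3 (r : R) (u1 u2 : C) (t : R) := [/\ 0 < t, nm (zvar (u1 - u2)) < r,
  nm (zvar u2) < r & nm (wvar u1 (itau t)) < r].

Lemma zvar3 u1 u2 : zvar u1 = zvar (u1 - u2) * zvar u2.
Proof. by rewrite -zvarD subrK. Qed.

Lemma wvar3_12 u1 u2 t : wvar (u1 - u2) t = zvar u2 * wvar u1 t.
Proof. by rewrite wvarD opprK mulrC. Qed.

Lemma wvar3_2 u1 u2 t : wvar u2 t = zvar (u1 - u2) * wvar u1 t.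
Proof.
have {1}-> : u2 = u1 + (u2 - u1) by rewrite addrCA subrr addr0.
by rewrite wvarD opprB mulrC.
Qed.

Lemma small3_all r u1 u2 t : r <= 1 -> small3 r u1 u2 t ->
  [/\ small r (u1 - u2) t, small r u1 t & small r u2 t].
Proof.
move=> r1 [t0 h1 h2 h3].
have m (x y : C) : nm x < r -> nm y < r -> nm (x * y) < r.
  move=> xr yr; have x1 := lt_le_trans xr r1.
  rewrite nmM; apply: le_lt_trans yr; rewrite -[X in _ <= X]mul1r.
  by rewrite ler_wpM2r ?nm_ge0// ltW.
split; split=> //.
- by rewrite wvar3_12; apply: m.
- by rewrite (zvar3 u1 u2); apply: m.
- by rewrite (wvar3_2 u1 u2); apply: m.
Qed.

Lemma expands_near3 f X : expands f X -> exists2 r, 0 < r & forall u t, small r u t ->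
  hsum (fun i => X i.1 i.2 * mon (zvar u) (wvar u (itau t)) i) (f u (itau t)).
Proof. by move=> [r [r0 _ h]]; exists r. Qed.

Section Exchange.
Variables (T : finType) (Rs X Y : T -> T -> T -> T -> C -> C -> C).
Variables (RS XS YS : T -> T -> T -> T -> ser R).
Hypotheses (hR : forall i j p q, expands (Rs i j p q) (RS i j p q))
  (hX : forall i j p q, expands (X i j p q) (XS i j p q))
  (hY : forall i j p q, expands (Y i j p q) (YS i j p q)).

(** When z1, z2 and w are small, so are the variables belonging to u1 - u2, u1 and u2. Both sides
    are then values of convergent triple series, and [expansion_unique3] applies to their
    difference. *)
Lemma exchange_coef (r : R) i j p q v x : 0 < r ->
  (forall u1 u2 t, small3 r u1 u2 t ->
    \sum_k \sum_l \sum_y Rs k l p q (u1 - u2) (itau t) * (X i y v k u1 (itau t) * Y j x y l u2 (itau t)) =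
    \sum_k \sum_l \sum_y Rs i j k l (u1 - u2) (itau t) * (Y k y v p u2 (itau t) * X l x y q u1 (itau t))) ->
  forall a b c,
  \sum_k \sum_l \sum_y cv3 (at_u12 (RS k l p q)) (cv3 (at1 (XS i y v k)) (at2 (YS j x y l))) a b c =
  \sum_k \sum_l \sum_y cv3 (at_u12 (RS i j k l)) (cv3 (at2 (YS k y v p)) (at1 (XS l x y q))) a b c.
Proof.
move=> r0 ex a b c.
have all4 (F : T -> T -> T -> T -> C -> C -> C) (FS : T -> T -> T -> T -> ser R) :
    (forall i j p q, expands (F i j p q) (FS i j p q)) -> exists2 r, 0 < r &
    forall i j p q u t, small r u t -> hsum (fun l => FS i j p q l.1 l.2 *
      mon (zvar u) (wvar u (itau t)) l) (F i j p q u (itau t)).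
  move=> hF; have : near0 (fun u t => forall k : T * T * T * T,
      hsum (fun l => FS k.1.1.1 k.1.1.2 k.1.2 k.2 l.1 l.2 *
      mon (zvar u) (wvar u (itau t)) l) (F k.1.1.1 k.1.1.2 k.1.2 k.2 u (itau t))).
    by apply: near0_all => k; have [s s0 h] := expands_near3 (hF k.1.1.1 k.1.1.2 k.1.2 k.2); exists s.
  by move=> [s s0 h]; exists s => // i' j' p' q' u t st; exact: (h u t st (i', j', p', q')).
have [r1 r10 kR] := all4 _ _ hR; have [r2 r20 kX] := all4 _ _ hX; have [r3 r30 kY] := all4 _ _ hY.
pose rm := Num.min (Num.min r 1) (Num.min r1 (Num.min r2 r3)).
have rm0 : 0 < rm by rewrite !lt_min r0 r10 r20 r30 ltr01.
have [rr rm1] : rm <= r /\ rm <= 1 by rewrite !ge_min !lexx ?orbT.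
have [rmr1 [rmr2 rmr3]] : rm <= r1 /\ rm <= r2 /\ rm <= r3 by rewrite !ge_min !lexx ?orbT.
apply/eqP; rewrite -subr_eq0; apply/eqP; move: a b c.
apply: (expansion_unique3 L0 (r := rm)) => // u1 u2 t t0 h1 h2 h3.
have s3 : small3 rm u1 u2 t by [].
have [s12 s1 s2] := small3_all rm1 s3.
have A i' j' p' q' : sum3 (at_u12 (RS i' j' p' q')) (zvar (u1 - u2)) (zvar u2) (wvar u1 (itau t))
    (Rs i' j' p' q' (u1 - u2) (itau t)).
  by apply: sum3_at12; rewrite -wvar3_12; apply: kR; exact: small_le s12.
have B i' j' p' q' : sum3 (at1 (XS i' j' p' q')) (zvar (u1 - u2)) (zvar u2) (wvar u1 (itau t))
    (X i' j' p' q' u1 (itau t)).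
  by apply: sum3_at1; rewrite -zvar3; apply: kX; exact: small_le s1.
have D i' j' p' q' : sum3 (at2 (YS i' j' p' q')) (zvar (u1 - u2)) (zvar u2) (wvar u1 (itau t))
    (Y i' j' p' q' u2 (itau t)).
  by apply: sum3_at2; rewrite -wvar3_2; apply: kY; exact: small_le s2.
have e := ex u1 u2 t (And4 t0 (lt_le_trans h1 rr) (lt_le_trans h2 rr) (lt_le_trans h3 rr)).
have H (F : T -> T -> T -> nat -> nat -> nat -> C) (f : T -> T -> T -> C) :
    (forall k l y, sum3 (F k l y) (zvar (u1 - u2)) (zvar u2) (wvar u1 (itau t)) (f k l y)) ->
    sum3 (fun a b c => \sum_k \sum_l \sum_y F k l y a b c) (zvar (u1 - u2)) (zvar u2) (wvar u1 (itau t))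
      (\sum_k \sum_l \sum_y f k l y).
  move=> h; rewrite /sum3; apply: eq_hsum; last first.
    apply: hsum_sum => k _; apply: hsum_sum => l _; apply: hsum_sum => y _; exact: (h k l y).
  move=> k; rewrite mulr_suml; apply: eq_bigr => ? _; rewrite mulr_suml; apply: eq_bigr => ? _.
  by rewrite mulr_suml.
have := hsumB (H _ _ (fun k l y => sum3_cv3 (A k l p q) (sum3_cv3 (B i y v k) (D j x y l))))
  (H _ _ (fun k l y => sum3_cv3 (A i j k l) (sum3_cv3 (D k y v p) (B l x y q)))).
rewrite e subrr; apply: eq_hsum => k; by rewrite -mulrBl.
Qed.

End Exchange.
End TripleSeries.

Section FieldFractions.
Variable K : fieldType.
Implicit Types a b c d : K.

Lemma frac_split a b c d : a * b / (c * d) = a / d * (b / c).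
Proof. by rewrite invfM; ring. Qed.

Lemma frac_opp a b : a / b = (- a) / (- b).
Proof. by rewrite invrN mulrNN. Qed.

Lemma frac_sgn a b c : a * (- b / c) = a * (- 1) * (b / c).
Proof. by ring. Qed.

Lemma mulr_zero a b : b = 0 -> a * b = 0.
Proof. by move=> ->; rewrite mulr0. Qed.

Lemma shift_exponent p c l k m :
  p * c / l * (k - m) = k * (p * (c / l)) + m * (p * (- c / l)).
Proof. by ring. Qed.

End FieldFractions.

(** * Existence of the expansions of all weights and pairings *)

Section WeightExpansions.
Variables (R : realType) (n ell : nat).
Hypothesis n2 : (2 <= n)%N.
Local Notation C := (cplx R).
Local Notation rc := (@rc R).
Local Notation L := (Lev R n ell).
Local Notation label := (label R n ell).
Local Notation alcove := (alcove R n ell).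
Local Notation expands := (expands L).
Local Notation expandable := (expandable L).
Local Notation near0 := (near0 L).
Local Notation br := (brac L).
Local Notation lam := (lam R n).
Local Notation Lpos := (L0 R ell n2).

Definition good (t : R) := forall d : nat, (0 < d < ell + n)%N -> 0 < br (rc d%:R) (itau t).

Lemma near0_good : near0 (fun _ => good).
Proof.
have : near0 (fun _ t => forall d : 'I_(ell + n), (0 < d)%N -> 0 < br (rc d%:R) (itau t)).
  apply: near0_all => d; have [d0|d0] := boolP (0 < d)%N; last by apply: near0_true.
  have dL : 0 < (d%:R : R) < L by rewrite ltr0n d0 ltr_nat ltn_ord.
  by apply: near0_imp (brac_pos Lpos dL) => u t _ h _.
apply: near0_imp => u t _ h d /andP[d0 dL]; exact: (h (Ordinal dL)).
Qed.

(** Three grades: an expansion ([xp]), one with nonzero constant term as division requires ([nzx]),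
    one with positive constant term as square roots require ([posx]). *)
Definition xp (f : C -> C -> C) := exists X, expands f X.
Definition nzx (f : C -> C -> C) := exists2 c, c != 0 & expandable f c.
Definition posx (f : C -> C -> C) := exists2 c : R, 0 < c & expandable f (rc c).

Lemma xp_expansion f : xp f -> expands f (expansion L f).
Proof. by move=> [X hX]; rewrite (expansionE Lpos hX). Qed.

Lemma xp_ext f g : near0 (fun u t => f u (itau t) = g u (itau t)) -> xp f -> xp g.
Proof. by move=> h [X hX]; exists X; exact: expands_ext hX. Qed.

Lemma xp_eq f g : (forall u t, 0 < t -> f u (itau t) = g u (itau t)) -> xp f -> xp g.
Proof. by move=> h; apply/xp_ext/near0_true. Qed.

Lemma xpM f g : xp f -> xp g -> xp (fun u t => f u t * g u t).
Proof. by move=> [X hX] [Y hY]; exists (conv X Y); exact: expands_mul. Qed.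

Lemma xp_cst c : xp (fun _ _ => c).
Proof. by exists (cst_ser c); exact: expands_cst. Qed.

Lemma nzx_xp f : nzx f -> xp f.
Proof. by move=> [c _ [X hX _]]; exists X. Qed.

Lemma posx_nzx f : posx f -> nzx f.
Proof. by move=> [c c0 h]; exists (rc c) => //; rewrite rc_eq0 gt_eqF. Qed.

Lemma posx_xp f : posx f -> xp f.
Proof. by move=> /posx_nzx/nzx_xp. Qed.

Lemma nzxM f g : nzx f -> nzx g -> nzx (fun u t => f u t * g u t).
Proof. by move=> [a a0 ha] [b b0 hb]; exists (a * b); [rewrite mulf_neq0|exact: expandable_mul]. Qed.

Lemma nzxV f : nzx f -> nzx (fun u t => (f u t)^-1).
Proof. by move=> [a a0 ha]; exists a^-1; [rewrite invr_eq0|exact: expandable_inv]. Qed.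

Lemma nzx_eq f g : (forall u t, 0 < t -> f u (itau t) = g u (itau t)) -> nzx f -> nzx g.
Proof. by move=> h [a a0 ha]; exists a => //; apply: expandable_ext ha; exact: near0_true. Qed.

Lemma posx_eq f g : (forall u t, 0 < t -> f u (itau t) = g u (itau t)) -> posx f -> posx g.
Proof. by move=> h [a a0 ha]; exists a => //; apply: expandable_ext ha; exact: near0_true. Qed.

Lemma posxM f g : posx f -> posx g -> posx (fun u t => f u t * g u t).
Proof.
by move=> [a a0 ha] [b b0 hb]; exists (a * b); [rewrite mulr_gt0|rewrite rcM; exact: expandable_mul].
Qed.

Lemma posx_prod (J : Type) (r : seq J) (P : pred J) (f : J -> C -> C -> C) :
  (forall j, P j -> posx (f j)) -> posx (fun u t => \prod_(j <- r | P j) f j u t).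
Proof.
move=> h; elim: r => [|j r IH].
  exists 1 => //; rewrite rc1; apply: expandable_ext (expandable_cst L 1).
  by apply: near0_true => u t _; rewrite big_nil.
have [Pj|Pj] := boolP (P j).
  by apply: posx_eq (posxM (h j Pj) IH) => u t _; rewrite big_cons Pj.
by apply: posx_eq IH => u t _; rewrite big_cons (negbTE Pj).
Qed.

Lemma posx_sqrt f : posx f -> near0 (fun u t => 0 <= f u (itau t)) ->
  posx (fun u t => sqrtC (f u t)).
Proof.
move=> [c c0 h] f0; exists (Num.sqrt c); first by rewrite sqrtr_gt0.
by apply: expandable_sqrt => //; rewrite ?sqrtr_gt0// sqr_sqrtr// ltW.
Qed.

Lemma posx_cst (d d' : nat) : (0 < d < ell + n)%N -> (0 < d' < ell + n)%N ->
  posx (fun _ tau => br (rc d%:R) tau / br (rc d'%:R) tau).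
Proof.
move=> dP dP'; have h (e : nat) : (0 < e < ell + n)%N -> 0 < (e%:R : R) < L.
  by rewrite ltr0n ltr_nat.
by have [c c0 hc] := brac_cst_expandable Lpos (h d dP) (h d' dP'); exists c.
Qed.

Lemma posx_Gfun (a b : alcove) : posx (fun _ tau => Gfun ell (aval a) tau / Gfun ell (aval b) tau).
Proof.
pose f (i j : 'I_n) (u tau : C) := br (rc (aval a 0 i - aval a 0 j)) tau / br (rc (aval b 0 i - aval b 0 j)) tau.
have H : posx (fun u tau => \prod_(i < n) \prod_(j < n | (i < j)%N) f i j u tau).
  apply: posx_prod => i _; apply: posx_prod => j ij.
  have [d dP dE] := alcove_gap n2 (alcoveP a) ij; have [e eP eE] := alcove_gap n2 (alcoveP b) ij.
  by rewrite /f dE eE; exact: posx_cst.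
apply: posx_eq H => u t _; rewrite /Gfun.
rewrite -prodfV -big_split; apply: eq_bigr => i _.
by rewrite -prodfV -big_split.
Qed.

Lemma posx_sqrtG (a b : alcove) :
  posx (fun _ tau => sqrtC (Gfun ell (aval a) tau / Gfun ell (aval b) tau)).
Proof.
apply: posx_sqrt (posx_Gfun a b) _; apply: near0_imp near0_good => u t t0 gt.
apply: divr_ge0; apply: ltW; exact: (Gfun_gt0 n2 gt).
Qed.

Lemma xp_up (b : label) : xp (fun _ => Defs.up b).
Proof. exact/posx_xp/posx_sqrtG. Qed.

Lemma xp_down (b : label) : xp (fun _ => Defs.down b).
Proof. exact/posx_xp/posx_sqrtG. Qed.

(** Next to a wall, for m = 1 or m = L - 1, a bracket under the root vanishes identically and the
    function is 0. Otherwise all arguments lie strictly between 0 and L, and the radicand has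
    positive constant term. *)
Lemma xp_Qnat (m : nat) : (0 < m < ell + n)%N -> xp (fun _ tau =>
  sqrtC (br (rc m%:R + 1) tau * br (rc m%:R - 1) tau / br (rc m%:R) tau ^+ 2)).
Proof.
move=> /andP[m0 mL]; have e1 : rc m%:R + 1 = rc m.+1%:R by rewrite -natr1 rcD rc1.
have e2 : rc m%:R - 1 = rc m.-1%:R.
  by rewrite -{1}(prednK m0) -natr1 rcD rc1 addrK.
rewrite e1 e2.
have [m1|m1] := eqVneq m.-1 0%N.
  apply: xp_eq (xp_cst 0) => u t t0.
  have z : br (rc m.-1%:R) (itau t) = 0 by rewrite m1 rc0; exact: (s0 (sN n ell t0)).
  by rewrite z mulr0 mul0r sqrtC0.
have [m2|m2] := eqVneq m.+1 (ell + n)%N.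
  apply: xp_eq (xp_cst 0) => u t t0.
  have z : br (rc m.+1%:R) (itau t) = 0 by rewrite m2; exact: (sL ell n2 t0).
  by rewrite z !mul0r sqrtC0.
have h1 : (0 < m.+1 < ell + n)%N by rewrite /= ltn_neqAle m2 mL.
have h2 : (0 < m.-1 < ell + n)%N by rewrite lt0n m1 (leq_ltn_trans (leq_pred _) mL).
have h0 : (0 < m < ell + n)%N by rewrite m0.
apply/posx_xp/posx_sqrt.
  apply: posx_eq (posxM (posx_cst h1 h0) (posx_cst h2 h0)) => u t _.
  by rewrite expr2 mulf_div.
apply: near0_imp near0_good => u t _ gt.
apply: divr_ge0; last exact: exprn_ge0 (ltW (gt _ h0)).
exact: mulr_ge0 (ltW (gt _ h1)) (ltW (gt _ h2)).
Qed.

Lemma xp_Q (a : alcove) (i j : 'I_n) : i != j -> xp (fun _ tau =>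
  let d := rc (aval a 0 i - aval a 0 j) in sqrtC (br (d + 1) tau * br (d - 1) tau / br d tau ^+ 2)).
Proof.
rewrite neq_ltn => /orP[] h; have [d dP dE] := alcove_gap n2 (alcoveP a) h.
  by rewrite dE; exact: xp_Qnat.
rewrite -(opprB (aval a 0 j)) dE.
by apply: xp_eq (xp_Qnat dP) => u t t0; rewrite rcN; exact/esym/(QfN n ell t0).
Qed.

Lemma xp_one_ratio (a : alcove) (i j : 'I_n) : i != j ->
  xp (fun _ tau => br 1 tau / br (rc (aval a 0 i - aval a 0 j)) tau).
Proof.
have n1 : (0 < 1 < ell + n)%N by rewrite /= (leq_trans n2)// leq_addl.
rewrite neq_ltn => /orP[] h; have [d dP dE] := alcove_gap n2 (alcoveP a) h.
  by rewrite dE -rc1; exact/posx_xp/(posx_cst n1 dP).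
rewrite -(opprB (aval a 0 j)) dE.
apply: xp_eq (xpM (xp_cst (-1)) (posx_xp (posx_cst n1 dP))) => u t t0.
have e := bracN L (rc d%:R) t0; rewrite rcN.
by apply: etrans (esym (congr1 (fun z => _ / z) e)); rewrite rc1 invrN mulrN mulN1r.
Qed.

Lemma nzx_ratio (e : bool) (a b : R) :
  nzx (fun u tau => br ((-1) ^+ e * u + rc a) tau / br ((-1) ^+ e * u + rc b) tau).
Proof.
case: e; last first.
  have [c c0 h] := brac_ratio_expandable Lpos a b; exists c => //.
  by apply: expandable_ext h; apply: near0_true => u t _; rewrite expr0 mul1r.
have [c c0 h] := brac_ratio_expandable Lpos (- a) (- b); exists c => //.
apply: expandable_ext h; apply: near0_true => u t t0.
have e z : (-1) ^+ true * u + rc z = - (u + rc (- z)) by rewrite expr1 mulN1r rcN opprD opprK.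
rewrite (e a) (e b); apply: etrans (esym (congr2 (fun x y => x / y) (bracN L _ t0) (bracN L _ t0))).
exact: frac_opp.
Qed.

(** The affine argument with either sign of u covers u itself and lam - u, so the weight and its
    quarter turn are treated together. *)
Lemma xp_Wt (e : bool) (c : R) (k l i j : 'I_n) (a : alcove) :
  xp (fun u => Wt ell k l i j ((-1) ^+ e * u + rc c) (aval a)).
Proof.
rewrite /Wt; case: (eqVneq i j) => [_|ij]; first exact: xp_cst.
set d := aval a 0 i - aval a 0 j.
case: ((k == i) && (l == j)).
  apply: xp_eq (xpM (xpM (xp_one_ratio a ij) (xp_cst (-1))) (nzx_xp (nzx_ratio e (c - d) (1 + c)))) => u t t0.
  refine (esym (etrans (frac_split _ _ _ _) _)).
  set v := (-1) ^+ e * u.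
  have -> : v + rc (1 + c) = 1 + (v + rc c) by rewrite rcD rc1; ring.
  have h := bracN L (v + rc (c - d)) t0.
  rewrite -(_ : rc d - (v + rc c) = - (v + rc (c - d))) in h; last by rewrite (rcB c); ring.
  have -> : br (rc d - (v + rc c)) (itau t) = - br (v + rc (c - d)) (itau t) by exact: h.
  exact: frac_sgn.
case: ((k == j) && (l == i)); last exact: xp_cst.
apply: xpM (xp_Q a ij).
apply: xp_eq (nzx_xp (nzx_ratio e c (1 + c))) => u t _.
refine (congr1 (fun z => br _ (itau t) / br z (itau t)) _).
by rewrite (rcD 1 c) rc1; ring.
Qed.

Lemma xp_Rvv_aff (e : bool) (c : R) (i j k l : label) :
  xp (fun u => Rvv i j k l ((-1) ^+ e * u + rc c)).
Proof.
rewrite /Rvv; case: [&& src j == tgt i, src k == src i & src l == tgt k]; last exact: xp_cst.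
exact: xp_Wt.
Qed.

Lemma xp_Rvv (i j k l : label) : xp (Rvv i j k l).
Proof.
apply: xp_eq (xp_Rvv_aff false 0 i j k l) => u t _.
by rewrite expr0 mul1r rc0 addr0.
Qed.

Lemma xp_Rdv (i j k l : label) : xp (Rdv i j k l).
Proof.
apply: xp_eq (xpM (xpM (xp_down i) (xp_up l)) (xp_Rvv_aff true (- (n%:R / 2)) j l i k)) => u t t0.
refine (etrans _ (esym (RdvE t i j k l u))).
refine (congr1 (fun z => _ * Rvv j l i k z (itau t)) _).
by rewrite -lam_rc expr1 mulN1r addrC.
Qed.

Lemma xp_Rdd (i j k l : label) : xp (Rdd i j k l).
Proof.
apply: xp_ext (xp_Rvv l k j i); apply: near0_imp near0_good => u t _ gt.
exact/esym/(RddE n2 gt).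
Qed.

Lemma xp_omega (b c : label) : xp (fun _ => Defs.omega b c).
Proof. by rewrite /Defs.omega; case: (b == c); [exact: xp_up|exact: xp_cst]. Qed.

Lemma xp_sigma (b c : label) : xp (fun _ => Defs.sigma b c).
Proof. by rewrite /Defs.sigma; case: (b == c); [exact: xp_down|exact: xp_cst]. Qed.

(** The nonzero constant term provides the series of the inverse, by which the xi^- generators
    act. *)
Lemma nzx_rho2 : nzx (@rho2 R n ell).
Proof.
pose c := - (n%:R / 2) : R.
apply: nzx_eq (nzxM (nzx_ratio false c (1 + c)) (nzx_ratio true c (1 + c))) => u t t0.
refine (etrans (mulf_div _ _ _ _) _).
have e1 : (-1) ^+ false * u + rc c = lam + u by rewrite expr0 mul1r lam_rc addrC.
have e2 : (-1) ^+ true * u + rc c = lam - u by rewrite expr1 mulN1r lam_rc addrC.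
have e3 : (-1) ^+ false * u + rc (1 + c) = 1 + lam + u.
  by rewrite expr0 mul1r lam_rc (rcD 1 c) rc1 addrC.
have e4 : (-1) ^+ true * u + rc (1 + c) = 1 + lam - u.
  by rewrite expr1 mulN1r lam_rc (rcD 1 c) rc1 addrC.
by rewrite e1 e2 e3 e4.
Qed.

End WeightExpansions.

(** * The relations between matrix elements, coefficient by coefficient *)

Section CoefficientRelations.
Variables (R : realType) (n ell : nat).
Hypothesis n2 : (2 <= n)%N.
Local Notation C := (cplx R).
Local Notation rc := (@rc R).
Local Notation L := (Lev R n ell).
Local Notation label := (label R n ell).
Local Notation alcove := (alcove R n ell).
Local Notation expands := (expands L).
Local Notation near0 := (near0 L).
Local Notation lam := (lam R n).
Local Notation Lpos := (L0 R ell n2).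
Local Notation good := (@good R n ell).
Local Notation generic := (generic n ell).
Local Notation Rvv_ser := (@Rvv_ser R n ell).
Local Notation Rdv_ser := (@Rdv_ser R n ell).
Local Notation Rdd_ser := (@Rdd_ser R n ell).
Local Notation rho2_ser := (rho2_ser R n ell).
Local Notation rho2V_ser := (rho2V_ser R n ell).

Lemma near0_generic : near0 (fun u t => good t /\ generic t u).
Proof. exact: near0_and (near0_good _ _ n2) (brac_shift_neq0 Lpos). Qed.

Lemma near3_generic : exists2 r, 0 < r & forall u1 u2 t, small3 L r u1 u2 t ->
  [/\ 0 < t, good t, generic t u1, generic t u2 & generic t (u1 - u2)].
Proof.
have [r r0 h] := near0_generic; exists (Num.min r 1); first by rewrite lt_min r0 ltr01.
move=> u1 u2 t st; have [rr r1] : Num.min r 1 <= r /\ Num.min r 1 <= 1 by rewrite !ge_min !lexx orbT.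
have [s12 s1 s2] := small3_all r1 st; have t0 : 0 < t by case: st.
by split=> //; [case: (h _ _ (small_le rr s1))|case: (h _ _ (small_le rr s1))|
  case: (h _ _ (small_le rr s2))|case: (h _ _ (small_le rr s12))].
Qed.

Lemma Rvv_expands i j k l : expands (Rvv i j k l) (Rvv_ser i j k l).
Proof. exact/(xp_expansion n2)/(xp_Rvv n2). Qed.
Lemma Rdv_expands i j k l : expands (Rdv i j k l) (Rdv_ser i j k l).
Proof. exact/(xp_expansion n2)/(xp_Rdv n2). Qed.
Lemma Rdd_expands i j k l : expands (Rdd i j k l) (Rdd_ser i j k l).
Proof. exact/(xp_expansion n2)/(xp_Rdd n2). Qed.

Definition exchange_series (RS XS YS : label -> label -> label -> label -> ser R) :=
  forall i j p q v x a b c,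
  \sum_k \sum_l \sum_y cv3 (at_u12 (RS k l p q)) (cv3 (at1 (XS i y v k)) (at2 (YS j x y l))) a b c =
  \sum_k \sum_l \sum_y cv3 (at_u12 (RS i j k l)) (cv3 (at2 (YS k y v p)) (at1 (XS l x y q))) a b c.

Lemma exchange_seriesVV : exchange_series Rvv_ser Rvv_ser Rvv_ser.
Proof.
move=> i j p q v x; have [r r0 h] := near3_generic.
apply: (exchange_coef Lpos Rvv_expands Rvv_expands Rvv_expands r0).
by move=> u1 u2 t /h[t0 gt g1 g2 g12]; exact: (exchangeVV n2 t0 gt g1 g2 g12).
Qed.

Lemma exchange_seriesDV : exchange_series Rdv_ser Rdv_ser Rvv_ser.
Proof.
move=> i j p q v x; have [r r0 h] := near3_generic.
apply: (exchange_coef Lpos Rdv_expands Rdv_expands Rvv_expands r0).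
by move=> u1 u2 t /h[t0 gt g1 g2 g12]; exact: (exchangeDV n2 t0 gt g1 g2 g12).
Qed.

Lemma exchange_seriesDD : exchange_series Rdd_ser Rdv_ser Rdv_ser.
Proof.
move=> i j p q v x; have [r r0 h] := near3_generic.
apply: (exchange_coef Lpos Rdd_expands Rdv_expands Rdv_expands r0).
by move=> u1 u2 t /h[t0 gt g1 g2 g12]; exact: (exchangeDD n2 t0 gt g1 g2 g12).
Qed.

Lemma expands_sum (J : Type) (r : seq J) (P : pred J) (f : J -> C -> C -> C) (X : J -> ser R) :
  (forall j, expands (f j) (X j)) ->
  expands (fun u t => \sum_(j <- r | P j) f j u t) (fun m k => \sum_(j <- r | P j) X j m k).
Proof.
move=> h; elim: r => [|j r IH].
  have -> : (fun m k => \sum_(j <- [::] | P j) X j m k) = cst_ser (0 : C).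
    by apply/funext => m; apply/funext => k; rewrite big_nil /cst_ser; case: ifP.
  apply: expands_ext (expands_cst L 0); apply: near0_true => u t _.
  exact/esym/big_nil.
have [Pj|Pj] := boolP (P j).
  have -> : (fun m k => \sum_(j <- j :: r | P j) X j m k) =
      (fun m k => X j m k + \sum_(j <- r | P j) X j m k).
    by apply/funext => m; apply/funext => k; rewrite big_cons Pj.
  apply: expands_ext (expands_add (h j) IH); apply: near0_true => u t _.
  by rewrite big_cons Pj.
have -> : (fun m k => \sum_(j <- j :: r | P j) X j m k) = (fun m k => \sum_(j <- r | P j) X j m k).
  by apply/funext => m; apply/funext => k; rewrite big_cons (negbTE Pj).
by apply: expands_ext IH; apply: near0_true => u t _; rewrite big_cons (negbTE Pj).
Qed.

Lemma expands_cv2 f g X Y : expands f X -> expands g Y ->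
  expands (fun u t => f u t * g u t) (cv2 X Y).
Proof.
move=> hX hY; have -> : cv2 X Y = conv X Y by apply/funext => m; apply/funext => k; rewrite convE.
exact: expands_mul.
Qed.

(** The scalar counterpart of [shift] at lam, with the two phases of z and w merged in one
    exponential. *)
Definition shift_ser (X : ser R) : ser R := fun m k =>
  cexp (twopii R * lam / L%:C%C * (k%:R - m%:R)) * X m k.

Lemma expands_shift_lam f X : expands f X -> expands (fun u => f (u + lam)) (shift_ser X).
Proof.
move=> h; rewrite lam_rc.
have -> : shift_ser X = (fun m k => zvar L (rc (- (n%:R / 2))) ^+ k *
    zvar L (- rc (- (n%:R / 2))) ^+ m * X m k).
  apply/funext => m; apply/funext => k; rewrite /shift_ser lam_rc.
  refine (congr1 (fun z => z * X m k) (etrans (congr1 (@cexp R) (shift_exponent _ _ _ _ _)) _)).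
  exact: etrans (cexpD _ _) (congr2 *%R (cexpMn _ _) (cexpMn _ _)).
exact: expands_shift.
Qed.

Lemma coef_eq f g X Y : near0 (fun u t => f u (itau t) = g u (itau t)) ->
  expands f X -> expands g Y -> X = Y.
Proof. by move=> fg hX hY; apply: (expands_unique Lpos) hY; exact: expands_ext hX. Qed.

Lemma rho2_expands : expands (@rho2 R n ell) rho2_ser.
Proof. exact/(xp_expansion n2)/nzx_xp/nzx_rho2. Qed.
Lemma rho2V_expands : expands (fun u tau => (@rho2 R n ell u tau)^-1) rho2V_ser.
Proof. exact/(xp_expansion n2)/nzx_xp/nzxV/nzx_rho2. Qed.

Lemma rho2_ser_inv m k : cv2 rho2_ser rho2V_ser m k = cst_ser 1 m k.
Proof.
have [c c0 h] := nzx_rho2 R ell n2.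
apply: (congr1 (fun X : ser R => X m k)).
apply: coef_eq (expands_cv2 rho2_expands rho2V_expands) (expands_cst L 1).
apply: near0_imp (expandable_neq0 h c0) => u t _ ne; exact: mulfV.
Qed.

Lemma cv2C (X Y : ser R) m k : cv2 X Y m k = cv2 Y X m k.
Proof.
rewrite /cv2 (reindex_inj rev_ord_inj) /=; apply: eq_bigr => i _.
rewrite (reindex_inj rev_ord_inj) /=; apply: eq_bigr => j _.
by rewrite mulrC !subSS !subKn// -ltnS.
Qed.

Lemma scaled_expands f X (b : bool) : expands f X ->
  expands (fun u t => f u t * b%:R) (fun m k => X m k * b%:R).
Proof.
move=> h; have -> : (fun m k => X m k * b%:R) = (fun m k => b%:R * X m k).
  by apply/funext => m; apply/funext => k; exact: mulrC.
by apply: expands_ext (expands_scale b%:R h); apply: near0_true => u t _; exact: mulrC.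
Qed.

Section Pairings.
Variables (i j : label) (o : alcove) (v x : label) (m k : nat).

Lemma coef_omega : tgt i = tgt j ->
  \sum_(p : label | src p == o) \sum_q \sum_y cv2 (omega_ser p q) (cv2 (shift_ser (Rvv_ser i y v p)) (Rdv_ser j x y q)) m k =
  cv2 (omega_ser i j) (fun m k => rho2_ser m k * [&& v == x, src v == src i & tgt v == o]%:R) m k.
Proof.
move=> ij; apply: (congr1 (fun X : ser R => X m k) (x := fun m k => _)).
have he (p q : label) : expands (fun _ => Defs.omega p q) (omega_ser p q).
  exact: (xp_expansion n2 (xp_omega n2 p q)).
apply: coef_eq; last first.
- exact: expands_cv2 (he i j) (scaled_expands _ rho2_expands).
- apply: expands_sum => p; apply: expands_sum => q; apply: expands_sum => y.
  exact: expands_cv2 (he p q) (expands_cv2 (expands_shift_lam (Rvv_expands i y v p)) (Rdv_expands j x y q)).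
- by apply: near0_imp near0_generic => u t t0 [gt gu]; exact: (rel_omegaE n2 t0 gt).
Qed.

Lemma coef_sigma : src i = src j ->
  \sum_(p : label | tgt p == o) \sum_q \sum_y cv2 (sigma_ser p q) (cv2 (Rdv_ser p y v i) (shift_ser (Rvv_ser q x y j))) m k =
  cv2 (sigma_ser i j) (fun m k => rho2_ser m k * [&& v == x, src v == o & tgt v == tgt i]%:R) m k.
Proof.
move=> ij; apply: (congr1 (fun X : ser R => X m k) (x := fun m k => _)).
have he (p q : label) : expands (fun _ => Defs.sigma p q) (sigma_ser p q).
  exact: (xp_expansion n2 (xp_sigma n2 p q)).
apply: coef_eq; last first.
- exact: expands_cv2 (he i j) (scaled_expands _ rho2_expands).
- apply: expands_sum => p; apply: expands_sum => q; apply: expands_sum => y.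
  exact: expands_cv2 (he p q) (expands_cv2 (Rdv_expands p y v i) (expands_shift_lam (Rvv_expands q x y j))).
- by apply: near0_imp near0_generic => u t t0 [gt gu]; exact: (rel_sigmaE n2 t0 gt).
Qed.

Lemma coef_omegas : src i = src j ->
  \sum_(p : label | tgt p == o) \sum_q \sum_y cv2 (omegas_ser p q) (cv2 (shift_ser (Rdv_ser i y v p)) (Rvv_ser j x y q)) m k =
  cv2 (omegas_ser i j) (cst_ser [&& v == x, src v == tgt i & tgt v == o]%:R) m k.
Proof.
move=> ij; apply: (congr1 (fun X : ser R => X m k) (x := fun m k => _)).
have he (p q : label) : expands (fun _ => Defs.omegas p q) (omegas_ser p q).
  exact: (xp_expansion n2 (xp_sigma n2 p q)).
apply: coef_eq; last first.
- exact: expands_cv2 (he i j) (expands_cst L _).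
- apply: expands_sum => p; apply: expands_sum => q; apply: expands_sum => y.
  exact: expands_cv2 (he p q) (expands_cv2 (expands_shift_lam (Rdv_expands i y v p)) (Rvv_expands j x y q)).
- by apply: near0_imp near0_generic => u t t0 [gt gu]; exact: (rel_omegasE n2 t0 gt).
Qed.

Lemma coef_sigmas : tgt i = tgt j ->
  \sum_(p : label | src p == o) \sum_q \sum_y cv2 (sigmas_ser p q) (cv2 (Rvv_ser p y v i) (shift_ser (Rdv_ser q x y j))) m k =
  cv2 (sigmas_ser i j) (cst_ser [&& v == x, src v == o & tgt v == src i]%:R) m k.
Proof.
move=> ij; apply: (congr1 (fun X : ser R => X m k) (x := fun m k => _)).
have he (p q : label) : expands (fun _ => Defs.sigmas p q) (sigmas_ser p q).
  exact: (xp_expansion n2 (xp_omega n2 p q)).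
apply: coef_eq; last first.
- exact: expands_cv2 (he i j) (expands_cst L _).
- apply: expands_sum => p; apply: expands_sum => q; apply: expands_sum => y.
  exact: expands_cv2 (he p q) (expands_cv2 (Rvv_expands p y v i) (expands_shift_lam (Rdv_expands q x y j))).
- by apply: near0_imp near0_generic => u t t0 [gt gu]; exact: (rel_sigmasE n2 t0 gt).
Qed.

End Pairings.

Lemma ser_eq0 f (X : ser R) m k : expands f X -> (forall u t, f u (itau t) = 0) -> X m k = 0.
Proof.
move=> h f0; have -> : X = cst_ser 0.
  by apply: (coef_eq _ h (expands_cst L 0)); apply: near0_true => u t _; exact: f0.
by rewrite /cst_ser; case: ifP.
Qed.

(** Off the composable quadruples the function is identically 0, hence so is the chosen series; this
    makes the matrices of the generators homogeneous of the prescribed degree. *)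
Lemma Rvv_ser_supp (b x y c : label) m k : Rvv_ser b x y c m k != 0 ->
  deg y = (src b, src c) /\ deg x = (tgt b, tgt c).
Proof.
move=> ne; have [//|no] := pselect (deg y = (src b, src c) /\ deg x = (tgt b, tgt c)).
case/eqP: ne; apply: ser_eq0 (Rvv_expands b x y c) _ => u t.
apply/eqP/negPn/negP => /Rvv_supp[xb yb cy cx _]; case: no.
by rewrite /deg yb cy xb cx.
Qed.

Lemma Rdv_ser_supp (b x y c : label) m k : Rdv_ser b x y c m k != 0 ->
  deg y = (tgt b, tgt c) /\ deg x = (src b, src c).
Proof.
move=> ne; have [//|no] := pselect (deg y = (tgt b, tgt c) /\ deg x = (src b, src c)).
case/eqP: ne; apply: ser_eq0 (Rdv_expands b x y c) _ => u t.
refine (etrans (RdvE t b x y c u) _); apply: mulr_zero.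
apply/eqP/negPn/negP => /Rvv_supp[cx bx yb yc _]; case: no.
by rewrite /deg yb -yc cx bx.
Qed.

End CoefficientRelations.

(** * The representation *)

Section Representation.
Variables (R : realType) (n ell : nat).
Hypothesis n2 : (2 <= n)%N.
Local Notation C := (cplx R).
Local Notation L := (Lev R n ell).
Local Notation label := (label R n ell).
Local Notation alcove := (alcove R n ell).
Local Notation arrow := (arrow R n ell).
Local Notation term := (@term R n ell).
Local Notation tot := (@tot R n ell).
Local Notation lam := (lam R n).
Local Notation Rvv_ser := (@Rvv_ser R n ell).
Local Notation Rdv_ser := (@Rdv_ser R n ell).
Local Notation Rdd_ser := (@Rdd_ser R n ell).
Local Notation rho2_ser := (rho2_ser R n ell).
Local Notation rho2V_ser := (rho2V_ser R n ell).

Definition xi_ser (e : bool) : ser R := if e then rho2_ser else rho2V_ser.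

Definition genmat (g : generator R n ell) (y x : label) : C :=
  match g with
  | gT b c m k => Rvv_ser b x y c m k
  | gTs b c m k => Rdv_ser b x y c m k
  | gxi e f m k => xi_ser e m k * ((y == x) && (deg x == f))%:R
  end.

(** Terms act as matrices indexed by all labels, whatever their degree. Homogeneity is recovered as
    the support property [ev_supp], by which a product over all labels is one over the labels of the
    middle arrow. *)
Fixpoint ev f g (s : term f g) : label -> label -> C :=
  match s with
  | tgen a => genmat a
  | tone f => fun y x => ((y == x) && (deg x == f))%:R
  | tzero f g => fun _ _ => 0
  | tadd f g s1 s2 => fun y x => ev s1 y x + ev s2 y x
  | tscale f g c s1 => fun y x => c * ev s1 y x
  | tmul f g h s1 s2 => fun y x => \sum_z ev s1 y z * ev s2 z x
  end.

Lemma genmat_supp a y x : genmat a y x != 0 -> deg y = gtop a /\ deg x = gbot a.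
Proof.
case: a => [b c m k|b c m k|e f m k] /=.
- by move=> /(Rvv_ser_supp n2).
- by move=> /(Rdv_ser_supp n2).
- by rewrite mulf_eq0 negb_or pnatr_eq0 eqb0 negbK => /andP[_ /andP[/eqP -> /eqP ->]].
Qed.

Lemma ev_supp f g (s : term f g) y x : ev s y x != 0 -> deg y = f /\ deg x = g.
Proof.
elim: s y x => {f g} [a|f|f g|f g s1 IH1 s2 IH2|f g c s1 IH1|f g h s1 IH1 s2 IH2] y x /=.
- exact: genmat_supp.
- by rewrite pnatr_eq0 eqb0 negbK => /andP[/eqP -> /eqP ->].
- by rewrite eqxx.
- have [e1|/IH1//] := eqVneq (ev s1 y x) 0.
  have [e2|/IH2//] := eqVneq (ev s2 y x) 0.
  by rewrite e1 e2 addr0 eqxx.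
- by rewrite mulf_eq0 negb_or => /andP[_ /IH1].
- move=> ne; have [z] : exists z, ev s1 y z * ev s2 z x != 0.
    apply: contrapT => no; case/eqP: ne; apply: big1 => z _; apply/eqP/negPn/negP => nz.
    by apply: no; exists z.
  by rewrite mulf_eq0 negb_or => /andP[/IH1[-> _] /IH2[_ ->]].
Qed.

Lemma ev_off f g (s : term f g) y x : (deg y != f) || (deg x != g) -> ev s y x = 0.
Proof.
by move=> h; apply/eqP/negPn/negP => /ev_supp[yf xg]; rewrite yf xg !eqxx in h.
Qed.

(** A family of homogeneous components amounts to one matrix, since the entry (y, x) can only come
    from the component with top [deg y] and bottom [deg x]. The casts and omitted products of [tot]
    become plain matrix operations. *)
Definition tmat (T : tot) (y x : label) : C := ev (T (deg y) (deg x)) y x.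

Lemma tmat_ev (T : tot) f g y x :
  ev (T f g) y x = if (deg y == f) && (deg x == g) then tmat T y x else 0.
Proof.
case: ifP => [/andP[/eqP <- /eqP <-]//|/negbT]; rewrite negb_and; exact: ev_off.
Qed.

Lemma tmat_of f g (s : term f g) y x : tmat (tot_of s) y x = ev s y x.
Proof.
rewrite /tmat /tot_of; case: eqP => [ef|/eqP ne]; last by rewrite [RHS]ev_off// [deg y == f]eq_sym ne.
case: eqP => [eg|/eqP ne]; last by rewrite [RHS]ev_off// [deg x == g]eq_sym ne orbT.
by case: _ / ef; case: _ / eg.
Qed.

Lemma tmat0 y x : tmat (@tot0 R n ell) y x = 0. Proof. by []. Qed.
Lemma tmatD S T y x : tmat (tot_add S T) y x = tmat S y x + tmat T y x. Proof. by []. Qed.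
Lemma tmat_sum (J : Type) (r : seq J) (P : pred J) (F : J -> tot) y x :
  tmat (\big[@tot_add R n ell/@tot0 R n ell]_(j <- r | P j) F j) y x = \sum_(j <- r | P j) tmat (F j) y x.
Proof. exact: (big_morph (fun T => tmat T y x) (fun S T => tmatD S T y x) (tmat0 y x)). Qed.

Lemma tmatM S T y x : tmat (tot_mul S T) y x = \sum_z tmat S y z * tmat T z x.
Proof.
rewrite /tmat /tot_mul.
rewrite (big_morph (fun s : term (deg y) (deg x) => ev s y x) (id1 := 0) (op1 := +%R))//=.
rewrite exchange_big /=; apply: eq_bigr => z _; rewrite (bigD1 (deg z))//= big1 ?addr0// => g ne.
by rewrite [X in X * _]ev_off ?mul0r// [deg z == g]eq_sym ne orbT.
Qed.

Lemma tmat_conv2_scale (om : ser R) (X : nat -> nat -> tot) m k y x :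
  tmat (conv2 (@tot_scale R n ell) om X m k) y x = cv2 om (fun m k => tmat (X m k) y x) m k.
Proof. by rewrite tmat_sum; apply: eq_bigr => i _; rewrite tmat_sum. Qed.

Lemma tmat_conv2_mul (X Y : nat -> nat -> tot) m k y x :
  tmat (conv2 (@tot_mul R n ell) X Y m k) y x =
  \sum_z cv2 (fun m k => tmat (X m k) y z) (fun m k => tmat (Y m k) z x) m k.
Proof.
rewrite tmat_sum [RHS]exchange_big; apply: eq_bigr => i _.
rewrite tmat_sum [RHS]exchange_big; apply: eq_bigr => j _; exact: tmatM.
Qed.

Lemma cv2_sumr (om : ser R) (F : label -> ser R) m k :
  cv2 om (fun m k => \sum_z F z m k) m k = \sum_z cv2 om (F z) m k.
Proof.
rewrite [RHS]exchange_big; apply: eq_bigr => i _; rewrite [RHS]exchange_big; apply: eq_bigr => j _.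
exact: mulr_sumr.
Qed.

Lemma tmat_scal2_mul2 (om : ser R) (X Y : nat -> nat -> tot) (XS YS : label -> ser R) m k y x :
  (forall z m k, tmat (X m k) y z = XS z m k) -> (forall z m k, tmat (Y m k) z x = YS z m k) ->
  tmat (conv2 (@tot_scale R n ell) om (conv2 (@tot_mul R n ell) X Y) m k) y x =
  \sum_z cv2 om (cv2 (XS z) (YS z)) m k.
Proof.
move=> hX hY; rewrite tmat_conv2_scale -cv2_sumr; congr (cv2 om _ m k).
apply/funext => m'; apply/funext => k'; rewrite tmat_conv2_mul; apply: eq_bigr => z _.
by congr (cv2 _ _ m' k'); apply/funext => a; apply/funext => b.
Qed.

Lemma tmat_conv3_scale (om : nat -> nat -> nat -> C) (X : nat -> nat -> nat -> tot) a b c y x :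
  tmat (conv3 (@tot_scale R n ell) om X a b c) y x = cv3 om (fun a b c => tmat (X a b c) y x) a b c.
Proof.
rewrite tmat_sum; apply: eq_bigr => i _; rewrite tmat_sum; apply: eq_bigr => j _.
exact: tmat_sum.
Qed.

Lemma tmat_conv3_mul (X Y : nat -> nat -> nat -> tot) a b c y x :
  tmat (conv3 (@tot_mul R n ell) X Y a b c) y x =
  \sum_z cv3 (fun a b c => tmat (X a b c) y z) (fun a b c => tmat (Y a b c) z x) a b c.
Proof.
rewrite tmat_sum [RHS]exchange_big; apply: eq_bigr => i _.
rewrite tmat_sum [RHS]exchange_big; apply: eq_bigr => j _.
rewrite tmat_sum [RHS]exchange_big; apply: eq_bigr => k _; exact: tmatM.
Qed.

Lemma cv3_sumr (om : nat -> nat -> nat -> C) (F : label -> nat -> nat -> nat -> C) a b c :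
  cv3 om (fun a b c => \sum_z F z a b c) a b c = \sum_z cv3 om (F z) a b c.
Proof.
rewrite [RHS]exchange_big; apply: eq_bigr => i _; rewrite [RHS]exchange_big; apply: eq_bigr => j _.
rewrite [RHS]exchange_big; apply: eq_bigr => k _; exact: mulr_sumr.
Qed.

Lemma tmat_scal3_mul3 (om : nat -> nat -> nat -> C) (X Y : nat -> nat -> nat -> tot)
    (XS YS : label -> nat -> nat -> nat -> C) a b c y x :
  (forall z a b c, tmat (X a b c) y z = XS z a b c) -> (forall z a b c, tmat (Y a b c) z x = YS z a b c) ->
  tmat (conv3 (@tot_scale R n ell) om (conv3 (@tot_mul R n ell) X Y) a b c) y x =
  \sum_z cv3 om (cv3 (XS z) (YS z)) a b c.
Proof.
move=> hX hY; rewrite tmat_conv3_scale -cv3_sumr; congr (cv3 om _ a b c).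
apply/funext => a'; apply/funext => b'; apply/funext => c'; rewrite tmat_conv3_mul; apply: eq_bigr => z _.
by congr (cv3 _ _ a' b' c'); apply/funext => i; apply/funext => j; apply/funext => k.
Qed.

Lemma tmat_at1 (X : nat -> nat -> tot) (XS : ser R) y x : (forall m k, tmat (X m k) y x = XS m k) ->
  forall a b c, tmat (at_u1 X a b c) y x = at1 XS a b c.
Proof. by move=> h a b c; rewrite /at_u1 /at1; case: ifP. Qed.

Lemma tmat_at2 (X : nat -> nat -> tot) (XS : ser R) y x : (forall m k, tmat (X m k) y x = XS m k) ->
  forall a b c, tmat (at_u2 X a b c) y x = at2 XS a b c.
Proof. by move=> h a b c; rewrite /at_u2 /at2; case: ifP. Qed.

Lemma tmat_T b c m k y x : tmat (Tser b c m k) y x = Rvv_ser b x y c m k.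
Proof. exact: tmat_of. Qed.
Lemma tmat_Ts b c m k y x : tmat (Tsser b c m k) y x = Rdv_ser b x y c m k.
Proof. exact: tmat_of. Qed.
Lemma tmat_xi e f m k y x : tmat (xiser e f m k) y x = xi_ser e m k * ((y == x) && (deg x == f))%:R.
Proof. exact: tmat_of. Qed.
Lemma tmat_eta f m k y x : tmat (etaser f m k) y x = cst_ser ((y == x) && (deg x == f))%:R m k.
Proof. by rewrite /etaser /cst_ser; case: ifP => // _; exact: tmat_of. Qed.
Lemma tmat_shift (X : tser R n ell) m k y x : tmat (Defs.shift lam X m k) y x = shift_ser n ell (fun m k => tmat (X m k) y x) m k.
Proof. by []. Qed.

Lemma tmat_exchange (RS XS YS : label -> label -> label -> label -> ser R)
    (X Y : label -> label -> tser R n ell) i j p q a b c v x :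
  exchange_series RS XS YS ->
  (forall b c m k y x, tmat (X b c m k) y x = XS b x y c m k) ->
  (forall b c m k y x, tmat (Y b c m k) y x = YS b x y c m k) ->
  tmat (exchange_lhs RS X Y i j p q a b c) v x = tmat (exchange_rhs RS X Y i j p q a b c) v x.
Proof.
move=> ex hX hY; transitivity (\sum_k \sum_l \sum_y
    cv3 (at_u12 (RS k l p q)) (cv3 (at1 (XS i y v k)) (at2 (YS j x y l))) a b c).
  rewrite tmat_sum; apply: eq_bigr => k _; rewrite tmat_sum; apply: eq_bigr => l _.
  apply: (@tmat_scal3_mul3 _ _ _ (fun z => at1 (XS i z v k)) (fun z => at2 (YS j x z l))) => z.
    by apply: tmat_at1 => *; exact: hX.
  by apply: tmat_at2 => *; exact: hY.
rewrite ex; apply/esym.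
rewrite tmat_sum; apply: eq_bigr => k _; rewrite tmat_sum; apply: eq_bigr => l _.
apply: (@tmat_scal3_mul3 _ _ _ (fun z => at2 (YS k z v p)) (fun z => at1 (XS l x z q))) => z.
  by apply: tmat_at2 => *; exact: hY.
by apply: tmat_at1 => *; exact: hX.
Qed.

Lemma tmat_pairing (P : pred label) (om : label -> label -> ser R)
    (X : label -> tser R n ell) (Y : label -> tser R n ell)
    (XS YS : label -> label -> ser R) v x m k :
  (forall p z m k, tmat (X p m k) v z = XS p z m k) -> (forall q z m k, tmat (Y q m k) z x = YS q z m k) ->
  tmat (\big[@tot_add R n ell/@tot0 R n ell]_(p | P p) \big[@tot_add R n ell/@tot0 R n ell]_q
    conv2 (@tot_scale R n ell) (om p q) (conv2 (@tot_mul R n ell) (X p) (Y q)) m k) v x =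
  \sum_(p | P p) \sum_q \sum_z cv2 (om p q) (cv2 (XS p z) (YS q z)) m k.
Proof.
move=> hX hY; rewrite tmat_sum; apply: eq_bigr => p _; rewrite tmat_sum; apply: eq_bigr => q _.
by apply: tmat_scal2_mul2.
Qed.

Lemma deg_eq (b : label) f : (deg b == f) = (src b == f.1) && (tgt b == f.2).
Proof. by case: f. Qed.

Lemma deg_and (y x : label) f :
  (y == x) && (deg x == f) = [&& y == x, src y == f.1 & tgt y == f.2].
Proof. by rewrite deg_eq; case: eqVneq => [->|]. Qed.

Lemma cv2_mul (X Y : ser R) (a b : C) m k :
  cv2 (fun m k => X m k * a) (fun m k => Y m k * b) m k = cv2 X Y m k * (a * b).
Proof.
rewrite /cv2 mulr_suml; apply: eq_bigr => i _; rewrite mulr_suml; apply: eq_bigr => j _.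
exact: mulrACA.
Qed.

Lemma xi_ser_inv e m k : cv2 (xi_ser e) (xi_ser (~~ e)) m k = cst_ser 1 m k.
Proof.
case: e; first exact: rho2_ser_inv.
exact: (etrans (cv2C rho2V_ser rho2_ser m k) (@rho2_ser_inv R n ell n2 m k)).
Qed.

Lemma tmat_xi_inv e f m k y x :
  tmat (conv2 (@tot_mul R n ell) (xiser e f) (xiser (~~ e) f) m k) y x = tmat (etaser f m k) y x.
Proof.
rewrite tmat_conv2_mul tmat_eta.
transitivity (\sum_z cst_ser 1 m k * (((y == z) && (deg z == f))%:R * ((z == x) && (deg x == f))%:R) : C).
  apply: eq_bigr => z _; rewrite -(xi_ser_inv e) -cv2_mul; congr (cv2 _ _ m k).
    by apply/funext => m'; apply/funext => k'; exact: tmat_xi.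
  by apply/funext => m'; apply/funext => k'; exact: tmat_xi.
rewrite (bigD1 y)//= big1 ?addr0 => [|z zy]; last first.
  by rewrite (eq_sym y) (negbTE zy) /= mul0r mulr0.
rewrite eqxx -natrM mulnb /cst_ser; case: ifP => _; last by rewrite mul0r.
by rewrite mul1r; case: (eqVneq y x) => [->|_]; rewrite /= ?andbb ?andbF.
Qed.

(** Apart from the centrality of xi, which holds because it acts by scalars, [tmat_ev] reduces all
    components of a relation to one identity of matrices, and that identity is read off from the
    coefficient relations. *)
Lemma ev_defrel f g (s s' : term f g) : defrel s s' -> ev s =2 ev s'.
Proof.
case=> {f g s s'}.
- move=> e f g s m k y x /=.
  rewrite (bigD1 y)//= big1 ?addr0 => [|z zy]; last first.
    by rewrite (eq_sym y) (negbTE zy) /= mulr0 mul0r.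
  rewrite [RHS](bigD1 x)//= [X in _ + X]big1 ?addr0 => [|z zx]; last first.
    by rewrite (negbTE zx) /= mulr0 mulr0.
  rewrite !eqxx /=; have [e0|/ev_supp[-> ->]] := eqVneq (ev s y x) 0.
    by rewrite e0 mulr0 mul0r.
  by rewrite !eqxx !mulr1 mulrC.
- move=> e f0 m k f h y x; rewrite !tmat_ev; case: ifP => // _.
  exact: tmat_xi_inv.
- move=> i j p q a b c f h y x; rewrite !tmat_ev; case: ifP => // _.
  exact: (tmat_exchange _ _ _ _ _ _ _ _ _ (exchange_seriesVV n2) tmat_T tmat_T).
- move=> i j p q a b c f h y x; rewrite !tmat_ev; case: ifP => // _.
  exact: (tmat_exchange _ _ _ _ _ _ _ _ _ (exchange_seriesDD n2) tmat_Ts tmat_Ts).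
- move=> i j p q a b c f h y x; rewrite !tmat_ev; case: ifP => // _.
  exact: (tmat_exchange _ _ _ _ _ _ _ _ _ (exchange_seriesDV n2) tmat_Ts tmat_T).
- move=> i j o m k f h ij y x; rewrite !tmat_ev; case: ifP => // _.
  refine (etrans (@tmat_pairing _ _ _ _ (fun p z => shift_ser n ell (Rvv_ser i z y p))
    (fun q z => Rdv_ser j x z q) _ _ _ _ _ _) _).
  + by move=> p z m' k'; rewrite tmat_shift /shift_ser tmat_T.
  + by move=> q z m' k'; exact: tmat_Ts.
  refine (etrans (coef_omega n2 o y x m k ij) (esym (etrans (tmat_conv2_scale _ _ _ _ _ _) _))).
  congr (cv2 _ _ m k); apply/funext => m'; apply/funext => k'; rewrite tmat_xi.
  by rewrite deg_and.
- move=> i j o m k f h ij y x; rewrite !tmat_ev; case: ifP => // _.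
  refine (etrans (@tmat_pairing _ _ _ _ (fun p z => shift_ser n ell (Rdv_ser i z y p))
    (fun q z => Rvv_ser j x z q) _ _ _ _ _ _) _).
  + by move=> p z m' k'; rewrite tmat_shift /shift_ser tmat_Ts.
  + by move=> q z m' k'; exact: tmat_T.
  refine (etrans (coef_omegas n2 o y x m k ij) (esym (etrans (tmat_conv2_scale _ _ _ _ _ _) _))).
  congr (cv2 _ _ m k); apply/funext => m'; apply/funext => k'; rewrite tmat_eta.
  by rewrite deg_and.
- move=> i j o m k f h ij y x; rewrite !tmat_ev; case: ifP => // _.
  refine (etrans (@tmat_pairing _ _ _ _ (fun p z => Rdv_ser p z y i)
    (fun q z => shift_ser n ell (Rvv_ser q x z j)) _ _ _ _ _ _) _).
  + by move=> p z m' k'; exact: tmat_Ts.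
  + by move=> q z m' k'; rewrite tmat_shift /shift_ser tmat_T.
  refine (etrans (coef_sigma n2 o y x m k ij) (esym (etrans (tmat_conv2_scale _ _ _ _ _ _) _))).
  congr (cv2 _ _ m k); apply/funext => m'; apply/funext => k'; rewrite tmat_xi.
  by rewrite deg_and.
- move=> i j o m k f h ij y x; rewrite !tmat_ev; case: ifP => // _.
  refine (etrans (@tmat_pairing _ _ _ _ (fun p z => Rvv_ser p z y i)
    (fun q z => shift_ser n ell (Rdv_ser q x z j)) _ _ _ _ _ _) _).
  + by move=> p z m' k'; exact: tmat_T.
  + by move=> q z m' k'; rewrite tmat_shift /shift_ser tmat_Ts.
  refine (etrans (coef_sigmas n2 o y x m k ij) (esym (etrans (tmat_conv2_scale _ _ _ _ _ _) _))).
  congr (cv2 _ _ m k); apply/funext => m'; apply/funext => k'; rewrite tmat_eta.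
  by rewrite deg_and.
Qed.

Lemma ev_cong f g (s s' : term f g) : cong s s' -> ev s =2 ev s'.
Proof.
elim=> {f g s s'} /=.
- by move=> f g s s'; exact: ev_defrel.
- by [].
- by move=> f g s s' _ IH y x; rewrite IH.
- by move=> f g s s' s'' _ IH1 _ IH2 y x; rewrite IH1.
- by move=> f g s s' t t' _ IH1 _ IH2 y x; rewrite IH1 IH2.
- by move=> f g c s s' _ IH y x; rewrite IH.
- by move=> f g h s s' t t' _ IH1 _ IH2 y x; apply: eq_bigr => z _; rewrite IH1 IH2.
- by move=> f g s t r y x; exact: addrA.
- by move=> f g s t y x; exact: addrC.
- by move=> f g s y x; exact: add0r.
- by move=> f g s y x; rewrite mulN1r addNr.
- by move=> f g a b s y x; exact: mulrA.
- by move=> f g s y x; exact: mul1r.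
- by move=> f g a s t y x; exact: mulrDr.
- by move=> f g a b s y x; exact: mulrDl.
- move=> f g h k s t r y x.
  transitivity (\sum_z \sum_w ev s y z * (ev t z w * ev r w x)).
    by apply: eq_bigr => z _; exact: mulr_sumr.
  rewrite exchange_big; apply: eq_bigr => w _; rewrite mulr_suml.
  by apply: eq_bigr => z _; exact: mulrA.
- move=> f g s y x; rewrite (bigD1 y)//= big1 ?addr0 => [|z zy]; last first.
    by rewrite (eq_sym y) (negbTE zy) mul0r.
  rewrite eqxx /=; have [e0|/ev_supp[-> _]] := eqVneq (ev s y x) 0; first by rewrite e0 mulr0.
  by rewrite eqxx mul1r.
- move=> f g s y x; rewrite (bigD1 x)//= big1 ?addr0 => [|z zx]; last first.
    by rewrite (negbTE zx) mulr0.
  rewrite eqxx /=; have [e0|/ev_supp[_ ->]] := eqVneq (ev s y x) 0; first by rewrite e0 mul0r.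
  by rewrite eqxx mulr1.
- by move=> f g h s t r y x; rewrite -big_split; apply: eq_bigr => z _; exact: mulrDl.
- by move=> f g h s t r y x; rewrite -big_split; apply: eq_bigr => z _; exact: mulrDr.
- by move=> f g h c s t y x; rewrite mulr_sumr; apply: eq_bigr => z _; exact/esym/mulrA.
- by move=> f g h c s t y x; rewrite mulr_sumr; apply: eq_bigr => z _; exact: mulrCA.
Qed.

(** Defined through a representative term; [ev_cong] makes the result independent of the
    representative. *)
Definition sigma_fun f g (X : Eell R n ell f g) (v : Vrsos g) : Vrsos f :=
  [ffun y => \sum_(x : Vlabel g) ev (repr (X : Ecomp f g)) (val y) (val x) * v x].

Lemma sigma_funE f g (X : Eell R n ell f g) (v : Vrsos g) y :
  sigma_fun X v y = \sum_(x : Vlabel g) ev (repr (X : Ecomp f g)) (val y) (val x) * v x.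
Proof. exact: ffunE. Qed.

Lemma VrsosE (f : arrow) (c : C) (v w : Vrsos f) y : (c *: v + w) y = c * v y + w y.
Proof. by rewrite 2!ffunE. Qed.

Lemma sigma_fun_linear f g (X : Eell R n ell f g) : linear (sigma_fun X).
Proof.
move=> c v w; apply/ffunP => y; refine (etrans (sigma_funE _ _ _) (esym (etrans (VrsosE _ _ _ _) _))).
refine (etrans (congr2 (fun a b => c * a + b) (sigma_funE _ _ _) (sigma_funE _ _ _)) _).
rewrite mulr_sumr -big_split; apply: eq_bigr => x _.
have -> : (c *: v + w) x = c * v x + w x by exact: VrsosE.
exact: (esym (etrans (mulrDr _ _ _) (congr1 (fun z => z + _) (mulrCA _ _ _)))).
Qed.

HB.instance Definition _ f g (X : Eell R n ell f g) :=
  GRing.isLinear.Build C (Vrsos g) (Vrsos f) *:%R (sigma_fun X) (sigma_fun_linear X).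

Lemma ev_repr f g (s : term f g) : ev (repr (Eclass s)) =2 ev s.
Proof. exact: ev_cong (cong_repr s). Qed.

Lemma sigma_fun_class f g (s : term f g) (v : Vrsos g) y :
  sigma_fun (Eclass s : Eell R n ell f g) v y = \sum_(x : Vlabel g) ev s (val y) (val x) * v x.
Proof.
refine (etrans (sigma_funE _ _ _) _); apply: eq_bigr => x _.
exact: (congr1 (fun z => z * v x) (ev_repr s (val y) (val x))).
Qed.

Lemma sum_Vlabel (g : arrow) (F : label -> C) : (forall z, deg z != g -> F z = 0) ->
  \sum_z F z = \sum_(z : Vlabel g) F (val z).
Proof.
move=> F0; rewrite (bigID (fun z => deg z == g))/= [X in _ + X]big1// addr0.
exact: sum_sub_type.
Qed.

Lemma sigma_fun_rep : is_representation (fun f g (X : Eell R n ell f g) =>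
  sigma_fun X : {linear Vrsos g -> Vrsos f}).
Proof.
split.
- move=> f g c X Y v; apply/ffunP => y /=.
  refine (etrans (sigma_fun_class _ _ _) (esym (etrans (VrsosE _ _ _ _) _))).
  refine (etrans (congr2 (fun a b => c * a + b) (sigma_funE _ _ _) (sigma_funE _ _ _)) _).
  rewrite mulr_sumr -big_split; apply: eq_bigr => x _ /=.
  have -> := ev_repr (tscale c (repr X)) (val y) (val x).
  exact: (esym (etrans (mulrDl _ _ _) (congr1 (fun z => z + _) (esym (mulrA _ _ _))))).
- move=> f g h X Y v; apply/ffunP => y /=.
  refine (etrans (sigma_fun_class _ _ _) (esym (etrans (sigma_funE _ _ _) _))).
  transitivity (\sum_(z : Vlabel g) \sum_(x : Vlabel h)
      ev (repr (X : Ecomp f g)) (val y) (val z) * ev (repr (Y : Ecomp g h)) (val z) (val x) * v x).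
    apply: eq_bigr => z _; refine (etrans (congr1 (fun a => _ * a) (sigma_funE _ _ _)) _).
    rewrite mulr_sumr; apply: eq_bigr => x _; exact: mulrA.
  refine (etrans (exchange_big _ _ _ _ _ _) _); apply: eq_bigr => x _.
  refine (etrans (esym (mulr_suml _ _ _ _)) (congr1 (fun z => z * v x) _)).
  rewrite /= -(sum_Vlabel (g := g) (F := fun z => ev (repr (X : Ecomp f g)) (val y) z * ev (repr (Y : Ecomp g h)) z (val x)))//.
  by move=> z zg; rewrite [X in X * _]ev_off ?mul0r// zg orbT.
- move=> f v; apply/ffunP => y /=.
  refine (etrans (sigma_fun_class _ _ _) _); rewrite (bigD1 y)//= big1 ?addr0 => [|x xy].
    by rewrite eqxx (valP y) mul1r.
  by rewrite (inj_eq val_inj) eq_sym (negbTE xy) mul0r.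
Qed.

Lemma Vrsos_sum (f : arrow) (J : Type) (r : seq J) (P : pred J) (F : J -> Vrsos f) y :
  (\sum_(j <- r | P j) F j) y = \sum_(j <- r | P j) F j y.
Proof. by apply: (big_morph (fun v : Vrsos f => v y)) => [v w|]; exact: ffunE. Qed.

Lemma VbasisE (f : arrow) (x y : Vlabel f) : Vbasis x y = (y == x)%:R.
Proof. exact: ffunE. Qed.

Lemma VrsosZ (f : arrow) (c : C) (v : Vrsos f) y : (c *: v) y = c * v y.
Proof. exact: ffunE. Qed.

Lemma sigma_fun_basis (a : generator R n ell) (x : Vlabel (gbot a)) :
  sigma_fun (Egen a) (Vbasis x) = \sum_(y : Vlabel (gtop a)) genmat a (val y) (val x) *: Vbasis y.
Proof.
apply/ffunP => y; refine (etrans (sigma_fun_class _ _ _) (esym (etrans (Vrsos_sum _ _ _ _) _))).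
transitivity (genmat a (val y) (val x)).
  rewrite (bigD1 y)//= big1 => [|z zy].
    by rewrite VrsosZ VbasisE eqxx mulr1 addr0.
  by rewrite VrsosZ VbasisE eq_sym (negbTE zy) mulr0.
rewrite (bigD1 x)//= big1 => [|z zx]; last by rewrite VbasisE (negbTE zx) mulr0.
by rewrite VbasisE eqxx mulr1 addr0.
Qed.

Lemma sigma_fun_xi e (f : arrow) m k (v : Vrsos f) :
  sigma_fun (Egen (gxi e f m k)) v = xi_ser e m k *: v.
Proof.
apply/ffunP => y; refine (etrans (sigma_fun_class _ _ _) _).
rewrite (bigD1 y)//= big1 ?addr0 => [|x xy].
  by rewrite eqxx (valP y) mulr1 [RHS]ffunE.
by rewrite (inj_eq val_inj) eq_sym (negbTE xy) mulr0 mul0r.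
Qed.

End Representation.

Theorem theorem6p1 (R : realType) (ell n : nat) (hn : (2 <= n)%N) :
  exists sigmaV : forall f g : arrow R n ell,
      Eell R n ell f g -> {linear Vrsos g -> Vrsos f},
    [/\ is_representation sigmaV,
        forall (b c : label R n ell) (m k : nat)
            (x : Vlabel (gbot (gT b c m k))),
          sigmaV _ _ (Egen (gT b c m k)) (Vbasis x) =
          \sum_(y : Vlabel (gtop (gT b c m k)))
            Rvv_ser b (val x) (val y) c m k *: Vbasis y,
        forall (b c : label R n ell) (m k : nat)
            (x : Vlabel (gbot (gTs b c m k))),
          sigmaV _ _ (Egen (gTs b c m k)) (Vbasis x) =
          \sum_(y : Vlabel (gtop (gTs b c m k)))
            Rdv_ser b (val x) (val y) c m k *: Vbasis y,
        forall (f : arrow R n ell) (m k : nat) (v : Vrsos f),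
          sigmaV _ _ (Egen (gxi true f m k)) v = rho2_ser R n ell m k *: v &
        forall (f : arrow R n ell) (m k : nat) (v : Vrsos f),
          sigmaV _ _ (Egen (gxi false f m k)) v = rho2V_ser R n ell m k *: v].
Proof.
exists (fun f g X => sigma_fun X : {linear Vrsos g -> Vrsos f}); split.
- exact: sigma_fun_rep.
- by move=> b c m k x; exact: (sigma_fun_basis hn (a := gT b c m k) x).
- by move=> b c m k x; exact: (sigma_fun_basis hn (a := gTs b c m k) x).
- by move=> f m k v; exact: (sigma_fun_xi hn true m k v).
- by move=> f m k v; exact: (sigma_fun_xi hn false m k v).
Qed.
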